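(* Let $\mathcal{G}=(\mathcal{V},\mathcal{E})$, $\mathcal{V}=\{1,\dots,n\}$, be a tree (connected undirected graph with $|\mathcal{E}|=n-1$), let $R_c\in SO(3)$, $\rho\in(0,\pi/2)$, $\mathcal{C}=\{R\in SO(3): d(R,R_c)\le\rho\}$, let $\mathcal{O}\supset\mathcal{C}$ be an open subset of $SO(3)$, let $f_i:\mathcal{O}\to\mathbb{R}$ be $C^2$ for each $i\in\mathcal{V}$, and let $F:=\sum_{i=1}^n f_i$. Assume: (A) on $\mathcal{C}$, $F$ is geodesically $\mu_F$-strongly convex with $\mu_F>0$; (B) $R^*:=\operatorname{argmin}_{R\in\mathcal{C}}F(R)$ lies in the interior of $\mathcal{C}$; (C) $M>0$ is any fixed constant with $M\ge\max_{i\in\mathcal{V}}\max_{R\in\mathcal{C}}\|\nabla_R f_i\|$; (D) for every $i$ and every $R\in\partial\mathcal{C}$ (i.e. $d(R,R_c)=\rho$), $\hat e_{c}(R)^\top\nabla_R f_i\le 0$, where $\hat e_c(R):=(\log(R^\top R_c))^\vee/\|(\log(R^\top R_c))^\vee\|$ is the unit body-coordinate direction from $R$ toward $R_c$. Let $\alpha,\gamma>0$ and consider the closed loop $\dot R_i=R_i\omega_i^\wedge$, $\omega_i=\alpha\sum_{j\in\mathcal{N}_i}\operatorname{sgn}(e_{ij})-\gamma\nabla_{R_i}f_i$, $i\in\mathcal{V}$, with solutions understood as Filippov solutions in the sense defined in the context. Then: (i) (Strong invariance and global existence.) From every initial condition $x(0)=(R_1(0),\dots,R_n(0))\in\mathcal{C}^n$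 a Filippov solution exists. Every maximal solution from this initial condition is defined on $[0,\infty)$ and satisfies $x(t)\in\mathcal{C}^n$ for all $t\ge0$. (ii) (Exact finite-time consensus.) If, additionally, $\dfrac{\alpha}{\gamma}>\dfrac{nM}{2}$, then every such solution reaches and maintains exact consensus: $R_i(t)=R_j(t)$ for all $i,j\in\mathcal{V}$ and all $t\ge T^*$, for a settling time $T^*\ge 0$ satisfying $$T^*\le\frac{nW(x(0))}{2(2\alpha-\gamma nM)}.$$ (iii) (Aggregate gradient flow and exponential convergence.) Under $\alpha/\gamma>nM/2$, let $\bar R(t):=R_i(t)$ for $t\ge T^*$ (the common attitude). Then $$\dot{\bar R}=\bar R\Bigl(-\frac{\gamma}{n}\nabla_{\bar R}F\Bigr)^{\wedge}\quad\text{for a.e. }t\ge T^*,$$ and $$d(\bar R(t),R^* )\le d(\bar R(T^* ),R^* )\,e^{-\frac{\gamma\mu_F}{n}(t-T^* )},\qquad t\ge T^*.$$ Here $T^*$ and $\bar R(T^* )$ may depend on the particular Filippov solution; for each solution, the common trajectory on $[T^*,\infty)$ is uniquely determined by $\bar R(T^* )$.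
   Context: Geometry. $SO(3)=\{R\in\mathbb{R}^{3\times3}:R^\top R=I_3,\det R=1\}$; the hat map $\xi\mapsto\xi^\wedge$ sends $\xi\in\mathbb{R}^3$ to the skew-symmetric matrix with $\xi^\wedge\eta=\xi\times\eta$, with inverse $(\cdot)^\vee$. $SO(3)$ carries the bi-invariant metric $\langle R\xi^\wedge,R\eta^\wedge\rangle_R=\xi^\top\eta$, with geodesic distance $d$; $d(R,Q)=\|(\log(R^\top Q))^\vee\|$ whenever $d(R,Q)<\pi$, where $\log$ is the principal matrix logarithm. Gradients and convexity. For a $C^2$ function $f$ on an open subset of $SO(3)$, $\nabla_R f\in\mathbb{R}^3$ is the body-coordinate Riemannian gradient, i.e. $\operatorname{grad}f(R)=R(\nabla_R f)^\wedge$, and $H_R$ is the $3\times 3$ matrix of the Riemannian Hessian of $f$ at $R$ in body coordinates (identifying $R\xi^\wedge\in T_RSO(3)$ with $\xi\in\mathbb{R}^3$). $f$ is geodesically $\mu$-strongly convex on a geodesically convex set $\mathcal{C}$ if $H_R\succeq\mu I_3$ for every $R\in\mathcal{C}$. Network quantities. $\mathcal{N}_i=\{j:(i,j)\in\mathcal{E}\}$. For $x=(R_1,\dots,R_n)$ with $d(R_i,R_j)<\pi$, $e_{ij}:=(\log(R_i^\top R_j))^\vee$. For $z\in\mathbb{R}^3$, $\operatorname{sgn}(z):=z/\|z\|$ if $z\ne0$ and $\operatorname{sgn}(0):=0$. $W(x):=\sum_{(i,j)\in\mathcal{E}}\|e_{ij}\|$ (each undirected edge counted once). Filippov solutions. Let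 $\mathcal{D}_{\mathcal{O}}:=\{x=(R_i)_{i\in\mathcal{V}}\in\mathcal{O}^n: d(R_i,R_j)<\pi\ \forall(i,j)\in\mathcal{E}\}$ (open, and containing $\mathcal{C}^n$), and let $h:\mathcal{D}_{\mathcal{O}}\to\mathbb{R}^{3n}$, $h(x):=\bigl(\alpha\sum_{j\in\mathcal{N}_i}\operatorname{sgn}(e_{ij})-\gamma\nabla_{R_i}f_i\bigr)_{i\in\mathcal{V}}$. The Filippov map is $\mathcal{K}[h](x):=\bigcap_{\delta>0}\bigcap_{\nu(\mathcal{S})=0}\overline{\mathrm{co}}\,h(\mathcal{B}_\delta(x)\setminus\mathcal{S})$, where $\mathcal{B}_\delta(x)$ is the radius-$\delta$ geodesic neighborhood of $x$ in $\mathcal{D}_{\mathcal{O}}$, $\nu$ is Riemannian volume, $\mathcal{S}$ ranges over measurable $\nu$-null sets, and $\overline{\mathrm{co}}$ is the closed convex hull in $\mathbb{R}^{3n}$. A Filippov solution on $[0,T]$ is an absolutely continuous map $x:[0,T]\to\mathcal{D}_{\mathcal{O}}$ with $\bigl((R_i^\top\dot R_i)^\vee\bigr)_i\in\mathcal{K}[h](x)$ almost everywhere; a solution on a half-open interval is one whose restriction to every compact subinterval $[0,T]$ is a solution, and it is maximal if it cannot be extended to a solution on a larger interval. *)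

(* Defs.v *)
From HB Require Import structures.
From mathcomp Require Import all_boot all_order all_algebra.
From mathcomp Require Import complex.
From mathcomp Require Import all_classical all_reals all_analysis.

Set Implicit Arguments.
Unset Strict Implicit.
Unset Printing Implicit Defensive.

Import Order.TTheory GRing.Theory Num.Theory.
Import numFieldNormedType.Exports.

Local Open Scope classical_set_scope.
Local Open Scope ring_scope.

Section Vectors.
Variable R : realType.
Implicit Types (u v xi : 'cV[R]_3) (A : 'M[R]_3).

Definition vec3 (a b c : R) : 'cV[R]_3 := \col_(i < 3) [:: a; b; c]`_i.

(* The library norm on matrices is the sup norm, hence a separate Euclidean
   norm. *)
Definition dotv u v : R := (u^T *m v) 0 0.
Definition enorm u : R := Num.sqrt (dotv u u).

Definition cross u v : 'cV[R]_3 :=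
  vec3 (u 1 0 * v 2 0 - u 2 0 * v 1 0)
       (u 2 0 * v 0 0 - u 0 0 * v 2 0)
       (u 0 0 * v 1 0 - u 1 0 * v 0 0).

Definition hat xi : 'M[R]_3 :=
  \matrix_(i < 3, j < 3)
    (nth [::] [:: [:: 0; - xi 2 0; xi 1 0];
                  [:: xi 2 0; 0; - xi 0 0];
                  [:: - xi 1 0; xi 0 0; 0]] i)`_j.

(* Left inverse of hat; only meaningful on skew-symmetric matrices. *)
Definition vee A : 'cV[R]_3 := vec3 (A 2 1) (A 0 2) (A 1 0).

Definition sgnv u : 'cV[R]_3 := if u == 0 then 0 else (enorm u)^-1 *: u.

Lemma hat_mul xi u : hat xi *m u = cross xi u.
Proof.
apply/matrixP => i j; rewrite ord1 !mxE !big_ord_recl big_ord0 !mxE /= addr0.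
rewrite (_ : ord0 = 0 :> 'I_3)// (_ : lift ord0 ord0 = 1 :> 'I_3); last exact/val_inj.
rewrite (_ : lift ord0 _ = 2 :> 'I_3); last exact/val_inj.
case: i => -[|[|[|//]]] ? /=; rewrite mul0r mulNr.
- by rewrite add0r addrC.
- by rewrite add0r.
- by rewrite addr0 addrC.
Qed.

Lemma hat_skew xi : (hat xi)^T = - hat xi.
Proof.
apply/matrixP => -[[|[|[|//]]] ?] -[[|[|[|//]]] ?];
  by rewrite !mxE /= ?oppr0 ?opprK.
Qed.

Lemma hatK : cancel hat vee.
Proof.
move=> xi; apply/matrixP => i j; rewrite ord1 !mxE /=.
by case: i => -[|[|[|//]]] ? /=; congr (xi _ _); apply/val_inj.
Qed.

End Vectors.

Section Rotations.
Variable R : realType.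
Implicit Types (A B Q : 'M[R]_3) (xi : 'cV[R]_3) (f : 'M[R]_3 -> R).

Definition SO3 : set 'M[R]_3 := [set A | A^T *m A = 1%:M /\ \det A = 1].

Definition expm A : 'M[R]_3 := limn (series (fun k => (k`!%:R)^-1 *: A ^+ k)).

(* Principal matrix logarithm: the logarithm all of whose complex eigenvalues
   lie in the open strip |Im z| < pi; junk value 0 if there is none. *)
Definition plog A : 'M[R]_3 :=
  xget 0 [set X | expm X = A /\
    forall z : R[i], eigenvalue (map_mx (fun a => a%:C)%C X) z ->
      `|complex.Im z| < pi].

Definition body_vel (c : R -> 'M[R]_3) (t : R) : 'cV[R]_3 :=
  vee ((c t)^T *m derive1 c t).

(* C^1 curves on [0, 1] are represented by C^1 extensions to the real line. *)
Definition C1_path A B (c : R -> 'M[R]_3) : Prop :=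
  [/\ forall t, derivable c t 1, continuous (derive1 c), c 0 = A, c 1 = B
    & forall t, t \in `[0, 1] -> SO3 (c t)].

(* Length for the bi-invariant metric <A xi^, A eta^>_A = xi^T eta. *)
Definition path_length (c : R -> 'M[R]_3) : R :=
  \int[@lebesgue_measure R]_(t in `[0, 1]) enorm (body_vel c t).

Definition gdist A B : R := inf (path_length @` C1_path A B).

Definition C2_on (U : set 'M[R]_3) (g : 'M[R]_3 -> R) : Prop :=
  forall A, U A ->
    [/\ {for A, continuous g},
        forall V, derivable g A V /\ {for A, continuous ('D_V g)}
      & forall V W, derivable ('D_V g) A W /\
          {for A, continuous ('D_W ('D_V g))}].

Definition C2_SO3 (O : set 'M[R]_3) f : Prop :=
  forall A, O A -> exists (U : set 'M[R]_3) (g : 'M[R]_3 -> R),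
    [/\ open U, U A, C2_on U g & forall B, U B -> O B -> g B = f B].

(* Derivative of f along the left-invariant vector field A |-> A xi^. *)
Definition lieD (xi : 'cV[R]_3) f (A : 'M[R]_3) : R :=
  derive1 (fun t : R => f (A *m expm (t *: hat xi))) 0.

Definition basev (i : 'I_3) : 'cV[R]_3 := delta_mx i 0.

Definition grad f A : 'cV[R]_3 := \col_i lieD (basev i) f A.

(* Hess f (X, Y) = X (Y f) - (nabla_X Y) f on the left-invariant frame, for
   which the Levi-Civita connection of the bi-invariant metric is
   nabla_xi eta = 1/2 [xi, eta] = 1/2 (xi x eta). *)
Definition hess f A : 'M[R]_3 :=
  \matrix_(i, j) (lieD (basev i) (lieD (basev j) f) A -
                  2^-1 * lieD (cross (basev i) (basev j)) f A).

Definition geod_strongly_convex (mu : R) (C : set 'M[R]_3) f : Prop :=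
  forall A, C A -> forall xi, mu * dotv xi xi <= dotv xi (hess f A *m xi).

Definition interior_SO3 (C : set 'M[R]_3) : set 'M[R]_3 :=
  [set A | SO3 A /\ within SO3 (nbhs A) C].
Definition open_SO3 (O : set 'M[R]_3) : Prop := O `<=` interior_SO3 O.

Definition gcball Q (rho : R) : set 'M[R]_3 :=
  [set A | SO3 A /\ gdist A Q <= rho].

Definition is_argmin (C : set 'M[R]_3) f A : Prop :=
  C A /\ forall B, C B -> f A <= f B.

Definition dir_to Q A : 'cV[R]_3 :=
  (enorm (vee (plog (A^T *m Q))))^-1 *: vee (plog (A^T *m Q)).

End Rotations.

Definition config (R : realType) (n : nat) : Type := 'I_n -> 'M[R]_3.

Section Volume.
Variable R : realType.
Local Open Scope ereal_scope.

(* Integral against the Riemannian volume of SO(3), in normal coordinates at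
   the identity: exp(xi^), |xi| < pi, covers SO(3) up to a null set, and the
   volume density is 2 (1 - cos |xi|) / |xi|^2. *)
Definition int_SO3 (g : 'M[R]_3 -> \bar R) : \bar R :=
  let mu := @lebesgue_measure R in
  \int[mu]_a \int[mu]_b \int[mu]_c
    (let xi := vec3 a b c in
     if (enorm xi < pi)%R
     then ((2 * (1 - cos (enorm xi)) / enorm xi ^+ 2)%R)%:E * g (expm (hat xi))
     else 0).

Definition cons_config n (A : 'M[R]_3) (x : config R n) : config R n.+1 :=
  fun i => if unlift ord0 i is Some j then x j else A.

Fixpoint int_config n : (config R n -> \bar R) -> \bar R :=
  match n with
  | 0 => fun g => g (fun=> 1%:M)
  | m.+1 => fun g =>
      int_SO3 (fun A => @int_config m (fun x => g (cons_config A x)))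
  end.

(* The Riemannian volume of SO(3)^n, as an iterated integral (Tonelli). *)
Definition volume n (S : set (config R n)) : \bar R :=
  int_config (fun x => (\1_S x)%:E).

Definition borel_config n : set (set (config R n)) :=
  <<s [set U | exists i (V : set 'M[R]_3), open V /\ U = [set x | V (x i)]] >>.

End Volume.

Section Filippov.
Variables (R : realType) (n : nat).
Implicit Types (dom : set (config R n)) (h : config R n -> 'M[R]_(3, n)).
Implicit Types (x : config R n) (y : R -> config R n).

(* R^{3n} is represented by 3 x n matrices, column i belonging to agent i. *)

Definition config_dist x x' : R := Num.sqrt (\sum_i gdist (x i) (x' i) ^+ 2).

Definition geo_nbhd dom x (delta : R) : set (config R n) :=
  [set x' | dom x' /\ config_dist x x' < delta].

Definition conv_hull (S : set 'M[R]_(3, n)) : set 'M[R]_(3, n) :=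
  [set v | forall A : set 'M[R]_(3, n), convex_set A -> S `<=` A -> A v].

Definition filippov_map dom h x : set 'M[R]_(3, n) :=
  [set v | forall (delta : R) (S : set (config R n)),
    0 < delta -> borel_config S -> volume S = 0%E ->
    closure (conv_hull (h @` (geo_nbhd dom x delta `\` S))) v].

Definition abs_continuous (V : normedModType R) (a b : R) (c : R -> V) : Prop :=
  forall eps : R, 0 < eps -> exists2 delta : R, 0 < delta &
    forall (m : nat) (s t : 'I_m -> R),
      (forall k, [/\ a <= s k, s k <= t k & t k <= b]) ->
      (forall k l, k != l -> t k <= s l \/ t l <= s k) ->
      \sum_k (t k - s k) < delta ->
      \sum_k `|c (t k) - c (s k)| < eps.

Definition filippov_solution_upto dom h (T : R) y : Prop :=
  [/\ forall t, 0 <= t <= T -> dom (y t),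
      forall i, abs_continuous 0 T (fun t => y t i)
    & {ae @lebesgue_measure R, forall t, 0 <= t <= T ->
        (forall i, derivable (fun s => y s i) t 1) /\
        filippov_map dom h (y t)
          (\matrix_(k, i) body_vel (fun s => y s i) t k 0)}].

Definition time_interval (I : set R) : Prop :=
  [\/ exists2 T : R, 0 < T & I = [set` `[0, T]],
      exists2 b : R, 0 < b & I = [set` `[0, b[]
    | I = [set` `[0, +oo[]].

(* For I = [0, T] this is the same as filippov_solution_upto at T. *)
Definition filippov_solution dom h (I : set R) y : Prop :=
  forall T : R, 0 < T -> [set` `[0, T]] `<=` I ->
    filippov_solution_upto dom h T y.

Definition maximal_solution dom h (I : set R) y : Prop :=
  [/\ time_interval I, filippov_solution dom h I y
    & forall J z, time_interval J -> filippov_solution dom h J z ->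
        I `<=` J -> (forall t, I t -> z t = y t) -> J = I].

End Filippov.

Section Network.
Variables (R : realType) (n : nat).
Implicit Types (e : rel 'I_n) (x : config R n).

Definition edges e : {set 'I_n * 'I_n} :=
  [set p : 'I_n * 'I_n | (p.1 < p.2)%N && e p.1 p.2].

(* |E| = n - 1 is written |E| + 1 = n, which also excludes n = 0. *)
Definition is_tree e : Prop :=
  [/\ symmetric e, irreflexive e, forall i j, connect e i j
    & #|edges e|.+1 = n].

Definition err x (i j : 'I_n) : 'cV[R]_3 := vee (plog ((x i)^T *m x j)).

Definition disagreement e x : R := \sum_(p in edges e) enorm (err x p.1 p.2).

Definition network_dom e (O : set 'M[R]_3) : set (config R n) :=
  [set x | (forall i, O (x i)) /\ forall i j, e i j -> gdist (x i) (x j) < pi].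

Definition network_field e (alpha gamma : R) (f : 'I_n -> 'M[R]_3 -> R)
    (x : config R n) : 'M[R]_(3, n) :=
  \matrix_(k, i)
    (alpha *: \sum_(j | e i j) sgnv (err x i j) - gamma *: grad (f i) (x i)) k 0.

Definition consensus_from (y : R -> config R n) (T : R) : Prop :=
  forall t, T <= t -> forall i j, y t i = y t j.

End Network.

(* Main.v *)
(* Existence: the field is continuous at the configurations whose agents are
   pairwise distinct, and such configurations are dense.  Euler polygons through
   them are uniformly Lipschitz; their limit along an ultrafilter has, almost
   everywhere, its velocity in the Filippov map.  An affine inequality that the
   field satisfies near x, with coefficients continuous in x, passes to all the
   velocities in the Filippov map at x; every estimate on solutions has this form.

   Invariance: the sum of the squares of (cos rho - cos d(R_i, R_c))_+ satisfies a
   Gronwall inequality along solutions, because the couplings at the two ends of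
   an edge together do not increase it, and by (D) neither does - grad f_i on the
   boundary.

   Consensus: write omega_i = alpha S_i - gamma grad f_i.  On a tree the couplings
   S_i are determined by one flow per edge, the sum of the S_k over one side of the
   cut at that edge.  In the Filippov map the flows have norm at most one, and are
   the unit directions on disagreeing edges, so W has derivative - sum_i <S_i,
   omega_i>.  If some edge disagrees then sum |S_i| >= 2, and Cauchy-Schwarz bounds
   this derivative by - (2/n)(2 alpha - gamma n M).

   At consensus the couplings cancel in the sum of the velocities, hence
   n omega = - gamma grad F, and strong convexity along the geodesic to R^* makes
   the distance to R^* decay exponentially. *)

Require Import Defs.
From HB Require Import structures.
From mathcomp Require Import all_boot all_order all_algebra.
From mathcomp Require Import complex spectral.
From mathcomp Require Import zify ring lra.
From mathcomp Require Import all_classical all_reals all_analysis.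
From mathcomp Require Import measurable_realfun.

Set Implicit Arguments.
Unset Strict Implicit.
Unset Printing Implicit Defensive.

Import Order.TTheory GRing.Theory Num.Theory.
Import numFieldNormedType.Exports.

Local Open Scope classical_set_scope.
Local Open Scope ring_scope.

(** The definitions are remote from calculus: the distance is an infimum of path lengths, the
    logarithm is singled out by complex eigenvalues, and solutions obey a condition almost
    everywhere. The geometry is therefore reduced to the trace: cos d(A, B) = (tr(A^T B) - 1) / 2 is
    polynomial in the entries and, along a geodesic, affine in cos s and sin s.

    Angles have corners where agents meet, exactly where the couplings jump. There a smooth function
    that lies below the angle and touches it at t bounds its upper left Dini derivative. Absolutely
    continuous functions with such bounds almost everywhere obey Gronwall's inequality, by a
    covering argument instead of the integration of a derivative.

    The penalty uses squares of positive parts of cosines because these are differentiable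
    everywhere. (D) constrains the gradients only on the boundary, so the estimate outside the ball
    is local, and invariance is propagated by real induction. *)

(** * Vectors and rotations in coordinates *)

Lemma ord3_cases (P : 'I_3 -> Prop) : P 0 -> P 1 -> P 2 -> forall i, P i.
Proof.
move=> P0 P1 P2 -[[|[|[|//]]] lti].
- by rewrite (_ : Ordinal lti = 0) //; apply/val_inj.
- by rewrite (_ : Ordinal lti = 1) //; apply/val_inj.
- by rewrite (_ : Ordinal lti = 2) //; apply/val_inj.
Qed.

Lemma sum_ord3 (V : nmodType) (F : 'I_3 -> V) : \sum_i F i = F 0 + F 1 + F 2.
Proof.
rewrite !big_ord_recl big_ord0 addr0 addrA.
by congr (F _ + F _ + F _); apply/val_inj.
Qed.

Section Algebra3.
Variable R : realType.
Implicit Types (u v w xi : 'cV[R]_3) (A B Q : 'M[R]_3).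

Lemma mx3P (A B : 'M[R]_3) :
  A 0 0 = B 0 0 -> A 0 1 = B 0 1 -> A 0 2 = B 0 2 ->
  A 1 0 = B 1 0 -> A 1 1 = B 1 1 -> A 1 2 = B 1 2 ->
  A 2 0 = B 2 0 -> A 2 1 = B 2 1 -> A 2 2 = B 2 2 -> A = B.
Proof.
move=> *; apply/matrixP.
by apply: ord3_cases; apply: ord3_cases.
Qed.

Lemma cv3P u v : u 0 0 = v 0 0 -> u 1 0 = v 1 0 -> u 2 0 = v 2 0 -> u = v.
Proof. by move=> *; apply/colP; apply: ord3_cases. Qed.

Lemma mulmx3E m p (A : 'M[R]_(m, 3)) (B : 'M[R]_(3, p)) i j :
  (A *m B) i j = A i 0 * B 0 j + A i 1 * B 1 j + A i 2 * B 2 j.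
Proof. by rewrite mxE sum_ord3. Qed.

Lemma mxtrace3E A : \tr A = A 0 0 + A 1 1 + A 2 2.
Proof. by rewrite /mxtrace sum_ord3. Qed.

Lemma det3E A : \det A =
  A 0 0 * (A 1 1 * A 2 2 - A 1 2 * A 2 1) -
  A 0 1 * (A 1 0 * A 2 2 - A 1 2 * A 2 0) +
  A 0 2 * (A 1 0 * A 2 1 - A 1 1 * A 2 0).
Proof.
have det2 (B : 'M[R]_2) : \det B = B 0 0 * B 1 1 - B 0 1 * B 1 0.
  rewrite (expand_det_row _ 0) !big_ord_recl big_ord0 addr0 /cofactor !det_mx11.
  rewrite !mxE /= expr0 expr1 mul1r mulN1r mulrN.
  by congr (B _ _ * B _ _ - B _ _ * B _ _); apply/val_inj.
rewrite (expand_det_row _ 0) sum_ord3 /cofactor !det2 !mxE /=.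
have -> : lift 0 0 = 1 :> 'I_3 by apply/val_inj.
have -> : lift 0 1 = 2 :> 'I_3 by apply/val_inj.
have -> : lift 1 0 = 0 :> 'I_3 by apply/val_inj.
have -> : lift 1 1 = 2 :> 'I_3 by apply/val_inj.
have -> : lift 2 0 = 0 :> 'I_3 by apply/val_inj.
have -> : lift 2 1 = 1 :> 'I_3 by apply/val_inj.
by ring.
Qed.

Lemma dotvE u v : dotv u v = u 0 0 * v 0 0 + u 1 0 * v 1 0 + u 2 0 * v 2 0.
Proof. by rewrite /dotv mulmx3E !mxE. Qed.

Lemma dotvC u v : dotv u v = dotv v u.
Proof. by rewrite !dotvE; ring. Qed.

Lemma dotvDr u v w : dotv u (v + w) = dotv u v + dotv u w.
Proof. by rewrite !dotvE !mxE; ring. Qed.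

Lemma dotvZr u a v : dotv u (a *: v) = a * dotv u v.
Proof. by rewrite !dotvE !mxE; ring. Qed.

Lemma dotvDl u v w : dotv (v + w) u = dotv v u + dotv w u.
Proof. by rewrite !dotvE !mxE; ring. Qed.

Lemma dotvZl u a v : dotv (a *: v) u = a * dotv v u.
Proof. by rewrite !dotvE !mxE; ring. Qed.

Lemma dotvNr u v : dotv u (- v) = - dotv u v.
Proof. by rewrite !dotvE !mxE; ring. Qed.

Lemma dotvNl u v : dotv (- u) v = - dotv u v.
Proof. by rewrite !dotvE !mxE; ring. Qed.

Lemma dotv0 u : dotv u 0 = 0.
Proof. by rewrite !dotvE !mxE; ring. Qed.

Lemma dot0v u : dotv 0 u = 0.
Proof. by rewrite !dotvE !mxE; ring. Qed.

Lemma dotv_sumr I (r : seq I) (P : pred I) (F : I -> 'cV[R]_3) u :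
  dotv u (\sum_(i <- r | P i) F i) = \sum_(i <- r | P i) dotv u (F i).
Proof.
elim/big_rec2: _ => [|i x y _ <-]; first exact: dotv0.
by rewrite dotvDr.
Qed.

Lemma dotvv_ge0 u : 0 <= dotv u u.
Proof. by rewrite dotvE; nra. Qed.

Lemma enorm_ge0 u : 0 <= enorm u.
Proof. exact: sqrtr_ge0. Qed.

Lemma enorm_sqr u : enorm u ^+ 2 = dotv u u.
Proof. by rewrite sqr_sqrtr // dotvv_ge0. Qed.

Lemma enorm0 : enorm (0 : 'cV[R]_3) = 0.
Proof. by rewrite /enorm dotv0 sqrtr0. Qed.

Lemma enorm_eq0 u : (enorm u == 0) = (u == 0).
Proof.
apply/idP/eqP => [|->]; last by rewrite enorm0.
rewrite sqrtr_eq0 dotvE => h.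
by apply: cv3P; rewrite mxE; nra.
Qed.

Lemma enormZ a u : enorm (a *: u) = `|a| * enorm u.
Proof.
by rewrite /enorm dotvZl dotvZr mulrA sqrtrM ?sqr_ge0 // -expr2 sqrtr_sqr.
Qed.

Lemma enormN u : enorm (- u) = enorm u.
Proof. by rewrite -scaleN1r enormZ normrN1 mul1r. Qed.

Lemma dotv_le u v : dotv u v <= enorm u * enorm v.
Proof.
have [->|v0] := eqVneq v 0; first by rewrite dotv0 enorm0 mulr0.
have [->|u0] := eqVneq u 0; first by rewrite dot0v enorm0 mul0r.
have {}u0 : 0 < enorm u by rewrite lt_neqAle eq_sym enorm_eq0 u0 enorm_ge0.
have {}v0 : 0 < enorm v by rewrite lt_neqAle eq_sym enorm_eq0 v0 enorm_ge0.
have := dotvv_ge0 (enorm v *: u - enorm u *: v).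
rewrite dotvDl !dotvDr !dotvNl !dotvNr !dotvZl !dotvZr -!enorm_sqr.
rewrite (dotvC v u) => h.
have : 0 <= (enorm u * enorm v) * (enorm u * enorm v - dotv u v) by nra.
by rewrite pmulr_rge0 ?mulr_gt0 // subr_ge0.
Qed.

Lemma normr_dotv_le u v : `|dotv u v| <= enorm u * enorm v.
Proof.
by rewrite ler_norml dotv_le andbT lerNl -dotvNl -(enormN u) dotv_le.
Qed.

Lemma enormD u v : enorm (u + v) <= enorm u + enorm v.
Proof.
rewrite -(@ler_pXn2r _ 2) ?nnegrE ?addr_ge0 ?enorm_ge0 //.
rewrite enorm_sqr dotvDl !dotvDr -!enorm_sqr (dotvC v u).
by have := dotv_le u v; lra.
Qed.

Lemma enorm_sum I (r : seq I) (P : pred I) (F : I -> 'cV[R]_3) :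
  enorm (\sum_(i <- r | P i) F i) <= \sum_(i <- r | P i) enorm (F i).
Proof.
elim/big_rec2: _ => [|i x y _ h]; first by rewrite enorm0.
by apply: le_trans (enormD _ _) _; rewrite lerD2l.
Qed.

Lemma enorm_sgnv_le1 u : enorm (sgnv u) <= 1.
Proof.
rewrite /sgnv; case: eqVneq => [_|u0]; first by rewrite enorm0 ler01.
by rewrite enormZ ger0_norm ?invr_ge0 ?enorm_ge0 // mulVf // enorm_eq0.
Qed.

Lemma enorm_sgnv u : u != 0 -> enorm (sgnv u) = 1.
Proof.
move=> u0; rewrite /sgnv (negbTE u0).
by rewrite enormZ ger0_norm ?invr_ge0 ?enorm_ge0 // mulVf // enorm_eq0.
Qed.

Lemma sgnvK u : enorm u *: sgnv u = u.
Proof.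
rewrite /sgnv; case: eqVneq => [->|u0]; first by rewrite scaler0.
by rewrite scalerA divff ?scale1r // enorm_eq0.
Qed.

Lemma hatD u v : hat (u + v) = hat u + hat v.
Proof. by apply: mx3P; rewrite !mxE /= ?mxE; ring. Qed.

Lemma hatZ a u : hat (a *: u) = a *: hat u.
Proof. by apply: mx3P; rewrite !mxE /= ?mxE; ring. Qed.

Lemma hatN u : hat (- u) = - hat u.
Proof. by rewrite -scaleN1r hatZ scaleN1r. Qed.

Lemma hat0 : hat (0 : 'cV[R]_3) = 0.
Proof. by rewrite -(scale0r 0) hatZ scale0r. Qed.

Lemma vee_skewK A : A^T = - A -> hat (vee A) = A.
Proof.
move=> h; have e i j : A j i = - A i j by move/matrixP/(_ i j): h; rewrite !mxE.
have d i : A i i = 0 by have := e i i; lra.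
by apply: mx3P; rewrite !mxE /= ?d // e ?opprK.
Qed.

Lemma veeZ a A : vee (a *: A) = a *: vee A.
Proof. by apply: cv3P; rewrite !mxE. Qed.

Lemma mxtrace_hatM u v : \tr (hat u *m hat v) = - 2 * dotv u v.
Proof. by rewrite mxtrace3E !mulmx3E !mxE /= dotvE; ring. Qed.

Lemma SO3_orth A : SO3 A -> A^T *m A = 1%:M /\ A *m A^T = 1%:M.
Proof. by move=> [h _]; split => //; exact: mulmx1C. Qed.

Lemma SO3_1 : SO3 (1%:M : 'M[R]_3).
Proof. by split; rewrite ?trmx1 ?mulmx1 ?det1. Qed.

Lemma SO3_mul A B : SO3 A -> SO3 B -> SO3 (A *m B).
Proof.
move=> [a1 a2] [b1 b2]; split; last by rewrite det_mulmx a2 b2 mulr1.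
by rewrite trmx_mul mulmxA -(mulmxA _ _ A) a1 mulmx1.
Qed.

Lemma SO3_tr A : SO3 A -> SO3 A^T.
Proof.
move=> h; have [_ h2] := SO3_orth h; split; first by rewrite trmxK.
by rewrite det_tr h.2.
Qed.

(* The adjugate of a rotation is its transpose. *)
Lemma SO3_cofactor A : SO3 A ->
  [/\ A 0 0 = A 1 1 * A 2 2 - A 1 2 * A 2 1,
      A 0 1 = A 1 2 * A 2 0 - A 1 0 * A 2 2 &
      A 0 2 = A 1 0 * A 2 1 - A 1 1 * A 2 0] /\
  [/\ A 1 0 = A 2 1 * A 0 2 - A 2 2 * A 0 1,
      A 1 1 = A 2 2 * A 0 0 - A 2 0 * A 0 2 &
      A 1 2 = A 2 0 * A 0 1 - A 2 1 * A 0 0] /\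
  [/\ A 2 0 = A 0 1 * A 1 2 - A 0 2 * A 1 1,
      A 2 1 = A 0 2 * A 1 0 - A 0 0 * A 1 2 &
      A 2 2 = A 0 0 * A 1 1 - A 0 1 * A 1 0].
Proof.
move=> hA; have [h1 h2] := SO3_orth hA; have := hA.2; rewrite det3E => hd.
pose adj : 'M[R]_3 := \matrix_(i, j) (nth [::]
  [:: [:: A 1 1 * A 2 2 - A 1 2 * A 2 1;
          A 2 1 * A 0 2 - A 2 2 * A 0 1; A 0 1 * A 1 2 - A 0 2 * A 1 1];
      [:: A 1 2 * A 2 0 - A 1 0 * A 2 2;
          A 2 2 * A 0 0 - A 2 0 * A 0 2; A 0 2 * A 1 0 - A 0 0 * A 1 2];
      [:: A 1 0 * A 2 1 - A 1 1 * A 2 0;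
          A 2 0 * A 0 1 - A 2 1 * A 0 0; A 0 0 * A 1 1 - A 0 1 * A 1 0]] i)`_j.
have adjE : A *m adj = 1%:M.
  by apply: mx3P; rewrite mulmx3E !mxE /=; try ring; rewrite mulr1n -hd; ring.
have {}adjE : A^T = adj by rewrite -(mulmx1 A^T) -adjE mulmxA h1 mul1mx.
have e i j : A j i = adj i j by rewrite -adjE mxE.
by do !split; rewrite e mxE.
Qed.

Lemma SO3_rows A : SO3 A -> forall i j,
  A i 0 * A j 0 + A i 1 * A j 1 + A i 2 * A j 2 = (i == j)%:R.
Proof.
move=> /SO3_orth[_ /matrixP h] i j.
by have := h i j; rewrite mulmx3E !mxE.
Qed.

Lemma SO3_cols A : SO3 A -> forall i j,
  A 0 i * A 0 j + A 1 i * A 1 j + A 2 i * A 2 j = (i == j)%:R.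
Proof.
move=> /SO3_orth[/matrixP h _] i j.
by have := h i j; rewrite mulmx3E !mxE.
Qed.

(* Twice the sine of the rotation angle times the axis. *)
Definition axv A : 'cV[R]_3 := vee (A - A^T).

(** For the rotation by an angle s about a unit vector u, with t = 1 + 2 cos s, both sides of the
    first identity are 4 (sin s)^2 u u^T. Proved from the entries of any rotation, it recovers the
    axis before a rotation is known to have one. *)
Lemma SO3_axis A : SO3 A -> let t := \tr A in
  (1 + t) *: (A + A^T - (t - 1)%:M) = axv A *m (axv A)^T /\
  dotv (axv A) (axv A) = (3 - t) * (1 + t).
Proof.
move=> hA t.
have [[c00 c01 c02] [[c10 c11 c12] [c20 c21 c22]]] := SO3_cofactor hA.
have r i j := SO3_rows hA i j; have c i j := SO3_cols hA i j.
have r01 := r 0 1; have r02 := r 0 2; have r12 := r 1 2.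
have q01 := c 0 1; have q02 := c 0 2; have q12 := c 1 2.
have r00 := r 0 0; have r11 := r 1 1; have r22 := r 2 2.
have q00 := c 0 0; have q11 := c 1 1; have q22 := c 2 2.
rewrite /= in r01 r02 r12 q01 q02 q12 r00 r11 r22 q00 q11 q22.
clear r c.
have mulE i j : (axv A *m (axv A)^T) i j = axv A i 0 * axv A j 0.
  by rewrite mxE big_ord1 [(axv A)^T _ _]mxE.
have E : (1 + t) *: (A + A^T - (t - 1)%:M) = axv A *m (axv A)^T.
  rewrite /t mxtrace3E.
  (* Each entry follows linearly from the cofactor and orthonormality relations, with products of
     entries as atoms. *)
  apply: mx3P; rewrite mulE /axv !mxE /= ?mulr1n ?mulr0n;
    move: c00 c01 c02 c10 c11 c12 c20 c21 c22 r01 r02 r12 q01 q02 q12 r00 r11 r22 q00 q11 q22;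
    clear; move: (A 0 0) (A 0 1) (A 0 2) (A 1 0) (A 1 1) (A 1 2) (A 2 0) (A 2 1) (A 2 2) => *; lra.
split => //.
have -> : dotv (axv A) (axv A) = \tr (axv A *m (axv A)^T).
  by rewrite mxtrace3E !mulE dotvE.
rewrite -E mxtraceZ mxtraceD raddfN /= mxtraceD mxtrace_tr mxtrace_scalar.
by rewrite -/t -mulr_natr; ring.
Qed.

End Algebra3.

(** * Limits and derivatives of matrices, entry by entry *)

Section MatrixAnalysis.
Variable R : realType.

Lemma le_mx_norm m n (A : 'M[R]_(m, n)) i j : `|A i j| <= `|A|.
Proof.
rewrite [leRHS]/Num.Def.normr /= mx_normrE.
exact: (le_bigmax _ (fun ij : 'I_m * 'I_n => `|A ij.1 ij.2|) (i, j)).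
Qed.

Lemma mx_norm_le m n (A : 'M[R]_(m, n)) e :
  0 <= e -> (forall i j, `|A i j| <= e) -> `|A| <= e.
Proof.
move=> e0 h; rewrite [leLHS]/Num.Def.normr /= mx_normrE.
by apply/bigmax_leP; split => // -[i j] _; exact: h.
Qed.

Lemma cvg_mxP (T : Type) (F : set_system T) (FF : Filter F) m n
    (M : T -> 'M[R]_(m, n)) (L : 'M[R]_(m, n)) :
  M @ F --> L <-> forall i j, (fun x => M x i j) @ F --> L i j.
Proof.
split => [h i j|h].
  apply/cvgrPdist_le => e e0; move/cvgrPdist_le : h => /(_ e e0).
  apply: filterS => x; apply: le_trans.
  by have := le_mx_norm (L - M x) i j; rewrite !mxE.
apply/cvgrPdist_le => e e0.
have : \forall x \near F, forall ij : 'I_m * 'I_n,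
    `|L ij.1 ij.2 - M x ij.1 ij.2| <= e.
  apply: filter_forall => -[i j] /=.
  by have /cvgrPdist_le/(_ e e0) := h i j.
apply: filterS => x hx; apply: mx_norm_le (ltW e0) _ => i j.
by have := hx (i, j); rewrite !mxE.
Qed.

Lemma is_derive_mxP m n (M : R -> 'M[R]_(m, n)) (t : R) (dM : 'M[R]_(m, n)) :
  is_derive t 1 M dM <->
  forall i j, is_derive t 1 (fun x => M x i j) (dM i j).
Proof.
split => [[dm <-] i j|h].
  split; last by rewrite derive_mx // mxE.
  exact: (derivable_mxP M t 1).1 dm i j.
have dm : derivable M t 1 by apply: (derivable_mxP M t 1).2 => i j; case: (h i j).
split => //; rewrite derive_mx //; apply/matrixP => i j; rewrite mxE.
by case: (h i j).
Qed.

Lemma is_derive_eqr (V : normedModType R) (f : R -> V) (t : R) (d d' : V) :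
  is_derive t 1 f d -> d = d' -> is_derive t 1 f d'.
Proof. by move=> h <-. Qed.

Lemma is_derive_mulmx m n p (A : R -> 'M[R]_(m, n)) (B : R -> 'M[R]_(n, p))
    (dA : 'M[R]_(m, n)) (dB : 'M[R]_(n, p)) (t : R) :
  is_derive t 1 A dA -> is_derive t 1 B dB ->
  is_derive t 1 (fun x => A x *m B x) (dA *m B t + A t *m dB).
Proof.
move=> /is_derive_mxP hA /is_derive_mxP hB; apply/is_derive_mxP => i j.
rewrite (_ : (fun x => _) = \sum_(k < n) (fun x => A x i k * B x k j)); last first.
  by apply/funext => x; rewrite fct_sumE mxE.
rewrite !mxE -big_split /=; apply: is_derive_sum => k.
have := @is_deriveM _ _ (fun x => A x i k) (fun x => B x k j) t 1 _ _
  (hA i k) (hB k j).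
move=> h; apply: (is_derive_eqr h).
by rewrite addrC; congr (_ + _); exact: mulrC.
Qed.

Lemma is_derive_trmx m n (A : R -> 'M[R]_(m, n)) (dA : 'M[R]_(m, n)) (t : R) :
  is_derive t 1 A dA -> is_derive t 1 (fun x => (A x)^T) dA^T.
Proof.
move=> /is_derive_mxP hA; apply/is_derive_mxP => i j.
rewrite mxE (_ : (fun x => _) = (fun x => A x j i)); first exact: hA.
by apply/funext => x; rewrite mxE.
Qed.

Lemma is_derive_mx_cst m n (A : R -> 'M[R]_(m, n)) :
  (forall t : R, is_derive t 1 A (0 : 'M[R]_(m, n))) -> forall t s, A t = A s.
Proof.
move=> h t s; apply/matrixP => i j.
apply: (@is_derive_0_is_cst _ (fun x => A x i j)) => x.
by have /is_derive_mxP/(_ i j) := h x; rewrite mxE.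
Qed.

End MatrixAnalysis.

(** * Rodrigues' formula and the axis-angle form of a rotation *)

Section Rotm.
Variable R : realType.
Implicit Types (u v w xi : 'cV[R]_3) (A B Q : 'M[R]_3) (s t : R).

(** Rodrigues' formula; for a unit vector [u] it is the rotation by the angle [t] about [u]. *)
Definition rotm u t : 'M[R]_3 :=
  1%:M + sin t *: hat u + (1 - cos t) *: (hat u *m hat u).

Lemma hat_sqr u : hat u *m hat u = u *m u^T - (dotv u u)%:M.
Proof.
apply: mx3P; rewrite !mulmx3E !mxE /= big_ord1 !mxE /= ?dotvE
  ?mulr1n ?mulr0n; ring.
Qed.

Lemma hat_cube u : dotv u u = 1 -> hat u *m hat u *m hat u = - hat u.
Proof.
move=> hu; rewrite hat_sqr hu mulmxBl mul1mx.
suff -> : u *m u^T *m hat u = 0 by rewrite sub0r.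
by apply: mx3P; rewrite !mulmx3E !mxE /= !big_ord1 !mxE; ring.
Qed.

Lemma rotm0 u : rotm u 0 = 1%:M.
Proof. by rewrite /rotm sin0 cos0 subrr !scale0r !addr0. Qed.

Lemma rotm_hat u t : dotv u u = 1 ->
  rotm u t *m hat u = cos t *: hat u + sin t *: (hat u *m hat u).
Proof.
move=> hu; rewrite /rotm !mulmxDl mul1mx -!scalemxAl hat_cube //.
move: (hat u *m hat u) (hat u) => H2 H.
by apply/matrixP => i j; rewrite !mxE; ring.
Qed.

Lemma rotmD u s t : dotv u u = 1 -> rotm u (s + t) = rotm u s *m rotm u t.
Proof.
move=> hu; rewrite [in RHS]/(rotm u t) !mulmxDr mulmx1 -!scalemxAr mulmxA.
rewrite rotm_hat // mulmxDl -!scalemxAl hat_cube // /rotm sinD cosD.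
move: (hat u *m hat u) (hat u) => H2 H; apply/matrixP => i j; rewrite !mxE; ring.
Qed.

Lemma rotm_tr u t : (rotm u t)^T = rotm u (- t).
Proof.
rewrite /rotm sinN cosN !linearD /= !linearZ /= trmx1 trmx_mul hat_skew.
by rewrite mulNmx mulmxN opprK scalerN scaleNr.
Qed.

Lemma SO3_rotm u t : dotv u u = 1 -> SO3 (rotm u t).
Proof.
move=> hu.
have orth s : (rotm u s)^T *m rotm u s = 1%:M.
  by rewrite rotm_tr -rotmD // addNr rotm0.
split => //.
(* As the square of an orthogonal matrix, the rotation has determinant 1 and not -1. *)
rewrite {1}(_ : t = t / 2 + t / 2); last by field.
rewrite rotmD // det_mulmx -{1}det_tr -det_mulmx orth det1 //.
Qed.

Lemma mxtrace_rotm u t : dotv u u = 1 -> \tr (rotm u t) = 1 + 2 * cos t.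
Proof.
move=> hu; rewrite /rotm !mxtraceD !mxtraceZ mxtrace_hatM hu mxtrace1.
by rewrite mxtrace3E !mxE /=; ring.
Qed.

Lemma axvE A : axv A = vec3 (A 2 1 - A 1 2) (A 0 2 - A 2 0) (A 1 0 - A 0 1).
Proof. by apply: cv3P; rewrite !mxE. Qed.

Lemma hat_axv A : hat (axv A) = A - A^T.
Proof. by rewrite vee_skewK // linearB /= trmxK opprB. Qed.

Lemma axv_rotm u t : axv (rotm u t) = (2 * sin t) *: u.
Proof.
rewrite /axv rotm_tr /rotm sinN cosN.
rewrite [X in vee X](_ : _ = (2 * sin t) *: hat u).
  by rewrite veeZ hatK.
by apply/matrixP => i j; rewrite !mxE; ring.
Qed.

Lemma axv_tr A : axv A^T = - axv A.
Proof. by apply: cv3P; rewrite !axvE !mxE /=; ring. Qed.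

Lemma mxtrace_hat A u : \tr (A *m hat u) = - dotv (axv A) u.
Proof.
by rewrite mxtrace3E !mulmx3E dotvE axvE !mxE /=; ring.
Qed.

Lemma SO3_trace_bounds A : SO3 A -> -1 <= \tr A <= 3.
Proof.
move=> hA; have [_ h] := SO3_axis hA.
have := dotvv_ge0 (axv A); rewrite h => h1.
suff h2 : \tr A <= 3.
  rewrite h2 andbT leNgt; apply/negP => h3.
  have /SO3_axis [/matrixP] := hA.
  by move=> _ _; nra.
have d i : A i i <= 1.
  have := SO3_rows hA i i; rewrite eqxx /= => hr.
  have : A i i ^+ 2 <= 1 by move: hr; move: i; apply: ord3_cases => /=; nra.
  by move=> hh; nra.
by rewrite mxtrace3E; have := d 0; have := d 1; have := d 2; lra.
Qed.

(* u spans the +1-eigenspace: a nonzero column of the rank-one matrix 1 + A. *)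
Lemma SO3_half_turn A : SO3 A -> \tr A = -1 ->
  exists2 u, dotv u u = 1 & A = rotm u pi.
Proof.
move=> hA hT; have [_] := SO3_axis hA; rewrite hT addrN mulr0 => w0.
have symA : A^T = A.
  apply/eqP; rewrite eq_sym -subr_eq0 -hat_axv.
  have -> : axv A = 0 by apply/eqP; rewrite -enorm_eq0 /enorm w0 sqrtr0.
  by rewrite hat0.
have sy i j : A j i = A i j by rewrite -[in RHS]symA mxE.
have [[c00 c01 c02] [[c10 c11 c12] [c20 c21 c22]]] := SO3_cofactor hA.
have hT' := hT; rewrite mxtrace3E in hT'.
have s10 := sy 0 1; have s20 := sy 0 2; have s21 := sy 1 2.
clear sy.
have rank1 k i j : (1%:M + A) i k * (1%:M + A) j k =
    (1%:M + A) k k * (1%:M + A) i j.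
  by move: k i j; do 3![apply: ord3_cases]; rewrite !mxE /=;
    rewrite ?s10 ?s20 ?s21 in c00 c01 c02 c10 c11 c12 c20 c21 c22 *;
    move: c00 c01 c02 c11 c12 c22 hT'; clear;
    move: (A 0 0) (A 0 1) (A 0 2) (A 1 1) (A 1 2) (A 2 2) => *; lra.
have [k hk] : exists k, 0 < (1%:M + A) k k.
  have : 0 < (1%:M + A) 0 0 + (1%:M + A) 1 1 + (1%:M + A) 2 2.
    by rewrite !mxE /=; lra.
  have [?|h0] := ltP 0 ((1%:M + A) 0 0); first by exists 0.
  have [?|h1] := ltP 0 ((1%:M + A) 1 1); first by exists 1.
  by move=> h2; exists 2; lra.
have [s hs] : exists s, 2 * s ^+ 2 * (1%:M + A) k k = 1.
  exists (Num.sqrt (2 * (1%:M + A) k k))^-1.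
  have hk0 : (1%:M + A) k k != 0 by rewrite gt_eqF.
  by rewrite exprVn sqr_sqrtr ?mulr_ge0 ?ltW //; field.
pose u : 'cV[R]_3 := s *: col k (1%:M + A).
have uu : 2 *: (u *m u^T) = 1%:M + A.
  apply/matrixP => i j; rewrite mxE [X in _ * X]mxE big_ord1.
  have uE l : u l 0 = s * (1%:M + A) l k by rewrite mxE [X in _ * X]mxE.
  rewrite [u^T 0 j]mxE !uE.
  transitivity (2 * s ^+ 2 * ((1%:M + A) i k * (1%:M + A) j k)); first by ring.
  by rewrite rank1 mulrA hs mul1r.
have hu : dotv u u = 1.
  have : \tr (2 *: (u *m u^T)) = 2.
    by rewrite uu mxtraceD mxtrace1 hT; ring.
  rewrite mxtraceZ mxtrace_mulC [\tr _]big_ord1 -/(dotv u u) => h; lra.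
exists u => //; rewrite /rotm sinpi cospi scale0r addr0 hat_sqr hu.
have -> : A = 2 *: (u *m u^T) - 1%:M by rewrite uu addrC addKr.
by apply/matrixP => i j; rewrite !mxE; ring.
Qed.

(** The axis is [axv A] divided by 2 sin t, so sin t = 0 is treated apart: trace -1 is a half turn,
    and trace 3 is the identity. *)
Lemma SO3_rotmP A : SO3 A -> exists u t,
  [/\ dotv u u = 1, 0 <= t <= pi, cos t = (\tr A - 1) / 2 & A = rotm u t].
Proof.
move=> hA; have /andP[tge tle] := SO3_trace_bounds hA.
have [hT|hT] := eqVneq (\tr A) (-1).
  have [u hu e] := SO3_half_turn hA hT.
  by exists u, pi; split; rewrite ?pi_ge0 ?lexx //= cospi hT; field.
have [E1 E2] := SO3_axis hA.
have {hT}tgt : -1 < \tr A by rewrite lt_neqAle eq_sym hT.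
pose c := (\tr A - 1) / 2.
have cb : -1 <= c <= 1 by rewrite /c; lra.
pose t := acos c.
have ct : cos t = c by rewrite acosK.
have tb : 0 <= t <= pi by rewrite acos_ge0 // acos_lepi.
have st : 0 <= sin t by rewrite sin_ge0_pi // in_itv.
have sc : sin t ^+ 2 = 1 - c ^+ 2 by rewrite sin2cos2 ct.
have [s0|s0] := eqVneq (sin t) 0.
  have c1 : c = 1 by move: sc tgt; rewrite s0 /c; nra.
  have w0 : axv A = 0.
    apply/eqP; rewrite -enorm_eq0 /enorm E2.
    by rewrite (_ : 3 - \tr A = 0) ?mul0r ?sqrtr0 //; move: c1; rewrite /c; lra.
  have hT3 : \tr A = 3 by move: c1; rewrite /c; lra.
  (* At angle 0 any unit vector serves as the axis. *)
  exists (vec3 1 0 0), t; split => //; first by rewrite dotvE !mxE /=; ring.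
  rewrite /rotm s0 ct c1 subrr !scale0r !addr0.
  move: E1; rewrite w0 mul0mx hT3 => /eqP.
  rewrite scaler_eq0 gt_eqF /=; last by lra.
  have symA : A^T = A by apply/eqP; rewrite eq_sym -subr_eq0 -hat_axv w0 hat0.
  rewrite symA => /eqP/matrixP h; apply/matrixP => i j.
  by have := h i j; rewrite !mxE; case: eqP => _; rewrite ?mulr1n ?mulr0n; lra.
have {s0}spos : 0 < sin t by rewrite lt_neqAle eq_sym s0.
have s4 : (3 - \tr A) * (1 + \tr A) = (2 * sin t) ^+ 2.
  by rewrite exprMn sc /c; field.
have s2 : sin t != 0 by rewrite gt_eqF.
have s1 : 1 + \tr A != 0 by rewrite gt_eqF //; lra.
have s3 : 3 - \tr A != 0 by apply/eqP => h3; move: sc; rewrite /c; nra.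
have hu : dotv ((2 * sin t)^-1 *: axv A) ((2 * sin t)^-1 *: axv A) = 1.
  by rewrite dotvZl dotvZr E2 s4; field.
exists ((2 * sin t)^-1 *: axv A), t; split => //.
rewrite /rotm hat_sqr hu ct hatZ hat_axv.
set u := _ *: axv A.
have -> : u *m u^T = (3 - \tr A)^-1 *: (A + A^T - (\tr A - 1)%:M).
  rewrite /u linearZ /= -scalemxAr -scalemxAl scalerA -E1 !scalerA.
  by congr (_ *: _); rewrite -expr2 exprVn -s4; field; rewrite s1 s3.
apply/matrixP => i j; rewrite !mxE /c.
by case: (i == j); rewrite ?mulr1n ?mulr0n; field; rewrite s2 s3.
Qed.

Lemma dotv_SO3_le A u : SO3 A -> dotv u u = 1 -> dotv u (A *m u) <= 1.
Proof.
move=> hA hu; apply: le_trans (dotv_le _ _) _.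
have -> : enorm (A *m u) = enorm u.
  congr Num.sqrt; rewrite /dotv trmx_mul mulmxA -(mulmxA _ _ A).
  by rewrite (SO3_orth hA).1 mulmx1.
by rewrite -expr2 enorm_sqr hu.
Qed.

End Rotm.

(** * The matrix exponential as a power series and as a flow *)

Section Expm.
Variable R : realType.
Implicit Types (u v w xi : 'cV[R]_3) (A B Q X Y : 'M[R]_3) (s t : R).

Lemma is_derive_rotm u t : dotv u u = 1 ->
  is_derive t 1 (rotm u) (rotm u t *m hat u).
Proof.
move=> hu; rewrite rotm_hat // (_ : rotm u = fun x =>
  1%:M + sin x *: hat u + (1 - cos x) *: (hat u *m hat u)) //.
move: (hat u) (hat u *m hat u) => H H2; apply/is_derive_mxP => i j.
rewrite (_ : (fun x => _) = cst ((1%:M : 'M[R]_3) i j) + (H i j \*: sin) +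
    (H2 i j \*: (cst 1 - cos))); last first.
  by apply/funext => x; rewrite !mxE; congr (_ + _ + _); exact: mulrC.
apply: (is_derive_eqr (is_deriveD (is_deriveD (is_derive_cst _ _ _)
  (is_deriveZ _ (is_derive_sin t)))
  (is_deriveZ _ (is_deriveB (is_derive_cst _ _ _) (is_derive_cos t))))).
rewrite !mxE add0r sub0r opprK.
by congr (_ + _); exact: mulrC.
Qed.

Lemma mx_entry_expr_le X k i j : `|(X ^+ k) i j| <= (3 * `|X|) ^+ k.
Proof.
elim: k i j => [|k IH] i j.
  by rewrite !expr0 mxE; case: eqP => _; rewrite ?normr1 ?normr0 ?ler01.
rewrite exprS [X * _]/(X *m _) mulmx3E exprS.
set K := (3 * `|X|) ^+ k.
have h l : `|X i l * (X ^+ k) l j| <= `|X| * K.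
  by rewrite normrM ler_pM // le_mx_norm.
rewrite -mulrA; apply: le_trans (ler_normD _ _) _.
have := ler_normD (X i 0 * (X ^+ k) 0 j) (X i 1 * (X ^+ k) 1 j).
by have := h 0; have := h 1; have := h 2; lra.
Qed.

(** The entries of exp(tX) are real power series in t, so convergence and termwise differentiation
    reduce to the scalar theory. *)
Let coef X i j : R^nat := fun k => (X ^+ k) i j / k`!%:R.

Let coef_cvg X i j (x : R) : cvgn (pseries (coef X i j) x).
Proof.
apply: normed_cvg.
apply: (@series_le_cvg _ _ (exp_coeff (3 * `|X| * `|x|))) => [n|n|n|].
- exact: normr_ge0.
- by rewrite /exp_coeff /= mulr_ge0 // exprn_ge0 // mulr_ge0 // mulr_ge0.
- rewrite /= /exp_coeff /= normrM normrX normrM [X in _ * X * _]ger0_norm //.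
  rewrite exprMn mulrAC ler_wpM2r // ler_wpM2r // ?exprn_ge0 //.
  exact: mx_entry_expr_le.
- exact: is_cvg_series_exp_coeff.
Qed.

(** Differentiating the series multiplies it by X, and X can be split off on either side; equating
    the two versions gives [expm_comm]. *)
Let coef_diffsl X i j : pseries_diffs (coef X i j) =
  fun k => X i 0 * coef X 0 j k + X i 1 * coef X 1 j k + X i 2 * coef X 2 j k.
Proof.
apply/funext => k; rewrite /pseries_diffs /coef exprS [X * _]/(X *m _) mulmx3E.
rewrite factS natrM; field.
by rewrite nat1r !pnatr_eq0 -!lt0n fact_gt0.
Qed.

Let coef_diffsr X i j : pseries_diffs (coef X i j) =
  fun k => coef X i 0 k * X 0 j + coef X i 1 k * X 1 j + coef X i 2 k * X 2 j.
Proof.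
apply/funext => k; rewrite /pseries_diffs /coef exprSr [_ * X]/(_ *m X) mulmx3E.
rewrite factS natrM; field.
by rewrite nat1r !pnatr_eq0 -!lt0n fact_gt0.
Qed.

Let lim_comb3 (f g h : R^nat) (a b c x : R) :
  cvgn (pseries f x) -> cvgn (pseries g x) -> cvgn (pseries h x) ->
  pseries (fun k => a * f k + b * g k + c * h k) x @ \oo -->
  a * limn (pseries f x) + b * limn (pseries g x) + c * limn (pseries h x).
Proof.
move=> cf cg ch.
rewrite (_ : pseries _ x = (fun n => a * pseries f x n + b * pseries g x n +
    c * pseries h x n)); last first.
  apply/funext => n; rewrite /pseries /series /= !mulr_sumr -!big_split /=.
  by apply: eq_bigr => k _; ring.
by apply: cvgD; [apply: cvgD|]; apply: cvgM => //; exact: cvg_cst.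
Qed.

Let expm_scale_entry X t i j : expm (t *: X) i j = limn (pseries (coef X i j) t).
Proof.
have h : series (fun k => (k`!%:R)^-1 *: (t *: X) ^+ k) @ \oo -->
    (\matrix_(i, j) limn (pseries (coef X i j) t) : 'M[R]_3).
  apply/cvg_mxP => a b; rewrite mxE.
  rewrite (_ : (fun n => _) = pseries (coef X a b) t); last first.
    apply/funext => n; rewrite /pseries /series /= summxE.
    apply: eq_bigr => k _; rewrite exprZn !mxE /coef; ring.
  exact: coef_cvg.
by rewrite /expm (cvg_lim _ h) ?mxE.
Qed.

Let expm_entry_derive X t i j : is_derive t 1
  (fun x => expm (x *: X) i j) (limn (pseries (pseries_diffs (coef X i j)) t)).
Proof.
rewrite (_ : (fun x => _) = fun x => limn (pseries (coef X i j) x)); last first.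
  by apply/funext => x; rewrite expm_scale_entry.
have cd a b (x : R) : cvgn (pseries (pseries_diffs (coef X a b)) x).
  rewrite coef_diffsl; apply/cvg_ex; eexists.
  by apply: lim_comb3; exact: coef_cvg.
(* Any radius larger than |t| serves here. *)
apply: (@pseries_snd_diffs _ _ (`|t| + 1)).
- exact: coef_cvg.
- exact: cd.
- rewrite (_ : pseries_diffs (pseries_diffs (coef X i j)) = fun k =>
     X i 0 * pseries_diffs (coef X 0 j) k +
     X i 1 * pseries_diffs (coef X 1 j) k +
     X i 2 * pseries_diffs (coef X 2 j) k).
    by apply/cvg_ex; eexists; apply: lim_comb3; exact: cd.
  by apply/funext => k; rewrite {1}/pseries_diffs coef_diffsl /pseries_diffs; ring.
- by rewrite [ltRHS]ger0_norm ?addr_ge0 // ltrDl.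
Qed.

Lemma is_derive_expm X t :
  is_derive t 1 (fun x => expm (x *: X)) (X *m expm (t *: X)).
Proof.
apply/is_derive_mxP => i j; apply: is_derive_eqr (expm_entry_derive X t i j) _.
rewrite coef_diffsl mulmx3E !expm_scale_entry.
by apply/cvg_lim => //; apply: lim_comb3; exact: coef_cvg.
Qed.

Lemma expm_comm X t : X *m expm (t *: X) = expm (t *: X) *m X.
Proof.
apply/matrixP => i j.
transitivity (limn (pseries (pseries_diffs (coef X i j)) t)).
  rewrite coef_diffsl mulmx3E !expm_scale_entry; apply/esym.
  by apply/cvg_lim => //; apply: lim_comb3; exact: coef_cvg.
rewrite coef_diffsr mulmx3E !expm_scale_entry.
apply/cvg_lim => //.
rewrite (_ : (fun k => _) = fun k =>
   X 0 j * coef X i 0 k + X 1 j * coef X i 1 k + X 2 j * coef X i 2 k).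
  by rewrite ![_ * X _ j]mulrC; apply: lim_comb3; exact: coef_cvg.
by apply/funext => k; ring.
Qed.

Lemma expm0 : expm (0 : 'M[R]_3) = 1%:M.
Proof.
apply/matrixP => i j; rewrite -(scale0r 0) expm_scale_entry.
apply/cvg_lim => //.
rewrite -(cvg_shiftn 1) (_ : (fun n => _) = cst ((1%:M : 'M[R]_3) i j)).
  exact: cvg_cst.
apply/funext => n; rewrite /pseries /series /= addn1 big_nat_recl //.
rewrite big1 ?addr0 => [|k _]; last by rewrite expr0n mulr0.
by rewrite /coef !expr0 fact0 divr1 mulr1.
Qed.

Lemma is_derive_reparam m n (M : R -> 'M[R]_(m, n)) (dM : R -> 'M[R]_(m, n))
    (a b t : R) :
  (forall x : R, is_derive x 1 M (dM x)) ->
  is_derive t 1 (fun x => M (a * x + b)) (a *: dM (a * t + b)).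
Proof.
move=> hM; apply/is_derive_mxP => i j.
have /is_derive_mxP/(_ i j) h := hM (a * t + b).
have hl : is_derive t 1 (fun x => a * x + b) a.
  rewrite (_ : (fun x => _) = (a \*: id) + cst b) //.
  by apply: is_derive_eqr; rewrite addr0 /GRing.scale /= mulr1.
have := @is_derive1_comp _ (fun x => M x i j) (fun x => a * x + b) t _ _ h hl.
by rewrite mxE mulrC.
Qed.

Lemma expm_scaleVK X t : expm ((- t) *: X) *m expm (t *: X) = 1%:M.
Proof.
pose W (x : R) := expm ((- x) *: X) *m expm (x *: X).
have <- : W 0 = 1%:M by rewrite /W oppr0 scale0r expm0 mulmx1.
apply: (@is_derive_mx_cst _ _ _ W) => x.
have h1 := is_derive_reparam (-1) 0 x (is_derive_expm X).
have h2 := is_derive_mulmx h1 (is_derive_expm X x).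
have -> : W = (fun x => expm ((-1 * x + 0) *: X) *m expm (x *: X)).
  by apply/funext => z; rewrite /W mulN1r addr0.
apply: (is_derive_eqr h2).
by rewrite scaleN1r mulNmx expm_comm -mulmxA addNr.
Qed.

(** Y exp(-tX) has derivative zero. This uniqueness for the linear equation Y' = Y X is what
    identifies the exponentials computed below. *)
Lemma expm_flow m (Y : R -> 'M[R]_(m, 3)) X :
  (forall t : R, is_derive t 1 Y (Y t *m X)) ->
  forall t, Y t = Y 0 *m expm (t *: X).
Proof.
move=> hY t.
pose Z (x : R) := Y x *m expm ((- x) *: X).
have Zc x : Z x = Z 0.
  apply: (@is_derive_mx_cst _ _ _ Z) => {}x.
  have h1 := is_derive_reparam (-1) 0 x (is_derive_expm X).
  have h2 := is_derive_mulmx (hY x) h1.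
  have -> : Z = (fun x => Y x *m expm ((-1 * x + 0) *: X)).
    by apply/funext => z; rewrite /Z mulN1r addr0.
  apply: (is_derive_eqr h2).
  by rewrite scaleN1r mulmxN -mulmxA subrr.
have := Zc t; rewrite /Z oppr0 scale0r expm0 mulmx1 => <-.
by rewrite -mulmxA expm_scaleVK mulmx1.
Qed.

Lemma expm_hat_unit u t : dotv u u = 1 -> expm (t *: hat u) = rotm u t.
Proof.
move=> hu.
have := @expm_flow _ (rotm u) (hat u) (fun x => is_derive_rotm x hu) t.
by rewrite rotm0 mul1mx.
Qed.

Lemma expm_hat xi : expm (hat xi) = rotm (sgnv xi) (enorm xi).
Proof.
have [->|xi0] := eqVneq xi 0; first by rewrite hat0 expm0 enorm0 rotm0.
have hu : dotv (sgnv xi) (sgnv xi) = 1.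
  by rewrite -enorm_sqr enorm_sgnv // expr1n.
by rewrite -expm_hat_unit // -hatZ sgnvK.
Qed.

Lemma expm_mulC X Y t : X *m Y = Y *m X ->
  Y *m expm (t *: X) = expm (t *: X) *m Y.
Proof.
move=> XY.
pose W (x : R) := expm ((- x) *: X) *m Y *m expm (x *: X).
have Wc : W t = W 0.
  apply: (@is_derive_mx_cst _ _ _ W) => x.
  have h1 := is_derive_reparam (-1) 0 x (is_derive_expm X).
  have h2 := is_derive_mulmx h1 (is_derive_mulmx (is_derive_cst Y x 1)
     (is_derive_expm X x)).
  have -> : W = (fun x => expm ((-1 * x + 0) *: X) *m (Y *m expm (x *: X))).
    by apply/funext => z; rewrite /W mulN1r addr0 mulmxA.
  apply: (is_derive_eqr h2).
  rewrite mul0mx add0r scaleN1r expm_comm mulNmx !mulmxA.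
  by rewrite -!(mulmxA (expm _)) XY addNr.
move: Wc; rewrite /W oppr0 scale0r expm0 mul1mx mulmx1 => Wt.
rewrite -{2}Wt !mulmxA.
have := expm_scaleVK X (- t); rewrite opprK => ->.
by rewrite mul1mx.
Qed.

Lemma expm_commD X Y : X *m Y = Y *m X -> expm (X + Y) = expm X *m expm Y.
Proof.
move=> XY.
pose P (x : R) := expm (x *: X) *m expm (x *: Y).
have hP (x : R) : is_derive x 1 P (P x *m (X + Y)).
  have h := is_derive_mulmx (is_derive_expm X x) (is_derive_expm Y x).
  apply: (is_derive_eqr h).
  rewrite /P mulmxDr expm_comm -!mulmxA expm_mulC ?mulmxA; last exact/esym.
  by rewrite -!mulmxA expm_comm.
have := @expm_flow _ P (X + Y) hP 1.
by rewrite /P !scale0r !scale1r expm0 !mul1mx.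
Qed.

End Expm.

(** * Uniqueness of the principal logarithm *)

(** [B] preserves the eigenspace of [A], hence has an eigenvector inside it. *)
Lemma eigenvector_comm (C : numClosedFieldType) n (A B : 'M[C]_n) (z : C) :
  A *m B = B *m A -> eigenvalue A z ->
  exists (v : 'rV[C]_n) w, [/\ v != 0, v *m A = z *: v & v *m B = w *: v].
Proof.
move=> AB zA; set E := eigenspace A z.
have rE : (0 < \rank E)%N by rewrite lt0n mxrank_eq0.
have stE : stablemx E B by apply: comm_mx_stable_eigenspace.
have [w /eigenvalueP[v' v'B v'0]] := eigenvalue_closed (restrictmx E B) rE.
pose v := v' *m row_base E.
have vE : (v <= E)%MS by rewrite mulmx_sub // eq_row_base.
exists v, w; split.
- by rewrite mulmx_free_eq0 ?row_base_free.
- exact/eigenspaceP.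
- rewrite /v scalemxAl -v'B -[in LHS]mulmxA -[in RHS]mulmxA; congr (_ *m _).
  by rewrite /conjmx mulmxKpV ?stablemx_row_base.
Qed.

Section Plog.
Variable R : realType.
Implicit Types (u v w xi : 'cV[R]_3) (A B Q X Y Z : 'M[R]_3) (s t : R).

Definition map_mxReal m n (M : 'M[R]_(m, n)) : 'M[R[i]]_(m, n) :=
  map_mx (real_complex R) M.

Lemma map_mxRealE m n (M : 'M[R]_(m, n)) i j :
  map_mxReal M i j = Complex (M i j) 0.
Proof. by rewrite mxE. Qed.

(** A row eigenvector v satisfies v exp(xZ) = e^(xz) v, so exp Z = 1 forces e^z = 1. The argument
    runs on real and imaginary parts, where the real exponential applies. *)
Lemma cexp_eigen Z (z : R[i]) : expm Z = 1%:M ->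
  eigenvalue (map_mxReal Z) z ->
  expR (complex.Re z) * cos (complex.Im z) = 1 /\ sin (complex.Im z) = 0.
Proof.
case: z => s t eZ /eigenvalueP[v vZ v0] /=.
pose a : 'rV[R]_3 := map_mx (@complex.Re R) v.
pose b : 'rV[R]_3 := map_mx (@complex.Im R) v.
have vE j : v 0 j = Complex (a 0 j) (b 0 j) by rewrite !mxE; case: (v 0 j).
clearbody a b.
have hZ j : (a *m Z) 0 j = s * a 0 j - t * b 0 j /\
            (b *m Z) 0 j = t * a 0 j + s * b 0 j.
  have /matrixP/(_ 0 j) e := vZ.
  rewrite mxE [in RHS]mxE sum_ord3 !vE !map_mxRealE in e.
  by move: e; rewrite !mulmx3E; simpc => -[h1 h2]; split; lra.
have aZ : a *m Z = s *: a - t *: b.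
  by apply/rowP => j; rewrite (hZ j).1 !mxE.
have bZ : b *m Z = t *: a + s *: b.
  by apply/rowP => j; rewrite (hZ j).2 !mxE.
have lin (x : R) : is_derive x 1 (fun x => s * x) s.
  by apply: is_derive_eqr; rewrite [LHS]mulr1.
have lint (x : R) : is_derive x 1 (fun x => t * x) t.
  by apply: is_derive_eqr; rewrite [LHS]mulr1.
have de (x : R) : is_derive x 1 (fun x => expR (s * x)) (s * expR (s * x)).
  by apply: is_derive_eqr; rewrite mulrC.
have dc (x : R) : is_derive x 1 (fun x => cos (t * x)) (- t * sin (t * x)).
  by apply: is_derive_eqr; rewrite mulrC mulrN mulNr.
have ds (x : R) : is_derive x 1 (fun x => sin (t * x)) (t * cos (t * x)).
  by apply: is_derive_eqr; rewrite mulrC.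
(* A combination f a + g b that solves the linear equation driven by Z takes the same values at 0
   and 1, since exp Z = 1. *)
have key (c d : 'rV[R]_3) (f g : R -> R) (f' g' : R -> R) :
    (forall x : R, is_derive x 1 f (f' x)) ->
    (forall x : R, is_derive x 1 g (g' x)) ->
    (forall x, f' x *: a + g' x *: b = (f x *: a + g x *: b) *m Z) ->
    f 1 *: a + g 1 *: b = f 0 *: a + g 0 *: b.
  move=> hf hg hfg.
  have hd (x : R) : is_derive x 1 (fun x => f x *: a + g x *: b)
      ((f x *: a + g x *: b) *m Z).
    rewrite -hfg; apply/is_derive_mxP => i j.
    rewrite (_ : (fun x => _) = (a i j \*: f) + (b i j \*: g)); last first.
      by apply/funext => y; rewrite !mxE; congr (_ + _); exact: mulrC.
    apply: (is_derive_eqr (is_deriveD (is_deriveZ _ (hf x)) (is_deriveZ _ (hg x)))).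
    by rewrite !mxE; congr (_ + _); exact: mulrC.
  have := expm_flow hd 1; rewrite scale1r eZ mulmx1; exact.
have E1 := key a a (fun x => expR (s * x) * cos (t * x))
  (fun x => - (expR (s * x) * sin (t * x)))
  (fun x => expR (s * x) * (s * cos (t * x) - t * sin (t * x)))
  (fun x => - (expR (s * x) * (s * sin (t * x) + t * cos (t * x)))).
have E2 := key a a (fun x => expR (s * x) * sin (t * x))
  (fun x => expR (s * x) * cos (t * x))
  (fun x => expR (s * x) * (s * sin (t * x) + t * cos (t * x)))
  (fun x => expR (s * x) * (s * cos (t * x) - t * sin (t * x))).
have dec (x : R) : is_derive x 1 (fun x => expR (s * x) * cos (t * x))
    (expR (s * x) * (s * cos (t * x) - t * sin (t * x))).
  have h := is_deriveM (de x) (dc x); apply: (is_derive_eqr h).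
  by rewrite /GRing.scale /=; ring.
have des (x : R) : is_derive x 1 (fun x => expR (s * x) * sin (t * x))
    (expR (s * x) * (s * sin (t * x) + t * cos (t * x))).
  have h := is_deriveM (de x) (ds x); apply: (is_derive_eqr h).
  by rewrite /GRing.scale /=; ring.
have {}E1 := E1 dec (fun x => is_deriveN (des x)).
have {}E2 := E2 des dec.
rewrite !mulr1 !mulr0 expR0 cos0 sin0 !mul1r oppr0 scale0r addr0 scale1r in E1 E2.
rewrite scale0r add0r scale1r in E2.
have {}E1 := E1 _; have {}E2 := E2 _.
have [j hj] : exists j, a 0 j ^+ 2 + b 0 j ^+ 2 != 0.
  apply: contrapT => /forallNP h; move/eqP: v0; apply; apply/rowP => j.
  have /negP := h j; rewrite negbK paddr_eq0 ?sqr_ge0 // !sqrf_eq0.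
  by move=> hh; rewrite vE [RHS]mxE; apply/eqP; rewrite eq_complex.
have {E1}/rowP/(_ j) : (expR s * cos t) *: a + (- (expR s * sin t)) *: b = a.
  by apply: E1 => x; rewrite mulmxDl -!scalemxAl aZ bZ;
    apply/rowP => i; rewrite !mxE; ring.
have {E2}/rowP/(_ j) : (expR s * sin t) *: a + (expR s * cos t) *: b = b.
  by apply: E2 => x; rewrite mulmxDl -!scalemxAl aZ bZ;
    apply/rowP => i; rewrite !mxE; ring.
rewrite !mxE.
set p := expR s * cos t; set q := expR s * sin t => h2 h1.
(* The two equations say that (p - 1 + iq)(a_j + i b_j) = 0. *)
have h : (p - 1) ^+ 2 + q ^+ 2 = 0.
  apply: (mulIf hj); rewrite mul0r.
  transitivity (((p - 1) * a 0 j - q * b 0 j) ^+ 2 +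
    ((p - 1) * b 0 j + q * a 0 j) ^+ 2); first by ring.
  have -> : (p - 1) * a 0 j - q * b 0 j = 0 by lra.
  have -> : (p - 1) * b 0 j + q * a 0 j = 0 by lra.
  by rewrite expr0n addr0.
move/eqP: h; rewrite paddr_eq0 ?sqr_ge0 // !sqrf_eq0 subr_eq0.
move=> /andP[/eqP p1 /eqP q0].
split => //; apply: (mulfI (lt0r_neq0 (expR_gt0 s))).
by rewrite mulr0.
Qed.

(** All roots of the characteristic polynomial vanish, so it is X^3, and Cayley-Hamilton applies. *)
Lemma nilpotent_of_eigen Z :
  (forall z, eigenvalue (map_mxReal Z) z -> z = 0) -> Z ^+ 3 = 0.
Proof.
move=> h; have Zc3 : (map_mxReal Z) ^+ 3 = 0.
  have [r pr] := closed_field_poly_normal (char_poly (map_mxReal Z)).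
  have hr : forall z, z \in r -> z = 0.
    move=> z zr; apply: h; rewrite eigenvalue_root_char pr.
    by rewrite (monicP (char_poly_monic _)) scale1r root_prod_XsubC.
  have sr : size r = 3%N.
    have := size_char_poly (map_mxReal Z).
    rewrite pr size_scale ?size_prod_XsubC => [[]//|].
    by rewrite (monicP (char_poly_monic _)) oner_eq0.
  have := Cayley_Hamilton (map_mxReal Z); rewrite pr.
  rewrite (monicP (char_poly_monic _)) scale1r.
  rewrite big_seq (eq_bigr (fun=> 'X)) => [|z /hr ->]; last by rewrite subr0.
  by rewrite -big_seq big_const_seq count_predT sr iter_mulr_1
     rmorphXn /= horner_mx_X.
apply/matrixP => i j; have /matrixP/(_ i j) := Zc3.
rewrite /map_mxReal -(rmorphXn (map_mx (real_complex R))) /= !mxE.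
by move=> /eqP; rewrite fmorph_eq0 => /eqP.
Qed.

(** Here exp(xZ) is the quadratic polynomial [Y]. At x = 1 this gives Z + Z^2 / 2 = 0, and a
    multiplication by Z gives first Z^2 = 0. *)
Lemma expm_eq1_nilpotent Z : expm Z = 1%:M -> Z ^+ 3 = 0 -> Z = 0.
Proof.
move=> eZ Z3.
have Z3' : Z *m Z *m Z = 0 by rewrite -[RHS]Z3 !exprS expr0 mulr1 -mulmxA.
pose Y (x : R) := 1%:M + x *: Z + (x ^+ 2 / 2) *: (Z *m Z).
have hY (x : R) : is_derive x 1 Y (Y x *m Z).
  rewrite {2}/Y !mulmxDl mul1mx -!scalemxAl Z3' scaler0 addr0.
  apply/is_derive_mxP => i j.
  rewrite (_ : (fun x => _) = cst ((1%:M : 'M[R]_3) i j) + (Z i j \*: id) +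
      ((2^-1 * (Z *m Z) i j) \*: (id ^+ 2))); last first.
    apply/funext => y; rewrite /Y mxE [X in X + _]mxE [X in _ + X + _]mxE.
    rewrite [X in _ + X = _]mxE; congr (_ + _ + _); first exact: mulrC.
    by rewrite /= -mulrA mulrC.
  apply: (is_derive_eqr (is_deriveD (is_deriveD (is_derive_cst _ _ _)
    (is_deriveZ _ (is_derive_id x 1))) (is_deriveZ _ (is_deriveX 2 (is_derive_id x 1))))).
  rewrite [in RHS]mxE [X in _ = _ + X]mxE.
  rewrite /GRing.scale /= expr1 add0r mulr1; congr (_ + _).
  by field.
have := expm_flow hY 1.
rewrite scale1r eZ mulmx1 /Y scale0r expr0n mul0r scale0r !addr0 scale1r.
rewrite expr1n mul1r -addrA => /eqP; rewrite -subr_eq0 addrAC subrr add0r => /eqP e.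
have ZZ : Z *m Z = 0.
  have := congr1 (mulmx Z) e.
  by rewrite mulmxDr mulmx0 -scalemxAr mulmxA Z3' scaler0 addr0.
by move: e; rewrite ZZ scaler0 addr0.
Qed.

(** A competing logarithm X commutes with the rotation, hence with Y = t u^, so exp(X - Y) = 1 and
    every eigenvalue of X - Y is an integer multiple of 2 pi i. It is also a difference of
    eigenvalues of X and Y on a common eigenvector, with imaginary part of modulus below 2 pi, hence
    it is zero. So X - Y is nilpotent with exponential 1. *)
Lemma plog_rotm u t : dotv u u = 1 -> 0 <= t < pi ->
  plog (rotm u t) = t *: hat u.
Proof.
move=> hu /andP[t0 tpi]; pose Y := t *: hat u.
(* Y^3 = - t^2 Y makes every eigenvalue a root of z^3 = - t^2 z. *)
have Yeig z : eigenvalue (map_mxReal Y) z -> `|complex.Im z| <= t.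
  case: z => p q /eigenvalueP[v vY v0] /=.
  have Y3 : Y *m Y *m Y = - (t ^+ 2) *: Y.
    rewrite /Y -!scalemxAl -!scalemxAr -!scalemxAl hat_cube //.
    by rewrite -(scaleN1r (hat u)) !scalerA; congr (_ *: _); ring.
  have hz : Complex p q ^+ 3 = - (t ^+ 2)%:C%C * Complex p q.
    have : v *m (map_mxReal Y *m map_mxReal Y *m map_mxReal Y) =
        (Complex p q ^+ 3) *: v.
      by rewrite !mulmxA !(vY, =^~ scalemxAl) !scalerA !exprS expr0 mulr1 mulrA.
    rewrite /map_mxReal -!map_mxM Y3 map_mxZ -scalemxAr vY scalerA.
    move=> /eqP; rewrite -subr_eq0 -scalerBl scaler_eq0 (negbTE v0) orbF subr_eq0.
    by move=> /eqP <-; rewrite rmorphN.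
  move: hz; rewrite !exprS expr0; simpc => -[h1 h2].
  rewrite -(@ler_pXn2r _ 2) ?nnegrE // real_normK ?num_real //.
  have [q0|q0] := eqVneq q 0; first by rewrite q0 expr0n sqr_ge0.
  have e2 : 3 * p ^+ 2 - q ^+ 2 + t ^+ 2 = 0 by apply: (mulIf q0); nra.
  have [p0|p0] := eqVneq p 0; first by move: e2; rewrite p0; nra.
  have e1 : p ^+ 2 - 3 * q ^+ 2 + t ^+ 2 = 0 by apply: (mulIf p0); nra.
  by nra.
have exY : expm Y = rotm u t by exact: expm_hat_unit.
rewrite /plog; apply: xget_unique.
  by split => // z hz; apply: le_lt_trans tpi; exact: Yeig.
move=> X [exX Xeig]; apply/eqP; rewrite -subr_eq0; apply/eqP.
have XA : X *m rotm u t = rotm u t *m X.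
  by have := expm_comm X 1; rewrite scale1r exX.
have XY : X *m Y = Y *m X.
  have [t00|tn0] := eqVneq t 0; first by rewrite /Y t00 scale0r mulmx0 mul0mx.
  have tp : 0 < t by rewrite lt_neqAle eq_sym tn0.
  have sint0 : 0 < sin t by rewrite sin_gt0_pi // tp.
  have [orth1 orth2] := SO3_orth (SO3_rotm t hu).
  have XA' : X *m (rotm u t)^T = (rotm u t)^T *m X.
    rewrite -[LHS]mul1mx -orth1 -!mulmxA (mulmxA (rotm u t)) -XA.
    by rewrite -(mulmxA X) orth2 mulmx1.
  (* Y is a multiple of the skew part of the rotation. *)
  have hY : Y = (t / (2 * sin t)) *: (rotm u t - (rotm u t)^T).
    rewrite -hat_axv axv_rotm hatZ scalerA /Y; congr (_ *: _).
    by field; rewrite gt_eqF.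
  by rewrite hY -scalemxAr -scalemxAl mulmxBr mulmxBl XA XA'.
have exZ : expm (X - Y) = 1%:M.
  rewrite expm_commD ?mulmxN ?mulNmx ?XY // exX.
  have -> : - Y = (- t) *: hat u by rewrite scaleNr.
  by rewrite expm_hat_unit // -rotmD // addrN rotm0.
apply: expm_eq1_nilpotent => //; apply: nilpotent_of_eigen => z hz.
have cZX : map_mxReal (X - Y) *m map_mxReal X =
    map_mxReal X *m map_mxReal (X - Y).
  by rewrite /map_mxReal -!map_mxM mulmxBl mulmxBr XY.
have [v [w [v0 vZ vX]]] := eigenvector_comm cZX hz.
have vY : v *m map_mxReal Y = (w - z) *: v.
  rewrite scalerBl -vX -vZ -mulmxBr; congr (_ *m _).
  by apply/matrixP => i j; rewrite !mxE rmorphB opprB addrC subrK.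
have wX : `|complex.Im w| < pi by apply: Xeig; apply/eigenvalueP; exists v.
have wY : `|complex.Im (w - z)| <= t by apply: Yeig; apply/eigenvalueP; exists v.
have [e1 e2] := cexp_eigen exZ hz.
move: wX wY e1 e2; case: w {vX vY} => w1 w2; case: z {hz vZ} => z1 z2 /=.
move=> wX wY e1 e2.
have z2b : `|z2 / 2| < pi.
  have : `|z2| <= `|w2| + `|w2 - z2|.
    by rewrite -{1}(subKr w2 z2); apply: le_trans (ler_normB _ _) _.
  by rewrite normrM [`|2^-1|]ger0_norm //; lra.
have c1 : cos z2 = 1.
  have c0 : 0 < cos z2.
    by rewrite -(pmulr_rgt0 _ (expR_gt0 z1)) e1.
  by have := cos2Dsin2 z2; rewrite e2; nra.
have s0 : sin (z2 / 2) = 0.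
  have := cosD (z2 / 2) (z2 / 2); rewrite -splitr c1.
  by have := cos2Dsin2 (z2 / 2); nra.
have z20 : z2 = 0.
  apply/eqP; apply: contraT => z2n0.
  have : 0 < sin `|z2 / 2|.
    by rewrite sin_gt0_pi // z2b normr_gt0 mulf_neq0 // invr_neq0.
  by case: (ger0P (z2 / 2)) => _; rewrite ?sinN s0 ?oppr0 ltxx.
have z10 : z1 = 0.
  by apply: expR_inj; rewrite expR0 -e1 c1 mulr1.
by rewrite z10 z20.
Qed.

End Plog.

(** * The geodesic distance is the rotation angle *)

Section Distance.
Variable R : realType.
Implicit Types (u v w xi : 'cV[R]_3) (A B Q : 'M[R]_3) (s t : R).

(** The cosine of the angle of A^T B, by tr R = 1 + 2 cos t; unlike the angle, it is polynomial in
    the entries. *)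
Definition rcos A B : R := (\tr (A^T *m B) - 1) / 2.
Definition rang A B : R := acos (rcos A B).

Lemma SO3_trmul A B : SO3 A -> SO3 B -> SO3 (A^T *m B).
Proof. by move=> hA hB; apply: SO3_mul => //; exact: SO3_tr. Qed.

Lemma SO3_mulK A B : SO3 A -> A *m (A^T *m B) = B.
Proof. by move=> hA; rewrite mulmxA (SO3_orth hA).2 mul1mx. Qed.

Lemma rcos_bounds A B : SO3 A -> SO3 B -> -1 <= rcos A B <= 1.
Proof.
move=> hA hB; have := SO3_trace_bounds (SO3_trmul hA hB).
by rewrite /rcos; lra.
Qed.

Lemma rcosC A B : rcos A B = rcos B A.
Proof. by rewrite /rcos -mxtrace_tr trmx_mul trmxK. Qed.

Lemma rcosK A : SO3 A -> rcos A A = 1.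
Proof. by move=> hA; rewrite /rcos (SO3_orth hA).1 mxtrace1; field. Qed.

Lemma cos_rang A B : SO3 A -> SO3 B -> cos (rang A B) = rcos A B.
Proof. by move=> hA hB; rewrite acosK // in_itv /= rcos_bounds. Qed.

Lemma rang_bounds A B : SO3 A -> SO3 B -> 0 <= rang A B <= pi.
Proof.
by move=> hA hB; rewrite acos_ge0 ?acos_lepi // rcos_bounds.
Qed.

Lemma rangC A B : rang A B = rang B A.
Proof. by rewrite /rang rcosC. Qed.

Lemma rangK A : SO3 A -> rang A A = 0.
Proof. by move=> hA; rewrite /rang rcosK // acos1. Qed.

Lemma rcos_rotm A u t : SO3 A -> dotv u u = 1 -> rcos A (A *m rotm u t) = cos t.
Proof.
move=> hA hu; rewrite /rcos mulmxA (SO3_orth hA).1 mul1mx mxtrace_rotm //.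
by field.
Qed.

Lemma rang_rotm A u t : SO3 A -> dotv u u = 1 -> 0 <= t <= pi ->
  rang A (A *m rotm u t) = t.
Proof. by move=> hA hu ht; rewrite /rang rcos_rotm // cosK // in_itv. Qed.

Lemma rang_axis A B : SO3 A -> SO3 B ->
  exists2 u, dotv u u = 1 & B = A *m rotm u (rang A B).
Proof.
move=> hA hB; have [u [t [hu t0 _ e]]] := SO3_rotmP (SO3_trmul hA hB).
exists u => //; rewrite -{1}(SO3_mulK B hA) e; congr (_ *m rotm u _).
by rewrite -(SO3_mulK B hA) e rang_rotm.
Qed.

Lemma rang_eq0 A B : SO3 A -> SO3 B -> rang A B = 0 -> A = B.
Proof.
move=> hA hB h; have [u hu ->] := rang_axis hA hB.
by rewrite h rotm0 mulmx1.
Qed.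

Lemma rang_ltpi A B : SO3 A -> SO3 B -> (rang A B < pi) = (-1 < rcos A B).
Proof.
move=> hA hB; rewrite -cos_rang // -cospi ltr_cos ?in_itv /= ?lexx ?pi_ge0 //.
exact: rang_bounds.
Qed.

Lemma rang_le A B s : SO3 A -> SO3 B -> 0 <= s <= pi ->
  (rang A B <= s) = (cos s <= rcos A B).
Proof.
move=> hA hB hs; rewrite -cos_rang // [RHS]leNgt ltr_cos ?in_itv //= -?leNgt //.
exact: rang_bounds.
Qed.

Lemma dotv_axv A : SO3 A ->
  dotv (axv A) (axv A) = 4 * (1 - ((\tr A - 1) / 2) ^+ 2).
Proof. by move=> hA; have [_ ->] := SO3_axis hA; field. Qed.

Lemma SO3_curve_vel (c : R -> 'M[R]_3) t (dc : 'M[R]_3) :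
  (\forall x \near t, SO3 (c x)) -> is_derive t 1 c dc ->
  dc = c t *m hat (vee ((c t)^T *m dc)).
Proof.
move=> hc hd; have hct : SO3 (c t) := nbhs_singleton hc.
have h1 := is_derive_mulmx (is_derive_trmx hd) hd.
have h2 : is_derive t 1 (fun x => (c x)^T *m c x) (0 : 'M[R]_3).
  apply: (@near_eq_is_derive _ _ _ (cst (1%:M : 'M[R]_3))).
    by near=> x; rewrite /cst; have [-> _] : SO3 (c x) by near: x.
have h : dc^T *m c t + (c t)^T *m dc = 0.
  by case: h1 => _ <-; case: h2 => _ <-.
rewrite vee_skewK ?SO3_mulK //.
by rewrite trmx_mul trmxK; apply/eqP; rewrite -addr_eq0 h.
Unshelve. all: by end_near. Qed.

Lemma is_derive_rcos A (c : R -> 'M[R]_3) t (dc : 'M[R]_3) :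
  is_derive t 1 c dc ->
  is_derive t 1 (fun x => rcos A (c x)) (\tr (A^T *m dc) / 2).
Proof.
move=> hc; have h := is_derive_mulmx (is_derive_cst A^T t 1) hc.
have /is_derive_mxP e := h.
have h2 : is_derive t 1 (fun x => \tr (A^T *m c x)) (\tr (A^T *m dc)).
  rewrite (_ : (fun x => _) = \sum_(i < 3) (fun x => (A^T *m c x) i i)); last first.
    by apply/funext => x; rewrite fct_sumE.
  apply: is_derive_sum => i.
  by have := e i i; rewrite mul0mx add0r.
rewrite (_ : (fun x => _) = (2^-1 \*: ((fun x => \tr (A^T *m c x)) - cst 1))).
  by apply: is_derive_eqr; rewrite subr0; exact: mulrC.
by apply/funext => x; rewrite /rcos mulrC.
Qed.

Lemma enorm_continuous (T : topologicalType) (f : T -> 'cV[R]_3) (x : T) :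
  {for x, continuous f} -> {for x, continuous (fun y => enorm (f y))}.
Proof.
move=> cf; have cfi i : {for x, continuous (fun y => f y i 0)}.
  by have /cvg_mxP/(_ i 0) := cf.
apply: (@continuous_comp _ _ _ (fun y => dotv (f y) (f y)) (@Num.sqrt R)).
  rewrite (_ : (fun y => _) = fun y => f y 0 0 * f y 0 0 + f y 1 0 * f y 1 0 +
     f y 2 0 * f y 2 0); last by apply/funext => y; rewrite dotvE.
  by apply: continuousD; [apply: continuousD|]; apply: continuousM.
exact: sqrt_continuous.
Qed.

(** The angle from A changes along the path no faster than the speed. As acos is not differentiable
    at 1, where the path starts, acos(l g) is estimated for l < 1, and then l tends to 1. *)
Lemma path_length_ge A B (c : R -> 'M[R]_3) : SO3 A -> C1_path A B c ->
  rang A B <= path_length c.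
Proof.
move=> hA [dc cdc c0 c1 cS].
pose w t := enorm (body_vel c t).
have isd t : is_derive t 1 c (derive1 c t).
  by split; [exact: dc|rewrite derive1E].
have cc : continuous c.
  by move=> t; apply: differentiable_continuous; apply/derivable1_diffP.
have w_cont : continuous w.
  move=> t; apply: enorm_continuous.
  have ce i j : {for t, continuous (fun x => ((c x)^T *m derive1 c x) i j)}.
    have cci k : {for t, continuous (fun x => c x k i)}.
      by have /cvg_mxP/(_ k i) := cc t.
    have cdi k : {for t, continuous (fun x => derive1 c x k j)}.
      by have /cvg_mxP/(_ k j) := cdc t.
    rewrite (_ : (fun x => _) = fun x => c x 0 i * derive1 c x 0 j +
      c x 1 i * derive1 c x 1 j + c x 2 i * derive1 c x 2 j); last first.
      by apply/funext => x; rewrite mulmx3E !mxE.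
    by apply: continuousD; [apply: continuousD|]; apply: continuousM.
  apply/cvg_mxP => i j; rewrite ord1 => {j}.
  rewrite (_ : (fun x => _) = fun x => ((c x)^T *m derive1 c x)
     (nth 0 [:: 2; 0; 1] i) (nth 0 [:: 1; 2; 0] i)); last first.
    by apply/funext => x; move: i; apply: ord3_cases; rewrite /body_vel mxE.
  rewrite (_ : body_vel c t i 0 = ((c t)^T *m derive1 c t)
     (nth 0 [:: 2; 0; 1] i) (nth 0 [:: 1; 2; 0] i)); last first.
    by move: i; apply: ord3_cases; rewrite /body_vel mxE.
  exact: ce.
pose g t := rcos A (c t).
pose dg t := \tr (A^T *m derive1 c t) / 2.
have isg t : is_derive t 1 g (dg t) by apply: is_derive_rcos.
have gb t : t \in `[0, 1] -> -1 <= g t <= 1.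
  by move=> ht; apply: rcos_bounds => //; exact: cS.
(* Cauchy-Schwarz: the norm of the skew part is twice the sine of the angle, so the cosine g changes
   at most at the rate sine times speed. *)
have dgb t : t \in `]0, 1[ -> `|dg t| <= Num.sqrt (1 - g t ^+ 2) * w t.
  move=> ht; have ht' : t \in `[0, 1] by apply: subset_itv_oo_cc ht.
  have e := @SO3_curve_vel c t (derive1 c t) _ (isd t).
  rewrite /dg e; last first.
    have := near_in_itvoo ht; apply: filterS => x hx.
    by apply: cS; apply: subset_itv_oo_cc hx.
  rewrite mulmxA mxtrace_hat -/(body_vel c t).
  have := normr_dotv_le (axv (A^T *m c t)) (body_vel c t).
  have -> : enorm (axv (A^T *m c t)) = 2 * Num.sqrt (1 - g t ^+ 2).
    rewrite /enorm dotv_axv ?sqrtrM //; last by apply: SO3_trmul => //; exact: cS.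
    congr (_ * _); rewrite (_ : 4 = 2 ^+ 2) ?sqrtr_sqr ?ger0_norm //.
    by rewrite -natrX.
  by rewrite normrM normrN [`|2^-1|]ger0_norm // -/(w t); lra.
pose L x := (\int[lebesgue_measure]_(t in `[0, x]) w t)%R.
have iw : (@lebesgue_measure R).-integrable `[0, 2] (EFin \o w).
  apply: continuous_compact_integrable; first exact: segment_compact.
  exact: continuous_subspaceT.
have iL t : t \in `]0, 1[ -> is_derive t 1 L (w t).
  rewrite in_itv /= => /andP[t0 t1].
  have t2 : t < 2 by lra.
  have [d1 d2] := continuous_FTC1_closed t2 iw t0 (w_cont t).
  by apply: DeriveDef; [exact: d1|rewrite -derive1E; exact: d2].
have cL : {within `[0, 1], continuous L}.
  apply: (@parameterized_integral_continuous _ 0 1) => //.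
  apply: continuous_compact_integrable; first exact: segment_compact.
  exact: continuous_subspaceT.
have L0 : L 0 = 0 by rewrite /L set_itv1 Rintegral_set1.
have key (l : R) : 0 < l < 1 -> acos (l * g 1) - acos (l * g 0) <= L 1.
  move=> /andP[l0 l1].
  have lg t : t \in `[0, 1] -> -1 < l * g t < 1.
    by move=> /gb /andP[? ?]; nra.
  pose phi t := acos (l * g t).
  have isphi t : t \in `[0, 1] ->
      is_derive t 1 phi (- (Num.sqrt (1 - (l * g t) ^+ 2))^-1 * (l * dg t)).
    move=> ht; have hlg : is_derive t 1 (fun x => l * g x) (l * dg t).
      by have := @is_deriveZ _ _ _ g l t 1 _ (isg t).
    exact: (@is_derive1_comp _ (@acos R) (fun x => l * g x) t _ _
      (is_derive1_acos (lg t ht)) hlg).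
  have hm : {in `[0, 1] &, {homo (L - phi) : x y / x <= y}}.
    apply: ger0_derive1_le_cc.
    - move=> x hx; apply: derivableB; first by have [] := iL x hx.
      by have [] := isphi x (subset_itv_oo_cc hx).
    - move=> x hx; have hx' := subset_itv_oo_cc hx.
      have h := is_deriveB (iL x hx) (isphi x hx').
      rewrite derive1E; case: h => _ ->.
      have dg1 := dgb x hx; have /andP[l2 l3] := lg x hx'.
      have w0 : 0 <= w x by exact: enorm_ge0.
      set S := Num.sqrt (1 - (l * g x) ^+ 2).
      have S0 : 0 < S by rewrite sqrtr_gt0; nra.
      (* This compares the bound on the derivative of g with the square root in the derivative of
         acos at l g. *)
      have S1 : l * Num.sqrt (1 - g x ^+ 2) <= S.
        rewrite -(ger0_norm (ltW l0)) -sqrtr_sqr -sqrtrM ?sqr_ge0 //.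
        by rewrite ler_wsqrtr //; nra.
      rewrite mulNr opprK.
      have h : - (l * dg x) <= S * w x.
        apply: le_trans (ler_norm _) _; rewrite normrN normrM (gtr0_norm l0).
        apply: le_trans (ler_wpM2l (ltW l0) dg1) _.
        by rewrite mulrA ler_wpM2r.
      have : - (w x) <= S^-1 * (l * dg x) by rewrite ler_pdivlMl //; lra.
      by lra.
    - have cphi : {within `[0, 1], continuous phi}.
        apply: continuous_in_subspaceT => x /[!inE] hx.
        apply: differentiable_continuous; apply/derivable1_diffP.
        by have [] := isphi x hx.
      by move=> x; apply: continuousB; [exact: cL|exact: cphi].
  have := hm 0 1; rewrite !in_itv /= !lexx ler01 => /(_ isT isT isT).
  by rewrite !fctE L0 /phi; lra.
have L1 : 0 <= L 1 by apply: Rintegral_ge0 => x _; exact: enorm_ge0.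
have cB : -1 <= rcos A B <= 1 by rewrite -c1; apply: gb; rewrite in_itv /= ler01 lexx.
change (path_length c) with (L 1).
have [|Lpi] := leP pi (L 1).
  by apply: le_trans; rewrite acos_lepi.
rewrite /rang -[leRHS]cosK ?in_itv /= ?L1 ?(ltW Lpi) //.
rewrite leNgt; apply/negP => hlt.
have hB : cos (L 1) > rcos A B.
  rewrite -[X in X < _]acosK ?in_itv //=.
  rewrite ltr_cos ?in_itv /= ?acos_ge0 ?acos_lepi ?L1 ?(ltW Lpi) //.
  by move: hlt; rewrite cosK // in_itv /= L1 ltW.
move: (L 1) L1 Lpi key hB {hlt} => ell L1 Lpi key hB.
have g0 : g 0 = 1 by rewrite /g c0 rcosK.
have g1 : g 1 = rcos A B by rewrite /g c1.
(* With l = cos s and g(0) = 1, [key] bounds the arc cosine of cos s times [rcos A B] by ell + s;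
   then s tends to 0. *)
have hle s : 0 < s < pi / 2 -> ell + s < pi -> cos (ell + s) <= cos s * rcos A B.
  move=> /andP[s0 s1] sL.
  have spi : s < pi by apply: lt_trans s1 _; have := pi_gt0 R; lra.
  have cs0 : 0 < cos s by rewrite cos_gt0_pihalf // s1 andbT; lra.
  have cs1 : cos s < 1.
    by rewrite -cos0 ltr_cos // in_itv /= ?lexx ?pi_ge0 // (ltW s0) ltW.
  have := key (cos s); rewrite cs0 cs1 => /(_ isT).
  rewrite g0 g1 mulr1 cosK ?in_itv /= ?(ltW s0) ?(ltW spi) // => hk.
  have cb : -1 <= cos s * rcos A B <= 1 by move/andP: cB => [? ?]; nra.
  rewrite -[leRHS]acosK ?in_itv //= leNgt ltr_cos; last 2 first.
  - by rewrite in_itv /= (ltW sL) andbT addr_ge0 // ltW.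
  - by rewrite in_itv /= acos_ge0 ?acos_lepi.
  by rewrite -leNgt; lra.
have hcvg : cos (ell + s) - cos s * rcos A B @[s --> 0^'+] -->
    cos ell - rcos A B.
  have -> : cos ell - rcos A B = cos (ell + 0) - cos 0 * rcos A B.
    by rewrite addr0 cos0 mul1r.
  apply: cvg_at_right_filter.
  apply: cvgB.
    apply: (@continuous_comp _ _ _ (fun s : R => ell + s) cos).
      by apply: continuousD; [exact: cst_continuous|exact: cvg_id].
    exact: continuous_cos.
  by apply: cvgMl; exact: continuous_cos.
have : cos ell - rcos A B <= 0.
  apply: (cvgr_to_le hcvg).
  near=> s; rewrite subr_le0; apply: hle.
    apply/andP; split; near: s; first exact: nbhs_right_gt.
    by apply: nbhs_right_lt; rewrite divr_gt0 ?pi_gt0.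
  by rewrite -ltrBrDl; near: s; apply: nbhs_right_lt; rewrite subr_gt0.
by rewrite subr_le0 leNgt hB.
Unshelve. all: by end_near. Qed.

(** The bound of [path_length_ge] is attained by the one-parameter geodesic from A to B. *)
Lemma gdistE A B : SO3 A -> SO3 B -> gdist A B = rang A B.
Proof.
move=> hA hB.
have [u hu e] := rang_axis hA hB.
set th := rang A B in e.
have /andP[th0 thpi] : 0 <= th <= pi by apply: rang_bounds.
pose c (t : R) := A *m rotm u (th * t + 0).
pose dc (t : R) := th *: (c t *m hat u).
have isc (t : R) : is_derive t 1 c (dc t).
  have h := is_derive_mulmx (is_derive_cst A t 1)
    (is_derive_reparam th 0 t (fun x => is_derive_rotm x hu)).
  apply: (is_derive_eqr h).
  by rewrite mul0mx add0r /dc /c -scalemxAr mulmxA.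
have dcE : derive1 c = dc.
  by apply/funext => t; rewrite derive1E; case: (isc t).
have cc : continuous c.
  move=> t; apply: differentiable_continuous; apply/derivable1_diffP.
  by case: (isc t).
have pc : C1_path A B c.
  split.
  - by move=> t; case: (isc t).
  - rewrite dcE => t; apply/cvg_mxP => i j; rewrite /dc mxE mulmx3E.
    have ck k : {for t, continuous (fun x => c x i k)}.
      by have /cvg_mxP/(_ i k) := cc t.
    rewrite (_ : (fun x => _) = fun x => th * (c x i 0 * hat u 0 j +
      c x i 1 * hat u 1 j + c x i 2 * hat u 2 j)); last first.
      by apply/funext => x; rewrite mxE mulmx3E.
    apply: cvgM; first exact: cvg_cst.
    by apply: cvgD; [apply: cvgD|]; apply: cvgM; [exact: ck|exact: cvg_cst|
      exact: ck|exact: cvg_cst|exact: ck|exact: cvg_cst].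
  - by rewrite /c mulr0 addr0 rotm0 mulmx1.
  - by rewrite /c mulr1 addr0 -e.
  - by move=> t _; apply: SO3_mul => //; exact: SO3_rotm.
have lenc : path_length c = th.
  rewrite /path_length (_ : (fun t => _) = cst th).
    have m1 : @lebesgue_measure R `[0, 1] = 1%:E.
      by rewrite lebesgue_measure_itv /= lte_fin ltr01 oppr0 adde0.
    rewrite Rintegral_cst // -[RHS]mulr1; congr (_ * _).
    by rewrite [X in fine X]m1.
  apply/funext => t; rewrite /body_vel dcE /dc -scalemxAr veeZ mulmxA.
  rewrite (SO3_orth _).1 ?mul1mx ?hatK ?enormZ ?ger0_norm //.
    by rewrite /enorm hu sqrtr1 mulr1.
  by apply: SO3_mul => //; exact: SO3_rotm.
have lb : lbound (@path_length R @` C1_path A B) th.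
  by move=> _ [d hd <-]; exact: path_length_ge.
apply/eqP; rewrite eq_le; apply/andP; split.
  rewrite -/th -lenc; apply: ge_inf; first by exists th.
  by exists c.
by apply: lb_le_inf => //; exists (path_length c), c.
Qed.

End Distance.

(** * Continuously differentiable functions of a matrix *)

Section EpsDerivative.
Variables (R : realType) (V : normedModType R).
Implicit Types (f : R -> V) (t : R) (D : V).

Lemma is_derive_epsP f t D : is_derive t 1 f D <->
  forall e : R, 0 < e -> exists2 d : R, 0 < d &
    forall s, `|s - t| < d -> `|f s - f t - (s - t) *: D| <= e * `|s - t|.
Proof.
have quot (h : R) : h != 0 ->
    `|D - h^-1 *: (f (h + t) - f t)| = `|h|^-1 * `|f (h + t) - f t - h *: D|.
  move=> h0; transitivity (`|h^-1 *: (f (h + t) - f t - h *: D)|).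
    by rewrite [in RHS]scalerBr scalerA mulVf // scale1r distrC.
  by rewrite normrZ normfV.
have shE : (fun h : R => h^-1 *: ((f \o shift t) (h *: 1) - f t)) =
    (fun h : R => h^-1 *: (f (h + t) - f t)).
  by apply/funext => h; rewrite /= [h *: 1]mulr1.
split=> [[df dfD] e e0|h].
  have : h^-1 *: (f (h + t) - f t) @[h --> 0^'] --> D.
    by rewrite -shE -dfD.
  move=> /cvgrPdist_le/(_ e e0)/nbhs_ballP[d /= d0 hd].
  exists d => // s st; have [->|nst] := eqVneq s t.
    by rewrite !subrr scale0r subr0 !normr0 mulr0.
  have st0 : s - t != 0 by rewrite subr_eq0.
  have := hd (s - t); rewrite /ball /= sub0r normrN => /(_ st st0).
  by rewrite quot // subrK ler_pdivrMl ?normr_gt0 // mulrC.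
have hc : h^-1 *: ((f \o shift t) (h *: 1) - f t) @[h --> 0^'] --> D.
  rewrite shE; apply/cvgrPdist_le => e e0; have [d d0 hd] := h e e0.
  apply/nbhs_ballP; exists d => //= s; rewrite /ball /= sub0r normrN => sd s0.
  rewrite quot // ler_pdivrMl ?normr_gt0 //.
  by have := hd (s + t); rewrite addrK mulrC => /(_ sd).
split; first by apply/cvg_ex; exists D.
exact: cvg_lim hc.
Qed.

End EpsDerivative.

Section C1Functions.
Variable R : realType.
Implicit Types (u v w xi : 'cV[R]_3) (A B Q V W H : 'M[R]_3) (s t r : R).
Implicit Types (U O : set 'M[R]_3) (f g : 'M[R]_3 -> R).

Definition C1_on U g := forall A, U A -> forall V,
  derivable g A V /\ {for A, continuous ('D_V g)}.

Lemma C1_on_near U f g : open U -> (forall A, U A -> f A = g A) ->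
  C1_on U f -> C1_on U g.
Proof.
move=> oU fg Cf A UA V; have [df cf] := Cf A UA V.
have fgn B : U B -> \forall x \near B, f x = g x.
  by move=> UB; have := open_nbhs_nbhs (conj oU UB); apply: filterS => x /fg.
split; first by apply: near_eq_derivable df; exact: fgn.
have Dfg B : U B -> 'D_V f B = 'D_V g B.
  by move=> UB; apply: near_eq_derive; exact: fgn.
rewrite /prop_for /continuous_at -Dfg //; apply: cvg_trans cf.
apply: (@near_eq_cvg _ _ (nbhs A)).
by have := open_nbhs_nbhs (conj oU UA); apply: filterS => x /Dfg.
Qed.

Lemma C1_on_of_derive U f (df : 'M[R]_3 -> 'M[R]_3 -> R) : open U ->
  (forall A V, U A -> is_derive A V f (df V A)) ->
  (forall A V, U A -> {for A, continuous (df V)}) -> C1_on U f.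
Proof.
move=> oU hd hc A UA V; split; first by case: (hd A V UA).
have Df B : U B -> df V B = 'D_V f B by move=> UB; case: (hd B V UB).
rewrite /prop_for /continuous_at -Df //; apply: cvg_trans (hc A V UA).
apply: (@near_eq_cvg _ _ (nbhs A)).
by have := open_nbhs_nbhs (conj oU UA); apply: filterS => x /Df.
Qed.

Lemma C1_onD U f g : open U -> C1_on U f -> C1_on U g ->
  C1_on U (fun A => f A + g A).
Proof.
move=> oU Cf Cg; apply: (@C1_on_of_derive _ _ (fun V A => 'D_V f A + 'D_V g A)) => //.
  move=> A V UA; have [df _] := Cf A UA V; have [dg _] := Cg A UA V.
  by apply: is_deriveD; exact: derivableP.
move=> A V UA; have [_ cf] := Cf A UA V; have [_ cg] := Cg A UA V.
exact: continuousD.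
Qed.

Lemma C1_onM U f g : open U -> C1_on U f -> C1_on U g ->
  (forall A, U A -> {for A, continuous f}) ->
  (forall A, U A -> {for A, continuous g}) ->
  C1_on U (fun A => f A * g A).
Proof.
move=> oU Cf Cg cf cg.
apply: (@C1_on_of_derive _ _ (fun V A => f A * 'D_V g A + g A * 'D_V f A)) => //.
  move=> A V UA; have [df _] := Cf A UA V; have [dg _] := Cg A UA V.
  by have := is_deriveM (derivableP df) (derivableP dg).
move=> A V UA; have [_ cf'] := Cf A UA V; have [_ cg'] := Cg A UA V.
by apply: continuousD; apply: continuousM => //; [exact: cf|exact: cg].
Qed.

Lemma continuous_mulmx_entry A Q i j : {for A, continuous (fun B => (B *m Q) i j)}.
Proof.
have c k : {for A, continuous (fun B => B i k * Q k j)}.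
  by apply: continuousM; [exact: coord_continuous|exact: cst_continuous].
rewrite (_ : (fun B => _) = fun B : 'M[R]_3 =>
  B i 0 * Q 0 j + B i 1 * Q 1 j + B i 2 * Q 2 j).
  by apply: continuousD; [apply: continuousD|].
by apply/funext => B; rewrite mulmx3E.
Qed.

Lemma C1_on_mulmx_entry U Q i j : open U -> C1_on U (fun B => (B *m Q) i j).
Proof.
move=> oU; apply: (@C1_on_of_derive _ _ (fun V A => (V *m Q) i j)) => //.
  move=> A V UA.
  have h : h^-1 *: (((fun B => (B *m Q) i j) \o shift A) (h *: V) - (A *m Q) i j)
      @[h --> 0^'] --> (V *m Q) i j.
    apply: cvg_near_cst; near=> h; rewrite /= mulmxDl -scalemxAl !mxE addrK.
    by rewrite [LHS]mulKf //; near: h; exact: nbhs_dnbhs_neq.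
  by split; [apply/cvg_ex; exists ((V *m Q) i j)|exact: cvg_lim h].
by move=> A V UA; exact: cst_continuous.
Unshelve. all: by end_near. Qed.

Lemma is_derive_line g A V s : derivable g (A + s *: V) V ->
  is_derive s 1 (fun x => g (A + x *: V)) ('D_V g (A + s *: V)).
Proof.
move=> dg.
have e : (fun h : R => h^-1 *: (((fun x : R => g (A + x *: V)) \o shift s) (h *: 1) -
     g (A + s *: V))) = (fun h => h^-1 *: ((g \o shift (A + s *: V)) (h *: V) -
     g (A + s *: V))).
  apply/funext => h /=; congr (_ *: (g _ - _)).
  by rewrite [h *: 1]mulr1 scalerDl addrCA addrA.
by split; [rewrite /derivable e|rewrite /derive e].
Qed.

Lemma mx_norm_lt m n (B : 'M[R]_(m, n)) e :
  0 < e -> (forall i j, `|B i j| < e) -> `|B| < e.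
Proof.
move=> e0 h; rewrite [ltLHS]/Num.Def.normr /= mx_normrE.
by apply/bigmax_ltP; split => // -[i j] _; exact: h.
Qed.

Definition dpart g (kl : 'I_3 * 'I_3) : 'M[R]_3 -> R := 'D_(delta_mx kl.1 kl.2) g.

Let mix A B (s : seq ('I_3 * 'I_3)) : 'M[R]_3 :=
  \matrix_(i, j) if (i, j) \in s then B i j else A i j.

(* Strict differentiability: change one matrix entry at a time and apply the
   mean value theorem; sup-norm balls contain all the intermediate points. *)
Lemma C1_on_strict U g A e : open U -> C1_on U g -> U A -> 0 < e ->
  exists2 r, 0 < r & forall B B', `|B - A| < r -> `|B' - A| < r ->
    `|g B' - g B - \sum_kl (B' - B) kl.1 kl.2 * dpart g kl A| <=
    e * \sum_(kl : 'I_3 * 'I_3) `|(B' - B) kl.1 kl.2|.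
Proof.
move=> oU Cg UA e0.
have near1 : \forall B \near A, U B /\ forall kl, `|dpart g kl A - dpart g kl B| <= e.
  near=> B; split; first by near: B; exact: open_nbhs_nbhs.
  near: B; apply: filter_forall => kl.
  have [_ c] := Cg A UA (delta_mx kl.1 kl.2).
  by move/cvgrPdist_le : c; exact.
have /nbhs_ballP[r /= r0 hr] := near1.
exists r => // B B' BA B'A.
(* [mix] has already taken the entries in [s] from B'; the entry (k, l) now moves along a segment,
   which stays in the sup-norm ball. *)
have mixin (a : R) (s : seq ('I_3 * 'I_3)) k l : 0 <= a <= 1 ->
    `|mix B B' s + (a * (B' - B) k l) *: delta_mx k l - A| < r \/ (k, l) \in s.
  move=> /andP[a0 a1]; have [ins|nins] := boolP ((k, l) \in s); [by right|left].
  have AB i j : `|B i j - A i j| < r.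
    by apply: le_lt_trans BA; have := le_mx_norm (B - A) i j; rewrite mxE [X in _ + X]mxE.
  have AB' i j : `|B' i j - A i j| < r.
    by apply: le_lt_trans B'A; have := le_mx_norm (B' - A) i j; rewrite mxE [X in _ + X]mxE.
  apply: mx_norm_lt => // i j; rewrite !mxE.
  case: eqVneq => [->|ik] /=; last by rewrite mulr0n mulr0 addr0; case: ifP.
  case: eqVneq => [->|jl] /=; last by rewrite mulr0n mulr0 addr0; case: ifP.
  rewrite (negbTE nins) mulr1n mulr1.
  pose m := Num.max `|B k l - A k l| `|B' k l - A k l|.
  apply: (@le_lt_trans _ _ m); last by rewrite gt_max AB AB'.
  have : `|B k l - A k l| <= m by rewrite le_max lexx.
  have : `|B' k l - A k l| <= m by rewrite le_max lexx orbT.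
  rewrite !ler_norml => /andP[? ?] /andP[? ?].
  by apply/andP; split; nra.
suff key (s : seq ('I_3 * 'I_3)) : uniq s -> `|g (mix B B' s) - g B -
     \sum_(kl <- s) (B' - B) kl.1 kl.2 * dpart g kl A| <=
    e * \sum_(kl <- s) `|(B' - B) kl.1 kl.2|.
  have := key (index_enum _) (index_enum_uniq _).
  rewrite (_ : mix B B' _ = B') //.
  by apply/matrixP => i j; rewrite mxE mem_index_enum.
elim: s => [_|[k l] s IH /= /andP[nins us]].
  rewrite !big_nil mulr0 subr0 (_ : mix B B' [::] = B) ?subrr ?normr0 //.
  by apply/matrixP => i j; rewrite mxE.
rewrite !big_cons /=; set h := (B' - B) k l; set E : 'M[R]_3 := delta_mx k l.
set P := mix B B' s.
have PE : mix B B' ((k, l) :: s) = P + h *: E.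
  apply/matrixP => i j; rewrite /P /E /h !mxE in_cons xpair_eqE.
  case: eqVneq => [->|ik] /=; last by rewrite mulr0n mulr0 addr0.
  case: eqVneq => [->|jl] /=; last by rewrite mulr0n mulr0 addr0.
  by rewrite (negbTE nins) mulr1n mulr1 addrC subrK.
have inball (a : R) : 0 <= a <= 1 -> `|P + (a * h) *: E - A| < r.
  by move=> a01; have [//|] := mixin a s k l a01; rewrite (negbTE nins).
have inU (a : R) : 0 <= a <= 1 ->
    U (P + (a * h) *: E) /\ `|dpart g (k, l) A - dpart g (k, l) (P + (a * h) *: E)| <= e.
  move=> a01; have [|h1 h2] := hr (P + (a * h) *: E).
    by rewrite -ball_normE /ball_ /= distrC; exact: inball.
  by split => //; exact: h2.
pose phi (a : R) := g (P + (a * h) *: E).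
have dphi (a : R) : 0 <= a <= 1 -> is_derive a 1 phi (dpart g (k, l) (P + (a * h) *: E) * h).
  move=> a01; have [Ua _] := inU a a01.
  have [da _] := Cg _ Ua E.
  have hl : is_derive a 1 (fun x : R => x * h) h.
    rewrite (_ : (fun x => _) = h \*: id); last by apply/funext => x; exact: mulrC.
    by apply: is_derive_eqr; rewrite [LHS]mulr1.
  exact: (@is_derive1_comp _ (fun x => g (P + x *: E)) (fun x => x * h) a _ _
    (is_derive_line da) hl).
have [||c c01 hc] := @MVT R phi (fun a => dpart g (k, l) (P + (a * h) *: E) * h) 0 1 ltr01.
- by move=> x; rewrite in_itv /= => /andP[x0 x1]; apply: dphi; rewrite !ltW.
- apply: continuous_in_subspaceT => x /[!inE] /=; rewrite in_itv /= => hx.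
  by apply: differentiable_continuous; apply/derivable1_diffP; case: (dphi x hx).
move: hc; rewrite /phi mul0r scale0r addr0 mul1r subr0 mulr1 -PE => hc.
have [|_ h2] := inU c; first by move: c01; rewrite in_itv /= => /andP[? ?]; rewrite !ltW.
have -> : g (mix B B' ((k, l) :: s)) - g B - (h * dpart g (k, l) A +
    \sum_(j <- s) (B' - B) j.1 j.2 * dpart g j A) =
   (g P - g B - \sum_(j <- s) (B' - B) j.1 j.2 * dpart g j A) +
   (dpart g (k, l) (P + (c * h) *: E) - dpart g (k, l) A) * h.
  by rewrite mulrBl -hc; ring.
apply: le_trans (ler_normD _ _) _; rewrite mulrDr addrC lerD ?IH //.
by rewrite normrM distrC ler_wpM2r.
Unshelve. all: by end_near. Qed.

Lemma C1_on_chain U g (c : R -> 'M[R]_3) t (dc : 'M[R]_3) : open U -> C1_on U g ->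
  U (c t) -> is_derive t 1 c dc ->
  is_derive t 1 (fun x => g (c x)) (\sum_kl dc kl.1 kl.2 * dpart g kl (c t)).
Proof.
move=> oU Cg Uct hc; apply/is_derive_epsP => e e0.
(* [K] adds up the error factors: nine entries of size at most (|dc| + 1)|s - t| in the strict
   estimate, and the remainder of the curve paired with the partial derivatives. *)
pose K := 9 * (`|dc| + 1) + \sum_(kl : 'I_3 * 'I_3) `|dpart g kl (c t)| + 1.
have K0 : 0 < K.
  rewrite /K ltr_pwDr // addr_ge0 ?sumr_ge0 // mulr_ge0 // addr_ge0 //.
pose e1 := Num.min 1 (e / K).
have e10 : 0 < e1 by rewrite lt_min ltr01 divr_gt0.
have [r r0 hr] := C1_on_strict oU Cg Uct e10.
have /is_derive_epsP/(_ _ e10)[d d0 hd] := hc.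
have cc : {for t, continuous c}.
  by apply: differentiable_continuous; apply/derivable1_diffP; case: hc.
have /cvgrPdist_lt/(_ _ r0)/nbhs_ballP[d' /= d'0 hd'] := cc.
exists (Num.min d d'); first by rewrite lt_min d0.
move=> s; rewrite lt_min => /andP[sd sd'].
have h1 := hr (c t) (c s).
have h2 : `|c s - c t| < r by rewrite distrC; apply: hd'; rewrite /ball /= distrC.
have {h1 h2} h1 := h1 _ h2; rewrite subrr normr0 in h1; have {}h1 := h1 r0.
have h3 := hd s sd.
pose q kl := (c s - c t - (s - t) *: dc) (kl : 'I_3 * 'I_3).1 kl.2.
have hq kl : `|q kl| <= e1 * `|s - t| by apply: le_trans h3; exact: le_mx_norm.
have qE kl : (c s - c t) kl.1 kl.2 = (s - t) * dc kl.1 kl.2 + q kl.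
  by rewrite /q !mxE; ring.
have e11 : e1 <= 1 by rewrite ge_min lexx.
have sum9 : \sum_(kl : 'I_3 * 'I_3) `|(c s - c t) kl.1 kl.2| <=
    9 * (`|dc| + 1) * `|s - t|.
  have -> : 9 * (`|dc| + 1) * `|s - t| =
      \sum_(kl : 'I_3 * 'I_3) (`|dc| + 1) * `|s - t|.
    by rewrite sumr_const card_prod !card_ord -[RHS]mulr_natl mulrA.
  apply: ler_sum => kl _; rewrite qE.
  apply: le_trans (ler_normD _ _) _; rewrite [leRHS]mulrDl mul1r; apply: lerD.
    by rewrite normrM mulrC ler_wpM2r // le_mx_norm.
  by apply: le_trans (hq kl) _; rewrite ler_piMl.
rewrite /GRing.scale /=.
have -> : g (c s) - g (c t) - (s - t) * (\sum_kl dc kl.1 kl.2 * dpart g kl (c t)) =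
  (g (c s) - g (c t) - \sum_kl (c s - c t) kl.1 kl.2 * dpart g kl (c t)) +
  \sum_kl q kl * dpart g kl (c t).
  have -> : \sum_kl (c s - c t) kl.1 kl.2 * dpart g kl (c t) =
     (s - t) * (\sum_kl dc kl.1 kl.2 * dpart g kl (c t)) +
     \sum_kl q kl * dpart g kl (c t).
    rewrite mulr_sumr -big_split /=; apply: eq_bigr => kl _.
    by rewrite qE mulrDl mulrA.
  by ring.
apply: le_trans (ler_normD _ _) _.
have h4 : `|\sum_kl q kl * dpart g kl (c t)| <=
    e1 * `|s - t| * \sum_(kl : 'I_3 * 'I_3) `|dpart g kl (c t)|.
  apply: le_trans (ler_norm_sum _ _ _) _; rewrite mulr_sumr; apply: ler_sum => kl _.
  by rewrite normrM ler_wpM2r.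
have h5 : e1 * K <= e by rewrite -ler_pdivlMr // ge_min lexx orbT.
apply: (@le_trans _ _ (e1 * (9 * (`|dc| + 1) * `|s - t|) +
  e1 * `|s - t| * \sum_(kl : 'I_3 * 'I_3) `|dpart g kl (c t)|)).
  apply: lerD => //; apply: le_trans h1 _.
  by rewrite ler_wpM2l // ltW.
apply: le_trans (ler_wpM2r (normr_ge0 (s - t)) h5).
rewrite /K; set S := \sum_kl _; have := normr_ge0 (s - t); nra.
Qed.

Lemma C1_on_lipschitz U g A : open U -> C1_on U g -> U A ->
  exists r L : R, [/\ 0 < r, 0 < L & forall B B', `|B - A| < r -> `|B' - A| < r ->
    `|g B' - g B| <= L * `|B' - B|].
Proof.
move=> oU Cg UA; have [r r0 hr] := C1_on_strict oU Cg UA ltr01.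
pose S := \sum_(kl : 'I_3 * 'I_3) `|dpart g kl A|.
have S0 : 0 <= S by apply: sumr_ge0.
exists r, (S + 9); split => //; first by lra.
move=> B B' BA B'A; have := hr B B' BA B'A; rewrite mul1r.
set X := \sum_kl _ * _; set Y := \sum_kl `|_|.
have hY : Y <= 9 * `|B' - B|.
  rewrite (_ : 9 * _ = \sum_(kl : 'I_3 * 'I_3) `|B' - B|).
    by apply: ler_sum => kl _; exact: le_mx_norm.
  by rewrite sumr_const card_prod !card_ord -[RHS]mulr_natl.
have hX : `|X| <= S * `|B' - B|.
  apply: le_trans (ler_norm_sum _ _ _) _; rewrite mulr_suml; apply: ler_sum => kl _.
  by rewrite normrM mulrC ler_wpM2l // le_mx_norm.
move=> h; rewrite -(subrK X (g B' - g B)) mulrDl addrC.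
by apply: le_trans (ler_normD _ _) _; lra.
Qed.

End C1Functions.

(** * Differentiation on open subsets of SO(3) *)

Section C1_SO3.
Variable R : realType.
Implicit Types (u v w xi : 'cV[R]_3) (A B Q V W H : 'M[R]_3) (s t r : R).
Implicit Types (U O : set 'M[R]_3) (f g : 'M[R]_3 -> R).

Definition C1_SO3 O f : Prop :=
  forall A, O A -> exists U g,
    [/\ open U, U A, C1_on U g & forall B, U B -> O B -> g B = f B].

Lemma C2_C1_SO3 O f : C2_SO3 O f -> C1_SO3 O f.
Proof.
move=> h A OA; have [U [g [oU UA Cg gf]]] := h A OA.
by exists U, g; split => // B UB V; have [_ + _] := Cg B UB; exact.
Qed.

Lemma SO3_expm_hat B xi t : SO3 B -> SO3 (B *m expm (t *: hat xi)).
Proof.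
move=> hB; apply: SO3_mul => //.
have [->|xi0] := eqVneq xi 0.
  by rewrite hat0 scaler0 expm0; exact: SO3_1.
rewrite -(sgnvK xi) hatZ scalerA expm_hat_unit; last first.
  by rewrite -enorm_sqr enorm_sgnv // expr1n.
by apply: SO3_rotm; rewrite -enorm_sqr enorm_sgnv // expr1n.
Qed.

Lemma is_derive_expm_curve B xi t :
  is_derive t 1 (fun x => B *m expm (x *: hat xi)) (B *m expm (t *: hat xi) *m hat xi).
Proof.
have h := is_derive_mulmx (is_derive_cst B t 1) (is_derive_expm (hat xi) t).
by apply: (is_derive_eqr h); rewrite mul0mx add0r expm_comm mulmxA.
Qed.

Lemma near_open_SO3 O (c : R -> 'M[R]_3) t : open_SO3 O -> O (c t) ->
  {for t, continuous c} -> (\forall s \near t, SO3 (c s)) -> \forall s \near t, O (c s).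
Proof.
move=> oO Oct cc hS; have [_ hw] := oO _ Oct.
have h : \forall s \near t, SO3 (c s) -> O (c s) := cc _ hw.
by near=> s; apply: (near h) => //; near: s.
Unshelve. all: by end_near. Qed.

(** The intrinsic derivative is a combination of the partial derivatives of a local extension, with
    coefficients linear in B and in xi. This makes it linear in xi and, for C^2 functions, again
    C^1. *)
Lemma lieD_C1_on U O g f xi B : open U -> open_SO3 O -> C1_on U g ->
  (forall B, U B -> O B -> g B = f B) -> U B -> O B ->
  lieD xi f B = \sum_kl (B *m hat xi) kl.1 kl.2 * dpart g kl B.
Proof.
move=> oU oO Cg gf UB OB.
pose c (x : R) := B *m expm (x *: hat xi).
have c0 : c 0 = B by rewrite /c scale0r expm0 mulmx1.
have hc : is_derive (0 : R) 1 c (B *m hat xi).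
  by apply: (is_derive_eqr (is_derive_expm_curve B xi 0)); rewrite scale0r expm0 mulmx1.
have cc : {for (0 : R), continuous c}.
  by apply: differentiable_continuous; apply/derivable1_diffP; case: hc.
have Uc0 : U (c 0) by rewrite c0.
have hg := C1_on_chain oU Cg Uc0 hc.
have : is_derive (0 : R) 1 (fun x => f (c x)) (\sum_kl (B *m hat xi) kl.1 kl.2 * dpart g kl B).
  rewrite c0 in hg; apply: near_eq_is_derive hg.
  have nU : \forall x \near (0 : R), U (c x).
    by apply: cc; rewrite c0; exact: open_nbhs_nbhs.
  have nO : \forall x \near (0 : R), O (c x).
    apply: near_open_SO3 => //; first by rewrite c0.
    by near=> x; apply: SO3_expm_hat; case: (oO _ OB).
  by near=> x; apply: gf; near: x.
by rewrite /lieD derive1E; case=> _ ->.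
Unshelve. all: by end_near. Qed.

Lemma grad_entry f A i : grad f A i 0 = lieD (basev R i) f A.
Proof. by rewrite mxE. Qed.

Lemma hat_basev xi : hat xi = xi 0 0 *: hat (basev R 0) + xi 1 0 *: hat (basev R 1) +
  xi 2 0 *: hat (basev R 2).
Proof. by apply: mx3P; rewrite !mxE /=; ring. Qed.

Lemma lieD_grad O f xi A : open_SO3 O -> C1_SO3 O f -> O A ->
  lieD xi f A = dotv xi (grad f A).
Proof.
move=> oO Cf OA; have [U [g [oU UA Cg gf]]] := Cf A OA.
rewrite dotvE !grad_entry !(lieD_C1_on _ oU oO Cg gf UA OA).
rewrite !mulr_sumr -!big_split /=; apply: eq_bigr => kl _.
rewrite {1}(hat_basev xi) !mulmxDr -!scalemxAr mxE [X in X + _]mxE.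
by rewrite 3![(_ *: (_ *m _)) _ _]mxE; ring.
Qed.

Lemma is_derive_C1_SO3 O f (c : R -> 'M[R]_3) t xi : open_SO3 O -> C1_SO3 O f ->
  O (c t) -> (\forall s \near t, SO3 (c s)) -> is_derive t 1 c (c t *m hat xi) ->
  is_derive t 1 (fun x => f (c x)) (dotv xi (grad f (c t))).
Proof.
move=> oO Cf Oct hS hc; have [U [g [oU UA Cg gf]]] := Cf _ Oct.
rewrite -(lieD_grad xi oO Cf Oct) (lieD_C1_on xi oU oO Cg gf UA Oct).
apply: near_eq_is_derive (C1_on_chain oU Cg UA hc).
have cc : {for t, continuous c}.
  by apply: differentiable_continuous; apply/derivable1_diffP; case: hc.
have nO : \forall x \near t, O (c x) by exact: near_open_SO3.
have nU : \forall x \near t, U (c x) by apply: cc; exact: open_nbhs_nbhs.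
by near=> x; apply: gf; near: x.
Unshelve. all: by end_near. Qed.

Lemma C1_on_cst U (a : R) : open U -> C1_on U (fun=> a).
Proof.
move=> oU; apply: (@C1_on_of_derive _ _ _ (fun _ _ => 0)) => //.
by move=> A V UA; exact: cst_continuous.
Qed.

Lemma C1_on_sum U (I : Type) (r : seq I) (g : I -> 'M[R]_3 -> R) : open U ->
  (forall i, C1_on U (g i)) -> C1_on U (fun A => \sum_(i <- r) g i A).
Proof.
move=> oU Cg; elim: r => [|i r IH].
  rewrite (_ : (fun A => _) = fun=> 0); first exact: C1_on_cst.
  by apply/funext => A; rewrite big_nil.
rewrite (_ : (fun A => _) = fun A => g i A + \sum_(j <- r) g j A).
  exact: C1_onD.
by apply/funext => A; rewrite big_cons.
Qed.

Lemma C2_SO3_lieD O f xi : open_SO3 O -> C2_SO3 O f -> C1_SO3 O (lieD xi f).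
Proof.
move=> oO Cf A OA; have [U [g [oU UA Cg gf]]] := Cf A OA.
have C1g : C1_on U g by move=> B UB V; have [_ + _] := Cg B UB; exact.
have C1dg kl : C1_on U (dpart g kl).
  by move=> B UB V; have [_ _ +] := Cg B UB; exact.
have cdg kl B : U B -> {for B, continuous (dpart g kl)}.
  by move=> UB; have [_ + _] := Cg B UB; move=> /(_ (delta_mx kl.1 kl.2))[].
exists U, (fun B => \sum_kl (B *m hat xi) kl.1 kl.2 * dpart g kl B); split => //.
  apply: (C1_on_sum _ oU) => kl; apply: (C1_onM oU).
  - exact: C1_on_mulmx_entry.
  - exact: C1dg.
  - by move=> B _; exact: continuous_mulmx_entry.
  - by move=> B UB; exact: cdg.
by move=> B UB OB; rewrite (lieD_C1_on xi oU oO C1g gf UB OB).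
Qed.

Lemma C1_SO3_lipschitz O f A : C1_SO3 O f -> O A ->
  exists r L : R, [/\ 0 < r, 0 < L & forall B B', O B -> O B' ->
    `|B - A| < r -> `|B' - A| < r -> `|f B' - f B| <= L * `|B' - B|].
Proof.
move=> Cf OA; have [U [g [oU UA Cg gf]]] := Cf _ OA.
have [r [L [r0 L0 hL]]] := C1_on_lipschitz oU Cg UA.
have /nbhs_ballP[d /= d0 hd] : nbhs A U by exact: open_nbhs_nbhs.
exists (Num.min r d), L; split => //; first by rewrite lt_min r0.
move=> B B' OB OB'; rewrite !lt_min => /andP[B1 B2] /andP[B'1 B'2].
have UB : U B by apply: hd; rewrite -ball_normE /ball_ /= distrC.
have UB' : U B' by apply: hd; rewrite -ball_normE /ball_ /= distrC.
by rewrite -!gf //; exact: hL.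
Qed.

End C1_SO3.

(** * Real induction and absolutely continuous functions *)

Section RealInduction.
Variable R : realType.
Implicit Types (a b c s t : R).

(** The supremum of the points up to which [P] holds is reached by the second hypothesis and cannot
    lie below b by the third. The lemma propagates properties for which only local estimates are
    available. *)
Lemma real_induction a b (P : R -> Prop) : P a ->
  (forall c, a < c <= b -> (forall s, a <= s < c -> P s) -> P c) ->
  (forall c, a <= c < b -> (forall s, a <= s <= c -> P s) ->
    exists2 h, 0 < h & forall s, c < s < c + h -> s <= b -> P s) ->
  forall s, a <= s <= b -> P s.
Proof.
move=> Pa Plim Pext s0 /andP[as0 s0b].
have ab : a <= b := le_trans as0 s0b.
pose S := [set s | a <= s <= b /\ forall s', a <= s' <= s -> P s'].
have Sa : S a.
  split; first by rewrite lexx.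
  by move=> s' /andP[? ?]; rewrite (_ : s' = a) //; apply/eqP; rewrite eq_le; apply/andP.
have Sb : ubound S b by move=> s [/andP[]].
have supS : has_sup S by split; [exists a|exists b].
set c := sup S.
have ac : a <= c by apply: ub_le_sup => //; exists b.
have cb : c <= b by apply: ge_sup => //; exists a.
have Pltc s : a <= s < c -> P s.
  move=> /andP[sa sc]; have cs : 0 < c - s by rewrite subr_gt0.
  have [x [_ Px] xc] := sup_adherent cs supS.
  by apply: Px; rewrite sa /=; move: xc; rewrite subKr => /ltW.
have Pc : P c.
  have [->|ca] := eqVneq c a; first by [].
  by apply: Plim => //; rewrite cb andbT lt_neqAle eq_sym ca.
have Plec s : a <= s <= c -> P s.
  move=> /andP[sa]; rewrite le_eqVlt => /predU1P[->//|sc].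
  by apply: Pltc; rewrite sa.
have [cltb|bc] := ltP c b; last first.
  by apply: Plec; rewrite as0 (le_trans s0b).
have [|h h0 Ph] := Pext c _ Plec; first by rewrite ac.
pose d := Num.min (c + h / 2) b.
have cd : c < d by rewrite lt_min cltb ltrDl divr_gt0.
suff /(ub_le_sup (ex_intro _ b Sb)) : S d by rewrite -/c leNgt cd.
split; first by rewrite (le_trans ac (ltW cd)) ge_min lexx orbT.
move=> s' /andP[as' s'd]; have [s'c|cs'] := leP s' c; first by apply: Plec; rewrite as'.
move: s'd; rewrite le_min => /andP[h1 h2]; apply: Ph => //.
by rewrite cs' (le_lt_trans h1) // ltrD2l ltr_pdivrMr // mulr_natr mulr2n ltrDl.
Qed.

Lemma real_induction_down a b (P : R -> Prop) : P b ->
  (forall c, a <= c < b -> (forall s, c < s <= b -> P s) -> P c) ->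
  (forall c, a < c <= b -> (forall s, c <= s <= b -> P s) ->
    exists2 h, 0 < h & forall s, c - h < s < c -> a <= s -> P s) ->
  forall s, a <= s <= b -> P s.
Proof.
move=> Pb Plim Pext s /andP[sa sb]; rewrite -(opprK s).
apply: (@real_induction (- b) (- a) (fun x => P (- x))) => [|c|c|].
- by rewrite opprK.
- move=> hc h; apply: Plim => [|s' hs']; first by lra.
  by rewrite -(opprK s'); apply: h; lra.
- move=> hc h; have [||k k0 hk] := Pext (- c); first by lra.
    by move=> s' hs'; rewrite -(opprK s'); apply: h; lra.
  by exists k => // s' hs' s'a; apply: hk; lra.
- by lra.
Qed.

End RealInduction.

Section AbsoluteContinuity.
Variable R : realType.
Local Notation mu := (@lebesgue_measure R).
Implicit Types (a b c s t : R).

Lemma ac_continuous (V : normedModType R) a b (phi : R -> V) :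
  abs_continuous a b phi -> forall t, a <= t <= b -> forall eps : R, 0 < eps ->
  exists2 h : R, 0 < h & forall s, a <= s <= b -> `|s - t| < h ->
    `|phi s - phi t| < eps.
Proof.
move=> ac t /andP[at_ tb] eps e0; have [d d0 hd] := ac _ e0.
exists d => // s /andP[as_ sb] st.
have [ts|st'] := leP t s.
  have := hd 1%N (fun=> t) (fun=> s); rewrite !big_ord1; apply => //.
    by move=> k l; rewrite !ord1 eqxx.
  by apply: le_lt_trans st; exact: ler_norm.
have := hd 1%N (fun=> s) (fun=> t); rewrite !big_ord1 distrC; apply => //.
- by move=> k; split => //; exact: ltW.
- by move=> k l; rewrite !ord1 eqxx.
by apply: le_lt_trans st; rewrite distrC; exact: ler_norm.
Qed.

Lemma ac_dominated (V W : normedModType R) a b (phi : R -> V) (psi : R -> W) K :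
  0 < K -> abs_continuous a b phi ->
  (forall s t, a <= s <= b -> a <= t <= b ->
     `|psi t - psi s| <= K * (`|phi t - phi s| + `|t - s|)) ->
  abs_continuous a b psi.
Proof.
move=> K0 ac h eps e0; have e1 : 0 < eps / (2 * K) by rewrite divr_gt0 // mulr_gt0.
have [d d0 hd] := ac _ e1.
exists (Num.min d (eps / (2 * K))); first by rewrite lt_min d0.
move=> m s t hst no; rewrite lt_min => /andP[l1 l2].
have := hd m s t hst no l1 => l3.
apply: (@le_lt_trans _ _ (\sum_k K * (`|phi (t k) - phi (s k)| + (t k - s k)))).
  apply: ler_sum => k _; have [h1 h2 h3] := hst k.
  have := h (s k) (t k); rewrite (ger0_norm (_ : 0 <= t k - s k)) ?subr_ge0 //.
  by apply; apply/andP; split => //; [exact: le_trans h3|exact: le_trans h2].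
rewrite -mulr_sumr big_split /= -ltr_pdivlMl //.
have -> : K^-1 * eps = eps / (2 * K) + eps / (2 * K) by field; rewrite gt_eqF.
exact: ltrD.
Qed.

Section Creep.
Variables (a b eps delta : R) (phi : R -> R) (U : set R).
Hypotheses (mU : measurable U) (muU : (mu U < delta%:E)%E).
Hypothesis ac : forall (m : nat) (s t : 'I_m -> R),
  (forall k, [/\ a <= s k, s k <= t k & t k <= b]) ->
  (forall k l, k != l -> t k <= s l \/ t l <= s k) ->
  \sum_k (t k - s k) < delta -> \sum_k `|phi (t k) - phi (s k)| < eps.

(* The variation of phi over finite families of non-overlapping subintervals
   of [c, b] whose total length is at most the measure of the bad set U there. *)
Let Var c : set R := [set v | exists (m : nat) (s t : 'I_m -> R),
  [/\ forall k, [/\ c <= s k, s k <= t k & t k <= b],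
      forall k l, k != l -> t k <= s l \/ t l <= s k,
      ((\sum_k (t k - s k))%:E <= mu (U `&` `[c, b]))%E
    & v = \sum_k `|phi (t k) - phi (s k)|]].

Let Var_le c v : a <= c -> Var c v -> v <= eps.
Proof.
move=> ac_ [m [s [t [h1 h2 h3 ->]]]]; apply/ltW/ac => //.
  by move=> k; have [? ? ?] := h1 k; split => //; exact: le_trans ac_ _.
rewrite -lte_fin; apply: le_lt_trans muU; apply: le_trans h3 _.
by apply: le_measure; rewrite ?inE //; exact: measurableI.
Qed.

Let Var0 c : Var c 0.
Proof.
exists 0%N, (fun=> 0), (fun=> 0); split; try by case.
- by rewrite big_ord0 measure_ge0.
- by rewrite big_ord0.
Qed.

Let Var_mono s c v : s <= c -> Var c v -> Var s v.
Proof.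
move=> sc [m [p [q [h1 h2 h3 hv]]]]; exists m, p, q; split => //.
  by move=> k; have [? ? ?] := h1 k; split => //; exact: le_trans sc _.
apply: le_trans h3 _; apply: le_measure; rewrite ?inE; try exact: measurableI.
by apply: setIS => x /=; rewrite !in_itv /= => /andP[? ->]; rewrite (le_trans sc).
Qed.

(** An interval inside [U] may join a family, because its length is charged to the part of U between
    s and c. *)
Let Var_cons s c v : s <= c -> c <= b -> `[s, c] `<=` U -> Var c v ->
  Var s (v + `|phi c - phi s|).
Proof.
move=> sc cb scU [m [p [q [h1 h2 h3 ->]]]].
pose p' (k : 'I_m.+1) := if unlift ord0 k is Some j then p j else s.
pose q' (k : 'I_m.+1) := if unlift ord0 k is Some j then q j else c.
exists m.+1, p', q'; rewrite /p' /q'; split.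
- move=> k; case: unliftP => [j _|_]; last by split.
  by have [? ? ?] := h1 j; split => //; exact: le_trans sc _.
- move=> k l; case: unliftP => [j ->|->]; case: unliftP => [i ->|->].
  + by rewrite (inj_eq lift_inj); exact: h2.
  + by right; have [] := h1 j.
  + by left; have [] := h1 i.
  + by rewrite eqxx.
- rewrite big_ord_recl unlift_none.
  under eq_bigr do rewrite liftK.
  (* The half-open interval is disjoint from [c, b], so the two measures add. *)
  rewrite EFinD; apply: (@le_trans _ _ (mu `[s, c[ + mu (U `&` `[c, b]))%E).
    apply: leeD => //; rewrite lebesgue_measure_itv /= lte_fin.
    case: ltP => // cs; rewrite lee_fin; lra.
  rewrite -measureU //; first last.
  + apply/seteqP; split => // x [] /=; rewrite !in_itv /=.
    by move=> /andP[_ xc] [_ /andP[cx _]]; move: (le_lt_trans cx xc); rewrite ltxx.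
  + exact: measurableI.
  apply: le_measure; rewrite ?inE; [|exact: measurableI|].
    by apply: measurableU => //; exact: measurableI.
  move=> x [/=|[Ux]]; rewrite /= !in_itv /= => /andP[h4 h5]; split.
  + by apply: scU; rewrite /= in_itv /= h4 ltW.
  + by rewrite h4 (le_trans (ltW h5)).
  + by [].
  + by rewrite h5 (le_trans sc).
- rewrite big_ord_recl unlift_none addrC; congr (_ + _).
  by apply: eq_bigr => k _; rewrite liftK.
Qed.

(** From s to b, [phi] increases by at most eps (b - s) plus a variation budget [nu s], which never
    exceeds eps. At a point outside [U] the slope bound pays for a step to the left; at a point of U
    a step inside U is charged to the budget. The induction runs downwards because the slope bound
    compares t with earlier points. *)
Lemma creep : a <= b -> 0 < eps -> open U ->
  (forall t, a <= t <= b -> forall e : R, 0 < e ->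
    exists2 h : R, 0 < h & forall s, a <= s <= b -> `|s - t| < h ->
      `|phi s - phi t| < e) ->
  (forall t, a < t <= b -> ~ U t -> exists2 h : R, 0 < h &
    forall s, a <= s -> t - h < s < t -> phi t - phi s <= eps * (t - s)) ->
  phi b - phi a <= eps * (b - a) + eps.
Proof.
move=> ab e0 oU cphi good.
pose nu c := sup (Var c).
have sVar c : a <= c -> has_sup (Var c).
  by move=> ac_; split; [exists 0; exact: Var0|exists eps => v; exact: Var_le].
have nu_le c : a <= c -> nu c <= eps.
  by move=> ac_; apply: ge_sup; [exists 0; exact: Var0|move=> v; exact: Var_le].
have nu_mono s c : a <= s -> s <= c -> nu c <= nu s.
  move=> as_ sc; apply: le_sup; [|by exists 0; exact: Var0|exact: sVar].
  move=> v vc; apply/downP; exists v => //.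
  exact: (Var_mono sc vc).
have nu_cons s c : a <= s -> s <= c -> c <= b -> `[s, c] `<=` U ->
    nu c + `|phi c - phi s| <= nu s.
  move=> as_ sc cb scU; rewrite -lerBrDr; apply: ge_sup.
    by exists 0; exact: Var0.
  move=> v vc; rewrite lerBrDr; apply: ub_le_sup; first by have [] := sVar _ as_.
  exact: Var_cons vc.
suff : phi b - phi a <= eps * (b - a) + nu a.
  by have := nu_le a (lexx _); lra.
apply: (@real_induction_down _ a b
  (fun s => phi b - phi s <= eps * (b - s) + nu s)); last by rewrite lexx.
- rewrite !subrr mulr0 add0r; apply: ub_le_sup; first by have [] := sVar _ ab.
  exact: Var0.
- move=> c /andP[ac_ cb] IH; apply/ler_addgt0Pr => e e0'.
  have [|h h0 hc] := cphi c _ e e0'; first by rewrite ac_ ltW.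
  pose s := Num.min (c + h / 2) b.
  have cs : c < s by rewrite lt_min cb ltrDl divr_gt0.
  have sb : s <= b by rewrite ge_min lexx orbT.
  have sh : `|s - c| < h.
    rewrite gtr0_norm ?subr_gt0 // ltrBlDl.
    apply: (@le_lt_trans _ _ (c + h / 2)); first by rewrite ge_min lexx.
    by rewrite ltrD2l; lra.
  have := IH s; rewrite cs sb => /(_ isT).
  have := hc s; rewrite sb (le_trans ac_ (ltW cs)) sh => /(_ isT isT).
  have := nu_mono c s ac_ (ltW cs).
  by rewrite ltr_norml => ? /andP[? ?]; nra.
- move=> c /andP[ac_ cb] IH.
  have Pc : phi b - phi c <= eps * (b - c) + nu c by apply: IH; rewrite lexx.
  have [Uc|nUc] := pselect (U c).
    have /nbhs_ballP[h /= h0 hU] : nbhs c U by exact: open_nbhs_nbhs.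
    exists h => // s /andP[s1 s2] as_.
    have := nu_cons s c as_ (ltW s2) cb.
    have scU : `[s, c] `<=` U.
      move=> x /=; rewrite in_itv /= => /andP[x1 x2]; apply: hU.
      by rewrite /ball /= ger0_norm ?subr_ge0 //; lra.
    move=> /(_ scU); have := ler_norm (phi c - phi s).
    by nra.
  have [|h h0 hh] := good c _ nUc; first by rewrite ac_.
  exists h => // s hs as_; have := hh s as_ hs.
  have := nu_mono s c as_; move/andP: hs => [s1 s2] /(_ (ltW s2)).
  by nra.
Qed.

End Creep.

(** It stands in for the fundamental theorem for absolutely continuous functions. The exceptional
    null set is covered by an open set so small that the variation of [phi] over it stays below
    e. *)
Lemma ac_nonincreasing a b (phi : R -> R) : a <= b -> abs_continuous a b phi ->
  {ae mu, forall t, a < t <= b -> forall e : R, 0 < e ->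
    exists2 h : R, 0 < h &
      forall s, a <= s -> t - h < s < t -> phi t - phi s <= e * (t - s)} ->
  phi b <= phi a.
Proof.
move=> ab ac [N [mN N0 hN]]; rewrite -subr_le0.
suff h (e : R) : 0 < e -> phi b - phi a <= e * (b - a + 1).
  apply/ler_addgt0Pr => e e0; rewrite add0r.
  have b0 : 0 < b - a + 1 by lra.
  have := h (e / (b - a + 1)); rewrite divr_gt0 // => /(_ isT).
  by rewrite divfK // gt_eqF.
move=> e0; have [d d0 hd] := ac _ e0.
have [|U [oU NU mUN]] := lebesgue_regularity_outer mN _ d0.
  by rewrite [ltLHS]N0 ltry.
have mU : measurable U by exact: open_measurable.
have muU : (mu U < d%:E)%E.
  rewrite -(setDUK NU) measureU //; last 2 first.
  - exact: measurableD.
  - by rewrite setDE setICA setICr setI0.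
  by rewrite [X in (X + _)%E]N0 add0e.
have := creep mU muU hd ab e0 oU (ac_continuous ac).
move=> hcr; rewrite mulrDr mulr1; apply: hcr => t tab nUt.
have : ~ N t by move=> /NU.
move=> nNt; have : (~` N) t by [].
move=> {}nNt; apply: contrapT => hh; apply: nNt; apply: hN => /= h.
by apply: hh; exact: h.
Qed.

End AbsoluteContinuity.

(** * Lipschitz functions are differentiable almost everywhere *)

Section LipschitzDerivable.
Variable R : realType.
Local Notation mu := (@lebesgue_measure R).

(** Cover a null set by half-open intervals of small total length; [g] stretches each of them by a
    factor of at most C. *)
Lemma stieltjes_dominated (g : cumulative R R) (C : R) : 0 < C ->
  (forall x y : R, x <= y -> g y - g x <= C * (y - x)) ->
  lebesgue_stieltjes_measure g `<< mu.
Proof.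
move=> C0 hg A nA B mB BA.
have := nA B mB BA; rewrite /lebesgue_measure => B0.
apply/eqP; rewrite eq_le measure_ge0 andbT; apply/lee_addgt0Pr => e e0.
rewrite add0e.
have : (lebesgue_stieltjes_measure idfun B < (e / C)%:E)%E.
  by rewrite B0 lte_fin divr_gt0.
move=> /ereal_inf_lt[_ [S [mS BS] <-] hS].
apply: (@le_trans _ _ (\sum_(k <oo) wlength g (S k))%E).
  by apply: ereal_inf_lbound; exists S.
apply: (@le_trans _ _ (C%:E * \sum_(k <oo) wlength idfun (S k))%E).
  rewrite -nneseriesZl; last by move=> k _; exact: measure_ge0.
  apply: lee_nneseries => [k _ _|k _]; first exact: measure_ge0.
  have [->|[[x y] /= xy ->]] := (ocitvP _).1 (mS k).
    by rewrite !wlength0 mule0.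
  rewrite (@wlength_itv_bnd _ g _ _ false false (ltW xy)).
  by rewrite (@wlength_itv_bnd _ idfun _ _ false false (ltW xy)) lee_fin hg // ltW.
have -> : e%:E = (C%:E * (e / C)%:E)%E by rewrite -EFinM mulrC divfK ?gt_eqF.
by rewrite lee_pmul2l // ltW.
Qed.

(** F(x) + (K + 1) x is increasing and Lipschitz, so its Stieltjes measure has a density by
    Radon-Nikodym, and Lebesgue differentiation recovers the derivative almost everywhere. *)
Lemma lipschitz_derivable (F : R -> R) (K a b : R) : a < b ->
  (forall s t : R, a <= s <= b -> a <= t <= b -> `|F t - F s| <= K * `|t - s|) ->
  {ae mu, forall t : R, a < t < b -> derivable F t 1}.
Proof.
move=> ab hF.
have K0 : 0 <= K.
  have := hF a b; rewrite !lexx ltW // => /(_ isT isT) h.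
  have := le_trans (normr_ge0 _) h.
  by rewrite pmulr_lge0 // normr_gt0 subr_eq0 gt_eqF.
pose cl (x : R) := Num.max a (Num.min x b).
have clab x : a <= cl x <= b.
  by rewrite le_max lexx /= ge_max (ltW ab) ge_min lexx orbT.
have cl_id x : a <= x <= b -> cl x = x.
  by move=> /andP[ax xb]; rewrite /cl (min_l xb) max_r.
have cl_mono x y : x <= y -> 0 <= cl y - cl x <= y - x.
  move=> xy; rewrite /cl; case: (leP y b) => yb; case: (leP x b) => xb;
    case: (leP a x) => ax; case: (leP a y) => ay;
    rewrite ?(max_r (ltW ab)); lra.
(* The slope K + 1 rather than K makes the total increase [D] positive, so that it can be normalised
   to 1. *)
pose G0 x := F (cl x) + (K + 1) * cl x.
pose D := G0 b - G0 a.
have G0_mono x y : x <= y -> cl y - cl x <= G0 y - G0 x <= (2 * K + 1) * (y - x).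
  move=> xy; have := hF (cl x) (cl y) (clab x) (clab y).
  have /andP[h1 h2] := cl_mono x y xy.
  rewrite (ger0_norm h1) ler_norml /G0 => /andP[h3 h4].
  by apply/andP; split; nra.
have D0 : 0 < D.
  have /andP[h _] := G0_mono a b (ltW ab).
  apply: lt_le_trans h; rewrite !cl_id ?lexx ?(ltW ab) //; lra.
pose G x := (G0 x - G0 a) / D.
pose L := (2 * K + 1) / D.
have L0 : 0 < L by rewrite divr_gt0 //; lra.
have GL x y : x <= y -> 0 <= G y - G x <= L * (y - x).
  move=> xy; have /andP[h1 h2] := G0_mono x y xy.
  have /andP[h3 _] := cl_mono x y xy.
  have -> : G y - G x = (G0 y - G0 x) / D by rewrite /G -mulrBl; congr (_ / _); lra.
  apply/andP; split; first by rewrite divr_ge0 ?(le_trans h3 h1) ?(ltW D0).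
  by rewrite /L mulrAC ler_pM2r ?invr_gt0.
have Gnd : nondecreasing G.
  by move=> x y xy; have /andP[h _] := GL x y xy; rewrite -subr_ge0.
have GLip x y : `|G x - G y| <= L * `|x - y|.
  have [xy|yx] := leP x y.
    have /andP[h1 h2] := GL x y xy.
    by rewrite distrC (distrC x) (ger0_norm h1) ger0_norm ?subr_ge0.
  have /andP[h1 h2] := GL y x (ltW yx).
  by rewrite (ger0_norm h1) ger0_norm ?subr_ge0 ?(ltW yx).
have Grc : right_continuous G.
  apply: right_continuousW => x; apply/cvgrPdist_le => e e0.
  apply/nbhs_ballP; exists (e / L) => /=; first exact: divr_gt0.
  move=> y; rewrite /ball /= => /ltW h; apply: le_trans (GLip x y) _.
  by rewrite mulrC -ler_pdivlMr.
have Ga x : x <= a -> G x = 0.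
  move=> xa; rewrite /G; have -> : G0 x = G0 a.
    rewrite /G0; suff -> : cl x = cl a by [].
    by rewrite /cl (min_l (le_trans xa (ltW ab))) (min_l (ltW ab)) max_l // max_l.
  by rewrite subrr mul0r.
have Gb x : b <= x -> G x = 1.
  move=> bx; rewrite /G; have -> : G0 x = G0 b.
    by rewrite /G0; suff -> : cl x = cl b by []; rewrite /cl (min_r bx) minxx.
  by rewrite divff // gt_eqF.
have G0l : G @ -oo --> (0 : R).
  apply: cvg_near_cst; near=> x; apply/Ga.
  by near: x; apply: nbhs_ninfty_le; exact: num_real.
have G1r : G @ +oo --> (1 : R).
  apply: cvg_near_cst; near=> x; apply/Gb.
  by near: x; apply: nbhs_pinfty_ge; exact: num_real.
pose Gc : cumulativeBounded (0 : R) (1 : R) :=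
  HB.pack G (@isCumulative.Build R _ R G Gnd Grc)
    (@isCumulativeBounded.Build R 0 1 G G0l G1r).
pose nu := lebesgue_stieltjes_measure Gc.
have dom : nu `<< mu.
  by apply: (stieltjes_dominated L0) => x y xy; have /andP[] := GL x y xy.
have [f [f0 ff fi fE]] := @radon_nikodym_sigma_finite _ _ _ mu nu dom.
pose g x := fine (f x).
have gE : EFin \o g = f by apply/funext => x /=; rewrite fineK.
have gi : mu.-integrable setT (EFin \o g) by rewrite gE.
have FTC := @FTC1 R g (BRight a).
have i1 y : mu.-integrable `]a, y] (EFin \o g) by exact: integrableS gi.
have i2 : locally_integrable setT g.
  by apply: open_integrable_locally => //; exact: openT.
have := FTC i1 i2; apply: filterS; first exact: (ae_filter_ringOfSetsType mu).
move=> t /= + /andP[at_ tb] => /(_ at_)[dI _].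
have GE : \forall x \near t, (\int[mu]_(t in `]a, x]) g t)%R = G x.
  have : t \in `]a, b[ by rewrite in_itv /= at_.
  move=> /near_in_itvoo; apply: filterS => x; rewrite in_itv /= => /andP[ax xb].
  have e1 : (\int[mu]_(t in `]a, x]) (g t)%:E)%E = nu [set` `]a, x]].
    transitivity (\int[mu]_(t in [set` `]a, x]]) f t)%E.
      by apply: eq_integral => z _; rewrite /g fineK.
    by apply/esym/fE; exact: measurable_itv.
  rewrite /Rintegral e1.
  have -> : nu [set` `]a, x]] = (G x - G a)%:E.
    rewrite /nu /lebesgue_stieltjes_measure /measure_extension measurable_mu_extE /=;
      last exact: is_ocitv.
    by rewrite (@wlength_itv_bnd _ _ _ _ false false) // ltW.
  by rewrite /= (Ga a) // subr0.
have dG : derivable G t 1 by apply: near_eq_derivable dI.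
apply: (@near_eq_derivable _ _ _ (fun x => D * G x + G0 a - (K + 1) * x)).
  have : t \in `]a, b[ by rewrite in_itv /= at_.
  move=> /near_in_itvoo; apply: filterS => x; rewrite in_itv /= => /andP[ax xb].
  rewrite /G mulrC divfK ?gt_eqF // subrK /G0 cl_id ?(ltW ax) ?(ltW xb) //; lra.
apply: derivableB; last first.
  by apply: derivableZ; exact: derivable_id.
apply: derivableD; last exact: derivable_cst.
exact: derivableZ.
Unshelve. all: by end_near. Qed.

End LipschitzDerivable.

(** * Null sets in SO(3)^n have dense complement *)

Section NullSets.
Variable R : realType.
Implicit Types (u v w xi : 'cV[R]_3) (A B Q : 'M[R]_3) (s t : R).
Local Notation mu := (@lebesgue_measure R).

(** The integrands in the iterated integrals behind [volume] may fail to be measurable; monotonicity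
    is taken from the definition as a supremum over simple functions. *)
Lemma le_integralT (f g : measurableTypeR R -> \bar R) :
  (forall x, 0 <= f x)%E -> (forall x, f x <= g x)%E ->
  (\int[mu]_x f x <= \int[mu]_x g x)%E.
Proof.
move=> f0 fg; have g0 x : (0 <= g x)%E := le_trans (f0 x) (fg x).
rewrite !ge0_integralTE //; apply: le_ereal_sup => _ [h hf <-].
by exists h => // x; exact: le_trans (hf x) (fg x).
Qed.

Lemma integral_ge_const (f : measurableTypeR R -> \bar R) (p q c : R) :
  p <= q -> 0 <= c -> (forall x, 0 <= f x)%E ->
  (forall x : R, p <= x <= q -> (c%:E <= f x)%E) ->
  ((c * (q - p))%:E <= \int[mu]_x f x)%E.
Proof.
move=> pq c0 f0 fc.
pose g : measurableTypeR R -> \bar R := (cst c%:E) \_ [set` `[p, q]].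
have <- : (\int[mu]_x g x = (c * (q - p))%:E)%E.
  rewrite -integral_mkcond integral_cst; last exact: measurable_itv.
  rewrite [X in (_ * X)%E](@lebesgue_measure_itv R `[p, q]) /= lte_fin.
  case: ltP => h; first by rewrite -EFinB -EFinM.
  have -> : q = p by apply/eqP; rewrite eq_le h pq.
  by rewrite subrr mulr0 mule0.
apply: le_integralT => x; rewrite /g patchE; case: ifPn => //.
by rewrite inE /= in_itv /=; exact: fc.
Qed.

Lemma norm_hat_le u : `|hat u| <= `|u|.
Proof.
apply: mx_norm_le => //; apply: ord3_cases; apply: ord3_cases;
  by rewrite mxE /= ?normr0 ?normrN ?le_mx_norm.
Qed.

Lemma expm_hat_continuous xi : xi != 0 ->
  {for xi, continuous (fun x : 'cV[R]_3 => expm (hat x))}.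
Proof.
move=> xi0.
have e0 : enorm xi != 0 by rewrite enorm_eq0.
have cid : {for xi, continuous (@id 'cV[R]_3)} by exact: cvg_id.
have ce : {for xi, continuous (@enorm R)} := enorm_continuous cid.
pose p (x : 'cV[R]_3) := sin (enorm x) / enorm x.
pose q (x : 'cV[R]_3) := (1 - cos (enorm x)) / (enorm x * enorm x).
pose E (x : 'cV[R]_3) := 1%:M + p x *: hat x + q x *: (hat x *m hat x).
have EE x : expm (hat x) = E x.
  have [->|x0] := eqVneq x 0.
    by rewrite /E hat0 mulmx0 !scaler0 !addr0 expm0.
  rewrite expm_hat /rotm /E /sgnv (negbTE x0) hatZ -scalemxAl -scalemxAr.
  by rewrite !scalerA /p /q invfM mulrA.
rewrite (_ : (fun x => _) = E); last by apply/funext => x; exact: EE.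
have ch i j : {for xi, continuous (fun x : 'cV[R]_3 => hat x i j)}.
  suff : hat x i j @[x --> xi] --> hat xi i j by [].
  apply/(@cvgrPdist_le _ _ _ (nbhs xi)) => e' e'0.
  apply/nbhs_ballP; exists e' => //= x.
  rewrite -ball_normE /ball_ /= => /ltW; apply: le_trans.
  apply: le_trans (norm_hat_le _); rewrite hatD hatN.
  by have := le_mx_norm (hat xi - hat x) i j; rewrite mxE [X in _ + X]mxE.
have cp : {for xi, continuous p}.
  apply: continuousM; last exact: continuousV.
  by apply: continuous_comp; [exact: ce|exact: continuous_sin].
have cq : {for xi, continuous q}.
  apply: continuousM; last by apply: continuousV; rewrite ?mulf_neq0 //; exact: continuousM.
  apply: continuousB; first exact: cst_continuous.
  by apply: continuous_comp; [exact: ce|exact: continuous_cos].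
apply/(@cvg_mxP _ _ (nbhs xi)) => i j.
rewrite (_ : (fun x => _) = fun x => (1%:M : 'M[R]_3) i j + p x * hat x i j +
  q x * (hat x i 0 * hat x 0 j + hat x i 1 * hat x 1 j + hat x i 2 * hat x 2 j)).
  rewrite (_ : E xi i j = (1%:M : 'M[R]_3) i j + p xi * hat xi i j +
    q xi * (hat xi i 0 * hat xi 0 j + hat xi i 1 * hat xi 1 j + hat xi i 2 * hat xi 2 j)).
    apply: cvgD; [apply: cvgD; [exact: cvg_cst|]|]; apply: cvgM => //; try exact: ch.
    by apply: cvgD; [apply: cvgD|]; apply: cvgM; exact: ch.
  by rewrite /E 2!mxE -mulmx3E; congr (_ + _ + _); rewrite [LHS]mxE.
apply/funext => x.
by rewrite /E 2!mxE -mulmx3E; congr (_ + _ + _); rewrite [LHS]mxE.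
Qed.

Lemma int_SO3_ge0 (g : 'M[R]_3 -> \bar R) :
  (forall B, 0 <= g B)%E -> (0 <= int_SO3 g)%E.
Proof.
move=> g0; apply: integral_ge0 => a _; apply: integral_ge0 => b _.
apply: integral_ge0 => c _ /=; case: ifP => // _.
by apply: mule_ge0 => //; rewrite lee_fin divr_ge0 ?sqr_ge0 // mulr_ge0 // subr_ge0 cos_le1.
Qed.

(** Every ball around A contains the image of a small cube of normal coordinates, where the density
    is bounded below. *)
Lemma int_SO3_ge A (e : R) : SO3 A -> 0 < e ->
  exists2 v : R, 0 < v & forall (g : 'M[R]_3 -> \bar R) (c : R), 0 <= c ->
    (forall B, 0 <= g B)%E ->
    (forall B, SO3 B -> `|B - A| < e -> (c%:E <= g B)%E) ->
    ((v * c)%:E <= int_SO3 g)%E.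
Proof.
move=> hA e0.
have [u [t [hu /andP[t0 tpi] _ At]]] := SO3_rotmP hA.
have pi0 := pi_gt0 R.
have crot : {for t, continuous (rotm u)}.
  apply: differentiable_continuous; apply/derivable1_diffP.
  by case: (is_derive_rotm t hu).
(* The angle is moved strictly between 0 and pi, into the interior of the chart and away from its
   centre. *)
have [t' [t'0 t'pi ht']] : exists t', [/\ 0 < t', t' < pi & `|rotm u t' - A| < e].
  have /cvgrPdist_lt/(_ e e0)/nbhs_ballP[d /= d0 hd] := crot.
  pose s := Num.min (d / 2) (pi / 4).
  have s0 : 0 < s by rewrite lt_min !divr_gt0.
  have sd : s < d by rewrite gt_min; apply/orP; left; lra.
  have s4 : s <= pi / 4 by rewrite ge_min lexx orbT.
  have [h|h] := leP t (pi / 2).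
    exists (t + s); split; [lra|lra|].
    rewrite distrC At; apply: hd; rewrite /ball /= opprD addNKr normrN.
    by rewrite gtr0_norm.
  exists (t - s); split; [lra|lra|].
  rewrite distrC At; apply: hd; rewrite /ball /= opprB addrC subrK.
  by rewrite gtr0_norm.
pose xi := t' *: u.
have nu : enorm u = 1 by rewrite /enorm hu sqrtr1.
have nxi : enorm xi = t' by rewrite enormZ nu mulr1 gtr0_norm.
have xi0 : xi != 0 by rewrite -enorm_eq0 nxi gt_eqF.
have Exi : expm (hat xi) = rotm u t' by rewrite hatZ expm_hat_unit.
pose lo := t' / 2.
have near1 : \forall x \near xi, [/\ lo < enorm x, enorm x < pi &
    `|expm (hat x) - A| < e].
  have cid : {for xi, continuous (@id 'cV[R]_3)} by exact: cvg_id.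
  have ce : enorm x @[x --> xi] --> enorm xi := enorm_continuous cid.
  have n1 : \forall x \near xi, lo < enorm x.
    by apply: (cvgr_gt _ ce); rewrite nxi /lo; lra.
  have n2 : \forall x \near xi, enorm x < pi.
    by apply: (cvgr_lt _ ce); rewrite nxi.
  have n3 : \forall x \near xi, `|expm (hat x) - A| < e.
    have e' : 0 < e - `|rotm u t' - A| by rewrite subr_gt0.
    have /cvgrPdist_lt/(_ _ e') := expm_hat_continuous xi0.
    apply: filterS => x; rewrite Exi => hx.
    rewrite -(subrKA (rotm u t')) addrC.
    apply: le_lt_trans (ler_normD _ _) _.
    by rewrite distrC in hx; lra.
  by near=> x; split; near: x.
have /nbhs_ballP[d /= d0 hd] := near1.
pose r := d / 2.
have r0 : 0 < r by rewrite divr_gt0.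
(* On the cube [lo] < |x| < pi, so the density is at least 2 (1 - cos lo) / pi^2; the cube has
   volume (2 r)^3. *)
pose dens := 2 * (1 - cos lo) / pi ^+ 2.
have lo0 : 0 < lo by rewrite divr_gt0.
have dens0 : 0 < dens.
  rewrite divr_gt0 ?exprn_gt0 // mulr_gt0 // subr_gt0 -cos0.
  by rewrite ltr_cos // in_itv /= ?lexx ?(ltW lo0) /lo; lra.
pose v := dens * (2 * r) ^+ 3.
exists v; first by rewrite mulr_gt0 // exprn_gt0 // mulr_gt0.
move=> g c c0 g0 hg.
have cell (x : 'cV[R]_3) : (0 <= if (enorm x < pi)%R then
    ((2 * (1 - cos (enorm x)) / enorm x ^+ 2)%R)%:E * g (expm (hat x)) else 0)%E.
  case: ifP => // _; apply: mule_ge0 => //; rewrite lee_fin.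
  by rewrite divr_ge0 ?sqr_ge0 // mulr_ge0 // subr_ge0 cos_le1.
have box (x : 'cV[R]_3) : (forall i, `|x i 0 - xi i 0| <= r) ->
   ((dens * c)%:E <= if (enorm x < pi)%R then
    ((2 * (1 - cos (enorm x)) / enorm x ^+ 2)%R)%:E * g (expm (hat x)) else 0)%E.
  move=> hx.
  have : ball xi d x.
    rewrite -ball_normE /ball_ /= distrC; apply: (@le_lt_trans _ _ r); last by rewrite /r; lra.
    apply: mx_norm_le => [|i j]; first exact: ltW.
    by rewrite ord1 mxE [X in _ + X]mxE.
  move=> /hd[h1 h2 h3]; rewrite h2 EFinM; apply: lee_pmul.
  - by rewrite lee_fin ltW.
  - by rewrite lee_fin.
  - have n0 : 0 < enorm x by exact: lt_trans h1.
    rewrite lee_fin /dens ler_pM //.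
    + by rewrite invr_ge0 sqr_ge0.
    + rewrite ler_pM2l // lerD2l lerN2 leNgt ltr_cos -?leNgt ?(ltW h1) // in_itv /=.
        by rewrite (ltW n0) ltW.
      by rewrite (ltW lo0) /lo; lra.
    + by rewrite lef_pV2 ?posrE ?exprn_gt0 // lerXn2r ?nnegrE ?ltW.
  - apply: hg => //; rewrite expm_hat; apply: SO3_rotm.
    by rewrite -enorm_sqr enorm_sgnv ?expr1n // -enorm_eq0 gt_eqF // (lt_trans lo0).
have itv (x z : R) : z - r <= x <= z + r -> `|x - z| <= r.
  by rewrite ler_norml => /andP[h1 h2]; apply/andP; split; lra.
have -> : v * c = (dens * c * (xi 2 0 + r - (xi 2 0 - r))) *
    (xi 1 0 + r - (xi 1 0 - r)) * (xi 0 0 + r - (xi 0 0 - r)).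
  by rewrite /v; ring.
have dc0 : 0 <= dens * c by rewrite mulr_ge0 // ltW.
have r2 z : 0 <= z + r - (z - r) by lra.
rewrite /int_SO3; apply: integral_ge_const; [lra| |move=> a|move=> a ha].
- by rewrite mulr_ge0 // mulr_ge0.
- by apply: integral_ge0 => b _; apply: integral_ge0 => k _; exact: cell.
apply: integral_ge_const; [lra| |move=> b|move=> b hb].
- by rewrite mulr_ge0 // mulr_ge0.
- by apply: integral_ge0 => k _; exact: cell.
apply: integral_ge_const; [lra|exact: dc0|move=> k; exact: cell|move=> k hk].
apply: box; apply: ord3_cases; rewrite mxE /=; exact: itv.
Unshelve. all: by end_near. Qed.

Lemma int_config_ge0 n (g : config R n -> \bar R) :
  (forall x, 0 <= g x)%E -> (0 <= int_config g)%E.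
Proof.
elim: n g => [|n IH] g g0 /=; first exact: g0.
by apply: int_SO3_ge0 => B; apply: IH.
Qed.

Lemma int_config_ge n (x : config R n) (e : R) : (forall i, SO3 (x i)) -> 0 < e ->
  exists2 v : R, 0 < v & forall (g : config R n -> \bar R) (c : R), 0 <= c ->
    (forall x', 0 <= g x')%E ->
    (forall x', (forall i, SO3 (x' i) /\ `|x' i - x i| < e) -> (c%:E <= g x')%E) ->
    ((v * c)%:E <= int_config g)%E.
Proof.
elim: n x => [|n IH] x hx e0.
  by exists 1 => // g c c0 g0 hg; rewrite mul1r; apply: hg; case.
have [v v0 hv] := IH (fun i => x (lift ord0 i)) (fun i => hx _) e0.
have [w w0 hw] := int_SO3_ge (hx ord0) e0.
exists (w * v); first exact: mulr_gt0.
move=> g c c0 g0 hg; rewrite -mulrA; apply: hw.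
- by rewrite mulr_ge0 // ltW.
- by move=> B; apply: int_config_ge0.
move=> B hB Bx; apply: hv => // x' hx'; apply: hg => i.
by rewrite /cons_config; case: unliftP => [j ->|->].
Qed.

(** A ball has positive volume, so no null set contains it. Removing a null set in the Filippov map
    thus leaves configurations arbitrarily close to any given one. *)
Lemma null_set_codense n (S : set (config R n)) (x : config R n) (e : R) :
  volume S = 0%E -> (forall i, SO3 (x i)) -> 0 < e ->
  exists2 x', ~ S x' & forall i, SO3 (x' i) /\ `|x' i - x i| < e.
Proof.
move=> S0 hx e0; apply: contrapT => h.
have [v v0 hv] := int_config_ge hx e0.
have := hv (fun x' => (\1_S x')%:E) 1 ler01.
rewrite -/(volume S) S0 mulr1 lee_fin leNgt v0; move=> hc; suff : false by [].
apply: hc => [x'|]; first by rewrite lee_fin indicE.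
move=> x' hx'; rewrite lee_fin indicE mem_set //.
by apply: contrapT => nS; apply: h; exists x'.
Qed.

End NullSets.

(** * The unit logarithm; comparison of angle and norm *)

Section UnitLog.
Variable R : realType.
Implicit Types (u v w xi : 'cV[R]_3) (A B Q : 'M[R]_3) (s t : R).

(** sgn(e_ij) in closed form: the skew part of A^T B over twice the sine of the angle. It also gives
    0 at A = B, and its continuity at angles strictly between 0 and pi is visible from the
    formula. *)
Definition unitlog A B : 'cV[R]_3 :=
  (2 * Num.sqrt (1 - rcos A B ^+ 2))^-1 *: axv (A^T *m B).

Lemma sqrt_rcos A B : SO3 A -> SO3 B ->
  Num.sqrt (1 - rcos A B ^+ 2) = sin (rang A B).
Proof. by move=> hA hB; rewrite sin_acos // rcos_bounds. Qed.

Lemma unitlog_rotm A u t : SO3 A -> dotv u u = 1 -> 0 < t < pi ->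
  unitlog A (A *m rotm u t) = u.
Proof.
move=> hA hu /andP[t0 tpi].
have hB : SO3 (A *m rotm u t) by apply: SO3_mul => //; exact: SO3_rotm.
rewrite /unitlog sqrt_rcos // rang_rotm ?(ltW t0) ?(ltW tpi) //.
rewrite mulmxA (SO3_orth hA).1 mul1mx axv_rotm scalerA mulVf ?scale1r //.
by rewrite mulf_neq0 // gt_eqF // sin_gt0_pi // t0.
Qed.

Lemma axv1 : axv (1%:M : 'M[R]_3) = 0.
Proof. by rewrite /axv trmx1 subrr; apply: cv3P; rewrite !mxE. Qed.

Lemma unitlogxx A : SO3 A -> unitlog A A = 0.
Proof. by move=> hA; rewrite /unitlog (SO3_orth hA).1 axv1 scaler0. Qed.

Lemma rang_gt0 A B : SO3 A -> SO3 B -> A != B -> 0 < rang A B.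
Proof.
move=> hA hB AB; have /andP[h _] := rang_bounds hA hB.
rewrite lt_neqAle h andbT eq_sym; apply: contra AB => /eqP h0.
by apply/eqP; exact: rang_eq0.
Qed.

Lemma unitlogP A B : SO3 A -> SO3 B -> A != B -> rang A B < pi ->
  dotv (unitlog A B) (unitlog A B) = 1 /\ B = A *m rotm (unitlog A B) (rang A B).
Proof.
move=> hA hB AB hpi; have [u hu e] := rang_axis hA hB.
have h0 := rang_gt0 hA hB AB.
have -> : unitlog A B = u by rewrite {1}e unitlog_rotm // h0.
by split.
Qed.

Lemma unitlogN A B : unitlog B A = - unitlog A B.
Proof.
rewrite /unitlog rcosC (_ : B^T *m A = (A^T *m B)^T) ?axv_tr ?scalerN //.
by rewrite trmx_mul trmxK.
Qed.

Lemma enorm_unitlog_le1 A B : SO3 A -> SO3 B -> rang A B < pi ->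
  enorm (unitlog A B) <= 1.
Proof.
move=> hA hB hpi; have [->|AB] := eqVneq A B.
  by rewrite unitlogxx // enorm0.
by have [h _] := unitlogP hA hB AB hpi; rewrite /enorm h sqrtr1.
Qed.

Lemma err_rang A B : SO3 A -> SO3 B -> rang A B < pi ->
  vee (plog (A^T *m B)) = rang A B *: unitlog A B.
Proof.
move=> hA hB hpi; have [u hu e] := rang_axis hA hB.
have rb := rang_bounds hA hB.
have h : plog (A^T *m B) = rang A B *: hat u.
  rewrite {1}e mulmxA (SO3_orth hA).1 mul1mx plog_rotm // hpi andbT.
  by case/andP: rb.
rewrite h veeZ hatK.
have [eAB|AB] := eqVneq A B; first by rewrite -eAB rangK // !scale0r.
by congr (_ *: _); rewrite {1}e unitlog_rotm // hpi rang_gt0.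
Qed.

Lemma sgnv_err A B : SO3 A -> SO3 B -> rang A B < pi ->
  sgnv (vee (plog (A^T *m B))) = unitlog A B.
Proof.
move=> hA hB hpi; rewrite err_rang //.
have [<-|AB] := eqVneq A B; first by rewrite unitlogxx // scaler0 /sgnv eqxx.
have [h1 _] := unitlogP hA hB AB hpi; have h0 := rang_gt0 hA hB AB.
have e1 : enorm (rang A B *: unitlog A B) = rang A B.
  by rewrite enormZ gtr0_norm // /enorm h1 sqrtr1 mulr1.
rewrite /sgnv -enorm_eq0 e1 gt_eqF // scalerA mulVf ?scale1r // gt_eqF //.
Qed.

Lemma enorm_err A B : SO3 A -> SO3 B -> rang A B < pi ->
  enorm (vee (plog (A^T *m B))) = rang A B.
Proof.
move=> hA hB hpi; rewrite err_rang // enormZ ger0_norm; last first.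
  by have /andP[] := rang_bounds hA hB.
have [<-|AB] := eqVneq A B; first by rewrite rangK // mul0r.
by have [h1 _] := unitlogP hA hB AB hpi; rewrite /enorm h1 sqrtr1 mulr1.
Qed.

Lemma sin_le_id t : 0 <= t -> sin t <= t.
Proof.
move=> t0; have [|c _ h] := @MVT_segment R sin cos 0 t t0 _ _.
  by apply: continuous_subspaceT; exact: continuous_sin.
move: h; rewrite sin0 !subr0 => ->.
by rewrite -{2}(mul1r t) ler_wpM2r // cos_le1.
Qed.

Lemma cos_ge_quad t : 0 <= t -> 1 - cos t <= t ^+ 2 / 2.
Proof.
move=> t0; have -> : 1 - cos t = 2 * sin (t / 2) ^+ 2.
  have := cosD (t / 2) (t / 2); rewrite -splitr => ->.
  by have := cos2Dsin2 (t / 2); lra.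
have h1 : sin (t / 2) <= t / 2 by apply: sin_le_id; rewrite divr_ge0.
have h2 : - sin (t / 2) <= t / 2.
  have t20 : 0 <= t / 2 by rewrite divr_ge0.
  have [|c _ h] := @MVT_segment R sin cos 0 (t / 2) t20 _.
    by apply: continuous_subspaceT; exact: continuous_sin.
  move: h; rewrite sin0 !subr0 => ->.
  by have := cos_geN1 c; nra.
nra.
Qed.

Lemma frob_rcos A B : SO3 A -> SO3 B ->
  \sum_i \sum_j (A i j - B i j) ^+ 2 = 4 * (1 - rcos A B).
Proof.
move=> hA hB.
have cA i := SO3_cols hA i i; have cB i := SO3_cols hB i i.
have := cA 0; have := cA 1; have := cA 2; have := cB 0; have := cB 1; have := cB 2.
rewrite !eqxx /rcos mxtrace3E !mulmx3E ![A^T _ _]mxE /= => *.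
by rewrite !sum_ord3; lra.
Qed.

Lemma norm_le_rang A B : SO3 A -> SO3 B -> `|A - B| <= 2 * rang A B.
Proof.
move=> hA hB; have /andP[r0 _] := rang_bounds hA hB.
apply: mx_norm_le => [|i j]; first by rewrite mulr_ge0.
rewrite !mxE -(@ler_pXn2r _ 2) ?nnegrE ?mulr_ge0 // real_normK ?num_real //.
have h : (A i j - B i j) ^+ 2 <= 4 * (1 - rcos A B).
  rewrite -frob_rcos // (bigD1 i) //= (bigD1 j) //= -addrA lerDl.
  by rewrite addr_ge0 // sumr_ge0 // => k _; rewrite ?sumr_ge0 // => *; rewrite sqr_ge0.
have := cos_ge_quad r0; rewrite cos_rang //; nra.
Qed.

Lemma rang_small (d : R) : 0 < d -> exists2 eta : R, 0 < eta &
  forall A B, SO3 A -> SO3 B -> `|A - B| < eta -> rang A B < d.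
Proof.
move=> d0; pose d1 := Num.min d pi / 2.
have pi0 := pi_gt0 R.
have m0 : 0 < Num.min d pi by rewrite lt_min d0.
have m1 : Num.min d pi <= pi by rewrite ge_min lexx orbT.
have m2 : Num.min d pi <= d by rewrite ge_min lexx.
have d10 : 0 < d1 by rewrite divr_gt0.
have d1pi : d1 <= pi by rewrite /d1; lra.
have c1 : cos d1 < 1.
  by rewrite -cos0 ltr_cos ?in_itv /= ?lexx ?(ltW pi0) ?(ltW d10).
pose eta := Num.min 1 ((1 - cos d1) / 9).
exists eta; first by rewrite lt_min ltr01 divr_gt0 // subr_gt0.
move=> A B hA hB; rewrite lt_min => /andP[h1 h2].
apply: (@le_lt_trans _ _ d1); last by rewrite /d1; lra.
rewrite rang_le ?(ltW d10) //.
have h3 : \sum_i \sum_j (A i j - B i j) ^+ 2 <= 9 * `|A - B|.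
  rewrite (_ : 9 * _ = \sum_(i < 3) \sum_(j < 3) `|A - B|); last first.
    by rewrite !sumr_const !card_ord -mulrnA -[RHS]mulr_natl.
  apply: ler_sum => i _; apply: ler_sum => j _.
  have := le_mx_norm (A - B) i j; rewrite !mxE => h.
  rewrite -real_normK ?num_real //; have := normr_ge0 (A i j - B i j); nra.
by move: h3; rewrite frob_rcos //; lra.
Qed.

End UnitLog.

Lemma cvg_sumr (R : realType) (T : Type) (F : set_system T) (FF : Filter F)
    (I : Type) (r : seq I) (f : I -> T -> R) (l : I -> R) :
  (forall i, f i x @[x --> F] --> l i) ->
  \sum_(i <- r) f i x @[x --> F] --> \sum_(i <- r) l i.
Proof.
move=> h; elim: r => [|i r IH].
  by under eq_fun do rewrite big_nil; rewrite big_nil; exact: cvg_cst.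
by under eq_fun do rewrite big_cons; rewrite big_cons; exact: cvgD.
Qed.

(** * Affine inequalities and the Filippov map *)

Section FilippovPrinciple.
Variables (R : realType) (n : nat).
Implicit Types (x y : config R n) (A B : 'M[R]_3).

(** Neighbourhoods of [x] within [dom] in the matrix norm; [geo_nbhd_norm] and [norm_geo_nbhd]
    compare them with the geodesic ones. *)
Definition cnbhs (dom : set (config R n)) x : set_system (config R n) :=
  [set P | exists2 eta : R, 0 < eta &
    forall x', dom x' -> (forall i, `|x' i - x i| < eta) -> P x'].

#[export] Instance cnbhs_filter dom x : Filter (cnbhs dom x).
Proof.
split.
- by exists 1.
- move=> P Q [d d0 hd] [d' d'0 hd']; exists (Num.min d d'); first by rewrite lt_min d0.
  move=> x' dx' h; split; [apply: hd => // i|apply: hd' => // i];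
  by have := h i; rewrite lt_min => /andP[].
- by move=> P Q PQ [d d0 hd]; exists d => // x' dx' h; apply/PQ/hd.
Qed.

Lemma cnbhs_dom dom x : \forall x' \near cnbhs dom x, dom x'.
Proof. by exists 1. Qed.

Lemma cvg_cnbhs dom x i : x' i @[x' --> cnbhs dom x] --> x i.
Proof.
apply/cvgrPdist_lt => e e0; exists e => // x' _ h.
by rewrite distrC; exact: h.
Qed.

Lemma int_config0 m : int_config (fun _ : config R m => 0%E) = 0%E.
Proof.
elim: m => [//|m IH] /=; rewrite /int_SO3.
apply: integral0_eq => a _; apply: integral0_eq => b _; apply: integral0_eq => c _.
by rewrite IH mule0 if_same.
Qed.

Lemma volume_set0 : volume (set0 : set (config R n)) = 0%E.
Proof.
rewrite /volume (_ : (fun x => _) = fun=> 0%E); first exact: int_config0.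
by apply/funext => x; rewrite indicE in_set0.
Qed.

Lemma borel_set0 : borel_config (set0 : set (config R n)).
Proof. by have [] := @smallest_sigma_algebra _ setT
  [set U | exists i (V : set 'M[R]_3), open V /\ U = [set x : config R n | V (x i)]]. Qed.

Definition pairing (a : 'I_n -> 'cV[R]_3) (w : 'M[R]_(3, n)) : R :=
  \sum_i dotv (a i) (col i w).

Lemma halfspace_convex a (c : R) : convex_set [set w | c <= pairing a w].
Proof.
apply/convex_setW => w w'; rewrite !inE /= => h h' k k0 k1; rewrite inE /=.
have -> : pairing a (conv k w w') = k%:num * pairing a w + (1 - k%:num) * pairing a w'.
  rewrite /pairing !mulr_sumr -big_split /=; apply: eq_bigr => i _.
  by rewrite -!dotvZr -dotvDr; congr dotv; apply/colP => j; rewrite !mxE.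
nra.
Qed.

Lemma pairing_continuous a : continuous (pairing a).
Proof.
move=> w; rewrite /pairing.
have e i v : dotv (a i) (col i v) = a i 0 0 * v 0 i + a i 1 0 * v 1 i + a i 2 0 * v 2 i.
  by rewrite dotvE !mxE.
rewrite (_ : (fun w => _) = fun v : 'M[R]_(3, n) => \sum_i
   (a i 0 0 * v 0 i + a i 1 0 * v 1 i + a i 2 0 * v 2 i)); last first.
  by apply/funext => v; apply: eq_bigr => i _; rewrite e.
rewrite /continuous_at; apply: (@cvg_sumr _ _ (nbhs w)) => i.
by apply: cvgD; [apply: cvgD|]; apply: cvgM; try exact: cvg_cst; exact: coord_continuous.
Qed.

Lemma halfspace_closed a (c : R) : closed [set w | c <= pairing a w].
Proof.
have -> : [set w | c <= pairing a w] = pairing a @^-1` [set x | c <= x] by [].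
apply: closed_comp; last exact: closed_ge.
by move=> w _; exact: pairing_continuous.
Qed.

Lemma geo_nbhd_norm dom x x' (d : R) : (forall x, dom x -> forall i, SO3 (x i)) ->
  dom x -> geo_nbhd dom x d x' -> dom x' /\ forall i, `|x' i - x i| < 2 * d.
Proof.
move=> domS dx [dx' hd]; split => // i.
have hi := domS _ dx i; have hi' := domS _ dx' i.
rewrite distrC; apply: le_lt_trans (norm_le_rang hi hi') _; rewrite ltr_pM2l //.
apply: le_lt_trans hd; rewrite -gdistE //.
have g0 : 0 <= gdist (x i) (x' i) by rewrite gdistE //; case/andP: (rang_bounds hi hi').
rewrite -{1}(ger0_norm g0) -sqrtr_sqr ler_wsqrtr // (bigD1 i) //= lerDl.
by apply: sumr_ge0 => j _; exact: sqr_ge0.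
Qed.

Lemma norm_geo_nbhd dom (d : R) : (forall x, dom x -> forall i, SO3 (x i)) ->
  0 < d -> exists2 eta : R, 0 < eta & forall x x', dom x -> dom x' ->
    (forall i, `|x' i - x i| < eta) -> geo_nbhd dom x d x'.
Proof.
move=> domS d0.
(* With n distances of at most d / (n + 1), the sum of squares stays below d^2. *)
pose d' := d / n.+1%:R; have d'0 : 0 < d' by rewrite divr_gt0.
have [eta e0 he] := rang_small d'0; exists eta => // y x' dy dx' h; split => //.
rewrite -(ger0_norm (ltW d0)) -sqrtr_sqr ltr_sqrt ?exprn_gt0 //.
have hg i : gdist (y i) (x' i) ^+ 2 <= d' ^+ 2.
  have hi := domS _ dy i; have hi' := domS _ dx' i.
  rewrite gdistE // lerXn2r ?nnegrE ?(ltW d'0) //; first by case/andP: (rang_bounds hi hi').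
  by apply/ltW/he => //; rewrite distrC; exact: h.
apply: (@le_lt_trans _ _ (\sum_(i < n) d' ^+ 2)); first by apply: ler_sum => i _; exact: hg.
rewrite sumr_const card_ord -mulr_natl /d' expr_div_n mulrA ltr_pdivrMr ?exprn_gt0 //.
rewrite mulrC ltr_pM2l ?exprn_gt0 // -natrX ltr_nat.
by rewrite expnS expn1 mulSn; lia.
Qed.

(** Near x the field is bounded by [K], so the coefficients may be frozen at x at a cost e. The
    inequality then cuts out a fixed closed half-space, which contains the closed convex hull. *)
Lemma filippov_affine dom h x w (a : config R n -> 'I_n -> 'cV[R]_3)
    (b : config R n -> R) (K : R) :
  (forall x, dom x -> forall i, SO3 (x i)) -> dom x ->
  (\forall x' \near cnbhs dom x, forall i, enorm (col i (h x')) <= K) ->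
  (forall i k, a x' i k 0 @[x' --> cnbhs dom x] --> a x i k 0) ->
  b x' @[x' --> cnbhs dom x] --> b x ->
  (\forall x' \near cnbhs dom x, 0 <= pairing (a x') (h x') + b x') ->
  filippov_map dom h x w -> 0 <= pairing (a x) w + b x.
Proof.
move=> domS dx hK ca cb hp hw; apply/ler_addgt0Pr => e e0.
have K1 : 0 < `|K| + 1 by rewrite ltr_pwDr.
(* [e1] bounds the change of each coefficient: a vector changes by at most 3 e1 in norm, the field
   has norm below |K| + 1, and n such terms add up to at most e / 2. *)
pose e1 := e / (2 * (3 * (`|K| + 1) * n.+1%:R)).
have e10 : 0 < e1 by rewrite divr_gt0 // !mulr_gt0.
have near1 : \forall x' \near cnbhs dom x, - e <= pairing (a x) (h x') + b x.
  near=> x'.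
  have hpx : 0 <= pairing (a x') (h x') + b x' by near: x'.
  have hbx : `|b x - b x'| <= e / 2.
    by near: x'; move/cvgrPdist_le : cb; apply; rewrite divr_gt0.
  have hax : forall ik : 'I_n * 'I_3, `|a x ik.1 ik.2 0 - a x' ik.1 ik.2 0| <= e1.
    near: x'; apply: filter_forall => -[i k] /=.
    by have /cvgrPdist_le := ca i k; apply.
  have hKx : forall i, enorm (col i (h x')) <= K by near: x'.
  have hdiff : `|pairing (a x) (h x') - pairing (a x') (h x')| <= e / 2.
    rewrite /pairing -sumrB; apply: le_trans (ler_norm_sum _ _ _) _.
    apply: (@le_trans _ _ (\sum_(i < n) 3 * e1 * (`|K| + 1))); last first.
      rewrite sumr_const card_ord -[leLHS]mulr_natl /e1.
      have n1 : (n%:R : R) <= n.+1%:R by rewrite ler_nat.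
      have n0 : (0 : R) < n.+1%:R by [].
      have -> : n%:R * (3 * (e / (2 * (3 * (`|K| + 1) * n.+1%:R))) * (`|K| + 1)) =
        e / 2 * (n%:R / n.+1%:R) by field; rewrite !gt_eqF.
      by rewrite ger_pMr ?divr_gt0 // ler_pdivrMr // mul1r.
    apply: ler_sum => i _.
    rewrite -dotvNl -dotvDl; apply: le_trans (normr_dotv_le _ _) _.
    rewrite ler_pM ?enorm_ge0 //; last first.
      by apply: le_trans (hKx i) _; apply: le_trans (ler_norm K) _; rewrite lerDl.
    set v := a x i - a x' i.
    have hv k : `|v k 0| <= e1 by have := hax (i, k); rewrite /v !mxE.
    have h3 : 0 <= 3 * e1 by rewrite mulr_ge0 // ltW.
    rewrite -(@ler_pXn2r _ 2) ?nnegrE ?enorm_ge0 ?h3 //.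
    rewrite enorm_sqr dotvE; have := hv 0; have := hv 1; have := hv 2.
    rewrite !ler_norml => /andP[? ?] /andP[? ?] /andP[? ?]; nra.
  by move: hdiff hbx; rewrite !ler_norml => /andP[? ?] /andP[? ?]; lra.
have [d d0 hd] := near1.
have d20 : 0 < d / 2 by rewrite divr_gt0.
(* The empty set is one of the null sets over which the Filippov map intersects. *)
have hcl := hw (d / 2) set0 d20 borel_set0 volume_set0.
have : [set w | - e - b x <= pairing (a x) w] w.
  rewrite ((closure_id _).1 (@halfspace_closed (a x) (- e - b x))).
  apply: closureS hcl => v hv; apply: hv; first exact: halfspace_convex.
  move=> _ [x' [gx' _] <-] /=.
  have [dx' hx'] := geo_nbhd_norm domS dx gx'.
  suff : - e <= pairing (a x) (h x') + b x by lra.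
  by apply: hd => // i; apply: lt_le_trans (hx' i) _; rewrite mulrC divfK.
by rewrite /=; lra.
Unshelve. all: by end_near. Qed.

Lemma filippov_affine_eq dom h x w (a : config R n -> 'I_n -> 'cV[R]_3)
    (b : config R n -> R) (K : R) :
  (forall x, dom x -> forall i, SO3 (x i)) -> dom x ->
  (\forall x' \near cnbhs dom x, forall i, enorm (col i (h x')) <= K) ->
  (forall i k, a x' i k 0 @[x' --> cnbhs dom x] --> a x i k 0) ->
  b x' @[x' --> cnbhs dom x] --> b x ->
  (\forall x' \near cnbhs dom x, pairing (a x') (h x') + b x' = 0) ->
  filippov_map dom h x w -> pairing (a x) w + b x = 0.
Proof.
move=> domS dx hK ca cb hp hw; apply/eqP; rewrite eq_le; apply/andP; split; last first.
  apply: (filippov_affine domS dx hK ca cb _ hw).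
  by apply: filterS hp => x' ->.
have pN a' v : pairing (fun i => - a' i) v = - pairing a' v.
  by rewrite /pairing -sumrN; apply: eq_bigr => i _; rewrite dotvNl.
rewrite -oppr_ge0 opprD -pN.
apply: (@filippov_affine dom h x w (fun x' i => - a x' i) (fun x' => - b x') K) => //.
- move=> i k; rewrite mxE; under eq_fun do rewrite mxE.
  by apply: cvgN; exact: ca.
- exact: cvgN.
- by apply: filterS hp => x' e; rewrite pN -opprD e oppr0.
Qed.

End FilippovPrinciple.

(** * Cutting a tree at an edge *)

Section Trees.
Variable n : nat.
Implicit Types (e : rel 'I_n) (i j k l r : 'I_n).

(* Sending a vertex other than the root to the edge that joins it to the
   previous vertex of a shortest path is injective. *)
Lemma connected_edges e : symmetric e -> (forall i j, connect e i j) ->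
  (n <= #|edges e|.+1)%N.
Proof.
move=> sym con; case: (posnP n) => [n0|n0].
  by apply: leq_trans (leq0n _); rewrite n0.
pose r : 'I_n := Ordinal n0.
pose reach k d := [exists p : d.-tuple 'I_n, path e r p && (last r p == k)].
have reachP k d : reflect (exists p, [/\ size p = d, path e r p & last r p = k]) (reach k d).
  apply: (iffP existsP) => [[p /andP[h1 /eqP h2]]|[p [sp h1 h2]]].
    by exists p; rewrite size_tuple.
  have sp' : size p == d by apply/eqP.
  by exists (Tuple sp'); rewrite /= h1 h2 eqxx.
have exd k : exists d, reach k d.
  have /connectP[p h1 h2] := con r k.
  by exists (size p); apply/reachP; exists p.
pose dist k := ex_minn (exd k).
have distP k : reach k (dist k) by rewrite /dist; case: ex_minnP.
have dist_le k d : reach k d -> (dist k <= d)%N.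
  by rewrite /dist; case: ex_minnP => m _ h /h.
have dist0 k : dist k = 0%N -> k = r.
  by move=> d0; have := distP k; rewrite d0 => /reachP[p [sp _ <-]]; move: sp; case: p.
have parent k : k != r -> exists l, e l k /\ (dist l).+1 = dist k.
  move=> kr; have /reachP[p [sp h1 h2]] := distP k.
  move: p sp h1 h2; apply: last_ind => [sp _ h2|p q _ sp h1 h2].
    by move: kr; rewrite -h2 eqxx.
  rewrite last_rcons in h2; subst q.
  rewrite rcons_path in h1; have /andP[h4 h3] := h1.
  exists (last r p); split => //.
  have hl : (dist (last r p) <= size p)%N by apply: dist_le; apply/reachP; exists p.
  have : (dist k <= (dist (last r p)).+1)%N.
    have /reachP[p' [sp' g1 g2]] := distP (last r p).
    apply: dist_le; apply/reachP; exists (rcons p' k).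
    by rewrite size_rcons sp' rcons_path g1 g2 h3 last_rcons.
  by rewrite size_rcons in sp; lia.
pose par k := if k != r then odflt r [pick l | e l k && ((dist l).+1 == dist k)] else r.
have parP k : k != r -> e (par k) k /\ (dist (par k)).+1 = dist k.
  move=> kr; rewrite /par kr; case: pickP => [l /andP[h1 /eqP h2] //|h].
  by have [l [h1 h2]] := parent k kr; have := h l; rewrite h1 h2 eqxx.
pose edge k : 'I_n * 'I_n := if (k < par k)%N then (k, par k) else (par k, k).
have edgeE k : k != r -> edge k \in edges e.
  move=> kr; have [h1 h2] := parP k kr; rewrite inE /edge.
  have nk : (k : nat) != par k.
    by apply/eqP => /val_inj ek; move: h2; rewrite -ek; lia.
  case: (ltnP k (par k)) => /= h3; first by rewrite h3 sym h1.
  by rewrite h1 andbT ltn_neqAle h3 eq_sym nk.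
have edge_inj : {in [set~ r]%SET &, injective edge}.
  move=> k l; rewrite !inE => kr lr; have [_ hk] := parP k kr; have [_ hl] := parP l lr.
  rewrite /edge; case: ifP => _; case: ifP => _ [] // e1 e2.
  - by move: hk hl; rewrite e2 -e1; lia.
  - by move: hk hl; rewrite e1 -e2; lia.
have := subset_leq_card (A := edge @: [set~ r]%SET) (B := edges e).
rewrite card_in_imset // => h.
have {}h : (#|[set~ r]%SET| <= #|edges e|)%N.
  apply: h; apply/fintype.subsetP => _ /imsetP[k kr ->].
  by apply: edgeE; rewrite !inE in kr.
by have := cardsC1 r; rewrite card_ord; lia.
Qed.

Definition cut_rel e i j : rel 'I_n :=
  fun k l => [&& e k l, (k, l) != (i, j) & (k, l) != (j, i)].

Definition tree_side e i j : {set 'I_n} := [set k | connect (cut_rel e i j) i k].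

Lemma tree_side_source e i j : i \in tree_side e i j.
Proof. by rewrite inE connect0. Qed.

Lemma cut_rel_sym e i j : symmetric e -> symmetric (cut_rel e i j).
Proof. by move=> sym k l; rewrite /cut_rel sym !xpair_eqE; lia. Qed.

(** Were j still reachable from i, the graph without this edge would be connected with fewer than n
    - 1 edges. *)
Lemma tree_side_target e i j : is_tree e -> e i j -> j \notin tree_side e i j.
Proof.
move=> [sym irr con card] eij; rewrite inE; apply/negP => cij.
have csym := cut_rel_sym i j sym.
have con' k l : connect (cut_rel e i j) k l.
  have /connectP[p h1 ->] := con k l.
  elim: p k h1 => [|q p IH] k /=; first by rewrite connect0.
  move=> /andP[ekq /IH]; apply: connect_trans.
  have [/eqP[-> ->]|n1] := boolP ((k, q) == (i, j)); first exact: cij.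
  have [/eqP[-> ->]|n2] := boolP ((k, q) == (j, i)).
    by rewrite (sym_connect_sym csym).
  by apply: connect1; rewrite /cut_rel ekq n1.
have := connected_edges csym con'.
pose m : 'I_n * 'I_n := if (i < j)%N then (i, j) else (j, i).
have me : m \in edges e.
  rewrite inE /m; case: (ltnP i j) => /= h; first by rewrite h.
  rewrite sym eij andbT ltn_neqAle h andbT; apply/eqP => /val_inj ji.
  by move: eij; rewrite ji irr.
have : (#|edges (cut_rel e i j)| < #|edges e|)%N.
  apply/proper_card/properP; split.
    by apply/fintype.subsetP => -[k l]; rewrite !inE /= => /and3P[-> -> _].
  exists m => //; rewrite inE /m /cut_rel; case: ifP => _ /=;
    by rewrite eqxx ?andbF.
by lia.
Qed.

Lemma tree_side_cross e i j k l : symmetric e -> e k l ->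
  k \in tree_side e i j -> l \notin tree_side e i j ->
  j \notin tree_side e i j -> k = i /\ l = j.
Proof.
move=> sym ekl; rewrite !inE => ck cl cj.
have [/eqP[-> ->] //|n1] := boolP ((k, l) == (i, j)).
have [/eqP[e1 e2]|n2] := boolP ((k, l) == (j, i)).
  by rewrite e1 in ck; rewrite ck in cj.
move: cl; rewrite (connect_trans ck) // connect1 //.
by rewrite /cut_rel ekl n1.
Qed.

(** Terms of edges inside the side cancel in pairs by antisymmetry; the edge of the cut is the only
    one that leaves it. *)
Lemma sum_tree_side (R : realDomainType) e i j (nu : 'I_n -> 'I_n -> R) :
  is_tree e -> e i j -> (forall k l, nu k l = - nu l k)%R ->
  (\sum_(k in tree_side e i j) \sum_(l | e k l) nu k l = nu i j)%R.
Proof.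
move=> tr eij anti; have [sym irr _ _] := tr.
set A := tree_side e i j.
have jA : j \notin A by exact: tree_side_target.
have iA : i \in A by exact: tree_side_source.
have E k : k \in A -> \sum_(l | e k l) nu k l =
    \sum_(l in A) (if e k l then nu k l else 0) + (if k == i then nu i j else 0).
  move=> kA; rewrite (bigID (mem A)) /=; congr (_ + _).
    by rewrite big_andbC -big_mkcondr; apply: eq_bigl => l; rewrite andbC.
  case: eqVneq => [->|ki]; last first.
    rewrite big1 // => l /andP[ekl lA].
    by have [ki' _] := tree_side_cross sym ekl kA lA jA; rewrite ki' eqxx in ki.
  rewrite (bigD1 j) /=; last by rewrite eij.
  rewrite big1 ?addr0 // => l /andP[/andP[eil lA] lj].
  by have [_ lj'] := tree_side_cross sym eil iA lA jA; rewrite lj' eqxx in lj.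
rewrite (eq_bigr _ E) big_split /=.
have -> : \sum_(k in A) (if k == i then nu i j else 0) = nu i j.
  by rewrite (bigD1 i) //= eqxx big1 ?addr0 // => k /andP[_ /negbTE->].
set S := \sum_(k in A) _; suff : S + S = 0 by lra.
rewrite {2}/S exchange_big /= -big_split /= big1 // => k kA.
rewrite -big_split /= big1 // => l lA; rewrite (sym l k).
by case: ifP => _; rewrite ?addr0 // anti addNr.
Qed.

End Trees.

(** * Limits of rotations *)

Section MatrixLimits.
Variable R : realType.
Implicit Types (A B Q : 'M[R]_3).

Section Filters.
Context {T : Type} {F : set_system T} {FF : Filter F}.

Lemma cvg_entry m n (M : T -> 'M[R]_(m, n)) (L : 'M[R]_(m, n)) i j :
  M x @[x --> F] --> L -> M x i j @[x --> F] --> L i j.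
Proof. by move=> /cvg_mxP; exact. Qed.

Lemma cvg_mulmx (M N : T -> 'M[R]_3) (L L' : 'M[R]_3) :
  M x @[x --> F] --> L -> N x @[x --> F] --> L' ->
  M x *m N x @[x --> F] --> L *m L'.
Proof.
move=> ML NL; apply/cvg_mxP => i j; rewrite mulmx3E.
under eq_fun do rewrite mulmx3E.
by apply: cvgD; [apply: cvgD|]; apply: cvgM; exact: cvg_entry.
Qed.

Lemma cvg_trmx (M : T -> 'M[R]_3) (L : 'M[R]_3) :
  M x @[x --> F] --> L -> (M x)^T @[x --> F] --> L^T.
Proof.
move=> ML; apply/cvg_mxP => i j; rewrite mxE.
by under eq_fun do rewrite mxE; exact: cvg_entry.
Qed.

Lemma cvg_rcos (M N : T -> 'M[R]_3) (L L' : 'M[R]_3) :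
  M x @[x --> F] --> L -> N x @[x --> F] --> L' ->
  rcos (M x) (N x) @[x --> F] --> rcos L L'.
Proof.
move=> ML NL; have h := cvg_mulmx (cvg_trmx ML) NL.
rewrite /rcos mxtrace3E; under eq_fun do rewrite mxtrace3E.
apply: cvgM; last exact: cvg_cst.
apply: cvgB; last exact: cvg_cst.
by apply: cvgD; [apply: cvgD|]; exact: (cvg_entry h).
Qed.

Lemma cvg_axv (M : T -> 'M[R]_3) (L : 'M[R]_3) i :
  M x @[x --> F] --> L -> axv (M x) i 0 @[x --> F] --> axv L i 0.
Proof.
move=> ML; move: i; apply: ord3_cases; rewrite axvE mxE /=;
  under eq_fun do rewrite axvE mxE /=; apply: cvgB; exact: cvg_entry.
Qed.

Lemma cvg_unitlog (M N : T -> 'M[R]_3) (L L' : 'M[R]_3) i :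
  SO3 L -> SO3 L' -> L != L' -> rang L L' < pi ->
  M x @[x --> F] --> L -> N x @[x --> F] --> L' ->
  unitlog (M x) (N x) i 0 @[x --> F] --> unitlog L L' i 0.
Proof.
move=> hL hL' LL' hpi ML NL.
rewrite /unitlog mxE; under eq_fun do rewrite mxE.
have hr := cvg_rcos ML NL.
have s0 : 0 < Num.sqrt (1 - rcos L L' ^+ 2).
  by rewrite sqrt_rcos // sin_gt0_pi // hpi rang_gt0.
apply: cvgM; last by apply: cvg_axv; apply: cvg_mulmx => //; exact: cvg_trmx.
apply: cvgV; first by rewrite mulf_neq0 // gt_eqF.
apply: cvgM; first exact: cvg_cst.
have hsq : 1 - rcos (M x) (N x) ^+ 2 @[x --> F] --> 1 - rcos L L' ^+ 2.
  apply: cvgB; first exact: cvg_cst.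
  by rewrite expr2; under eq_fun do rewrite expr2; exact: cvgM.
apply: (cvg_comp _ _ hsq); exact: sqrt_continuous.
Qed.

End Filters.

Lemma cvg_SO3 {T : Type} {F : set_system T} {FF : ProperFilter F} (M : T -> 'M[R]_3) (L : 'M[R]_3) :
  M x @[x --> F] --> L -> (\forall x \near F, SO3 (M x)) -> SO3 L.
Proof.
move=> ML hS; split.
  have h : (M x)^T *m M x @[x --> F] --> L^T *m L.
    by apply: cvg_mulmx => //; exact: cvg_trmx.
  apply: cvg_unique h _; first exact: norm_hausdorff.
  by apply: cvg_near_cst; apply: filterS hS => x [].
have h : \det (M x) @[x --> F] --> \det L.
  rewrite det3E; under eq_fun do rewrite det3E.
  by apply: cvgD; [apply: cvgB|]; apply: cvgM; try (apply: cvgB; apply: cvgM);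
    exact: cvg_entry.
apply: cvg_unique h _; first exact: norm_hausdorff.
by apply: cvg_near_cst; apply: filterS hS => x [].
Qed.

Lemma SO3_entry_le1 A i j : SO3 A -> `|A i j| <= 1.
Proof.
move=> hA; have := SO3_rows hA i i; rewrite eqxx /= => h.
rewrite -(@ler_pXn2r _ 2) ?nnegrE // real_normK ?num_real // expr1n.
by move: h; move: j; apply: ord3_cases => h; nra.
Qed.

(** SO(3) is closed and its entries lie in [-1, 1], so an ultrafilter has a limit in it. This
    supplies limits at all times at once, without extracting subsequences. *)
Lemma ultra_cvg_SO3 (T : Type) (F : set_system T) (M : T -> 'M[R]_3) :
  UltraFilter F -> (\forall x \near F, SO3 (M x)) ->
  exists2 L : 'M[R]_3, M x @[x --> F] --> L & SO3 L.
Proof.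
move=> FU hS.
have ex i j : exists l : R, M x i j @[x --> F] --> l.
  have UF : UltraFilter ((fun x => M x i j) @ F).
    split=> [|G GF FG]; first exact: fmap_proper_filter.
    rewrite predeqE => A; split; last exact: FG.
    move=> GA; have [//|nA] := in_ultra_setVsetC ((fun x => M x i j) @^-1` A) FU.
    have GnA : G (~` A) by exact: FG.
    by have /filter_ex [? []] : G (A `&` ~` A) by exact: filterI.
  have := @segment_compact R (-1) 1; rewrite compact_ultra => /(_ _ UF) [].
    rewrite /fmap /=; apply: filterS hS => x hx.
    by rewrite /= in_itv /= -ler_norml SO3_entry_le1.
  by move=> l [_ hl]; exists l.
have [L hL] : exists L : 'M[R]_3, M x @[x --> F] --> L.
  exists (\matrix_(i, j) sval (cid (ex i j))); apply/cvg_mxP => i j.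
  by rewrite mxE; exact: (svalP (cid (ex i j))).
by exists L => //; exact: cvg_SO3 hL hS.
Qed.

Lemma gcballE Q rho A : SO3 Q -> 0 < rho -> rho < pi ->
  gcball Q rho A <-> SO3 A /\ cos rho <= rcos Q A.
Proof.
move=> hQ r0 rpi; rewrite /gcball /=; split=> -[hA h]; split => //.
  by move: h; rewrite gdistE // rang_le ?(ltW r0) ?(ltW rpi) // rcosC.
by rewrite gdistE // rang_le ?(ltW r0) ?(ltW rpi) // rcosC.
Qed.

End MatrixLimits.

(** * The action of one edge on the distances to the centre *)

Section EdgeGeometry.
Variable R : realType.
Implicit Types (u v w xi : 'cV[R]_3) (A B Q : 'M[R]_3) (t : R).

(** The body gradient of [rcos Q] at [A]: the sine of the distance times the unit direction from A
    towards Q. *)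
Definition push Q A : 'cV[R]_3 := - (2^-1 *: axv (Q^T *m A)).

Lemma is_derive_rcos_push Q (c : R -> 'M[R]_3) t xi :
  is_derive t 1 c (c t *m hat xi) ->
  is_derive t 1 (fun x => rcos Q (c x)) (dotv (push Q (c t)) xi).
Proof.
move=> hc; apply: (is_derive_eqr (is_derive_rcos Q hc)).
by rewrite mulmxA mxtrace_hat /push dotvNl dotvZl mulrC mulrN.
Qed.

Lemma mxtrace_mul_rotm Q u t : dotv u u = 1 -> \tr (Q *m rotm u t) =
  \tr Q * cos t + (1 - cos t) * dotv u (Q *m u) - sin t * dotv (axv Q) u.
Proof.
move=> hu; rewrite /rotm !mulmxDr mulmx1 -!scalemxAr !mxtraceD !mxtraceZ.
rewrite mxtrace_hat hat_sqr hu mulmxBr mulmx1 mulmxA raddfB /=.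
have -> : \tr (Q *m u *m u^T) = dotv u (Q *m u).
  by rewrite mxtrace_mulC /dotv [\tr _]big_ord1.
by ring.
Qed.

(** Along the geodesic, g(t) - g(0) = - (1 - cos t)(g(0) - a) + g'(0) sin t with a = (q - 1) / 2 <=
    0. The first term is nonpositive because g(0) >= 0; this is where a radius below pi / 2
    enters. *)
Lemma push_rotm Q A u t : SO3 Q -> SO3 A -> dotv u u = 1 -> 0 < t < pi ->
  0 <= rcos Q A ->
  (rcos Q (A *m rotm u t) - rcos Q A) / sin t <= dotv (push Q A) u.
Proof.
move=> hQ hA hu ht g0.
have st : 0 < sin t by exact: sin_gt0_pi.
have hq : dotv u (Q^T *m A *m u) <= 1 by apply: dotv_SO3_le => //; exact: SO3_trmul.
rewrite ler_pdivrMr // {1}/rcos mulmxA mxtrace_mul_rotm //.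
rewrite /push dotvNl dotvZl.
have e : \tr (Q^T *m A) = 2 * rcos Q A + 1 by rewrite /rcos; field.
rewrite e; have := cos_le1 t; have := cos_geN1 t.
set q := dotv u _ in hq *; set c := dotv (axv _) u; set g := rcos Q A in g0 *.
nra.
Qed.

Lemma max_sub_mono (rho a b : R) :
  0 <= (Num.max (rho - a) 0 - Num.max (rho - b) 0) * (b - a).
Proof.
case: (leP (rho - a) 0) => ha; case: (leP (rho - b) 0) => hb.
- by rewrite subrr mul0r.
- by rewrite mulr_le0 //; lra.
- by rewrite mulr_ge0 //; lra.
- have -> : rho - a - (rho - b) = b - a by ring.
  by rewrite -expr2 sqr_ge0.
Qed.

(** By [push_rotm] at both ends, the sum is at least (P - P')(g(B) - g(A)) over the sine of the
    angle, and the weights P decrease with the cosine g. *)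
Lemma edge_push Q A B rho : SO3 Q -> SO3 A -> SO3 B -> rang A B < pi ->
  0 <= rcos Q A -> 0 <= rcos Q B ->
  0 <= Num.max (rho - rcos Q A) 0 * dotv (push Q A) (unitlog A B) +
       Num.max (rho - rcos Q B) 0 * dotv (push Q B) (unitlog B A).
Proof.
move=> hQ hA hB hpi gA gB; have [<-|AB] := eqVneq A B.
  by rewrite unitlogxx // dotv0 !mulr0 addr0.
have [u1 eB] := unitlogP hA hB AB hpi.
have t0 := rang_gt0 hA hB AB.
have ht : 0 < rang A B < pi by rewrite t0.
have := push_rotm hQ hA u1 ht gA; rewrite -eB => h1.
have BA : B != A by rewrite eq_sym.
have hpi' : rang B A < pi by rewrite rangC.
have [v1 eA] := unitlogP hB hA BA hpi'.
have ht' : 0 < rang B A < pi by rewrite rangC.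
have := push_rotm hQ hB v1 ht' gB; rewrite -eA rangC => h2.
have st : 0 < sin (rang A B) by exact: sin_gt0_pi.
have s0 : 0 < (sin (rang A B))^-1 by rewrite invr_gt0.
set P := Num.max (rho - rcos Q A) 0; set P' := Num.max (rho - rcos Q B) 0.
have P0 : 0 <= P by rewrite le_max lexx orbT.
have P'0 : 0 <= P' by rewrite le_max lexx orbT.
have hP : 0 <= (P - P') * (rcos Q B - rcos Q A).
  exact: max_sub_mono.
have h3 := mulr_ge0 hP (ltW s0).
have h4 := ler_wpM2l P0 h1; have h5 := ler_wpM2l P'0 h2.
apply: le_trans (lerD h4 h5); apply: le_trans h3 _.
by rewrite le_eqVlt; apply/orP; left; apply/eqP; ring.
Qed.

Lemma push_boundary Q A rho : SO3 Q -> SO3 A -> 0 < rho < pi -> rang A Q = rho ->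
  push Q A = sin rho *: unitlog A Q.
Proof.
move=> hQ hA /andP[r0 rpi] e; rewrite /push /unitlog sqrt_rcos // e.
have -> : A^T *m Q = (Q^T *m A)^T by rewrite trmx_mul trmxK.
rewrite axv_tr scalerA scalerN; congr (- (_ *: _)).
by field; rewrite gt_eqF // sin_gt0_pi // r0.
Qed.

End EdgeGeometry.

(** * The network field near a configuration *)

Section NetworkField.
Variables (R : realType) (n : nat) (e : rel 'I_n) (O : set 'M[R]_3).
Variables (f : 'I_n -> 'M[R]_3 -> R) (alpha gamma : R).
Hypotheses (OS : O `<=` @SO3 R) (Oo : open_SO3 O).
Hypothesis fC2 : forall i, C2_SO3 O (f i).
Hypotheses (a0 : 0 < alpha) (g0 : 0 < gamma).
Implicit Types (A B : 'M[R]_3) (x : config R n).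

Let dom := network_dom e O.
Let h := network_field e alpha gamma f.

Lemma network_dom_SO3 x : dom x -> forall i, SO3 (x i).
Proof. by move=> [Ox _] i; exact: OS. Qed.

Lemma network_domP x : dom x <->
  (forall i, O (x i)) /\ forall i j, e i j -> rang (x i) (x j) < pi.
Proof.
split=> -[Ox he]; split=> // i j eij; have := he i j eij;
  by rewrite gdistE //; exact: OS.
Qed.

Lemma network_fieldE x i : dom x -> col i (h x) =
  alpha *: (\sum_(j | e i j) unitlog (x i) (x j)) - gamma *: grad (f i) (x i).
Proof.
move=> dx; have [Ox he] := (network_domP x).1 dx.
have <- : \sum_(j | e i j) sgnv (err x i j) = \sum_(j | e i j) unitlog (x i) (x j).
  by apply: eq_bigr => j eij; apply: sgnv_err; [exact: OS|exact: OS|exact: he].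
by apply/colP => k; rewrite [LHS]mxE [LHS]mxE.
Qed.

Lemma enorm_le_entries (u : 'cV[R]_3) (b : R) : (forall k, `|u k 0| <= b) ->
  enorm u <= 3 * b.
Proof.
move=> hb; have b0 : 0 <= b by apply: le_trans (hb 0).
rewrite -(@ler_pXn2r _ 2) ?nnegrE ?enorm_ge0 ?mulr_ge0 //.
rewrite enorm_sqr dotvE; have e1 k : u k 0 * u k 0 <= b * b.
  by rewrite -expr2 -real_normK ?num_real // expr2 ler_pM.
by have := e1 0; have := e1 1; have := e1 2; nra.
Qed.

Lemma subcvE (u v : 'cV[R]_3) k : (u - v) k 0 = u k 0 - v k 0.
Proof. by rewrite mxE [X in _ + X]mxE. Qed.

Lemma grad_lipschitz g A : C2_SO3 O g -> O A -> exists r L : R,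
  [/\ 0 < r, 0 <= L & forall B B', O B -> O B' -> `|B - A| < r -> `|B' - A| < r ->
    enorm (grad g B' - grad g B) <= L * `|B' - B|].
Proof.
move=> gC2 OA.
have hk (k : 'I_3) := C1_SO3_lipschitz (C2_SO3_lieD (basev R k) Oo gC2) OA.
have [r0 [L0 [r00 L00 h0]]] := hk 0; have [r1 [L1 [r10 L10 h1]]] := hk 1.
have [r2 [L2 [r20 L20 h2]]] := hk 2.
exists (Num.min r0 (Num.min r1 r2)), (3 * (L0 + L1 + L2)); split.
- by rewrite !lt_min r00 r10.
- by rewrite mulr_ge0 // ?addr_ge0 ?ltW.
move=> B B' OB OB'; rewrite !lt_min => /and3P[b0 b1 b2] /and3P[c0 c1 c2].
rewrite -mulrA; apply: enorm_le_entries.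
have n0 := normr_ge0 (B' - B).
have e1 k : (grad g B' - grad g B) k 0 = lieD (basev R k) g B' - lieD (basev R k) g B.
  by rewrite subcvE !grad_entry.
apply: ord3_cases; rewrite e1.
- by apply: le_trans (h0 _ _ OB OB' b0 c0) _; nra.
- by apply: le_trans (h1 _ _ OB OB' b1 c1) _; nra.
- by apply: le_trans (h2 _ _ OB OB' b2 c2) _; nra.
Qed.

(** [O] is open in SO(3), and a distance below pi is the open condition that the cosine exceeds
    -1. *)
Lemma network_dom_open x : dom x ->
  \forall x' \near cnbhs [set x | forall i, SO3 (x i)] x, dom x'.
Proof.
move=> dx; have [Ox he] := (network_domP x).1 dx.
set G := cnbhs _ _.
have h1 : \forall x' \near G, forall i, O (x' i).
  apply: filter_forall => i; have [_] := Oo (Ox i).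
  rewrite /within /= => hO.
  have := @cvg_cnbhs R n [set x | forall i, SO3 (x i)] x i _ hO.
  have hS := @cnbhs_dom R n [set x | forall i, SO3 (x i)] x.
  rewrite nbhs_filterE -/G => hx.
  have {}hx : \forall x' \near G, SO3 (x' i) -> O (x' i) by exact: hx.
  by near=> x'; apply: (near hx x') => //; apply: (near hS x').
have h2 : \forall x' \near G, forall ij : 'I_n * 'I_n, e ij.1 ij.2 -> -1 < rcos (x' ij.1) (x' ij.2).
  apply: filter_forall => -[i j] /=; case eij : (e i j); last by near=> x'.
  have hc : rcos (x' i) (x' j) @[x' --> G] --> rcos (x i) (x j).
    by apply: cvg_rcos; exact: cvg_cnbhs.
  have h3 : -1 < rcos (x i) (x j) by rewrite -rang_ltpi ?he //; exact: OS.
  by apply: filterS (cvgr_gt _ hc _ h3).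
near=> x'; apply/network_domP.
have k1 : forall i, O (x' i) by near: x'.
split => // i j eij; rewrite rang_ltpi; try exact: OS.
have k2 : forall ij : 'I_n * 'I_n, e ij.1 ij.2 -> -1 < rcos (x' ij.1) (x' ij.2) by near: x'.
exact: (k2 (i, j)).
Unshelve. all: by end_near.
Qed.

Lemma near_grad x i : dom x -> exists L : R, 0 <= L /\
  \forall x' \near cnbhs dom x,
    enorm (grad (f i) (x' i) - grad (f i) (x i)) <= L * `|x' i - x i|.
Proof.
move=> [Ox _]; have [r [L [r0 L0 hL]]] := grad_lipschitz (fC2 i) (Ox i).
exists L; split => //; exists r => // x' [Ox' _] hx'.
by apply: hL => //; rewrite subrr normr0.
Qed.

Lemma cvg_enorm_grad x i : dom x ->
  enorm (grad (f i) (x' i) - grad (f i) (x i)) @[x' --> cnbhs dom x] --> (0 : R).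
Proof.
move=> dx; have [L [L0 hL]] := near_grad i dx.
apply/cvgrPdist_lt => eps e0.
have h1 : \forall x' \near cnbhs dom x, `|x' i - x i| < eps / (L + 1).
  by exists (eps / (L + 1)); [rewrite divr_gt0 // ltr_wpDl|].
near=> x'; rewrite sub0r normrN ger0_norm ?enorm_ge0 //.
have k1 : enorm (grad (f i) (x' i) - grad (f i) (x i)) <= L * `|x' i - x i| by near: x'.
have k2 : `|x' i - x i| < eps / (L + 1) by near: x'.
apply: le_lt_trans k1 _; move: k2; rewrite ltr_pdivlMr ?ltr_wpDl // => k2.
by have := normr_ge0 (x' i - x i); nra.
Unshelve. all: by end_near.
Qed.

Lemma abs_entry_le_enorm (u : 'cV[R]_3) k : `|u k 0| <= enorm u.
Proof.
rewrite -(@ler_pXn2r _ 2) ?nnegrE ?enorm_ge0 // enorm_sqr real_normK ?num_real //.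
by rewrite dotvE; move: k; apply: ord3_cases; nra.
Qed.

Lemma cvg_grad x i k : dom x ->
  grad (f i) (x' i) k 0 @[x' --> cnbhs dom x] --> grad (f i) (x i) k 0.
Proof.
move=> dx; have hc := cvg_enorm_grad i dx.
apply/cvgrPdist_lt => eps e0; have /cvgrPdist_lt /(_ _ e0) := hc.
apply: filterS => x'; rewrite sub0r normrN ger0_norm ?enorm_ge0 // => hx.
apply: le_lt_trans hx; rewrite distrC.
have -> : grad (f i) (x' i) k 0 - grad (f i) (x i) k 0 =
  (grad (f i) (x' i) - grad (f i) (x i)) k 0 by rewrite subcvE.
exact: abs_entry_le_enorm.
Qed.

(** Each agent has at most n couplings of norm at most one, and near x the gradients differ by less
    than 1 from their values at x. *)
Lemma network_field_bound x M : dom x -> (forall i, enorm (grad (f i) (x i)) <= M) ->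
  \forall x' \near cnbhs dom x,
    forall i, enorm (col i (h x')) <= alpha * n%:R + gamma * (M + 1).
Proof.
move=> dx hM.
have hg : \forall x' \near cnbhs dom x,
    forall i, enorm (grad (f i) (x' i) - grad (f i) (x i)) < 1.
  apply: filter_forall => i; have /cvgrPdist_lt /(_ _ ltr01) := cvg_enorm_grad i dx.
  by apply: filterS => x'; rewrite sub0r normrN ger0_norm ?enorm_ge0.
have hd := @cnbhs_dom R n dom x.
near=> x' => i.
have dx' : dom x' by near: x'.
have [Ox' he'] := (network_domP x').1 dx'.
rewrite network_fieldE //; apply: le_trans (enormD _ _) _; rewrite enormN !enormZ.
rewrite !gtr0_norm // lerD // ler_pM2l //.
  apply: le_trans (enorm_sum _ _ _) _.
  apply: (@le_trans _ _ (\sum_(j < n | e i j) 1)).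
    by apply: ler_sum => j eij; apply: enorm_unitlog_le1; [exact: OS|exact: OS|exact: he'].
  rewrite sumr_const -[leLHS]mulr_natl mulr1 ler_nat.
  by apply: leq_trans (max_card _) _; rewrite card_ord.
rewrite -[X in enorm X](subrK (grad (f i) (x i))); apply: le_trans (enormD _ _) _.
rewrite addrC lerD //; apply: ltW.
have k2 : forall i, enorm (grad (f i) (x' i) - grad (f i) (x i)) < 1 by near: x'.
exact: k2.
Unshelve. all: by end_near.
Qed.

End NetworkField.

(** * Gronwall's inequality with one-sided derivatives *)

Section Gronwall.
Variable R : realType.
Implicit Types (a b k t s : R) (phi : R -> R).
Local Notation mu := (@lebesgue_measure R).

Lemma expR_small k : forall e : R, 0 < e -> exists2 h : R, 0 < h &
  forall t, 0 < t < h -> `|expR (k * t) - 1 - k * t| <= e * t.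
Proof.
move=> e e0.
have hd : is_derive (0 : R) 1 (fun t => expR (k * t)) (k : R).
  have h1 : is_derive (0 : R) 1 (fun t : R => k *: t) (k *: 1) by exact: is_deriveZ.
  apply: (is_derive_eqr (is_derive1_comp (is_derive_expR _) h1)).
  by rewrite scaler0 expR0 /= mul1r -[k *: 1]/(k * 1) mulr1.
have [h h0 hh] := (is_derive_epsP _ _ _).1 hd _ e0.
exists h => // t /andP[t0 th]; have := hh t; rewrite subr0 mulr0 expR0 gtr0_norm // => /(_ th).
by rewrite -[t *: k]/(t * k) [t * k]mulrC.
Qed.

Lemma abs_continuousB a a' b b' (V : normedModType R) (c : R -> V) :
  a <= a' -> b' <= b -> abs_continuous a b c -> abs_continuous a' b' c.
Proof.
move=> aa bb hc e e0; have [d d0 hd] := hc e e0; exists d => // m s t hst dis sm.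
apply: hd => // i; have [h1 h2 h3] := hst i; split => //; first exact: le_trans h1.
exact: le_trans bb.
Qed.

Lemma aeS (P Q : R -> Prop) : (forall t, P t -> Q t) ->
  {ae mu, forall t, P t} -> {ae mu, forall t, Q t}.
Proof.
by move=> PQ; exact: (@filterS _ _ (ae_filter_ringOfSetsType mu) [set t | P t] [set t | Q t] PQ).
Qed.

Lemma aeS2 (P Q S : R -> Prop) : (forall t, P t -> Q t -> S t) ->
  {ae mu, forall t, P t} -> {ae mu, forall t, Q t} -> {ae mu, forall t, S t}.
Proof.
move=> PQS.
exact: (@filterS2 _ _ (ae_filter_ringOfSetsType mu) [set t | P t] [set t | Q t] [set t | S t] PQS).
Qed.

Lemma ae_point (b : R) : {ae mu, forall t : R, t <> b}.
Proof.
exists [set b]; split => //.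
- exact: lebesgue_measure_set1.
- by move=> t /= /contrapT.
Qed.

Lemma ac_bounded a b phi : a <= b -> abs_continuous a b phi ->
  exists2 B : R, 0 <= B & forall t, a <= t <= b -> `|phi t| <= B.
Proof.
move=> ab ac; have hc : {within `[a, b], continuous (fun t => `|phi t|)}.
  apply/subspace_continuousP => t; rewrite /= in_itv /= => tab.
  apply/cvgrPdist_lt => e e0; have [h h0 hh] := ac_continuous ac tab e0.
  rewrite near_withinE; apply/nbhs_ballP; exists h => //= s.
  rewrite /ball /= in_itv /= => st sab; apply: le_lt_trans (hh s sab _).
    by rewrite distrC; exact: ler_dist_dist.
  by rewrite distrC.
have [c _ hmax] := EVT_max ab hc.
by exists `|phi c| => // t tab; apply: hmax; rewrite in_itv.
Qed.

Lemma expR_sub_le (x y : R) : expR x - expR y <= expR x * (x - y).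
Proof.
have := expR_ge1Dx (y - x); rewrite expRB => h.
have ex := expR_gt0 x.
have : expR x * (1 + (y - x)) <= expR y.
  by apply: le_trans (ler_wpM2l (ltW ex) h) _; rewrite mulrCA divff ?mulr1 // gt_eqF.
by lra.
Qed.

Lemma ac_exp a b k phi : a <= b -> abs_continuous a b phi ->
  abs_continuous a b (fun t => expR (- k * t) * phi t).
Proof.
move=> ab ac; have [B B0 hB] := ac_bounded ab ac.
pose E := expR (`|k| * (`|a| + `|b|)); have E0 : 0 < E by exact: expR_gt0.
have hE t : a <= t <= b -> expR (- k * t) <= E.
  move=> /andP[at_ tb]; rewrite ler_expR; apply: le_trans (ler_norm _) _.
  rewrite normrM normrN ler_wpM2l // ler_norml.
  have := ler_norm a; have := ler_norm b; have := ler_norm (- a); have := ler_norm (- b).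
  by rewrite !normrN; have := normr_ge0 a; have := normr_ge0 b; lra.
have hL s t : a <= s <= b -> a <= t <= b ->
    `|expR (- k * t) - expR (- k * s)| <= E * (`|k| * `|t - s|).
  move=> sab tab; have h1 := expR_sub_le (- k * t) (- k * s).
  have h2 := expR_sub_le (- k * s) (- k * t).
  have e1 : - k * t - - k * s = - (k * (t - s)) by ring.
  have e2 : - k * s - - k * t = k * (t - s) by ring.
  rewrite e1 in h1; rewrite e2 in h2.
  have := hE t tab; have := hE s sab; have := expR_gt0 (- k * t); have := expR_gt0 (- k * s).
  rewrite -normrM; have := ler_norm (k * (t - s)); have := ler_norm (- (k * (t - s))).
  rewrite normrN ler_norml; set q := k * (t - s) in h1 h2 *.
  set p := expR _ in h1 h2 *; set p' := expR _ in h1 h2 *.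
  have := normr_ge0 q; set nq := `|q| => q0 q1 q2 p0 p'0 pE p'E.
  by apply/andP; split; nra.
have kB : 0 < E + E * `|k| * B + 1.
  by rewrite ltr_pwDr // addr_ge0 ?mulr_ge0 // ltW.
apply: (ac_dominated kB ac) => s t sab tab.
have -> : expR (- k * t) * phi t - expR (- k * s) * phi s =
  expR (- k * t) * (phi t - phi s) + (expR (- k * t) - expR (- k * s)) * phi s by ring.
apply: le_trans (ler_normD _ _) _; rewrite !normrM (gtr0_norm (expR_gt0 _)).
have h1 := hE t tab; have h2 := hL s t sab tab; have h3 := hB s sab.
have h4 : expR (- k * t) * `|phi t - phi s| <= E * `|phi t - phi s| by exact: ler_wpM2r.
have h5 : `|expR (- k * t) - expR (- k * s)| * `|phi s| <= E * (`|k| * `|t - s|) * B by exact: ler_pM.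
apply: le_trans (lerD h4 h5) _.
have n1 := normr_ge0 (phi t - phi s); have n2 := normr_ge0 (t - s); have n3 := normr_ge0 k.
set X := `|phi t - phi s| in n1 *; set Y := `|t - s| in n2 *; set Z := `|k| in n3 *.
have -> : (E + E * Z * B + 1) * (X + Y) =
  E * X + E * (Z * Y) * B + (E * Y + E * Z * B * X + X + Y) by ring.
by rewrite lerDl !addr_ge0 // !mulr_ge0 // ltW.
Qed.

(** Multiplication by exp(- k t) reduces the claim to [ac_nonincreasing]. The estimate concerns the
    left of t, the side on which angles with corners can be bounded. *)
Lemma ac_gronwall a b k phi : a <= b -> abs_continuous a b phi ->
  {ae mu, forall t, a < t < b -> forall e : R, 0 < e ->
    exists2 h : R, 0 < h & forall s, a <= s -> t - h < s < t ->
      phi t - phi s <= (k * phi t + e) * (t - s)} ->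
  phi b <= phi a * expR (k * (b - a)).
Proof.
move=> ab ac hd.
pose psi t := expR (- k * t) * phi t.
suff h : psi b <= psi a.
  have := ler_wpM2l (ltW (expR_gt0 (k * b))) h; rewrite /psi !mulrA -!expRD.
  rewrite -mulrDl subrr mul0r expR0 mul1r.
  by congr (_ <= _); rewrite mulrC; congr (_ * expR _); ring.
apply: (ac_nonincreasing ab (ac_exp k ab ac)).
apply: aeS2 hd (ae_point b) => t hd tb /andP[at_ tb'] e e0.
have tab : a < t < b by rewrite at_ lt_neqAle tb' andbT; apply/eqP.
pose E := expR (- k * t); have E0 : 0 < E by exact: expR_gt0.
(* [D] collects the factors of e': |k| from the oscillation of phi, |phi t| + 1 from the expansion
   of the exponential, 1 from the hypothesis. *)
pose D := `|k| + 2 + `|phi t|.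
have D0 : 0 < D by rewrite /D ltr_pwDl // ltr_wpDl.
pose e' := Num.min 1 (e / (E * D)).
have e'0 : 0 < e' by rewrite lt_min ltr01 divr_gt0 // mulr_gt0.
have e'1 : e' <= 1 by rewrite ge_min lexx.
have e'e : E * (e' * D) <= e.
  have : e' <= e / (E * D) by rewrite ge_min lexx orbT.
  by rewrite ler_pdivlMr ?mulr_gt0 // mulrCA.
have [h1 h10 hh1] := hd tab _ e'0.
have [h2 h20 hh2] := expR_small k e'0.
have tab' : a <= t <= b by rewrite (ltW at_).
have [h3 h30 hh3] := ac_continuous ac tab' e'0.
exists (Num.min h1 (Num.min h2 h3)); first by rewrite !lt_min h10 h20.
move=> s as_ /andP[]; rewrite ltrBlDr -ltrBlDl !lt_min => /and3P[k1 k2 k3] st.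
have q1 := hh1 s as_; rewrite ltrBlDr -ltrBlDl k1 st in q1.
have {}q1 := q1 isT.
have q2 := hh2 (t - s); rewrite subr_gt0 st k2 in q2; have {}q2 := q2 isT.
have q3 : `|phi s - phi t| < e'.
  apply: hh3; first by rewrite as_ (le_trans (ltW st)).
  by rewrite distrC gtr0_norm ?subr_gt0.
have es : expR (- k * s) = E * expR (k * (t - s)) by rewrite -expRD; congr expR; ring.
rewrite es -/E; move: q2; set X := expR _ => q2.
have t0 : 0 < t - s by rewrite subr_gt0.
have -> : E * phi t - E * X * phi s = E * (phi t - phi s - (X - 1 - k * (t - s)) * phi s - k * (t - s) * phi s) by ring.
apply: (@le_trans _ _ (E * (e' * D) * (t - s))); last by rewrite ler_pM2r.
rewrite -[leRHS]mulrA ler_pM2l //.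
have q4 : - ((X - 1 - k * (t - s)) * phi s) <= e' * (t - s) * (`|phi t| + 1).
  apply: le_trans (ler_norm _) _; rewrite normrN normrM; apply: ler_pM => //.
  have : `|phi s| <= `|phi t| + `|phi s - phi t| by rewrite -{1}(subrKC (phi t) (phi s)) ler_normD.
  by lra.
have q5 : k * (phi t - phi s) <= `|k| * e'.
  by apply: le_trans (ler_norm _) _; rewrite normrM distrC ler_wpM2l // ltW.
have q6 := ler_wpM2r (ltW t0) q5.
by rewrite /D; lra.
Qed.

End Gronwall.

(** * Solutions on an interval and left Dini derivatives *)

Section Solutions.
Variables (R : realType) (n : nat).
Implicit Types (dom : set (config R n)) (h : config R n -> 'M[R]_(3, n)).
Implicit Types (a b c s t k : R) (x : config R n) (y : R -> config R n).
Local Notation mu := (@lebesgue_measure R).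

Lemma ac_cst a b k : abs_continuous a b (fun=> k).
Proof.
move=> eps e0; exists 1 => // m s t _ _ _.
by rewrite big1 // => i _; rewrite subrr normr0.
Qed.

Lemma ac_add a b (phi psi : R -> R) : abs_continuous a b phi ->
  abs_continuous a b psi -> abs_continuous a b (fun t => phi t + psi t).
Proof.
move=> h1 h2 eps e0; have e2 : 0 < eps / 2 by rewrite divr_gt0.
have [d1 d10 hd1] := h1 _ e2; have [d2 d20 hd2] := h2 _ e2.
exists (Num.min d1 d2); first by rewrite lt_min d10.
move=> m s t st dis; rewrite lt_min => /andP[s1 s2].
rewrite [ltRHS]splitr; apply: le_lt_trans (ltrD (hd1 m s t st dis s1) (hd2 m s t st dis s2)).
rewrite -big_split /=; apply: ler_sum => i _.
by rewrite opprD addrACA ler_normD.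
Qed.

Lemma ac_sum a b (I : Type) (r : seq I) (phi : I -> R -> R) :
  (forall i, abs_continuous a b (phi i)) ->
  abs_continuous a b (fun t => \sum_(i <- r) phi i t).
Proof.
move=> hp; elim: r => [|i r IH].
  by under eq_fun do rewrite big_nil; exact: ac_cst.
by under eq_fun do rewrite big_cons; exact: (ac_add (hp i) IH).
Qed.

(** The upper left Dini derivative of [phi] at [t] is at most [d]. A smooth lower bound that touches
    phi at t controls this side. *)
Definition ldini (phi : R -> R) t d : Prop := forall e : R, 0 < e ->
  exists2 h : R, 0 < h & forall s, t - h < s < t -> phi t - phi s <= (d + e) * (t - s).

Lemma ldini_derive phi t d : is_derive t 1 phi d -> ldini phi t d.
Proof.
move=> hd e e0; have [h h0 hh] := (is_derive_epsP _ _ _).1 hd e e0.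
exists h => // s /andP[h1 st].
have st' : `|s - t| = t - s by rewrite distrC gtr0_norm ?subr_gt0.
have := hh s; rewrite st' => /(_ _)/wrap[]; first by lra.
rewrite ler_norml => /andP[h2 _]; move: h2; rewrite -[_ *: d]/(_ * d) => h2.
by nra.
Qed.

Lemma ldini_le phi t d d' : d <= d' -> ldini phi t d -> ldini phi t d'.
Proof.
move=> dd hp e e0; have [h h0 hh] := hp e e0; exists h => // s hs.
apply: le_trans (hh s hs) _; rewrite ler_wpM2r ?lerD2r //.
by have /andP[_ st] := hs; rewrite subr_ge0 ltW.
Qed.

(** At a = 0 this is [filippov_solution_upto]; a general left end allows solutions to be restricted
    and restarted. *)
Definition solution_on dom h a b y : Prop :=
  [/\ forall t, a <= t <= b -> dom (y t),
      forall i, abs_continuous a b (fun t => y t i)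
    & {ae mu, forall t, a <= t <= b ->
        (forall i, derivable (fun s => y s i) t 1) /\
        filippov_map dom h (y t)
          (\matrix_(k, i) body_vel (fun s => y s i) t k 0)}].

Lemma solution_on_sub dom h a b a' b' y : a <= a' -> b' <= b ->
  solution_on dom h a b y -> solution_on dom h a' b' y.
Proof.
move=> aa bb [h1 h2 h3]; split.
- by move=> t /andP[t1 t2]; apply: h1; rewrite (le_trans aa) // (le_trans t2).
- by move=> i; exact: abs_continuousB (h2 i).
- apply: aeS h3 => t h3 /andP[t1 t2].
  by apply: h3; rewrite (le_trans aa) // (le_trans t2).
Qed.

Lemma solution_velocity dom h a b y : (forall x, dom x -> forall i, SO3 (x i)) ->
  solution_on dom h a b y ->
  {ae mu, forall t, a < t < b -> exists2 w, filippov_map dom h (y t) w &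
    forall i, is_derive t 1 (fun s => y s i) (y t i *m hat (col i w))}.
Proof.
move=> domS [h1 _ h3]; apply: aeS h3 => t h3 /andP[at_ tb].
have [|d1 d2] := h3; first by rewrite !ltW.
exists (\matrix_(k, i) body_vel (fun s => y s i) t k 0) => // i.
have hd := derivableP (d1 i).
have hS : \forall s \near t, SO3 (y s i).
  have : t \in `]a, b[ by rewrite in_itv /= at_.
  move=> /near_in_itvoo; apply: filterS => s; rewrite in_itv /= => /andP[s1 s2].
  by apply: domS; apply: h1; rewrite !ltW.
have e := SO3_curve_vel hS hd.
apply: (is_derive_eqr hd); rewrite {1}e; congr (_ *m hat _).
by apply/colP => k; rewrite [RHS]mxE [RHS]mxE /body_vel derive1E.
Qed.

Lemma solution_near dom h a b y c (P : set (config R n)) :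
  solution_on dom h a b y -> a <= c <= b ->
  (\forall x \near cnbhs dom (y c), P x) ->
  exists2 d : R, 0 < d & forall s, a <= s <= b -> `|s - c| < d -> P (y s).
Proof.
move=> [h1 h2 _] cab [eta e0 hP].
have hc i := ac_continuous (h2 i) cab e0.
pose d i := s2val (cid2 (hc i)).
have d0 i : 0 < d i by rewrite /d; case: cid2.
have hd i s : a <= s <= b -> `|s - c| < d i -> `|y s i - y c i| < eta.
  by rewrite /d; case: cid2 => /= q _ hq; exact: hq.
exists (\big[Num.min/1]_i d i); first by apply: lt_bigmin => // i _.
move=> s sab; move=> /bigmin_gtP[_ hs]; apply: hP; first exact: h1.
by move=> i; apply: hd => //; exact: hs.
Qed.

End Solutions.

(** * Tools for the penalty outside the ball *)

Section Penalty.
Variable R : realType.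
Implicit Types (A B Q : 'M[R]_3) (rho : R).

Definition pospart (z : R) : R := Num.max z 0.

Lemma pospart_ge0 z : 0 <= pospart z.
Proof. by rewrite /pospart le_max lexx orbT. Qed.

Lemma pospart_lip z z' : `|pospart z - pospart z'| <= `|z - z'|.
Proof.
rewrite /pospart; case: (leP z 0) => h; case: (leP z' 0) => h'.
- by rewrite subrr normr0.
- by rewrite sub0r normrN gtr0_norm // ltr0_norm; lra.
- by rewrite subr0 gtr0_norm // gtr0_norm; lra.
- by [].
Qed.

Lemma cvg_pospart (T : Type) (F : set_system T) (FF : Filter F) (z : T -> R) (l : R) :
  z x @[x --> F] --> l -> pospart (z x) @[x --> F] --> pospart l.
Proof.
move=> /cvgrPdist_lt h; apply/cvgrPdist_lt => e e0; apply: filterS (h e e0) => x.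
by apply: le_lt_trans; exact: pospart_lip.
Qed.

(** The corner of the positive part at 0 disappears in the square. *)
Lemma is_derive_pospart_sqr (z : R -> R) (t dz : R) : is_derive t 1 z dz ->
  is_derive t 1 (fun s => pospart (z s) ^+ 2) (2 * pospart (z t) * dz).
Proof.
move=> hz.
suff hp (u : R) : is_derive u 1 (fun s => pospart s ^+ 2) (2 * pospart u).
  by apply: (is_derive_eqr (is_derive1_comp (hp _) hz)); rewrite mulrC.
apply/is_derive_epsP => e e0; exists e => // s hs.
rewrite -[_ *: _]/((s - u) * (2 * pospart u)).
apply: (@le_trans _ _ (`|s - u| * `|s - u|)); last by rewrite ler_wpM2r // ltW.
rewrite -expr2 real_normK ?num_real // /pospart ler_norml.
case: (leP s 0) => h; case: (leP u 0) => h'.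
- by rewrite expr0n /= mulr0 mulr0 !subr0 sqr_ge0 oppr_le0 sqr_ge0.
- have su : 0 <= - s * u by rewrite mulr_ge0 ?oppr_ge0 // ltW.
  by rewrite expr0n /=; apply/andP; split; nra.
- have su : 0 <= s * - u by rewrite mulr_ge0 ?oppr_ge0 // ltW.
  by rewrite expr0n /= mulr0 mulr0; apply/andP; split; nra.
- rewrite (_ : s ^+ 2 - u ^+ 2 - (s - u) * (2 * u) = (s - u) ^+ 2); last by ring.
  by rewrite lexx andbT; have := sqr_ge0 (s - u); lra.
Qed.

Lemma cvg_dotv (T : Type) (F : set_system T) (FF : Filter F) (u v : T -> 'cV[R]_3)
    (U V : 'cV[R]_3) :
  (forall k, u x k 0 @[x --> F] --> U k 0) -> (forall k, v x k 0 @[x --> F] --> V k 0) ->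
  dotv (u x) (v x) @[x --> F] --> dotv U V.
Proof.
move=> hu hv; rewrite dotvE; under eq_fun do rewrite dotvE.
by apply: cvgD; [apply: cvgD|]; apply: cvgM.
Qed.

Lemma cvg_push (T : Type) (F : set_system T) (FF : Filter F) Q (M : T -> 'M[R]_3)
    (L : 'M[R]_3) k :
  M x @[x --> F] --> L -> push Q (M x) k 0 @[x --> F] --> push Q L k 0.
Proof.
have e (v : 'cV[R]_3) : (- (2^-1 *: v)) k 0 = - (2^-1 * v k 0) by rewrite mxE [X in - X]mxE.
move=> ML; rewrite /push e; under eq_fun do rewrite e.
apply: cvgN; apply: cvgM; first exact: cvg_cst.
by apply: cvg_axv; apply: cvg_mulmx => //; exact: cvg_cst.
Qed.

Lemma rcos_lip Q A B : SO3 Q -> `|rcos Q A - rcos Q B| <= 5 * `|A - B|.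
Proof.
move=> hQ; rewrite /rcos -mulrBl opprB addrA subrK -raddfB /= -mulmxBr.
rewrite normrM [`|2^-1|]gtr0_norm // ler_pdivrMr //.
set D := A - B; have n0 := normr_ge0 D.
have e k : `|(Q^T *m D) k k| <= 3 * `|D|.
  rewrite mulmx3E ![Q^T _ _]mxE.
  have q i j : `|Q i j * D i j| <= `|D|.
    rewrite normrM -[leRHS]mul1r; apply: ler_pM => //; first exact: SO3_entry_le1.
    exact: le_mx_norm.
  apply: le_trans (ler_normD _ _) _; have := q 0 k; have := q 1 k; have := q 2 k.
  by have := ler_normD (Q 0 k * D 0 k) (Q 1 k * D 1 k); lra.
rewrite mxtrace3E; apply: le_trans (ler_normD _ _) _.
have := ler_normD ((Q^T *m D) 0 0) ((Q^T *m D) 1 1).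
by have := e 0; have := e 1; have := e 2; lra.
Qed.

Lemma push_rotm_axis Q u t : SO3 Q -> push Q (Q *m rotm u t) = - (sin t *: u).
Proof.
move=> hQ; rewrite /push mulmxA; have [-> _] := SO3_orth hQ.
by rewrite mul1mx axv_rotm scalerA mulrA mulVf ?mul1r.
Qed.

Lemma cos_sub_ge (rho t : R) : 0 < rho -> rho <= t -> t <= pi / 2 ->
  sin rho * (t - rho) <= cos rho - cos t.
Proof.
move=> r0 rt tpi; have [<-|rt'] := eqVneq rho t; first by rewrite !subrr mulr0.
have lt_rt : rho < t by rewrite lt_neqAle rt'.
have [|c] := @MVT R cos (fun x => - sin x) rho t lt_rt.
  by apply: continuous_subspaceT => x; exact: continuous_cos.
rewrite in_itv /= => /andP[rc ct] e.
have -> : cos rho - cos t = sin c * (t - rho) by rewrite -opprB e mulNr opprK.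
rewrite ler_pM2r ?subr_gt0 //; apply: ltW.
have pi0 := pi_gt0 R.
by rewrite ltr_sin // in_itv /=; apply/andP; split; lra.
Qed.

Lemma sin_sub_bounds (rho t : R) : 0 < rho -> rho <= t -> t <= pi / 2 ->
  0 <= sin t - sin rho <= t - rho.
Proof.
move=> r0 rt tpi; have [<-|rt'] := eqVneq rho t; first by rewrite !subrr lexx.
have lt_rt : rho < t by rewrite lt_neqAle rt'.
have st : sin rho < sin t.
  by rewrite ltr_sin // in_itv /=; apply/andP; split; lra.
rewrite subr_ge0 (ltW st) /=.
have := sin_le_id (t := t - rho); rewrite subr_ge0 => /(_ rt).
have -> : sin t = sin (t - rho) * cos rho + cos (t - rho) * sin rho by rewrite -sinD subrK.
have pi0 := pi_gt0 R.
have : 0 <= sin (t - rho) by apply: sin_ge0_pi; apply/andP; split; lra.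
have : 0 < sin rho by apply: sin_gt0_pi; apply/andP; split; lra.
by have := cos_le1 (t - rho); have := cos_le1 rho; nra.
Qed.

Lemma dir_toE Q A : SO3 A -> SO3 Q -> rang A Q < pi -> dir_to Q A = unitlog A Q.
Proof.
move=> hA hQ hpi; rewrite -sgnv_err // /dir_to /sgnv.
by case: eqP => // ->; rewrite scaler0.
Qed.

(** Half a turn about any axis takes a point with positive cosine to Q to one with negative cosine,
    so two points of the ball are never antipodal. *)
Lemma rcos_rotm_pi Q A u : SO3 Q -> SO3 A -> dotv u u = 1 ->
  rcos Q (A *m rotm u pi) <= - rcos Q A.
Proof.
move=> hQ hA hu; rewrite /rcos mulmxA mxtrace_mul_rotm // cospi sinpi.
have hq : dotv u (Q^T *m A *m u) <= 1 by apply: dotv_SO3_le => //; exact: SO3_trmul.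
by lra.
Qed.

End Penalty.

Lemma sum_sym_ge0 (R : numDomainType) (n : nat) (e : rel 'I_n) (T : 'I_n -> 'I_n -> R) :
  symmetric e -> (forall i j, e i j -> 0 <= T i j + T j i) ->
  0 <= \sum_i \sum_(j | e i j) T i j.
Proof.
move=> sym hT; set S := \sum_i _.
have e2 : S + S = \sum_i \sum_(j | e i j) (T i j + T j i).
  have -> : \sum_i \sum_(j | e i j) (T i j + T j i) =
      S + \sum_i \sum_(j | e i j) T j i.
    by rewrite -big_split /=; apply: eq_bigr => i _; rewrite big_split.
  congr (_ + _); rewrite (exchange_big_dep predT) //=; apply: eq_bigr => i _.
  by apply: eq_bigl => j; rewrite sym.
have : 0 <= S + S by rewrite e2; apply: sumr_ge0 => i _; apply: sumr_ge0 => j; exact: hT.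
by rewrite -mulr2n pmulrn_lge0.
Qed.

Lemma is_derive_bigsum (R : realType) (V : normedModType R) (I : Type) (r : seq I) (g : I -> V -> R)
    (dg : I -> R) (a v : V) : (forall i, is_derive a v (g i) (dg i)) ->
  is_derive a v (fun b => \sum_(i <- r) g i b) (\sum_(i <- r) dg i).
Proof.
move=> hg; elim: r => [|i r IH].
  by under eq_fun do rewrite big_nil; rewrite big_nil; exact: is_derive_cst.
by under eq_fun do rewrite big_cons; rewrite big_cons; exact: (is_deriveD (hg i) IH).
Qed.

(** * Strong invariance of the ball *)

Section Invariance.
Variables (R : realType) (n : nat) (e : rel 'I_n) (O : set 'M[R]_3).
Variables (f : 'I_n -> 'M[R]_3 -> R) (alpha gamma rho : R) (Rc : 'M[R]_3).
Hypotheses (OS : O `<=` @SO3 R) (Oo : open_SO3 O).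
Hypothesis fC2 : forall i, C2_SO3 O (f i).
Hypotheses (a0 : 0 < alpha) (g0 : 0 < gamma) (sym : symmetric e).
Hypotheses (hRc : SO3 Rc) (r0 : 0 < rho) (rpi : rho < pi / 2).
Let C := gcball Rc rho.
Hypothesis CO : C `<=` O.
Hypothesis inward : forall i A, SO3 A -> gdist A Rc = rho ->
  dotv (dir_to Rc A) (grad (f i) A) <= 0.
Implicit Types (A B : 'M[R]_3) (x : config R n) (y : R -> config R n).
Local Notation mu := (@lebesgue_measure R).

Let dom := network_dom e O.
Let h := network_field e alpha gamma f.
Let domS x (dx : dom x) : forall i, SO3 (x i) := network_dom_SO3 OS dx.

Lemma ball_radius : rho < pi. Proof. by have := pi_gt0 R; have := rpi; lra. Qed.

Lemma cos_radius : 0 < cos rho.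
Proof. by apply: cos_gt0_pihalf; apply/andP; split; have := pi_gt0 R; have := rpi; have := r0;
  lra. Qed.

Lemma ballE A : C A <-> SO3 A /\ cos rho <= rcos Rc A.
Proof. exact: gcballE ball_radius. Qed.

Lemma ball_rang A B : C A -> C B -> rang A B < pi.
Proof.
move=> /ballE[hA gA] /ballE[hB gB]; have c0 := cos_radius.
rewrite rang_ltpi // lt_neqAle; have [-> _] := andP (rcos_bounds hA hB).
rewrite andbT; apply/eqP => e1; have [u u1 eB] := rang_axis hA hB.
have ar : rang A B = pi by rewrite /rang -e1 acosN1.
move: gB; rewrite eB ar => gB; have := rcos_rotm_pi hRc hA u1; lra.
Qed.

Lemma ball_dom x : (forall i, C (x i)) -> dom x.
Proof.
move=> hx; apply/(network_domP e OS); split=> [i|i j _]; first exact: CO.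
exact: ball_rang.
Qed.

(** (D) speaks only of the boundary. A point A outside the ball is compared with the boundary point
    B on the geodesic from [Rc] to A: the gradient is locally Lipschitz, |A - B| <= 2 (t - rho), and
    t - rho <= (cos rho - cos t) / sin rho. *)
Lemma boundary_estimate i A0 : C A0 -> exists r L : R, [/\ 0 < r, 0 <= L &
  forall A, O A -> `|A - A0| < r ->  cos rho - rcos Rc A > 0 ->
    dotv (push Rc A) (grad (f i) A) <= L * (cos rho - rcos Rc A)].
Proof.
move=> CA0; have OA0 := CO CA0; have [hA0 gA0] := (ballE A0).1 CA0.
have [r1 [L [r10 L0 hL]]] := grad_lipschitz Oo (fC2 i) OA0.
have s0 : 0 < sin rho by rewrite sin_gt0_pi // r0 ball_radius.
have c0 := cos_radius; have pi0 := pi_gt0 R.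
(* The second bound keeps the cosine of A positive, hence t below pi / 2. The third gives 4 (t -
   rho) < r1, so that, with the first, B stays within r1 of A0. *)
pose r := Num.min (r1 / 2) (Num.min (cos rho / 5) (r1 * sin rho / 20)).
have r'0 : 0 < r by rewrite !lt_min !divr_gt0 // mulr_gt0.
pose G := enorm (grad (f i) A0) + L * r1.
have G0 : 0 <= G by rewrite addr_ge0 ?enorm_ge0 // mulr_ge0 // ltW.
exists r, ((G + L * 2) / sin rho); split => //.
  by rewrite divr_ge0 ?(ltW s0) // addr_ge0 // mulr_ge0.
move=> A OA; rewrite !lt_min => /and3P[d1 d2 d3] gA.
have hA := OS OA.
have lipA := rcos_lip A A0 hRc.
have gA' : 0 < rcos Rc A.
  have := ler_norm (rcos Rc A0 - rcos Rc A); rewrite distrC; lra.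
have [u u1 eA] := rang_axis hRc hA; set t := rang Rc A in eA.
have ct : cos t = rcos Rc A by rewrite cos_rang.
have /andP[t0 tpi] : 0 <= t <= pi by exact: rang_bounds.
have tr : rho <= t.
  rewrite leNgt; apply/negP => tr.
  have : cos rho < cos t.
    by rewrite ltr_cos // in_itv /=; apply/andP; split;
      have := ball_radius; have := r0; clear - t0 tpi tr OS Oo fC2 a0 g0 sym hRc r0 rpi CO inward domS h; lra.
  by lra.
have tpi2 : t <= pi / 2.
  rewrite leNgt; apply/negP => tr'.
  have : cos t < cos (pi / 2).
    by rewrite ltr_cos // in_itv /=; apply/andP; split; 
      clear - t0 tpi pi0 tr' OS Oo fC2 a0 g0 sym hRc r0 rpi CO inward domS h; lra.
  by rewrite cos_pihalf; lra.
pose B := Rc *m rotm u rho.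
have hB : SO3 B by apply: SO3_mul => //; exact: SO3_rotm.
have rB : rang Rc B = rho by rewrite /B rang_rotm // ltW // ltW // ball_radius.
have CB : C B by split => //; rewrite gdistE // rangC rB.
have BA : A = B *m rotm u (t - rho).
  by rewrite /B -mulmxA -rotmD // addrC subrK.
have dAB : `|A - B| <= 2 * (t - rho).
  have := norm_le_rang hB hA; rewrite distrC {2}BA rang_rotm //; last first.
    by apply/andP; split; have := r0; lra.
have tc := cos_sub_ge r0 tr tpi2; rewrite ct in tc.
have tsm : 4 * (t - rho) < r1.
  have : rcos Rc A0 - rcos Rc A <= 5 * `|A - A0|.
    by apply: le_trans lipA; rewrite distrC; exact: ler_norm.
  move=> k; have : sin rho * (t - rho) < r1 * sin rho / 4 by lra.
  by rewrite mulrC -mulrA [sin rho / 4]mulrC mulrA ltr_pM2r // => ?; lra.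
have nB : `|B - A0| < r1.
  have : `|B - A0| <= `|A - B| + `|A - A0|.
    by rewrite -(subrKA A) distrC; apply: le_trans (ler_normD _ _) _; rewrite distrC.
  by lra.
have nA : `|A - A0| < r1 by lra.
have lipg := hL B A (CO CB) OA nB nA.
have bd : dotv (push Rc B) (grad (f i) B) <= 0.
  rewrite (push_boundary hRc hB (rho := rho)) ?r0 ?ball_radius //; last by rewrite rangC.
  rewrite dotvZl pmulr_rle0 // -dir_toE //; last by rewrite rangC rB ball_radius.
  by apply: inward => //; rewrite gdistE // rangC.
(* Both pushes point along - u, with lengths sin t and sin rho, so the difference splits into a
   change of the gradient of f_i and a change of length. *)
have e1 : dotv (push Rc A) (grad (f i) A) = dotv (push Rc B) (grad (f i) B) +
    dotv (push Rc B) (grad (f i) A - grad (f i) B) +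
    (sin rho - sin t) * dotv u (grad (f i) A).
  rewrite eA -/t /B !push_rotm_axis // -/B -eA !dotvNl !dotvZl dotvDr dotvNr.
  by ring.
have nG : enorm (grad (f i) A) <= G.
  have := hL A0 A OA0 OA; rewrite subrr normr0 => /(_ r10 nA) k.
  rewrite -[X in enorm X](subrK (grad (f i) A0)).
  apply: le_trans (enormD _ _) _; rewrite /G addrC lerD2l.
  by apply: le_trans k _; rewrite ler_wpM2l // ltW.
have eu : enorm u = 1 by rewrite /enorm u1 sqrtr1.
have p2 : dotv (push Rc B) (grad (f i) A - grad (f i) B) <= L * (2 * (t - rho)).
  apply: le_trans (dotv_le _ _) _; rewrite /B push_rotm_axis // -/B enormN enormZ eu mulr1.
  rewrite gtr0_norm // -[leRHS]mul1r; apply: ler_pM; rewrite ?enorm_ge0 ?sin_le1 ?(ltW s0) //.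
  by apply: le_trans lipg _; rewrite ler_wpM2l.
have /andP[st st2] := sin_sub_bounds r0 tr tpi2.
have p3 : (sin rho - sin t) * dotv u (grad (f i) A) <= (t - rho) * G.
  apply: le_trans (ler_norm _) _; rewrite normrM distrC (ger0_norm st).
  apply: ler_pM => //; apply: le_trans (normr_dotv_le _ _) _.
  by rewrite eu mul1r.
rewrite -mulrA mulrCA -[leLHS]mulr1.
have st0 : t - rho <= (cos rho - rcos Rc A) / sin rho.
  by rewrite ler_pdivlMr // mulrC.
have GL : 0 <= G + L * 2 by rewrite addr_ge0 // mulr_ge0.
have := ler_wpM2l GL st0; rewrite mulr1 e1 [(sin rho)^-1 * _]mulrC.
by clear - bd p2 p3 OS Oo fC2 a0 g0 sym hRc r0 rpi CO inward domS h; lra.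
Qed.

Definition penalty x : R := \sum_i pospart (cos rho - rcos Rc (x i)) ^+ 2.

Lemma penalty_pairing x w : dom x -> (forall i, 0 < rcos Rc (x i)) ->
  filippov_map dom h x w ->
  - gamma * (\sum_i pospart (cos rho - rcos Rc (x i)) *
      dotv (push Rc (x i)) (grad (f i) (x i))) <=
  \sum_i pospart (cos rho - rcos Rc (x i)) * dotv (push Rc (x i)) (col i w).
Proof.
move=> dx gx hw; pose G := \sum_i enorm (grad (f i) (x i)).
have hG i : enorm (grad (f i) (x i)) <= G.
  by rewrite /G (bigD1 i) //= lerDl sumr_ge0 // => j _; exact: enorm_ge0.
have hK := network_field_bound OS Oo fC2 a0 g0 dx hG.
pose P x i := pospart (cos rho - rcos Rc (x i)).
pose a x i : 'cV[R]_3 := P x i *: push Rc (x i).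
pose b x : R := gamma * \sum_i P x i * dotv (push Rc (x i)) (grad (f i) (x i)).
have cr i : rcos Rc (x' i) @[x' --> cnbhs dom x] --> rcos Rc (x i).
  by apply: cvg_rcos; [exact: cvg_cst|exact: cvg_cnbhs].
have cP i : P x' i @[x' --> cnbhs dom x] --> P x i.
  by apply: cvg_pospart; apply: cvgB; [exact: cvg_cst|exact: cr].
have cp i k : push Rc (x' i) k 0 @[x' --> cnbhs dom x] --> push Rc (x i) k 0.
  by apply: cvg_push; exact: cvg_cnbhs.
have ca i k : a x' i k 0 @[x' --> cnbhs dom x] --> a x i k 0.
  rewrite /a mxE; under eq_fun do rewrite mxE.
  by apply: cvgM; [exact: cP|exact: cp].
have cb : b x' @[x' --> cnbhs dom x] --> b x.
  apply: cvgM; first exact: cvg_cst.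
  apply: cvg_sumr => i; apply: cvgM; first exact: cP.
  by apply: cvg_dotv => k; [exact: cp|exact: cvg_grad].
have near_g : \forall x' \near cnbhs dom x, forall i, 0 < rcos Rc (x' i).
  by apply: filter_forall => i; apply: cvgr_gt (cr i) _ (gx i).
have key : \forall x' \near cnbhs dom x, 0 <= pairing (a x') (h x') + b x'.
  have hd := @cnbhs_dom R n dom x.
  near=> x'.
  have dx' : dom x' by near: x'.
  have gx' : forall i, 0 < rcos Rc (x' i) by near: x'.
  have [_ he] := (network_domP e OS x').1 dx'.
  (* Adding [b] removes the gradient part of the field; the couplings remain, edge by edge. *)
  have -> : pairing (a x') (h x') + b x' = alpha * (\sum_i \sum_(j | e i j)
      P x' i * dotv (push Rc (x' i)) (unitlog (x' i) (x' j))).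
    rewrite /pairing /b mulr_sumr -big_split /= mulr_sumr; apply: eq_bigr => i _.
    rewrite (network_fieldE f alpha gamma OS i dx') /a dotvZl dotvDr dotvNr !dotvZr dotv_sumr mulr_sumr.
    rewrite mulrDr -addrA [X in _ + X](_ : _ = 0) ?addr0; last by ring.
    rewrite mulr_sumr mulr_sumr; apply: eq_bigr => j _; ring.
  apply: mulr_ge0; first exact: ltW.
  apply: sum_sym_ge0 => // i j eij.
  by apply: edge_push => //; first [exact: domS|exact: he|exact: ltW].
have := filippov_affine domS dx hK ca cb key hw.
have -> : pairing (a x) w = \sum_i P x i * dotv (push Rc (x i)) (col i w).
  by apply: eq_bigr => i _; rewrite /a dotvZl.
by rewrite /b /P; lra.
Unshelve. all: by end_near.
Qed.

Lemma ball_rcos_gt0 x : (forall i, C (x i)) -> forall i, 0 < rcos Rc (x i).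
Proof. by move=> hx i; have [_] := (ballE (x i)).1 (hx i); have := cos_radius; lra. Qed.

(** [boundary_estimate] turns each gradient term into a multiple of the squared positive part, hence
    of the penalty, at a rate valid only near x. *)
Lemma penalty_decay x : (forall i, C (x i)) -> exists2 k : R, 0 <= k &
  \forall x' \near cnbhs dom x, forall w, filippov_map dom h x' w ->
    \sum_i 2 * pospart (cos rho - rcos Rc (x' i)) *
      (- dotv (push Rc (x' i)) (col i w)) <= k * penalty x'.
Proof.
move=> hx; have dx := ball_dom hx.
pose bd i := boundary_estimate i (hx i).
pose r i := sval (cid (bd i)); pose L i := sval (cid (svalP (cid (bd i)))).
have hrL i : [/\ 0 < r i, 0 <= L i & forall A, O A -> `|A - x i| < r i ->
    cos rho - rcos Rc A > 0 ->
    dotv (push Rc A) (grad (f i) A) <= L i * (cos rho - rcos Rc A)].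
  by exact: (svalP (cid (svalP (cid (bd i))))).
have h1 : \forall x' \near cnbhs dom x, forall i, `|x' i - x i| < r i.
  apply: filter_forall => i; have [ri _ _] := hrL i; exists (r i) => //.
have h2 : \forall x' \near cnbhs dom x, forall i, 0 < rcos Rc (x' i).
  apply: filter_forall => i; apply: cvgr_gt (ball_rcos_gt0 hx i).
  by apply: cvg_rcos; [exact: cvg_cst|exact: cvg_cnbhs].
have hd := @cnbhs_dom R n dom x.
pose S := \sum_i L i.
have LS i : L i <= S.
  by rewrite /S (bigD1 i) //= lerDl sumr_ge0 // => j _; have [] := hrL j.
exists (2 * gamma * S).
  by rewrite !mulr_ge0 ?(ltW g0) // sumr_ge0 // => j _; have [] := hrL j.
near=> x' => w hw.
have dx' : dom x' by near: x'.
have gx' : forall i, 0 < rcos Rc (x' i) by near: x'.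
have nx' : forall i, `|x' i - x i| < r i by near: x'.
have := penalty_pairing dx' gx' hw.
set X := \sum_i _; set Y := \sum_i pospart _ * dotv _ (col i w) => XY.
have -> : \sum_i 2 * pospart (cos rho - rcos Rc (x' i)) *
      (- dotv (push Rc (x' i)) (col i w)) = - 2 * Y.
  by rewrite mulr_sumr; apply: eq_bigr => i _; ring.
have : X <= S * penalty x'.
  rewrite mulr_sumr; apply: ler_sum => i _.
  have [_ Li hi] := hrL i; have [Ox' _] := dx'.
  have p0 := pospart_ge0 (cos rho - rcos Rc (x' i)).
  have [neg|pos] := leP (cos rho - rcos Rc (x' i)) 0.
    by rewrite /pospart max_r // mul0r expr0n mulr0.
  have := hi _ (Ox' i) (nx' i) pos; rewrite /pospart max_l ?(ltW pos) //.
  by have := LS i; set z := cos rho - _ in pos *; set d := dotv _ _; nra.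
by have := g0; nra.
Unshelve. all: by end_near.
Qed.

Lemma penalty_ac a b y : solution_on dom h a b y ->
  abs_continuous a b (fun t => penalty (y t)).
Proof.
move=> [h1 h2 _]; apply: ac_sum => i.
apply: (@ac_dominated R _ _ a b (fun t => y t i) _ 30) => //.
move=> s t sab tab; have hs := domS (h1 s sab) i; have ht := domS (h1 t tab) i.
have bd A : SO3 A -> 0 <= pospart (cos rho - rcos Rc A) <= 2.
  move=> hA; rewrite pospart_ge0 /= /pospart ge_max.
  have := rcos_bounds hRc hA => /andP[q1 q2]; have := cos_le1 rho.
  by move=> q3; apply/andP; split; lra.
have := bd _ hs; have := bd _ ht; have := pospart_lip (cos rho - rcos Rc (y t i))
  (cos rho - rcos Rc (y s i)).
have := rcos_lip (y s i) (y t i) hRc.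
have -> : cos rho - rcos Rc (y t i) - (cos rho - rcos Rc (y s i)) =
  rcos Rc (y s i) - rcos Rc (y t i) by ring.
rewrite [`|y s i - _|]distrC.
set p := pospart _; set p' := pospart _.
have n1 := normr_ge0 (y t i - y s i); have n2 := normr_ge0 (t - s).
move=> k1 k2 /andP[k3 k4] /andP[k5 k6].
rewrite subr_sqr normrM [`|p + p'|]ger0_norm ?addr_ge0 //.
have n3 := normr_ge0 (p - p').
by nra.
Qed.

Lemma penalty_eq0 x : dom x -> penalty x <= 0 -> forall i, C (x i).
Proof.
move=> dx h0 i; apply/ballE; split; first exact: domS.
have : pospart (cos rho - rcos Rc (x i)) ^+ 2 <= 0.
  apply: le_trans h0; rewrite /penalty (bigD1 i) //= lerDl.
  by apply: sumr_ge0 => j _; exact: sqr_ge0.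
have := pospart_ge0 (cos rho - rcos Rc (x i)); rewrite /pospart.
by case: (leP (cos rho - rcos Rc (x i)) 0) => ? *; [lra|nra].
Qed.

(** Continuity keeps the closed ball under limits. Beyond a time c in the ball, [penalty_decay]
    holds near y(c), and Gronwall's inequality from the value 0 keeps the penalty at 0. The rate is
    local, hence the real induction. *)
Lemma solution_invariant a b y : solution_on dom h a b y -> (forall i, C (y a i)) ->
  forall t, a <= t <= b -> forall i, C (y t i).
Proof.
move=> sol ya; have [h1 h2 _] := sol.
apply: (@real_induction R a b (fun t => forall i, C (y t i))) => //.
  move=> c /andP[ac cb] hs i; have cab : a <= c <= b by rewrite (ltW ac).
  have dc := h1 c cab; apply/ballE; split; first exact: domS.
  rewrite leNgt; apply/negP => lt.
  have hn : \forall x' \near cnbhs dom (y c), rcos Rc (x' i) < cos rho.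
    apply: cvgr_lt lt; apply: cvg_rcos; first exact: cvg_cst.
    exact: cvg_cnbhs.
  have [d d0 hd] := solution_near sol cab hn.
  pose s := Num.max a (c - d / 2).
  have sc : s < c by rewrite /s gt_max ac; lra.
  have as_ : a <= s by rewrite /s le_max lexx.
  have : rcos Rc (y s i) < cos rho.
    apply: hd; first by rewrite as_ (le_trans (ltW sc)).
    rewrite distrC gtr0_norm ?subr_gt0 //.
    have : c - d / 2 <= s by rewrite /s le_max lexx orbT.
    lra.
  have sI : a <= s < c by rewrite as_ sc.
  have [_ k] := (ballE _).1 (hs s sI i).
  by rewrite ltNge k.
move=> c /andP[ac cb] hs; have cab : a <= c <= b by rewrite ac ltW.
have yc : forall i, C (y c i) by apply: hs; rewrite ac lexx.
have [k k0 hk] := penalty_decay yc.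
have [d d0 hd] := solution_near sol cab hk.
exists d => // s /andP[cs scd] sb.
have sol' := solution_on_sub ac sb sol.
apply: penalty_eq0; first by apply: h1; rewrite sb (le_trans ac) // ltW.
have -> : 0 = penalty (y c) * expR (k * (s - c)).
  rewrite /penalty big1 ?mul0r // => i _; have [_ q] := (ballE _).1 (yc i).
  by rewrite /pospart max_r ?expr0n //; lra.
apply: (ac_gronwall (ltW cs) (penalty_ac sol')).
apply: aeS (solution_velocity domS sol') => t hv /andP[ct ts].
have [|w hw hder] := hv; first by rewrite ct.
have nt : forall w, filippov_map dom h (y t) w -> \sum_i 2 * pospart (cos rho - rcos Rc (y t i)) *
      (- dotv (push Rc (y t i)) (col i w)) <= k * penalty (y t).
  apply: hd; first by rewrite (le_trans ac (ltW ct)) (le_trans (ltW ts)).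
  by rewrite gtr0_norm ?subr_gt0 //; lra.
have hp : is_derive t 1 (fun s => penalty (y s))
   (\sum_i 2 * pospart (cos rho - rcos Rc (y t i)) * (- dotv (push Rc (y t i)) (col i w))).
  apply: is_derive_bigsum => i; apply: is_derive_pospart_sqr.
  have := is_derive_rcos_push Rc (hder i) => hr.
  by apply: (is_derive_eqr (is_deriveB (is_derive_cst _ _ _) hr)); rewrite sub0r.
have dini := ldini_le (nt w hw) (ldini_derive hp).
by move=> eps e0; have [q q0 hq] := dini eps e0; exists q => // z _; exact: hq.
Qed.

End Invariance.

(** * Euler steps by exponentials *)

Section DiscreteFlow.
Variable R : realType.
Implicit Types (A B : 'M[R]_3) (u xi : 'cV[R]_3) (t r K eta : R).

Lemma mx_norm_mul3 m p (A : 'M[R]_(m, 3)) (B : 'M[R]_(3, p)) :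
  `|A *m B| <= 3 * `|A| * `|B|.
Proof.
apply: mx_norm_le => [|i j]; first by rewrite !mulr_ge0.
rewrite mulmx3E; have q k : `|A i k * B k j| <= `|A| * `|B|.
  by rewrite normrM; apply: ler_pM => //; exact: le_mx_norm.
apply: le_trans (ler_normD _ _) _; have := ler_normD (A i 0 * B 0 j) (A i 1 * B 1 j).
by have := q 0; have := q 1; have := q 2; rewrite -mulrA; lra.
Qed.

Lemma norm_SO3_le1 A : SO3 A -> `|A| <= 1.
Proof. by move=> hA; apply: mx_norm_le => // i j; exact: SO3_entry_le1. Qed.

Lemma norm_le_enorm u : `|u| <= enorm u.
Proof.
apply: mx_norm_le => [|i j]; first exact: enorm_ge0.
by rewrite [j]ord1; exact: abs_entry_le_enorm.
Qed.

Lemma norm_hat_enorm u : `|hat u| <= enorm u.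
Proof. exact: le_trans (norm_hat_le u) (norm_le_enorm u). Qed.

Lemma sub_sin_le t : 0 <= t -> `|sin t - t| <= t ^+ 2.
Proof.
move=> t0; have [->|tn] := eqVneq t 0; first by rewrite sin0 subrr normr0 expr0n.
have tp : 0 < t by rewrite lt_neqAle eq_sym tn.
have [|c] := @MVT R (@sin R) (@cos R) 0 t tp.
  by apply: continuous_subspaceT => x; exact: continuous_sin.
rewrite in_itv /= => /andP[c0 ct]; rewrite sin0 !subr0 => ->.
have := cos_ge_quad (ltW c0); have := cos_geN1 c; have := cos_le1 c => c1 c2 c3.
have -> : cos c * t - t = - ((1 - cos c) * t) by ring.
rewrite normrN ger0_norm ?mulr_ge0 ?subr_ge0 // expr2 ler_pM2r //.
have [c4|c4] := leP c 2; last by lra.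
have := c3; nra.
Qed.

Lemma expm_hat_step xi : `|expm (hat xi) - 1%:M - hat xi| <= 3 * enorm xi ^+ 2.
Proof.
rewrite expm_hat /rotm; set u := sgnv xi; set t := enorm xi.
have t0 : 0 <= t by exact: enorm_ge0.
have hx : hat xi = t *: hat u by rewrite -hatZ sgnvK.
have -> : 1%:M + sin t *: hat u + (1 - cos t) *: (hat u *m hat u) - 1%:M - hat xi =
  (sin t - t) *: hat u + (1 - cos t) *: (hat u *m hat u).
  have Z (I s q c : 'M[R]_3) : I + s + q - I - c = s - c + q.
    by apply/matrixP => i j; rewrite !mxE; ring.
  by rewrite hx [(sin t - t) *: _]scalerBl; exact: Z.
have nu : `|hat u| <= 1.
  by apply: le_trans (norm_hat_enorm u) _; exact: enorm_sgnv_le1.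
have nuu : `|hat u *m hat u| <= 3.
  by apply: le_trans (mx_norm_mul3 _ _) _; have := normr_ge0 (hat u); nra.
apply: le_trans (ler_normD _ _) _; rewrite !normrZ.
have h1 : `|sin t - t| * `|hat u| <= t ^+ 2 * 1 by apply: ler_pM => //; exact: sub_sin_le.
have h2 : `|1 - cos t| * `|hat u *m hat u| <= t ^+ 2 / 2 * 3.
  apply: ler_pM => //; rewrite ger0_norm ?subr_ge0 ?cos_le1 //; exact: cos_ge_quad.
have := sqr_ge0 t; lra.
Qed.

Lemma norm_expm_hat_sub A xi : SO3 A -> `|A *m expm (hat xi) - A| <= 2 * enorm xi.
Proof.
move=> hA; have [->|xn] := eqVneq xi 0.
  by rewrite hat0 expm0 mulmx1 subrr normr0 enorm0 mulr0.
have u1 : dotv (sgnv xi) (sgnv xi) = 1 by rewrite -enorm_sqr enorm_sgnv // expr1n.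
rewrite expm_hat.
have hB : SO3 (A *m rotm (sgnv xi) (enorm xi)) by apply: SO3_mul => //; exact: SO3_rotm.
rewrite distrC; apply: le_trans (norm_le_rang hA hB) _; rewrite ler_pM2l //.
have x0 := enorm_ge0 xi; have [xpi|xpi] := leP (enorm xi) pi.
  by rewrite rang_rotm // x0.
by apply: le_trans (ltW xpi); case/andP: (rang_bounds hA hB).
Qed.

Section Steps.
Variables (X : nat -> 'M[R]_3) (v : nat -> 'cV[R]_3) (eta K : R).
Hypotheses (eta0 : 0 <= eta) (XS : forall k, SO3 (X k)).
Hypothesis Xv : forall k, X k.+1 = X k *m expm (eta *: hat (v k)).

Lemma euler_lip p N : (forall k, enorm (v k) <= K) ->
  `|X (p + N)%N - X p| <= 2 * K * eta * N%:R.
Proof.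
move=> vK; elim: N => [|N IH]; first by rewrite addn0 subrr normr0 mulr0.
rewrite addnS -(subrKA (X (p + N)%N)); apply: le_trans (ler_normD _ _) _.
have -> : 2 * K * eta * N.+1%:R = 2 * (K * eta) + 2 * K * eta * N%:R by rewrite -natr1; ring.
rewrite lerD // Xv -hatZ.
apply: le_trans (norm_expm_hat_sub _ (XS _)) _.
rewrite enormZ ger0_norm // ler_pM2l // mulrC ler_wpM2r //; exact: vK.
Qed.

(** A step moves X by eta X v^ up to 9 (eta K)^2, the second-order part of the exponential;
    replacing X by the nearby A costs another 3 eta r K. *)
Lemma euler_average A r p N :
  (forall j, (j < N)%N -> enorm (v (p + j)%N) <= K /\ `|X (p + j)%N - A| <= r) ->
  `|X (p + N)%N - X p - eta *: (A *m hat (\sum_(j < N) v (p + j)%N))| <=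
    N%:R * (eta * (9 * eta * K ^+ 2 + 3 * r * K)).
Proof.
elim: N => [|N IH] h.
  by rewrite addn0 subrr big_ord0 hat0 mulmx0 scaler0 subrr normr0 mul0r.
have {}IH := IH (fun j jN => h j (ltnW jN)).
have [vK Xr] := h N (ltnSn N).
rewrite big_ord_recr /= hatD mulmxDr scalerDr addnS.
set Y := X (p + N)%N; set V := v (p + N)%N.
have -> : X (p + N).+1%N - X p - (eta *: (A *m hat (\sum_(j < N) v (p + j)%N)) +
    eta *: (A *m hat V)) =
  (Y - X p - eta *: (A *m hat (\sum_(j < N) v (p + j)%N))) +
  (Y *m (expm (hat (eta *: V)) - 1%:M - hat (eta *: V)) + eta *: ((Y - A) *m hat V)).
  rewrite Xv -/Y -/V -hatZ !mulmxBr mulmx1 mulmxBl scalerBr hatZ -!scalemxAr.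
  have Z (E P S T T' Y' : 'M[R]_3) : E - P - (S + T') = Y' - P - S + (E - Y' - T + (T - T')).
    by apply/matrixP => k l; rewrite !mxE; ring.
  exact: Z.
apply: le_trans (ler_normD _ _) _; rewrite -natr1 mulrDl mul1r lerD //.
apply: le_trans (ler_normD _ _) _.
have K0 : 0 <= K by apply: le_trans vK; exact: enorm_ge0.
have h1 : `|Y *m (expm (hat (eta *: V)) - 1%:M - hat (eta *: V))| <= 3 * 1 * (3 * (eta * K) ^+ 2).
  apply: le_trans (mx_norm_mul3 _ _) _; apply: ler_pM => //.
  - by rewrite ler_pM2l //; exact: norm_SO3_le1 (XS _).
  - apply: le_trans (expm_hat_step _) _; rewrite ler_pM2l // enormZ ger0_norm //.
    by rewrite lerXn2r ?nnegrE ?mulr_ge0 ?enorm_ge0 // ler_wpM2l.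
have h2 : `|eta *: ((Y - A) *m hat V)| <= eta * (3 * r * K).
  rewrite normrZ ger0_norm // ler_wpM2l //; apply: le_trans (mx_norm_mul3 _ _) _.
  apply: ler_pM; rewrite ?mulr_ge0 //; first by rewrite ler_pM2l.
  by apply: le_trans (norm_hat_enorm _) _.
by apply: le_trans (lerD h1 h2) _; rewrite le_eqVlt; apply/orP; left; apply/eqP; ring.
Qed.

End Steps.

Lemma rotm_eq1 u t : dotv u u = 1 -> 0 < t < 2 * pi -> rotm u t <> 1%:M.
Proof.
move=> u1 /andP[t0 t2] e.
have h : cos t = 1.
  by have := mxtrace_rotm t u1; rewrite e mxtrace1 => k; lra.
have s0 : 0 < sin (t / 2) by apply: sin_gt0_pi; apply/andP; split; lra.
have : cos t = 1 - 2 * sin (t / 2) ^+ 2.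
  by rewrite [in LHS](splitr t) cosD -!expr2 cos2sin2; ring.
have := exprn_gt0 2 s0; rewrite h; lra.
Qed.

(* Rotating the agents at pairwise different rates about a common axis separates
   any two of them for all small positive times. *)
Lemma distinct_dense n (X : config R n) eta : (forall i, SO3 (X i)) -> 0 < eta ->
  exists2 x : config R n, (forall i, SO3 (x i) /\ `|x i - X i| < eta) &
    forall i j, i != j -> x i != x j.
Proof.
move=> hX e0.
pose u : 'cV[R]_3 := basev R 0.
have u1 : dotv u u = 1 by rewrite dotvE !mxE /= !mulr0 !addr0 mulr1.
pose x s i : 'M[R]_3 := X i *m rotm u (s * (i : nat)%:R).
have xS s i : SO3 (x s i) by apply: SO3_mul => //; exact: SO3_rotm.
pose s0 : R := pi / n.+1%:R.
have pi0 := pi_gt0 R; have s00 : 0 < s0 by rewrite divr_gt0.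
have small (s : R) (d : nat) : 0 < s < s0 -> (0 < d < n)%N -> 0 < s * d%:R < 2 * pi.
  move=> /andP[h1 h2] /andP[d0 dn]; rewrite mulr_gt0 ?ltr0n //=.
  apply: (@lt_trans _ _ pi); last by lra.
  have : s * d%:R <= s * n.+1%:R by rewrite ler_pM2l // ler_nat (leq_trans (ltnW dn)).
  by move=> k; apply: le_lt_trans k _; rewrite -ltr_pdivlMr.
(* Coincidence at two times s < s' would make the rotation by (s' - s)(j - i) trivial, although its
   angle lies strictly between 0 and 2 pi. So a pair meets at most once in the window. *)
have sep (i j : 'I_n) s s' : (i < j)%N -> 0 < s -> s < s' -> s' < s0 ->
    x s i = x s j -> x s' i = x s' j -> False.
  move=> ij h0 h1 h2 e1 e2.
  have q z : x z i = x z j -> (X j)^T *m X i = rotm u (z * (j - i)%:R).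
    move=> e; have : (X j)^T *m (x z i) *m rotm u (- (z * (i : nat)%:R)) = (X j)^T *m X i.
      by rewrite /x -!mulmxA -rotmD // subrr rotm0 mulmx1.
    move=> <-; rewrite e /x !mulmxA; have [-> _] := SO3_orth (hX j).
    by rewrite mul1mx -rotmD // natrB ?(ltnW ij) //; congr rotm; ring.
  have := q s' e2; rewrite (q s e1) => e.
  apply: (@rotm_eq1 u ((s' - s) * (j - i)%:R) u1).
    apply: small; first by apply/andP; split; lra.
    by rewrite subn_gt0 ij /=; apply: leq_ltn_trans (leq_subr _ _) _.
  have -> : (s' - s) * (j - i)%:R = s' * (j - i)%:R + - (s * (j - i)%:R) by ring.
  by rewrite rotmD // -e -rotmD // subrr rotm0.
have ev (ij : 'I_n * 'I_n) : \forall s \near (0 : R)^'+, (ij.1 < ij.2)%N -> x s ij.1 != x s ij.2.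
  case: ij => i j /=; have [ij|ij] := ltnP i j; last by near=> s.
  have [[s1 [h1 h2 e1]]|no] := pselect (exists s1, [/\ 0 < s1, s1 < s0 & x s1 i = x s1 j]).
    near=> s => _; apply/eqP => e2.
    have p1 : 0 < s by near: s; exact: nbhs_right_gt.
    have p2 : s < s1 by near: s; exact: nbhs_right_lt.
    exact: (sep i j s s1).
  near=> s => _; apply/eqP => e2; apply: no; exists s.
  have p1 : 0 < s by near: s; exact: nbhs_right_gt.
  have p2 : s < s0 by near: s; exact: nbhs_right_lt.
  by split.
have ev2 : \forall s \near (0 : R)^'+, forall ij : 'I_n * 'I_n,
    (ij.1 < ij.2)%N -> x s ij.1 != x s ij.2 by exact: filter_forall.
have ev3 : \forall s \near (0 : R)^'+, 0 < s by exact: nbhs_right_gt.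
have ev4 : \forall s \near (0 : R)^'+, s < eta / (2 * n.+1%:R).
  by apply: nbhs_right_lt; rewrite divr_gt0 // mulr_gt0.
have [s [[k1 k2] k3]] := filter_ex (filterI (filterI ev2 ev3) ev4).
exists (x s) => [i|i j ij]; last first.
  have [lt|gt|/val_inj eq] := ltngtP i j; last by rewrite eq eqxx in ij.
  - exact: (k1 (i, j)).
  - by rewrite eq_sym; exact: (k1 (j, i)).
split => //; have si0 : 0 <= s * (i : nat)%:R by rewrite mulr_ge0 // ltW.
have := @norm_expm_hat_sub (X i) ((s * (i : nat)%:R) *: u) (hX i).
rewrite hatZ expm_hat_unit // => k; apply: le_lt_trans k _.
have eu : enorm u = 1 by rewrite /enorm u1 sqrtr1.
rewrite enormZ eu mulr1 ger0_norm //.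
move: k3; rewrite ltr_pdivlMr ?mulr_gt0 // => k3; apply: le_lt_trans k3.
have -> : s * (2 * n.+1%:R) = 2 * (s * n.+1%:R) by ring.
rewrite ler_pM2l // ler_pM2l // ler_nat.
by apply: ltnW; apply: leq_trans (ltn_ord i) _.
Unshelve. all: by end_near.
Qed.

Lemma conv_hull_average n (H : set 'M[R]_(3, n)) (v : nat -> 'M[R]_(3, n)) N :
  (forall k, (k < N.+1)%N -> H (v k)) ->
  conv_hull H (N.+1%:R^-1 *: \sum_(k < N.+1) v k).
Proof.
move=> hv A cA HA; elim: N hv => [|N IH] hv.
  by rewrite big_ord1 invr1 scale1r; apply/HA/hv.
have {}IH : A (N.+1%:R^-1 *: \sum_(k < N.+1) v k) by apply: IH => k kN; apply: hv; exact: ltnW.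
rewrite big_ord_recr /=.
have Nn0 : (N.+1%:R : R) != 0 by rewrite pnatr_eq0.
have N2 : (N.+2%:R : R) != 0 by rewrite pnatr_eq0.
have e1 : 1 - N.+1%:R / N.+2%:R = N.+2%:R^-1 :> R.
  by rewrite -[X in X - _](divff N2) -mulrBl -[N.+2%:R]natr1 addrC addKr mul1r.
have k0 : (0 : R) <= N.+1%:R / N.+2%:R by rewrite divr_ge0.
have k1 : (N.+1%:R / N.+2%:R : R) <= 1 by rewrite ler_pdivrMr // mul1r ler_nat.
have -> : N.+2%:R^-1 *: (\sum_(i < N.+1) v i + v N.+1) =
   (N.+1%:R / N.+2%:R) *: (N.+1%:R^-1 *: \sum_(k < N.+1) v k) +
   (1 - N.+1%:R / N.+2%:R) *: v N.+1.
  by rewrite e1 scalerDr scalerA mulrAC divff // mul1r.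
have := cA (N.+1%:R^-1 *: \sum_(k < N.+1) v k) (v N.+1) (Itv01 k0 k1).
by rewrite !inE; apply => //; apply/HA/hv.
Qed.

End DiscreteFlow.

Lemma norm_le_norm_hat (R : realType) (u : 'cV[R]_3) k : `|u k 0| <= `|hat u|.
Proof.
move: k; apply: ord3_cases.
- by have := le_mx_norm (hat u) 2 1; rewrite !mxE.
- by have := le_mx_norm (hat u) 0 2; rewrite !mxE.
- by have := le_mx_norm (hat u) 1 0; rewrite !mxE.
Qed.

(** [Y0], [Y1] are the limit curve and [X0], [X1] a nearby polygon at the ends of a time step tau; N
    Euler steps of size eta lie in between, with V the sum of their velocities. Dividing all errors
    by tau shows that the derivative w is close to the average V / N. *)
Lemma euler_velocity (R : realType) (A Y0 Y1 X0 X1 : 'M[R]_3) (V w : 'cV[R]_3)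
    (K e tau eta : R) (N : nat) :
  SO3 A -> 0 <= K -> 0 < tau -> 0 < e -> e <= 1 -> tau <= e -> 0 < eta -> eta <= tau * e ->
  (0 < N)%N -> tau - eta <= N%:R * eta <= tau + eta -> enorm V <= N%:R * K ->
  `|Y1 - Y0 - tau *: (A *m hat w)| <= e * tau ->
  `|X0 - Y0| <= tau * e -> `|X1 - Y1| <= tau * e ->
  `|X1 - X0 - eta *: (A *m hat V)| <=
    N%:R * (eta * (9 * eta * K ^+ 2 + 3 * ((4 * K + 1) * tau) * K)) ->
  forall k, `|w k 0 - (N%:R^-1 *: V) k 0| <=
    3 * (e * (3 + 3 * K + 2 * (9 * K ^+ 2 + 3 * (4 * K + 1) * K))).
Proof.
move=> hA K0 t0 e0 e1 te n0 ne N0 /andP[N1 N2] VK hY h0 h1 hX k.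
have Np : (0 : R) < N%:R by rewrite ltr0n.
set v := N%:R^-1 *: V.
have eV : V = N%:R *: v by rewrite /v scalerA divff ?scale1r ?gt_eqF.
have vK : enorm v <= K.
  by rewrite /v enormZ gtr0_norm ?invr_gt0 // mulrC ler_pdivrMr // mulrC.
have hAv : `|A *m hat v| <= 3 * K.
  apply: le_trans (mx_norm_mul3 _ _) _.
  have q1 := norm_SO3_le1 hA; have q2 := le_trans (norm_hat_enorm v) vK.
  by have := normr_ge0 A; have := normr_ge0 (hat v); nra.
(* Four errors: differentiability of Y, closeness of X and Y at the ends, the Euler estimate, and
   the deviation of N eta from tau. *)
have ent : tau *: (A *m hat (w - v)) =
   - (Y1 - Y0 - tau *: (A *m hat w)) + ((Y1 - X1) + (X0 - Y0)) +
   (X1 - X0 - eta *: (A *m hat V)) + (N%:R * eta - tau) *: (A *m hat v).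
  rewrite eV hatZ hatD hatN mulmxDr mulmxN -scalemxAr scalerA scalerDr scalerN scalerBl.
  rewrite [eta * _]mulrC.
  set P := tau *: (A *m hat w); set Q := tau *: (A *m hat v); set S := _ *: (A *m hat v).
  by apply/matrixP => a b; rewrite !mxE; ring.
have B1 : `|(N%:R * eta - tau) *: (A *m hat v)| <= tau * e * (3 * K).
  rewrite normrZ; apply: ler_pM => //; rewrite ler_norml; apply/andP; split; lra.
have B2 : N%:R * (eta * (9 * eta * K ^+ 2 + 3 * ((4 * K + 1) * tau) * K)) <=
   2 * tau * (e * (9 * K ^+ 2 + 3 * (4 * K + 1) * K)).
  rewrite mulrA; apply: ler_pM.
  - by rewrite mulr_ge0 // ltW.
  - have KK := sqr_ge0 K; have q : 0 <= (4 * K + 1) * tau * K by rewrite !mulr_ge0 ?(ltW t0) //;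
    lra.
    by apply: addr_ge0; [rewrite !mulr_ge0 // ltW|lra].
  - by apply: le_trans N2 _; nra.
  - have ee : eta <= e by apply: le_trans ne _; nra.
    have KK := sqr_ge0 K; have q := ler_wpM2r KK ee.
    have q3 : 0 <= (4 * K + 1) * K by rewrite mulr_ge0 //; lra.
    by have q2 := ler_wpM2l q3 te; lra.
have n1 : `|Y1 - X1| <= tau * e by rewrite distrC.
have tot : `|tau *: (A *m hat (w - v))| <=
    tau * (e * (3 + 3 * K + 2 * (9 * K ^+ 2 + 3 * (4 * K + 1) * K))).
  rewrite ent; apply: le_trans (ler_normD _ _) _.
  have k1 := ler_normD (- (Y1 - Y0 - tau *: (A *m hat w)) + ((Y1 - X1) + (X0 - Y0)))
    (X1 - X0 - eta *: (A *m hat V)).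
  have k2 := ler_normD (- (Y1 - Y0 - tau *: (A *m hat w))) ((Y1 - X1) + (X0 - Y0)).
  have k3 := ler_normD (Y1 - X1) (X0 - Y0).
  rewrite normrN in k2.
  apply: le_trans (lerD (le_trans k1 (lerD (le_trans k2 (lerD hY (le_trans k3 (lerD n1 h0))))
    (le_trans hX B2))) B1) _.
  by rewrite le_eqVlt; apply/orP; left; apply/eqP; ring.
rewrite normrZ gtr0_norm // ler_pM2l // in tot.
(* Multiplication by A^T recovers the vector, at the price of a factor 3 in the sup norm. *)
have e2 : hat (w - v) = A^T *m (A *m hat (w - v)).
  by rewrite mulmxA; have [-> _] := SO3_orth hA; rewrite mul1mx.
have -> : w k 0 - v k 0 = (w - v) k 0 by rewrite subcvE.
apply: le_trans (norm_le_norm_hat _ _) _; rewrite e2.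
apply: le_trans (mx_norm_mul3 _ _) _.
have := norm_SO3_le1 (SO3_tr hA); have := normr_ge0 (A^T).
have := normr_ge0 (A *m hat (w - v)); nra.
Qed.

Lemma cvg_near_eq (R : realType) (T : Type) (F : set_system T) (FF : Filter F)
    (phi psi : T -> R) (l l' : R) : l = l' ->
  (\forall x \near F, phi x = psi x) -> psi x @[x --> F] --> l' ->
  phi x @[x --> F] --> l.
Proof.
move=> -> hn /cvgrPdist_lt hc; apply/cvgrPdist_lt => e e0.
by apply: filterS2 hn (hc e e0) => x ->.
Qed.

(** * Euler polygons and their limit *)

Section Existence.
Variables (R : realType) (n : nat) (e : rel 'I_n) (O : set 'M[R]_3).
Variables (f : 'I_n -> 'M[R]_3 -> R) (alpha gamma : R).
Hypotheses (OS : O `<=` @SO3 R) (Oo : open_SO3 O).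
Hypothesis fC2 : forall i, C2_SO3 O (f i).
Hypotheses (a0 : 0 < alpha) (g0 : 0 < gamma) (irr : irreflexive e).
Implicit Types (A B : 'M[R]_3) (x : config R n) (y : R -> config R n).
Local Notation mu := (@lebesgue_measure R).

Let dom := network_dom e O.
Let h := network_field e alpha gamma f.
Let domS x (dx : dom x) : forall i, SO3 (x i) := network_dom_SO3 OS dx.

Lemma cvg_field x k i : dom x -> (forall i j, i != j -> x i != x j) ->
  h x' k i @[x' --> cnbhs dom x] --> h x k i.
Proof.
move=> dx dist; have [Ox he] := (network_domP e OS x).1 dx.
pose g x := alpha * (\sum_(j | e i j) unitlog (x i) (x j) k 0) - gamma * grad (f i) (x i) k 0.
have hg x' : dom x' -> h x' k i = g x'.
  move=> dx'; have -> : h x' k i = (col i (h x')) k 0 by rewrite [RHS]mxE.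
  rewrite (network_fieldE f alpha gamma OS i dx') subcvE mxE summxE.
  by rewrite [X in _ - X]mxE.
have cg : g x' @[x' --> cnbhs dom x] --> g x.
  apply: cvgB; last by apply: cvgM; [exact: cvg_cst|exact: cvg_grad].
  apply: cvgM; first exact: cvg_cst.
  under eq_fun do rewrite big_mkcond; rewrite big_mkcond.
  apply: cvg_sumr => j; case eij : (e i j); last exact: cvg_cst.
  have ij : i != j by apply: contraTneq eij => ->; rewrite irr.
  by apply: cvg_unitlog; try exact: cvg_cnbhs; [exact: OS|exact: OS|exact: dist|exact: he].
exact: cvg_near_eq (hg x dx) (filterS hg (cnbhs_dom dom x)) cg.
Qed.

(** Around such an [x] the field is defined and bounded by [K]. The polygons run for all times, with
    velocity 0 where the bound fails, so their limit is compared with the Filippov map only at these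
    configurations. *)
Definition regular (K : R) x : Prop := exists2 eta : R, 0 < eta &
  forall x', (forall i, SO3 (x' i) /\ `|x' i - x i| < eta) ->
    dom x' /\ forall i, enorm (col i (h x')) <= K.

(** The field is continuous where the agents are pairwise distinct, and null sets have dense
    complement, so a sampled value is nearly a value taken outside [S]. *)
Lemma field_value_near x x' (delta r eps : R) S :
  0 < r -> 0 < eps -> volume S = 0%E ->
  (forall z, (forall i, SO3 (z i) /\ `|z i - x i| < 2 * r) -> geo_nbhd dom x delta z) ->
  (forall i, SO3 (x' i) /\ `|x' i - x i| < r) -> (forall i j, i != j -> x' i != x' j) ->
  exists2 v, (h @` (geo_nbhd dom x delta `\` S)) v &
    forall k i, `|h x' k i - v k i| <= eps.
Proof.
move=> r0 e0 vS hr hx' dist.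
have dx' : dom x'.
  have [] // : geo_nbhd dom x delta x'; apply: hr => i; have [s1 s2] := hx' i.
  by split => //; lra.
have [eta n0 hn] : \forall z \near cnbhs dom x', forall ki : 'I_3 * 'I_n,
    `|h x' ki.1 ki.2 - h z ki.1 ki.2| <= eps.
  apply: filter_forall => -[k i] /=.
  by have /cvgrPdist_le/(_ _ e0) := @cvg_field x' k i dx' dist.
have m0 : 0 < Num.min eta r by rewrite lt_min n0.
have [z zS hz] := null_set_codense vS (domS dx') m0.
have nz : geo_nbhd dom x delta z.
  apply: hr => i; have [s1 s2] := hz i; have [s3 s4] := hx' i; split => //.
  move: s2; rewrite lt_min => /andP[_ s2].
  by rewrite -(subrKA (x' i)); apply: le_lt_trans (ler_normD _ _) _; lra.
exists (h z); first by exists z.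
move=> k i; apply: (hn z _ _ (k, i)); first by case: nz.
by move=> j; have [_] := hz j; rewrite lt_min => /andP[].
Qed.


Lemma euler_limit t0 x0 (K : R) : 0 < K -> (forall i, SO3 (x0 i)) ->
  exists y : R -> config R n,
  [/\ y t0 = x0, forall t i, SO3 (y t i),
      forall s t i, t0 <= s -> t0 <= t -> `|y t i - y s i| <= 2 * K * `|t - s|
    & forall t w, t0 < t -> regular K (y t) ->
        (forall i, is_derive t 1 (fun s => y s i) (y t i *m hat (col i w))) ->
        filippov_map dom h (y t) w].
Proof.
move=> K0 hx0.
pose eta m : R := m.+1%:R^-1.
have eta0 m : 0 < eta m by rewrite invr_gt0.
(* The velocity of each step is sampled at a configuration with distinct agents within eta of the
   current one. *)
have exs (Z : config R n) m : exists z, (forall i, SO3 (Z i)) ->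
    (forall i, SO3 (z i) /\ `|z i - Z i| < eta m) /\ forall i j, i != j -> z i != z j.
  have [hZ|nZ] := pselect (forall i, SO3 (Z i)); last by exists Z.
  by have [z z1 z2] := distinct_dense hZ (eta0 m); exists z.
pose sm Z m := sval (cid (exs Z m)).
have smP Z m := svalP (cid (exs Z m)).
(* Truncation bounds every velocity by K, which makes the polygons uniformly Lipschitz. *)
pose vel Z m : 'M[R]_(3, n) :=
  if `[< forall i, enorm (col i (h (sm Z m))) <= K >] then h (sm Z m) else 0.
have velK Z m i : enorm (col i (vel Z m)) <= K.
  rewrite /vel; case: asboolP => [hK|_]; first exact: hK.
  by rewrite col0 enorm0 ltW.
pose step m (Z : config R n) : config R n :=
  fun i => Z i *m expm (eta m *: hat (col i (vel Z m))).
pose X m k := iter k (step m) x0.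
have XS m k i : SO3 (X m k i).
  by elim: k i => [|k IH] i; [exact: hx0|exact: SO3_expm_hat].
have Xv m i k : X m k.+1 i = X m k i *m expm (eta m *: hat (col i (vel (X m k) m))).
  by [].
(* The number of complete steps of size [eta m] made by the time t. *)
pose idx m t := Num.truncn ((t - t0) * m.+1%:R).
have idxP m t : t0 <= t -> (idx m t)%:R * eta m <= t - t0 < (idx m t)%:R * eta m + eta m.
  move=> tt; have /truncn_itv /andP[h1 h2] : 0 <= (t - t0) * m.+1%:R.
    by rewrite mulr_ge0 // subr_ge0.
  rewrite -{3}[eta m]mul1r -mulrDl natr1 /eta.
  by rewrite ler_pdivrMr // ltr_pdivlMr // h1.
have idx_le m s t : s <= t -> (idx m s <= idx m t)%N.
  by move=> st; apply: le_truncn; rewrite ler_pM2r // lerD2r.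
(* One ultrafilter provides the limit at every time and for every agent. *)
have [U [UU oU]] := @ultraFilterLemma nat \oo _.
have ev (P : nat -> Prop) : (\forall m \near \oo, P m) -> U [set m | P m] by exact: oU.
have exy t i : exists2 L, X m (idx m t) i @[m --> U] --> L & SO3 L.
  by apply: ultra_cvg_SO3; apply: ev; near=> m.
pose y t i := s2val (cid2 (exy t i)).
have yS t i : SO3 (y t i) by rewrite /y; case: cid2.
have cy t i (eps : R) : 0 < eps -> \forall m \near U, `|X m (idx m t) i - y t i| <= eps.
  move=> e0; rewrite /y; case: cid2 => /= L hL _.
  by move/cvgrPdist_le : hL => /(_ _ e0); apply: filterS => m; rewrite distrC.
have ceta (eps : R) : 0 < eps -> \forall m \near U, eta m <= eps.
  move=> e0; apply: ev; near=> m; apply: ltW; rewrite /eta.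
  by near: m; exact: (near_infty_natSinv_lt (PosNum e0)).
have lipX m i s t : t0 <= s -> s <= t ->
    `|X m (idx m t) i - X m (idx m s) i| <= 2 * K * (t - s + eta m).
  move=> s0 st; have sti := idx_le m s t st.
  have tt : t0 <= t by exact: le_trans st.
  have /andP[i1 i2] := idxP m s s0; have /andP[i3 i4] := idxP m t tt.
  have := euler_lip (ltW (eta0 m)) (fun k => XS m k i) (Xv m i) (idx m s) (idx m t - idx m s)
    (fun k => velK (X m k) m i).
  rewrite subnKC // => k; apply: le_trans k _; rewrite -mulrA.
  by rewrite ler_pM2l ?mulr_gt0 // natrB // mulrC mulrBl; lra.
exists y; split => //.
- apply/funext => i; apply/eqP; rewrite -subr_eq0 -normr_le0.
  apply/ler_addgt0Pr => eps e0; rewrite add0r.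
  have [m hm] := filter_ex (cy t0 i eps e0).
  by rewrite distrC; move: hm; rewrite /idx subrr mul0r truncn0.
- have lip s t i : t0 <= s -> s <= t -> `|y t i - y s i| <= 2 * K * `|t - s|.
    move=> s0 st; rewrite ger0_norm ?subr_ge0 //; apply/ler_addgt0Pr => eps e0.
    pose d := eps / (2 * K + 2); have k0 : 0 < 2 * K + 2 by rewrite addr_gt0 // mulr_gt0.
    have d0 : 0 < d by rewrite divr_gt0.
    have [m [[h1 h2] h3]] := filter_ex (filterI (filterI (cy t i d d0) (cy s i d d0)) (ceta d d0)).
    have -> : y t i - y s i = - (X m (idx m t) i - y t i) + (X m (idx m t) i - X m (idx m s) i)
        + (X m (idx m s) i - y s i).
      by apply/matrixP => k l; rewrite !mxE; ring.
    apply: le_trans (ler_normD _ _) _.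
    have := ler_normD (- (X m (idx m t) i - y t i)) (X m (idx m t) i - X m (idx m s) i).
    have := lipX m i s t s0 st; rewrite normrN.
    have ed : eps = 2 * K * d + 2 * d by rewrite /d; field; rewrite gt_eqF.
    have : 2 * K * eta m <= 2 * K * d by rewrite ler_pM2l ?mulr_gt0.
    rewrite ed; lra.
  move=> s t i s0 t1; have [st|ts] := leP s t; first exact: lip.
  by rewrite distrC [`|t - s|]distrC; apply: lip => //; exact: ltW.
move=> t w t0t [eta1 e10 reg] hder delta S d0 bS vS.
set x := y t; have dx : dom x.
  have [] // := reg x; move=> i; split; first exact: yS.
  by rewrite subrr normr0.
have [eta2 e20 hgeo] := norm_geo_nbhd domS d0.
pose r := Num.min eta1 eta2 / 2.
have rp : 0 < r by rewrite divr_gt0 // lt_min e10.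
have r1 : 2 * r <= eta1 by rewrite /r mulrC divfK ?ge_min ?lexx.
have r2 : 2 * r <= eta2 by rewrite /r mulrC divfK ?ge_min ?lexx ?orbT.
have hr z : (forall i, SO3 (z i) /\ `|z i - x i| < 2 * r) -> geo_nbhd dom x delta z.
  move=> hz; apply: hgeo => //; last by move=> i; have [_ k] := hz i; exact: lt_le_trans r2.
  have [] // := reg z => i; have [k1 k2] := hz i; split => //; exact: lt_le_trans r1.
move=> B /nbhs_ballP[eps /= ep0 hB].
pose D := 3 + 3 * K + 2 * (9 * K ^+ 2 + 3 * (4 * K + 1) * K).
have D0 : 0 < D.
  have := sqr_ge0 K; have : 0 < K * K by rewrite mulr_gt0.
  by rewrite /D => ? ?; nra.
pose ep := Num.min 2^-1 (eps / (12 * D)).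
have epp : 0 < ep by rewrite lt_min invr_gt0 ltr0n divr_gt0 // mulr_gt0.
have ep1 : ep <= 2^-1 by rewrite ge_min lexx.
have ep2 : 3 * (ep * D) <= eps / 4.
  have : ep <= eps / (12 * D) by rewrite ge_min lexx orbT.
  rewrite ler_pdivlMr ?mulr_gt0 //; lra.
clearbody ep r.
have hdi i := (is_derive_epsP _ _ _).1 (hder i) ep epp.
pose di i := s2val (cid2 (hdi i)).
have di0 i : 0 < di i by rewrite /di; case: cid2.
have hd i s : `|s - t| < di i ->
    `|y s i - x i - (s - t) *: (x i *m hat (col i w))| <= ep * `|s - t|.
  by rewrite /di; case: cid2 => /= q _ hq; exact: hq.
have K1 : 0 < 4 * K + 3 by rewrite addr_gt0 // mulr_gt0.
(* The step tau must fit the differentiability of y at t and keep all samples within r of x, where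
   the bound of [regular] applies. *)
pose m0 := Num.min (\big[Num.min/1]_i di i) (Num.min ep (r / (4 * K + 3))).
have m00 : 0 < m0.
  by rewrite !lt_min epp divr_gt0 // !andbT; apply: lt_bigmin.
pose tau := m0 / 2; have tau0 : 0 < tau by rewrite divr_gt0.
have tm : tau < m0 by rewrite /tau; lra.
have [tdi te tr] : [/\ forall i, tau < di i, tau <= ep & (4 * K + 3) * tau <= r].
  move: tm; rewrite !lt_min => /and3P[/bigmin_gtP[_ k1] /ltW k2 /ltW k3]; split => //.
    by move=> i; exact: k1.
  by rewrite mulrC -ler_pdivlMr.
have te0 : 0 < tau * ep by rewrite mulr_gt0.
have all_cy s : \forall m \near U, forall i, `|X m (idx m s) i - y s i| <= tau * ep.
  by apply: filter_forall => i; exact: cy.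
(* The polygon has to be close to y only at the two times t and t + tau, so one index m meets all
   requirements. *)
have [m [[hm1 hm2] hm3]] :=
  filter_ex (filterI (filterI (all_cy t) (all_cy (t + tau))) (ceta _ te0)).
have tt1 : t0 <= t + tau by rewrite ler_wpDr ?ltW.
have /andP[i1 i2] := idxP m t (ltW t0t); have /andP[i3 i4] := idxP m (t + tau) tt1.
have pq : (idx m t <= idx m (t + tau)%R)%N by apply: idx_le; rewrite lerDl ltW.
set p := idx m t in i1 i2 pq hm1; set q := idx m (t + tau) in i3 i4 pq hm2.
have etat : eta m < tau by apply: le_lt_trans hm3 _; rewrite gtr_pMr //;
  clear - ep1 OS Oo fC2 a0 g0 irr h domS; lra.
have Ne : tau - eta m <= (q - p)%:R * eta m <= tau + eta m.
  by rewrite natrB // mulrBl; apply/andP; split; clear - i1 i2 i3 i4 OS Oo fC2 a0 g0 irr h domS;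
    lra.
have N0 : (0 < q - p)%N.
  rewrite lt0n; apply/eqP => e1; move: Ne; rewrite e1 mul0r;
    clear - etat OS Oo fC2 a0 g0 irr h domS; lra.
have Xr i j : (j < q - p)%N -> `|X m (p + j)%N i - x i| <= (4 * K + 1) * tau.
  move=> jN; have q1 : `|X m p i - x i| <= tau * ep := hm1 i.
  have q2 := euler_lip (ltW (eta0 m)) (fun k => XS m k i) (Xv m i) p j
    (fun k => velK (X m k) m i).
  have j1 : j%:R * eta m <= tau + eta m.
    have /andP[_ k] := Ne; apply: le_trans k; rewrite ler_pM2r // ler_nat; exact: ltnW.
  have k0 : 0 < 2 * K by rewrite mulr_gt0.
  have j2 := ler_wpM2l (ltW k0) j1.
  rewrite -(subrKA (X m p i)); apply: le_trans (ler_normD _ _) _.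
  have q3 : 2 * K * (tau + eta m) <= 2 * K * (2 * tau).
    by rewrite ler_pM2l //; clear - etat OS Oo fC2 a0 g0 irr h domS; lra.
  have q4 : tau * ep <= tau by rewrite ger_pMr //; clear - ep1 OS Oo fC2 a0 g0 irr h domS; lra.
  by clear - q1 q2 q3 q4 j2 OS Oo fC2 a0 g0 irr h domS; lra.
have smr j : (j < q - p)%N -> forall i, SO3 (sm (X m (p + j)%N) m i) /\
    `|sm (X m (p + j)%N) m i - x i| < r.
  move=> jN i; have [k1 _] := smP (X m (p + j)%N) m (XS m _); have [k2 k3] := k1 i.
  split => //; rewrite -(subrKA (X m (p + j)%N i)); apply: le_lt_trans (ler_normD _ _) _.
  have k4 := Xr i j jN; have {}k3 : `|sm (X m (p + j)%N) m i - X m (p + j)%N i| < eta m by [].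
  by clear - k3 k4 etat tr tau0 OS Oo fC2 a0 g0 irr h domS; lra.
have velE j : (j < q - p)%N -> vel (X m (p + j)%N) m = h (sm (X m (p + j)%N) m).
  move=> jN; rewrite /vel; case: asboolP => // nb; exfalso; apply: nb.
  by have [] // := reg (sm (X m (p + j)%N) m) => i; have [k1 k2] := smr j jN i; split => //;
    clear - k2 r1 rp OS Oo fC2 a0 g0 irr h domS; lra.
have e40 : 0 < eps / 4 by rewrite divr_gt0.
have exv j : exists v, (j < q - p)%N -> (h @` (geo_nbhd dom x delta `\` S)) v /\
    forall k i, `|vel (X m (p + j)%N) m k i - v k i| <= eps / 4.
  have [jN|_] := ltnP j (q - p); last by exists 0.
  have [_ dist] := smP (X m (p + j)%N) m (XS m _).
  have [v v1 v2] := field_value_near rp e40 vS hr (smr j jN) dist.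
  by exists v => _; rewrite velE.
pose vv j := sval (cid (exv j)); have vvP j := svalP (cid (exv j)).
pose V := \sum_(j < q - p) vel (X m (p + j)%N) m.
have colV i : col i V = \sum_(j < q - p) col i (vel (X m (p + j)%N) m).
  by apply/colP => k; rewrite mxE summxE summxE; apply: eq_bigr => j _; rewrite mxE.
have Np : (0 : R) < (q - p)%:R by rewrite ltr0n.
(* The average of the values outside [S] lies in the hull. It differs from w by at most eps / 4
   through [euler_velocity] and eps / 4 through the replacement of the samples. *)
exists ((q - p)%:R^-1 *: \sum_(j < q - p) vv j); split.
  have [N' eN] : exists N', (q - p)%N = N'.+1 by exists (q - p).-1; rewrite prednK.
  rewrite eN; apply: conv_hull_average => j jN; have [] // := vvP j.
  by rewrite eN.
apply: hB; rewrite -ball_normE /=; apply: mx_norm_lt => // k i.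
have main : `|w k i - ((q - p)%:R^-1 *: V) k i| <= eps / 4.
  apply: le_trans ep2.
  have -> : w k i = col i w k 0 by rewrite mxE.
  have -> : ((q - p)%:R^-1 *: V) k i = ((q - p)%:R^-1 *: col i V) k 0.
    by rewrite [LHS]mxE [RHS]mxE; congr (_ * _); rewrite [RHS]mxE.
  apply: (@euler_velocity R (x i) (x i) (y (t + tau) i) (X m p i)
    (X m q i) _ _ K ep tau (eta m)) => //.
  - exact: yS.
  - exact: ltW.
  - by clear - ep1 OS Oo fC2 a0 g0 irr h domS; lra.
  - rewrite colV; apply: le_trans (enorm_sum _ _ _) _.
    rewrite mulrC mulr_natr -[X in _ *+ X]card_ord -sumr_const; apply: ler_sum => j _.
    exact: velK.
  - have := hd i (t + tau); rewrite [t + tau]addrC addrK gtr0_norm // => k0.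
    by apply: k0; exact: tdi.
  - have := euler_average (ltW (eta0 m)) (fun k => XS m k i) (Xv m i)
      (A := x i) (r := (4 * K + 1) * tau) (K := K) (p := p) (N := (q - p)%N).
    rewrite subnKC // colV; apply => j jN; split; first exact: velK.
    exact: Xr.
have diff : `|((q - p)%:R^-1 *: V) k i - ((q - p)%:R^-1 *: \sum_(j < q - p) vv j) k i| <= eps / 4.
  rewrite [X in X - _]mxE [X in _ - X]mxE -mulrBr normrM gtr0_norm ?invr_gt0 //.
  rewrite ler_pdivrMl // !summxE -sumrB; apply: le_trans (ler_norm_sum _ _ _) _.
  rewrite mulr_natl -[X in _ *+ X]card_ord -sumr_const; apply: ler_sum => j _.
  by have [_ k1] := vvP j (ltn_ord j); exact: k1.
have -> : (w - (q - p)%:R^-1 *: \sum_(j < q - p) vv j) k i =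
   (w k i - ((q - p)%:R^-1 *: V) k i) +
   (((q - p)%:R^-1 *: V) k i - ((q - p)%:R^-1 *: \sum_(j < q - p) vv j) k i).
  by rewrite [LHS]mxE [X in _ + X = _]mxE; ring.
apply: le_lt_trans (ler_normD _ _) _; clear - main diff ep0 OS Oo fC2 a0 g0 irr h domS; lra.
Unshelve. all: by end_near.
Qed.

End Existence.

(** * Gluing of solutions and bounds on velocities *)

Section Gluing.
Variables (R : realType) (n : nat).
Implicit Types (dom : set (config R n)) (h : config R n -> 'M[R]_(3, n)).
Implicit Types (a b c s t k : R) (x : config R n) (y z : R -> config R n).
Local Notation mu := (@lebesgue_measure R).

Lemma ac_lipschitz (V : normedModType R) a b (c : R -> V) (K : R) : 0 <= K ->
  (forall s t, a <= s <= b -> a <= t <= b -> s <= t -> `|c t - c s| <= K * (t - s)) ->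
  abs_continuous a b c.
Proof.
move=> K0 hc eps e0; exists (eps / (K + 1)); first by rewrite divr_gt0 // ltr_wpDl.
move=> m s t st _; rewrite ltr_pdivlMr ?ltr_wpDl // => sm.
apply: le_lt_trans sm; rewrite mulr_suml; apply: ler_sum => i _.
have [h1 h2 h3] := st i.
apply: le_trans (hc (s i) (t i) _ _ h2) _.
- by rewrite h1 (le_trans h2).
- by rewrite h3 (le_trans h1).
- by rewrite mulrC ler_wpM2l ?subr_ge0 // lerDl.
Qed.

Lemma ac_glue (V : normedModType R) a b c (f g : R -> V) : a <= b -> b <= c ->
  abs_continuous a b f -> abs_continuous b c g -> f b = g b ->
  abs_continuous a c (fun t => if t <= b then f t else g t).
Proof.
move=> ab bc hf hg fg eps e0; have e2 : 0 < eps / 2 by rewrite divr_gt0.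
have [d1 d10 hd1] := hf _ e2; have [d2 d20 hd2] := hg _ e2.
exists (Num.min d1 d2); first by rewrite lt_min d10.
move=> m s t st dis; rewrite lt_min => /andP[s1 s2].
(* Each interval is cut at b into a left and a right part, one of them possibly degenerate. *)
pose s' i := Num.min (s i) b; pose t' i := Num.min (t i) b.
pose s'' i := Num.max (s i) b; pose t'' i := Num.max (t i) b.
have mono_min (p q : R) : p <= q -> Num.min p b <= Num.min q b.
  by move=> pq; rewrite le_min !ge_min pq lexx orbT.
have mono_max (p q : R) : p <= q -> Num.max p b <= Num.max q b.
  by move=> pq; rewrite ge_max !le_max pq lexx orbT.
have sum_le (p q : R) : p <= q -> Num.min q b - Num.min p b <= q - p /\
    Num.max q b - Num.max p b <= q - p.
  by move=> pq; case: (leP p b) => ?; case: (leP q b) => ?; split; lra.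
rewrite [ltRHS]splitr.
have k1 : \sum_i `|f (t' i) - f (s' i)| < eps / 2.
  apply: hd1.
  - move=> i; have [h1 h2 h3] := st i; split; first by rewrite le_min h1.
      exact: mono_min.
    by rewrite ge_min lexx orbT.
  - by move=> i j ij; have [h|h] := dis i j ij; [left|right]; exact: mono_min.
  - apply: le_lt_trans s1; apply: ler_sum => i _; have [h1 h2 h3] := st i.
    by have [] := sum_le _ _ h2.
have k2 : \sum_i `|g (t'' i) - g (s'' i)| < eps / 2.
  apply: hd2.
  - move=> i; have [h1 h2 h3] := st i; split; first by rewrite le_max lexx orbT.
      exact: mono_max.
    by rewrite ge_max h3.
  - by move=> i j ij; have [h|h] := dis i j ij; [left|right]; exact: mono_max.
  - apply: le_lt_trans s2; apply: ler_sum => i _; have [h1 h2 h3] := st i.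
    by have [] := sum_le _ _ h2.
apply: le_lt_trans (ltrD k1 k2); rewrite -big_split /=; apply: ler_sum => i _.
rewrite /t' /s' /t'' /s''; have [_ h2 _] := st i.
case: (leP (t i) b) => tb; case: (leP (s i) b) => sb.
- by rewrite subrr normr0 addr0.
- by have := le_lt_trans (le_trans h2 tb) sb; rewrite ltxx.
- rewrite -fg; apply: le_trans (ler_normD _ _); rewrite fg -(subrKA (g b)) addrC.
  by rewrite lexx.
- by rewrite subrr normr0 add0r.
Qed.

Lemma body_vel_near (f g : R -> 'M[R]_3) t : (\forall s \near t, f s = g s) ->
  body_vel f t = body_vel g t.
Proof.
by move=> fg; rewrite /body_vel !derive1E (near_eq_derive _ fg) (nbhs_singleton fg).
Qed.

Lemma velocity_near dom h y z t : (\forall s \near t, y s = z s) ->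
  (forall i, derivable (fun s => y s i) t 1) /\ filippov_map dom h (y t)
    (\matrix_(k, i) body_vel (fun s => y s i) t k 0) ->
  (forall i, derivable (fun s => z s i) t 1) /\ filippov_map dom h (z t)
    (\matrix_(k, i) body_vel (fun s => z s i) t k 0).
Proof.
move=> yz [h1 h2]; have yzi i : \forall s \near t, y s i = z s i.
  by apply: filterS yz => s ->.
split=> [i|]; first exact: near_eq_derivable (yzi i) (h1 i).
have E : \matrix_(k, i) body_vel (fun s => y s i) t k 0 =
    \matrix_(k, i) body_vel (fun s => z s i) t k 0.
  by apply: eq_mx => k i; rewrite (body_vel_near (yzi i)).
by rewrite -E -(nbhs_singleton yz).
Qed.

Lemma solution_glue dom h a b c y z : a <= b -> b <= c ->
  solution_on dom h a b y -> solution_on dom h b c z -> y b = z b ->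
  solution_on dom h a c (fun t => if t <= b then y t else z t).
Proof.
move=> ab bc [y1 y2 y3] [z1 z2 z3] yz; split.
- move=> t /andP[t1 t2]; case: leP => tb; first by apply: y1; rewrite t1.
  by apply: z1; rewrite t2 ltW.
- move=> i; have := ac_glue ab bc (y2 i) (z2 i); rewrite yz => /(_ erefl).
  by congr abs_continuous; apply/funext => t; case: ifP.
- apply: aeS2 (ae_point b) _; last exact: aeS2 (fun t => @conj _ _) y3 z3.
  move=> t /= tb [k1 k2] /andP[ta tc].
  have /orP[lt|gt] : (t < b) || (b < t) by rewrite -neq_lt; apply/eqP.
  + apply: velocity_near (k1 _); last by rewrite ta ltW.
    have : \forall s \near t, s < b by exact: lt_nbhsl.
    by apply: filterS => s sb; rewrite ltW.
  + apply: velocity_near (k2 _); last by rewrite tc ltW.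
    have : \forall s \near t, b < s by exact: lt_nbhsr.
    by apply: filterS => s sb; rewrite leNgt sb.
Qed.

(** For each entry and sign, [phi] has nonpositive derivative almost everywhere; the factor 3 comes
    from the sup norm of a product of matrices. *)
Lemma solution_lipschitz_velocity dom h a b y (K : R) : a <= b -> 0 <= K ->
  (forall x, dom x -> forall i, SO3 (x i)) -> solution_on dom h a b y ->
  (forall t w i, a <= t <= b -> filippov_map dom h (y t) w -> enorm (col i w) <= K) ->
  forall s t i, a <= s <= b -> a <= t <= b -> s <= t ->
    `|y t i - y s i| <= 3 * K * (t - s).
Proof.
move=> ab K0 domS sol hK s t i /andP[as_ sb] /andP[at_ tb] st.
have K3 : 0 <= 3 * K by rewrite mulr_ge0.
have main (sg : R) (k l : 'I_3) : `|sg| = 1 -> sg * (y t i k l - y s i k l) <= 3 * K * (t - s).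
  move=> sg1; pose phi r := sg * y r i k l + - (3 * K) * r.
  have ac : abs_continuous s t phi.
    have [_ h2 _] := sol; have K31 : 0 < 1 + 3 * K by rewrite ltr_pwDl.
    apply: (@ac_dominated R _ _ s t (fun r => y r i) phi _ K31).
      exact: abs_continuousB (h2 i).
    move=> p q _ _; rewrite /phi.
    have -> : sg * y q i k l + - (3 * K) * q - (sg * y p i k l + - (3 * K) * p) =
      sg * (y q i k l - y p i k l) + - (3 * K) * (q - p) by ring.
    apply: le_trans (ler_normD _ _) _; rewrite !normrM normrN sg1 mul1r (ger0_norm K3).
    have := le_mx_norm (y q i - y p i) k l; rewrite !mxE => m1.
    have m2 := normr_ge0 (y q i - y p i); have m3 := normr_ge0 (q - p).
    by rewrite mulrDl mul1r mulrDr; have := mulr_ge0 K3 m2; have := mulr_ge0 K3 m3; lra.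
  have := @ac_gronwall R s t 0 phi st ac _; rewrite mul0r expR0 mulr1 => k1.
  have {}k1 : phi t <= phi s.
    apply: k1; have sol' := solution_on_sub as_ tb sol.
    apply: aeS (solution_velocity domS sol') => r hr rst e e0.
    have [w hw hd] := hr rst.
    have hphi : is_derive r 1 phi (sg * (y r i *m hat (col i w)) k l + - (3 * K) * 1).
      have /is_derive_mxP/(_ k l) hkl := hd i.
      exact: (is_deriveD (is_deriveZ sg hkl) (is_deriveZ (- (3 * K)) (is_derive_id r 1))).
    have neg : sg * (y r i *m hat (col i w)) k l + - (3 * K) * 1 <= 0 * phi r.
      rewrite mul0r mulr1 subr_le0; apply: le_trans (ler_norm _) _.
      rewrite normrM sg1 mul1r; apply: le_trans (le_mx_norm _ _ _) _.
      apply: le_trans (mx_norm_mul3 _ _) _.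
      have /andP[rs rt] := rst.
      have rab : a <= r <= b by rewrite (le_trans as_ (ltW rs)) (le_trans (ltW rt)).
      have dr : SO3 (y r i) by apply: domS; have [d1 _ _] := sol; exact: d1.
      have := hK r w i rab hw; have := norm_hat_enorm (col i w); have := norm_SO3_le1 dr.
      have := normr_ge0 (y r i); have := normr_ge0 (hat (col i w)); nra.
    have [q q0 hq] := ldini_le neg (ldini_derive hphi) e0.
    by exists q => // p _; exact: hq.
  by rewrite /phi in k1; lra.
apply: mx_norm_le => [|k l]; first by rewrite mulr_ge0 // subr_ge0.
rewrite !mxE ler_norml.
have := main 1 k l (normr1 _); have := main (-1) k l; rewrite normrN1 => /(_ erefl).
by rewrite mul1r mulN1r => ? ?; apply/andP; split; lra.
Qed.

(** The half-space with normal - w_i / |w_i| contains all nearby values of the field, hence w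
    itself. *)
Lemma filippov_bound dom h x w (K : R) : (forall x, dom x -> forall i, SO3 (x i)) -> dom x ->
  (\forall x' \near cnbhs dom x, forall i, enorm (col i (h x')) <= K) ->
  filippov_map dom h x w -> forall i, enorm (col i w) <= K.
Proof.
move=> domS dx hK hw i.
have K0 : 0 <= K.
  have [eta e0 hh] := hK.
  apply: le_trans (hh x dx _ i); first exact: enorm_ge0.
  by move=> j; rewrite subrr normr0.
have [->|wn] := eqVneq (col i w) 0; first by rewrite enorm0.
pose u := - sgnv (col i w).
pose a (_ : config R n) j : 'cV[R]_3 := if j == i then u else 0.
have pE v : pairing (a x) v = dotv u (col i v).
  rewrite /pairing (bigD1 i) //= /a eqxx big1 ?addr0 // => j /negbTE ->.
  by rewrite dot0v.
have := @filippov_affine R n dom h x w a (fun=> K) K domS dx hK.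
rewrite pE /u dotvNl; have -> : dotv (sgnv (col i w)) (col i w) = enorm (col i w).
  have := sgnvK (col i w) => {2}<-; rewrite dotvZr -enorm_sqr enorm_sgnv // expr1n mulr1 //.
have k1 : forall k : 'I_n, forall j, a x k j 0 @[_ --> cnbhs dom x] --> a x k j 0.
  by move=> k j; exact: cvg_cst.
move=> /(_ k1 (cvg_cst _) _ hw) k2.
rewrite -subr_ge0 addrC; apply: k2; apply: filterS hK => x' hx'.
have -> : pairing (a x') (h x') = dotv u (col i (h x')).
  rewrite /pairing (bigD1 i) //= /a eqxx big1 ?addr0 // => j /negbTE ->.
  by rewrite dot0v.
have := normr_dotv_le u (col i (h x')); rewrite {2}/u enormN enorm_sgnv // mul1r.
by rewrite ler_norml => /andP[k3 _]; have := hx' i; lra.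
Qed.

End Gluing.

Lemma ae_forall_fin (R : realType) (I : finType) (P : I -> R -> Prop) :
  (forall i, {ae @lebesgue_measure R, forall t, P i t}) ->
  {ae @lebesgue_measure R, forall t, forall i, P i t}.
Proof.
move=> hP.
have hl (s : seq I) : {ae @lebesgue_measure R, forall t, forall i, i \in s -> P i t}.
  elim: s => [|i s IH]; first by apply: aeS (ae_point 0) => t _ i; rewrite in_nil.
  by apply: aeS2 (hP i) IH => t h1 h2 j; rewrite inE => /orP[/eqP -> //|]; exact: h2.
by apply: aeS (hl (enum I)) => t h i; apply: h; rewrite mem_enum.
Qed.

(** * Existence, extension and maximal solutions *)

Section GlobalSolutions.
Variables (R : realType) (n : nat) (e : rel 'I_n) (O : set 'M[R]_3).
Variables (f : 'I_n -> 'M[R]_3 -> R) (alpha gamma rho M : R) (Rc : 'M[R]_3).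
Hypotheses (OS : O `<=` @SO3 R) (Oo : open_SO3 O).
Hypothesis fC2 : forall i, C2_SO3 O (f i).
Hypotheses (a0 : 0 < alpha) (g0 : 0 < gamma) (sym : symmetric e) (irr : irreflexive e).
Hypotheses (hRc : SO3 Rc) (r0 : 0 < rho) (rpi : rho < pi / 2).
Let C := gcball Rc rho.
Hypothesis CO : C `<=` O.
Hypotheses (M0 : 0 < M) (hM : forall i A, C A -> enorm (grad (f i) A) <= M).
Hypothesis inward : forall i A, SO3 A -> gdist A Rc = rho ->
  dotv (dir_to Rc A) (grad (f i) A) <= 0.
Implicit Types (A B : 'M[R]_3) (x : config R n) (y z : R -> config R n).
Local Notation mu := (@lebesgue_measure R).

Let dom := network_dom e O.
Let h := network_field e alpha gamma f.
Let domS x (dx : dom x) : forall i, SO3 (x i) := network_dom_SO3 OS dx.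
Let K : R := alpha * n%:R + gamma * (M + 1).

Let K_gt0 : 0 < K.
Proof.
rewrite /K ltr_wpDl ?mulr_ge0 // ?ltW // mulr_gt0 // addr_gt0 //.
Qed.

Let ball_iff A : C A <-> SO3 A /\ cos rho <= rcos Rc A.
Proof. exact: gcballE (ball_radius rpi). Qed.

Lemma ball_regular x : (forall i, C (x i)) -> regular e O f alpha gamma K x.
Proof.
move=> hx; have dx : dom x by exact: (ball_dom e OS hRc r0 rpi CO hx).
have [d1 d10 h1] := network_field_bound OS Oo fC2 a0 g0 dx (fun i => hM i (hx i)).
have [d2 d20 h2] := network_dom_open OS Oo dx.
exists (Num.min d1 d2); first by rewrite lt_min d10.
move=> x' hx'; have dx' : dom x'.
  apply: h2 => [i|i]; have [k1 k2] := hx' i => //.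
  by move: k2; rewrite lt_min => /andP[].
split => //; apply: h1 => // i; have [_ k2] := hx' i.
by move: k2; rewrite lt_min => /andP[].
Qed.

Lemma regular_near x : regular e O f alpha gamma K x -> exists2 d : R, 0 < d &
  forall x', (forall i, SO3 (x' i) /\ `|x' i - x i| < d) -> regular e O f alpha gamma K x'.
Proof.
move=> [eta e0 hr]; exists (eta / 2); first by rewrite divr_gt0.
move=> x' hx'; exists (eta / 2); first by rewrite divr_gt0.
move=> z hz; apply: hr => i; have [k1 k2] := hx' i; have [k3 k4] := hz i; split => //.
rewrite -(subrKA (x' i)); apply: le_lt_trans (ler_normD _ _) _.
by rewrite [ltRHS]splitr ltrD.
Qed.

Lemma ball_closed A : SO3 A ->
  (forall eps : R, 0 < eps -> exists2 B, C B & `|B - A| < eps) -> C A.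
Proof.
move=> hA hB; apply/ball_iff; split => //; apply/ler_addgt0Pr => eps e0.
have [|B /ball_iff[_ gB] dB] := hB (eps / 5); first by rewrite divr_gt0.
have := rcos_lip B A hRc; rewrite ler_norml => /andP[_ k]; lra.
Qed.

Lemma ball_velocity_bound x w : (forall i, C (x i)) -> filippov_map dom h x w ->
  forall i, enorm (col i w) <= K.
Proof.
move=> hx; have dx : dom x by exact: (ball_dom e OS hRc r0 rpi CO hx).
by apply: filippov_bound => //; exact: network_field_bound (fun i => hM i (hx i)).
Qed.

(** The limit of the polygons is Lipschitz, hence differentiable almost everywhere, entry by entry;
    there its velocity belongs to the Filippov map. *)
Lemma solution_of_lipschitz t0 a b y : t0 <= a -> a < b ->
  (forall t i, SO3 (y t i)) ->
  (forall s t i, t0 <= s -> t0 <= t -> `|y t i - y s i| <= 2 * K * `|t - s|) ->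
  (forall t w, t0 < t -> regular e O f alpha gamma K (y t) ->
     (forall i, is_derive t 1 (fun s => y s i) (y t i *m hat (col i w))) ->
     filippov_map dom h (y t) w) ->
  (forall t, a <= t <= b -> regular e O f alpha gamma K (y t)) ->
  solution_on dom h a b y.
Proof.
move=> ta ab yS lip incl reg; have K2 : 0 <= 2 * K by rewrite mulr_ge0 // ltW.
split.
- move=> t tab; have [eta e0 hr] := reg t tab.
  by have [] // := hr (y t) => i; rewrite subrr normr0.
- move=> i; apply: (ac_lipschitz K2) => s t /andP[as_ _] /andP[at_ _] st.
  have := lip s t i (le_trans ta as_) (le_trans ta at_).
  by rewrite [X in _ <= _ * X]ger0_norm ?subr_ge0.
have all_der : {ae mu, forall t, forall ikl : 'I_n * 'I_3 * 'I_3, a < t < b ->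
    derivable (fun s => y s ikl.1.1 ikl.1.2 ikl.2) t 1}.
  apply: ae_forall_fin => -[[i k] l] /=.
  apply: (@lipschitz_derivable R _ (2 * K) a b ab) => s t /andP[as_ _] /andP[at_ _].
  apply: le_trans (lip s t i (le_trans ta as_) (le_trans ta at_)).
  by have := le_mx_norm (y t i - y s i) k l; rewrite !mxE.
apply: aeS2 (ae_point b) (aeS2 (fun t => @conj _ _) (ae_point a) all_der) => t tb [ta' hd].
move=> /andP[t1 t2].
have ta0 : a < t by rewrite lt_neqAle t1 eq_sym andbT; apply/eqP.
have tb0 : t < b by rewrite lt_neqAle t2 andbT; apply/eqP.
have hder i : is_derive t 1 (fun s => y s i) (\matrix_(k, l) 'D_1 (fun s => y s i k l) t).
  apply/is_derive_mxP => k l; rewrite mxE; apply: derivableP.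
  by apply: (hd (i, k, l)); rewrite ta0.
split=> [i|]; first by have [] := hder i.
apply: incl; [exact: le_lt_trans ta0|apply: reg; rewrite t1 t2|] => // i.
have hd' := hder i; have hS : \forall s \near t, SO3 (y s i) by near=> s; exact: yS.
have e1 := SO3_curve_vel hS hd'.
apply: (is_derive_eqr hd'); rewrite {1}e1; congr (_ *m hat _).
have [_ e2] := hd'; rewrite -e2.
by apply/colP => k; rewrite [RHS]mxE [RHS]mxE /body_vel derive1E.
Unshelve. all: by end_near.
Qed.

(** The limit of the polygons is known to be a solution only while it is regular, and invariance
    concerns solutions. Real induction combines the two: a configuration in the ball is regular
    together with its neighbours, so y is a solution for a short time, which keeps it in the
    ball. *)
Lemma existence t0 x0 : (forall i, C (x0 i)) -> exists y,
  [/\ y t0 = x0, forall T, t0 < T -> solution_on dom h t0 T y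
    & forall t, t0 <= t -> forall i, C (y t i)].
Proof.
move=> hx0; have x0S i : SO3 (x0 i) by exact: OS (CO (hx0 i)).
have [y [y0 yS lip incl]] := @euler_limit R n e O f alpha gamma OS Oo fC2 irr t0 x0 K K_gt0 x0S.
have inC T : t0 <= T -> forall t, t0 <= t <= T -> forall i, C (y t i).
  move=> tT; apply: (@real_induction R t0 T (fun t => forall i, C (y t i))).
  - by rewrite y0.
  - move=> c /andP[tc cT] hs i; apply: ball_closed => // eps e0.
    pose s := Num.max t0 (c - eps / (2 * K + 1)).
    have k0 : 0 < 2 * K + 1 by rewrite ltr_wpDl // mulr_ge0 // ltW.
    have d0 : 0 < eps / (2 * K + 1) by rewrite divr_gt0.
    have sc : s < c by rewrite /s gt_max tc gtrBl.
    have ts : t0 <= s by rewrite /s le_max lexx.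
    exists (y s i); first by apply: hs; rewrite ts.
    rewrite distrC; apply: le_lt_trans (lip s c i ts (ltW tc)) _.
    rewrite gtr0_norm ?subr_gt0 //.
    have : c - s <= eps / (2 * K + 1).
      have : c - eps / (2 * K + 1) <= s by rewrite /s le_max lexx orbT.
      lra.
    rewrite ler_pdivlMr // => k1; apply: lt_le_trans k1.
    by rewrite mulrC ltr_pM2l ?subr_gt0 // ltrDl.
  - move=> c /andP[tc cT] hs; have yc : forall i, C (y c i) by apply: hs; rewrite tc lexx.
    have [d d0 hd] := regular_near (ball_regular yc).
    have k0 : 0 < 2 * K + 1 by rewrite ltr_wpDl // mulr_ge0 // ltW.
    exists (d / (2 * K + 1)); first by rewrite divr_gt0.
    move=> s /andP[cs sd] _.
    have sol : solution_on dom h c s y.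
      apply: (solution_of_lipschitz tc cs yS lip incl) => t /andP[ct ts].
      apply: hd => i; split => //.
      apply: le_lt_trans (lip c t i tc (le_trans tc ct)) _.
      rewrite ger0_norm ?subr_ge0 //.
      have : t - c < d / (2 * K + 1) by lra.
      rewrite ltr_pdivlMr // => k1; apply: le_lt_trans k1.
      by rewrite mulrC ler_wpM2l ?subr_ge0 // lerDl.
    apply: (solution_invariant OS Oo fC2 a0 g0 sym hRc r0 rpi CO inward sol yc).
    by rewrite (ltW cs) lexx.
have Cy t : t0 <= t -> forall i, C (y t i).
  by move=> tt; apply: (inC t tt); rewrite tt lexx.
exists y; split => // T tT.
apply: (solution_of_lipschitz (lexx t0) tT yS lip incl) => t /andP[tt _].
exact: ball_regular (Cy t tt).
Qed.

Lemma solution_ball_lipschitz a b y : a <= b -> solution_on dom h a b y ->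
  (forall i, C (y a i)) -> forall s t i, a <= s <= b -> a <= t <= b -> s <= t ->
  `|y t i - y s i| <= 3 * K * (t - s).
Proof.
move=> ab sol ya; apply: (solution_lipschitz_velocity ab (ltW K_gt0) domS sol).
move=> t w i tab hw; apply: (ball_velocity_bound _ hw) => j.
exact: (solution_invariant OS Oo fC2 a0 g0 sym hRc r0 rpi CO inward sol ya tab).
Qed.

(* A solution staying in the ball is Lipschitz, hence has a limit at b. *)
Lemma solution_extend b y : 0 < b ->
  (forall T, 0 < T -> T < b -> solution_on dom h 0 T y) -> (forall i, C (y 0 i)) ->
  exists2 z, solution_on dom h 0 b z & forall t, t < b -> z t = y t.
Proof.
move=> b0 sol y0.
have Cy t i : 0 <= t -> t < b -> C (y t i).
  move=> t0 tb; pose T := (t + b) / 2.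
  have T0 : 0 < T by rewrite /T; lra.
  have Tb : T < b by rewrite /T; lra.
  apply: (solution_invariant OS Oo fC2 a0 g0 sym hRc r0 rpi CO inward (sol T T0 Tb) y0).
  by rewrite t0 /T; lra.
have lip s t i : 0 <= s -> s <= t -> t < b -> `|y t i - y s i| <= 3 * K * (t - s).
  move=> s0 st tb; pose T := (t + b) / 2.
  have T0 : 0 < T by rewrite /T; lra.
  have Tb : T < b by rewrite /T; lra.
  have tT : t <= T by rewrite /T; lra.
  apply: (solution_ball_lipschitz (ltW T0) (sol T T0 Tb) y0) => //.
    by rewrite s0 (le_trans st).
  by rewrite tT (le_trans s0).
(* As y is Lipschitz on [0, b[, a limit along one ultrafilter is the limit at b. *)
have [U [UU bU]] := @ultraFilterLemma R (b^'-) _.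
have ev (P : R -> Prop) : (\forall t \near b^'-, P t) -> U [set t | P t] by exact: bU.
have ev0 : U [set t | 0 <= t /\ t < b].
  apply: ev; near=> t; split; near: t; last exact: nbhs_left_lt.
  exact: nbhs_left_ge.
have exL i : exists2 L, y t i @[t --> U] --> L & SO3 L.
  apply: ultra_cvg_SO3; apply: filterS ev0 => t [t0 tb].
  by apply: OS; apply: CO; exact: Cy.
pose L i := s2val (cid2 (exL i)).
have LS i : SO3 (L i) by rewrite /L; case: cid2.
have cL i (eps : R) : 0 < eps -> \forall t \near U, `|y t i - L i| <= eps.
  move=> e0; rewrite /L; case: cid2 => /= q hq _.
  by move/cvgrPdist_le : hq => /(_ _ e0); apply: filterS => t; rewrite distrC.
have K3 : 0 <= 3 * K by rewrite mulr_ge0 // ltW.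
have lipL s i : 0 <= s -> s < b -> `|L i - y s i| <= 3 * K * (b - s).
  move=> s0 sb; apply/ler_addgt0Pr => eps e0.
  have ev1 : U [set t | s <= t] by apply: ev; exact: nbhs_left_ge.
  have [t [[[t0 tb] k1] st]] := filter_ex (filterI (filterI ev0 (cL i eps e0)) ev1).
  rewrite -(subrKA (y t i)); apply: le_trans (ler_normD _ _) _.
  have k2 := lip s t i s0 st tb; rewrite distrC in k1.
  have k3 : 3 * K * (t - s) <= 3 * K * (b - s) by rewrite ler_wpM2l //; lra.
  lra.
have CL i : C (L i).
  apply: ball_closed => // eps e0; have e2 : 0 < eps / 2 by rewrite divr_gt0.
  have [t [[t0 tb] k1]] := filter_ex (filterI ev0 (cL i _ e2)).
  by exists (y t i); [exact: Cy|lra].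
pose z t : config R n := if t < b then y t else L.
exists z; last by move=> t tb; rewrite /z tb.
split.
- move=> t /andP[t0 tb]; apply: (ball_dom e OS hRc r0 rpi CO) => i; rewrite /z.
  by case: ifP => tb'; [exact: Cy|exact: CL].
- move=> i; apply: (ac_lipschitz K3) => s t /andP[s0 sb] /andP[t0 tb] st; rewrite /z.
  case: (ltP t b) => tb'; first by rewrite (le_lt_trans st tb'); exact: lip.
  have -> : t = b by apply/eqP; rewrite eq_le tb.
  case: (ltP s b) => sb'; first exact: lipL.
  have -> : s = b by apply/eqP; rewrite eq_le sb.
  by rewrite !subrr normr0 mulr0.
(* The inclusion holds almost everywhere on each [0, T m], and these countably many intervals
   exhaust [0, b[. *)
pose T m : R := b * (1 - m.+2%:R^-1).
have m1 m : 0 < (m.+2%:R^-1 : R) < 1.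
  by rewrite invr_gt0 ltr0n /= invf_lt1 // ltr1n.
have T0 m : 0 < T m by rewrite /T mulr_gt0 // subr_gt0; case/andP: (m1 m).
have Tb m : T m < b by rewrite /T gtr_pMr // gtrBl; case/andP: (m1 m).
have := @ae_foralln _ _ _ mu (fun m t => 0 <= t <= T m ->
  (forall i, derivable (fun s => y s i) t 1) /\
  filippov_map dom h (y t) (\matrix_(k, i) body_vel (fun s => y s i) t k 0)).
have hm m : {ae mu, forall t, 0 <= t <= T m ->
  (forall i, derivable (fun s => y s i) t 1) /\
  filippov_map dom h (y t) (\matrix_(k, i) body_vel (fun s => y s i) t k 0)}.
  by have [] := sol (T m) (T0 m) (Tb m).
move=> /(_ hm); apply: aeS2 (ae_point b) => t tb ht /andP[t0 tb'].
have lt : t < b by rewrite lt_neqAle tb' andbT; apply/eqP.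
have [m tm] : exists m, t <= T m.
  have q0 : 0 < (b - t) / b by rewrite divr_gt0 // subr_gt0.
  have [m _ hm'] := near_infty_natSinv_lt (PosNum q0).
  exists m; have := hm' m.+1 (leqnSn m); rewrite /= ltr_pdivlMr //.
  by move=> k; rewrite /T mulrBr mulr1 lerBrDr addrC -lerBrDr mulrC ltW.
apply: velocity_near (ht m _); last by rewrite t0.
have : \forall s \near t, s < b by exact: lt_nbhsl.
by apply: filterS => s sb; rewrite /z sb.
Unshelve. all: by end_near.
Qed.

(** A solution on a closed interval is continued by [existence] from its end point, one on a
    half-open interval by its limit there; both contradict maximality. *)
Lemma maximal_global I y : maximal_solution dom h I y -> (forall i, C (y 0 i)) ->
  [/\ I = [set` `[0, +oo[], forall T, 0 < T -> solution_on dom h 0 T y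
    & forall t, 0 <= t -> forall i, C (y t i)].
Proof.
move=> [tI sol maxI] y0.
have IE : I = [set` `[0, +oo[].
  case: tI => [[T T0 IE]|[b b0 IE]|] //; exfalso.
  - have solT : solution_on dom h 0 T y by apply: sol => //; rewrite IE.
    have yT : forall i, C (y T i).
      apply: (solution_invariant OS Oo fC2 a0 g0 sym hRc r0 rpi CO inward solT y0).
      by rewrite (ltW T0) lexx.
    have [z [z0 solz _]] := existence T yT.
    have T1 : T < T + 1 by rewrite ltrDl.
    pose Z t := if t <= T then y t else z t.
    have solZ : solution_on dom h 0 (T + 1) Z.
      exact: (solution_glue (ltW T0) (ltW T1) solT (solz _ T1) (esym z0)).
    suff JI : [set` `[0, T + 1]] = I.
      have : I (T + 1) by rewrite -JI /= in_itv /= lexx (ltW (lt_trans T0 T1)).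
      by rewrite IE /= in_itv /= => /andP[_]; rewrite leNgt T1.
    apply: (maxI _ Z).
    + by apply: Or31; exists (T + 1) => //; rewrite addr_gt0.
    + move=> S S0 SI; apply: (solution_on_sub (lexx 0) _ solZ).
      have /SI : [set` `[0, S]] S by rewrite /= in_itv /= lexx (ltW S0).
      by rewrite /= in_itv /= => /andP[].
    + rewrite IE => t; rewrite /= !in_itv /= => /andP[-> tT] /=.
      exact: le_trans (ltW T1).
    + by rewrite IE => t; rewrite /= in_itv /= => /andP[_ tT]; rewrite /Z tT.
  - have sol' T : 0 < T -> T < b -> solution_on dom h 0 T y.
      move=> T0 Tb; apply: sol => // t; rewrite IE /= !in_itv /= => /andP[-> tT] /=.
      exact: le_lt_trans Tb.
    have [z solz zy] := solution_extend b0 sol' y0.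
    suff JI : [set` `[0, b]] = I.
      have : I b by rewrite -JI /= in_itv /= lexx (ltW b0).
      by rewrite IE /= in_itv /= ltxx andbF.
    apply: (maxI _ z).
    + by apply: Or31; exists b.
    + move=> S S0 SI; apply: (solution_on_sub (lexx 0) _ solz).
      have /SI : [set` `[0, S]] S by rewrite /= in_itv /= lexx (ltW S0).
      by rewrite /= in_itv /= => /andP[].
    + by rewrite IE => t; rewrite /= !in_itv /= => /andP[-> /ltW].
    + by rewrite IE => t; rewrite /= in_itv /= => /andP[_ tb]; rewrite zy.
have solT T : 0 < T -> solution_on dom h 0 T y.
  by move=> T0; apply: sol => // t; rewrite IE /= !in_itv /= andbT => /andP[].
split => // t t0; have T0 : 0 < t + 1 by rewrite ltr_wpDl.
apply: (solution_invariant OS Oo fC2 a0 g0 sym hRc r0 rpi CO inward (solT _ T0) y0).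
by rewrite t0 lerDl ler01.
Qed.

End GlobalSolutions.

(** * The angle as a metric and its one-sided derivative *)

Section AngleMetric.
Variable R : realType.
Implicit Types (A B Q T : 'M[R]_3) (u v a b : 'cV[R]_3) (p q s t d : R).

(** The product of unit quaternions in terms of traces: the square contains the scalar part of the
    product, which is the cosine of its half angle. *)
Lemma mxtrace_rotm_mul u v p q : dotv u u = 1 -> dotv v v = 1 ->
  \tr (rotm u p *m rotm v q) =
    4 * (cos (p / 2) * cos (q / 2) - sin (p / 2) * sin (q / 2) * dotv u v) ^+ 2 - 1.
Proof.
move=> hu hv; rewrite mxtrace_mul_rotm // mxtrace_rotm // axv_rotm dotvZl.
have -> : dotv v (rotm u p *m v) = cos p + (1 - cos p) * dotv u v ^+ 2.
  rewrite /rotm !mulmxDl mul1mx -!scalemxAl !dotvDr !dotvZr hv hat_sqr hu.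
  have -> : dotv v (hat u *m v) = 0.
    by rewrite hat_mul dotvE /cross /vec3 !mxE /=; ring.
  rewrite mulmxBl mul1mx dotvDr dotvNr hv -mulmxA.
  have -> : u *m (u^T *m v) = dotv u v *: u.
    by apply/colP => k; rewrite !mxE big_ord1 /dotv mulrC.
  by rewrite dotvZr (dotvC v u); ring.
have e2 (x : R) : cos x = 1 - 2 * sin (x / 2) ^+ 2 /\ sin x = 2 * sin (x / 2) * cos (x / 2).
  by rewrite [in cos x](splitr x) [in sin x](splitr x) cosD sinD -!expr2 cos2sin2; split; ring.
have [cp sp] := e2 p; have [cq sq] := e2 q; rewrite cp sp cq sq.
have c2 (x : R) : cos x * cos x = 1 - sin x ^+ 2 by rewrite -expr2 cos2sin2.
set sP := sin (p / 2); set cP := cos (p / 2); set sQ := sin (q / 2); set cQ := cos (q / 2).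
have h1 : cP * cP = 1 - sP ^+ 2 by exact: c2.
have h2 : cQ * cQ = 1 - sQ ^+ 2 by exact: c2.
set D := dotv u v.
have -> : 4 * (cP * cQ - sP * sQ * D) ^+ 2 - 1 =
  4 * ((cP * cP) * (cQ * cQ) - 2 * (cP * cQ * sP * sQ * D) + (sP * sQ * D) ^+ 2) - 1 by ring.
by rewrite h1 h2; ring.
Qed.

(** As u and v are unit vectors, dotv u v <= 1, so the cosine of the half angle of the product is at
    least cos((p + q) / 2). *)
Lemma rang_triangle A B Q : SO3 A -> SO3 B -> SO3 Q ->
  rang A Q <= rang A B + rang B Q.
Proof.
move=> hA hB hQ; have [u u1 eB] := rang_axis hA hB; have [v v1 eQ] := rang_axis hB hQ.
set p := rang A B in eB *; set q := rang B Q in eQ *.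
have /andP[p0 ppi] : 0 <= p <= pi by exact: rang_bounds.
have /andP[q0 qpi] : 0 <= q <= pi by exact: rang_bounds.
have pi0 := pi_gt0 R.
have [le|gt] := leP (p + q) pi; last first.
  by apply: le_trans (ltW gt); case/andP: (rang_bounds hA hQ).
rewrite rang_le // ?addr_ge0 //.
have -> : rcos A Q = (\tr (rotm u p *m rotm v q) - 1) / 2.
  rewrite /rcos eQ {1}eB -mulmxA mulmxA; have [-> _] := SO3_orth hA.
  by rewrite mul1mx.
pose c' := cos (p / 2) * cos (q / 2) - sin (p / 2) * sin (q / 2) * dotv u v.
rewrite mxtrace_rotm_mul // -/c'.
have d1 : dotv u v <= 1.
  by have := dotv_le u v; rewrite /enorm u1 v1 sqrtr1 mulr1.
have sp : 0 <= sin (p / 2) by apply: sin_ge0_pi; apply/andP; split; lra.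
have sq : 0 <= sin (q / 2) by apply: sin_ge0_pi; apply/andP; split; lra.
have cc : cos ((p + q) / 2) <= c'.
  rewrite /c' mulrDl cosD lerD2l lerN2 -[leRHS]mulr1.
  by rewrite ler_wpM2l // mulr_ge0.
have c0 : 0 <= cos ((p + q) / 2) by apply: cos_ge0_pihalf; apply/andP; split; lra.
have -> : cos (p + q) = 2 * cos ((p + q) / 2) ^+ 2 - 1.
  by rewrite [in LHS](splitr (p + q)) cosD -!expr2 sin2cos2; ring.
move: cc c0; set c := cos _ => cc c0; nra.
Qed.

(** A crude constant suffices: the bound only serves to make the angle Lipschitz in the matrix
    norm. *)
Lemma cos_le_quad t : 0 <= t -> t <= pi -> t ^+ 2 / 32 <= 1 - cos t.
Proof.
move=> t0 tpi.
have sin_ge (x : R) : 0 <= x -> x <= 1 -> x / 2 <= sin x.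
  move=> x0 x1; have [->|xn] := eqVneq x 0; first by rewrite sin0 mul0r.
  have xp : 0 < x by rewrite lt_neqAle eq_sym xn.
  have [|c] := @MVT R (@sin R) (@cos R) 0 x xp.
    by apply: continuous_subspaceT => z; exact: continuous_sin.
  rewrite in_itv /= => /andP[c0 cx]; rewrite sin0 !subr0 => ->.
  have := cos_ge_quad (ltW c0); have : c * c <= 1 by nra.
  by rewrite expr2; nra.
have e2 (x : R) : 1 - cos x = 2 * sin (x / 2) ^+ 2.
  by rewrite [in cos x](splitr x) cosD -!expr2 cos2sin2; ring.
have [t2|t2] := leP t 2.
  have := sin_ge (t / 2); rewrite divr_ge0 // ler_pdivrMr // mul1r => /(_ isT t2).
  by rewrite e2; nra.
have h1 : 1 - cos 2 <= 1 - cos t.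
  rewrite lerD2l lerN2; apply: ltW; have := pi_gt0 R => pi0.
  by rewrite ltr_cos // in_itv /=; apply/andP; split; lra.
have := sin_ge 1 ler01 (lexx _) => s1.
have : 2^-1 <= 1 - cos (2 : R).
  by rewrite e2 divff //; nra.
have t4 : t <= 4 by have := pihalf_lt2 R; lra.
have : t ^+ 2 <= 16 by nra.
by rewrite ler_pdivrMr //; lra.
Qed.

Lemma rang_le_norm A B : SO3 A -> SO3 B -> rang A B <= 9 * `|A - B|.
Proof.
move=> hA hB; have /andP[t0 tpi] := rang_bounds hA hB.
have := cos_le_quad t0 tpi; rewrite cos_rang // => h1.
have h3 : \sum_i \sum_j (A i j - B i j) ^+ 2 <= 9 * `|A - B| ^+ 2.
  rewrite (_ : 9 * _ = \sum_(i < 3) \sum_(j < 3) `|A - B| ^+ 2); last first.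
    by rewrite !sumr_const !card_ord -mulrnA -[RHS]mulr_natl.
  apply: ler_sum => i _; apply: ler_sum => j _.
  have := le_mx_norm (A - B) i j; rewrite !mxE => h.
  by rewrite -real_normK ?num_real // lerXn2r ?nnegrE.
move: h3; rewrite frob_rcos // => h3.
have n0 := normr_ge0 (A - B).
rewrite -(@ler_pXn2r _ 2) ?nnegrE ?mulr_ge0 //.
by rewrite exprMn; have := sqr_ge0 `|A - B|; lra.
Qed.

(** This makes angles along a Lipschitz solution absolutely continuous, corners included. *)
Lemma rang_lip A B A' B' : SO3 A -> SO3 B -> SO3 A' -> SO3 B' ->
  `|rang A' B' - rang A B| <= 9 * (`|A' - A| + `|B' - B|).
Proof.
move=> hA hB hA' hB'.
have k1 := rang_le_norm hA' hA; have k2 := rang_le_norm hB' hB.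
have t1 := rang_triangle hA' hA hB'; have t2 := rang_triangle hA hB hB'.
have t3 := rang_triangle hA hA' hB; have t4 := rang_triangle hA' hB' hB.
rewrite (rangC A A') in t3; rewrite (rangC B B') in t2.
by rewrite ler_norml; apply/andP; split; lra.
Qed.

Lemma is_derive_mxtrace (M : R -> 'M[R]_3) t (dM : 'M[R]_3) : is_derive t 1 M dM ->
  is_derive t 1 (fun s => \tr (M s)) (\tr dM).
Proof.
move=> /is_derive_mxP hM; rewrite mxtrace3E.
under eq_fun do rewrite mxtrace3E.
exact: (is_deriveD (is_deriveD (hM 0 0) (hM 1 1)) (hM 2 2)).
Qed.

Lemma is_derive_rang (c c' : R -> 'M[R]_3) t a b : SO3 (c t) -> SO3 (c' t) ->
  c t != c' t -> rang (c t) (c' t) < pi ->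
  is_derive t 1 c (c t *m hat a) -> is_derive t 1 c' (c' t *m hat b) ->
  is_derive t 1 (fun s => rang (c s) (c' s)) (- dotv (unitlog (c t) (c' t)) (a - b)).
Proof.
move=> hA hB AB hpi hc hc'.
have hr : is_derive t 1 (fun s => rcos (c s) (c' s))
    (2^-1 * dotv (axv ((c t)^T *m c' t)) (a - b)).
  have h1 := is_derive_mxtrace (is_derive_mulmx (is_derive_trmx hc) hc').
  have h2 := is_deriveZ (2^-1) (is_deriveB h1 (is_derive_cst (1 : R) t 1)).
  rewrite (_ : (fun s => rcos (c s) (c' s)) =
    2^-1 *: ((fun s => \tr ((c s)^T *m c' s)) - cst 1)); last first.
    by apply/funext => s; rewrite /rcos mulrC.
  apply: (is_derive_eqr h2); rewrite subr0 -[_ *: _]/(2^-1 * _); congr (_ * _).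
  rewrite trmx_mul hat_skew mxtraceD mulNmx mulNmx raddfN /= mulmxA mxtrace_hat.
  by rewrite -mulmxA mxtrace_mulC mxtrace_hat dotvDr dotvNr opprK.
have rb : -1 < rcos (c t) (c' t) < 1.
  rewrite -rang_ltpi // hpi /= lt_neqAle; have /andP[_ ->] := rcos_bounds hA hB.
  rewrite andbT; apply/eqP => r1; move: AB; rewrite (rang_eq0 hA hB) ?eqxx //.
  by rewrite /rang r1 acos1.
have := @is_derive1_comp _ (@acos R) (fun s => rcos (c s) (c' s)) t _ _ (is_derive1_acos rb) hr.
move=> h; apply: (is_derive_eqr h).
by rewrite /unitlog dotvZl invfM; ring.
Qed.

(* The chordal test function <T, A - B> with T = Q hat v bounds the angle from
   below, with equality to first order where A = B. *)
Lemma rang_ge_test A B Q v : SO3 A -> SO3 B -> SO3 Q -> dotv v v <= 1 ->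
  - (2^-1 * \tr ((Q *m hat v)^T *m (A - B))) <= rang A B.
Proof.
move=> hA hB hQ v1; have [->|AB] := eqVneq A B.
  by rewrite subrr mulmx0 mxtrace0 mulr0 oppr0; case/andP: (rang_bounds hB hB).
have t0 := rang_gt0 hA hB AB; set t := rang A B in t0 *.
set T := Q *m hat v.
have trE (S D : 'M[R]_3) : \tr (S^T *m D) = \sum_i \sum_j S i j * D i j.
  by rewrite mxtrace3E !mulmx3E !sum_ord3 !mxE; ring.
have tT : \sum_i \sum_j T i j ^+ 2 <= 2.
  have -> : \sum_i \sum_j T i j ^+ 2 = \tr (T^T *m T).
    by rewrite trE; apply: eq_bigr => i _; apply: eq_bigr => j _; rewrite expr2.
  rewrite /T trmx_mul -mulmxA (mulmxA _ Q); have [-> _] := SO3_orth hQ.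
  by rewrite mul1mx hat_skew mulNmx raddfN /= mxtrace_hatM; lra.
have tD : \sum_i \sum_j (A i j - B i j) ^+ 2 <= 2 * t ^+ 2.
  by rewrite frob_rcos // -cos_rang //; have := cos_ge_quad (ltW t0); rewrite -/t; lra.
have e1 : \tr (T^T *m (A - B)) = \sum_i \sum_j T i j * (A i j - B i j).
  rewrite trE; apply: eq_bigr => i _; apply: eq_bigr => j _; congr (_ * _).
  by rewrite mxE [X in _ + X]mxE.
have cs : - (2 * t * \sum_i \sum_j T i j * (A i j - B i j)) <=
    t ^+ 2 * (\sum_i \sum_j T i j ^+ 2) + \sum_i \sum_j (A i j - B i j) ^+ 2.
  rewrite !mulr_sumr -sumrN -big_split /=; apply: ler_sum => i _.
  rewrite !mulr_sumr -sumrN -big_split /=; apply: ler_sum => j _.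
  by have := sqr_ge0 (t * T i j + (A i j - B i j)); lra.
rewrite e1; set X := \sum_i _ in cs *.
have h1 := ler_wpM2l (sqr_ge0 t) tT.
have : - (2 * t * X) <= 4 * t ^+ 2 by lra.
have -> : - (2 * t * X) = t * (- (2 * X)) by ring.
have -> : 4 * t ^+ 2 = t * (4 * t) by ring.
rewrite ler_pM2l //; lra.
Qed.

Lemma ldiniD phi psi t d d' : ldini phi t d -> ldini psi t d' ->
  ldini (fun s => phi s + psi s) t (d + d').
Proof.
move=> h1 h2 e e0; have e2 : 0 < e / 2 by rewrite divr_gt0.
have [q1 q10 hq1] := h1 _ e2; have [q2 q20 hq2] := h2 _ e2.
exists (Num.min q1 q2); first by rewrite lt_min q10.
move=> s /andP[k1 st]; move: k1; rewrite ltrBlDr -ltrBlDl lt_min => /andP[k1 k2].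
have := hq1 s; rewrite st andbT => /(_ _)/wrap[]; first by lra.
have := hq2 s; rewrite st andbT => /(_ _)/wrap[]; first by lra.
lra.
Qed.

Lemma ldini_sum (I : Type) (r : seq I) (P : pred I) (phi : I -> R -> R) t (d : I -> R) :
  (forall i, P i -> ldini (phi i) t (d i)) ->
  ldini (fun s => \sum_(i <- r | P i) phi i s) t (\sum_(i <- r | P i) d i).
Proof.
move=> hp; elim: r => [|i r IH].
  under eq_fun do rewrite big_nil; rewrite big_nil.
  exact: ldini_derive (is_derive_cst _ _ _).
under eq_fun do rewrite big_cons; rewrite big_cons.
by case Pi : (P i) => //; apply: ldiniD => //; exact: hp.
Qed.

(* Where the two curves meet the angle has a corner, hence the freedom in [v]. *)
Lemma ldini_rang (c c' : R -> 'M[R]_3) t a b v :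
  (\forall s \near t, SO3 (c s)) -> (\forall s \near t, SO3 (c' s)) ->
  rang (c t) (c' t) < pi -> dotv v v <= 1 ->
  (c t != c' t -> v = unitlog (c t) (c' t)) ->
  is_derive t 1 c (c t *m hat a) -> is_derive t 1 c' (c' t *m hat b) ->
  ldini (fun s => rang (c s) (c' s)) t (- dotv v (a - b)).
Proof.
move=> hS hS' hpi v1 hv hc hc'; have hA := nbhs_singleton hS; have hB := nbhs_singleton hS'.
have [eAB|AB] := eqVneq (c t) (c' t); last first.
  by apply: ldini_derive; rewrite (hv AB); exact: is_derive_rang.
pose phi s := - (2^-1 * \tr ((c t *m hat v)^T *m (c s - c' s))).
have dphi : is_derive t 1 phi (- dotv v (a - b)).
  have h1 := is_derive_mulmx (is_derive_cst ((c t *m hat v)^T) t 1) (is_deriveB hc hc').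
  have h2 := is_deriveN (is_deriveZ (2^-1) (is_derive_mxtrace h1)).
  apply: (is_derive_eqr h2); rewrite mul0mx add0r -[_ *: _]/(2^-1 * _); congr (- _).
  rewrite -eAB -mulmxBr -hatN -hatD trmx_mul -mulmxA (mulmxA _ (c t)).
  have [-> _] := SO3_orth hA; rewrite mul1mx hat_skew mulNmx raddfN /= mxtrace_hatM.
  by rewrite mulNr opprK mulrA mulVf ?mul1r.
have [d d0 hd] : exists2 d : R, 0 < d & forall s, `|s - t| < d -> SO3 (c s) /\ SO3 (c' s).
  have [d /= d0 hd] := (nbhs_ballP _ _).1 (filterI hS hS').
  by exists d => // s st; apply: hd; rewrite /ball /= distrC.
move=> e e0; have [h h0 hh] := ldini_derive dphi e0.
exists (Num.min h d); first by rewrite lt_min h0.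
move=> s /andP[k1 st]; move: k1; rewrite ltrBlDr -ltrBlDl lt_min => /andP[k1 k2].
have := hh s; rewrite st andbT => /(_ _)/wrap[]; first by lra.
have [s1 s2] : SO3 (c s) /\ SO3 (c' s) by apply: hd; rewrite distrC gtr0_norm ?subr_gt0.
have := rang_ge_test s1 s2 hA v1; rewrite -/(phi s).
rewrite [in rang (c t)]eAB rangK // /phi eAB subrr mulmx0 mxtrace0 mulr0 oppr0; lra.
Qed.

End AngleMetric.

(** * Edge flows and dissipation *)

Lemma sum_edges (V : zmodType) (n : nat) (e : rel 'I_n) (T : 'I_n -> 'I_n -> V) :
  symmetric e -> irreflexive e ->
  \sum_i \sum_(j | e i j) T i j = \sum_(p in edges e) (T p.1 p.2 + T p.2 p.1).
Proof.
move=> sym irr; rewrite pair_big_dep /= big_split /=.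
rewrite (bigID (fun p : 'I_n * 'I_n => (p.1 < p.2)%N)) /=; congr (_ + _).
  by apply: eq_bigl => p; rewrite inE andbC.
pose sw (p : 'I_n * 'I_n) := (p.2, p.1).
have swK : involutive sw by case.
rewrite (reindex_inj (inv_inj swK)) /=; apply: eq_bigl => -[i j]; rewrite inE /= (sym j i).
rewrite -leqNgt leq_eqVlt andbC; case: eqP => [/val_inj ->|_] //=.
by rewrite irr andbF.
Qed.

Section Consensus.
Variables (R : realType) (n : nat) (e : rel 'I_n) (O : set 'M[R]_3).
Variables (f : 'I_n -> 'M[R]_3 -> R) (alpha gamma : R).
Hypotheses (OS : O `<=` @SO3 R) (Oo : open_SO3 O).
Hypothesis fC2 : forall i, C2_SO3 O (f i).
Hypotheses (a0 : 0 < alpha) (g0 : 0 < gamma) (tree : is_tree e).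
Implicit Types (A B : 'M[R]_3) (x : config R n) (y z : R -> config R n).
Implicit Types (u : 'cV[R]_3) (w : 'M[R]_(3, n)).

Let dom := network_dom e O.
Let h := network_field e alpha gamma f.
Let domS x (dx : dom x) : forall i, SO3 (x i) := network_dom_SO3 OS dx.

(** Solves w_i = alpha S_i - gamma grad f_i for S_i; for a general w in the Filippov map this
    defines the coupling. *)
Definition coupling x w i : 'cV[R]_3 := alpha^-1 *: (col i w + gamma *: grad (f i) (x i)).

(* Over one side of the cut at {i, j} the contributions of all other edges cancel. *)
Definition edge_flow x w i j : 'cV[R]_3 := \sum_(k in tree_side e i j) coupling x w k.

Lemma coupling_field x i : dom x ->
  coupling x (h x) i = \sum_(j | e i j) unitlog (x i) (x j).
Proof.
move=> dx; rewrite /coupling (network_fieldE f alpha gamma OS i dx) subrK scalerA.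
by rewrite mulVf ?scale1r // gt_eqF.
Qed.

Let field_bound x : dom x -> exists K : R, \forall x' \near cnbhs dom x,
  forall i, enorm (col i (h x')) <= K.
Proof.
move=> dx; pose G := \sum_i enorm (grad (f i) (x i)).
have hG i : enorm (grad (f i) (x i)) <= G.
  by rewrite /G (bigD1 i) //= lerDl sumr_ge0 // => j _; exact: enorm_ge0.
by eexists; exact: (network_field_bound OS Oo fC2 a0 g0 dx hG).
Qed.

Let lin (c : 'I_n -> R) u x w : R := \sum_k c k * dotv u (coupling x w k).

Let linE c u x w : alpha * lin c u x w =
  pairing (fun k => c k *: u) w + gamma * \sum_k c k * dotv u (grad (f k) (x k)).
Proof.
rewrite /lin /pairing !mulr_sumr -big_split /=; apply: eq_bigr => k _.
rewrite /coupling dotvZr dotvDr dotvZr dotvZl.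
by field; rewrite gt_eqF.
Qed.

Let lin_cvg c u x (g : config R n -> R) : dom x -> g x' @[x' --> cnbhs dom x] --> g x ->
  gamma * \sum_k c k * dotv u (grad (f k) (x' k)) - alpha * g x' @[x' --> cnbhs dom x] -->
  gamma * \sum_k c k * dotv u (grad (f k) (x k)) - alpha * g x.
Proof.
move=> dx cg; apply: cvgB; last by apply: cvgM => //; exact: cvg_cst.
apply: cvgM; first exact: cvg_cst.
apply: cvg_sumr => k; apply: cvgM; first exact: cvg_cst.
by apply: cvg_dotv => l; [exact: cvg_cst|exact: cvg_grad].
Qed.

(** [filippov_affine] for linear functionals of the couplings; the gradients are continuous and move
    into the affine term. *)
Lemma coupling_le c u x w (b : R) : dom x -> filippov_map dom h x w ->
  (forall x', dom x' ->
     \sum_k c k * dotv u (\sum_(j | e k j) unitlog (x' k) (x' j)) <= b) ->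
  \sum_k c k * dotv u (coupling x w k) <= b.
Proof.
move=> dx hw hb; have [K hK] := field_bound dx.
have := @filippov_affine R n dom h x w (fun _ k => - c k *: u)
  (fun x => - (gamma * \sum_k c k * dotv u (grad (f k) (x k)) - alpha * b)) K domS dx hK.
have pN v : pairing (fun k => - c k *: u) v = - pairing (fun k => c k *: u) v.
  by rewrite /pairing -sumrN; apply: eq_bigr => k _; rewrite !dotvZl mulNr.
rewrite pN => /(_ (fun k l => cvg_cst _)) /(_ (cvgN (lin_cvg dx (cvg_cst b)))).
have := linE c u x w; rewrite /lin => hx.
move=> k1; suff : 0 <= alpha * (b - \sum_k c k * dotv u (coupling x w k)).
  by rewrite pmulr_rge0 // subr_ge0.
rewrite mulrBr hx; apply: le_trans (k1 _ hw) _; last by lra.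
apply: filterS (cnbhs_dom dom x) => x' dx'; rewrite pN.
have := linE c u x' (h x'); rewrite /lin.
under eq_bigr do rewrite coupling_field //.
have := ler_wpM2l (ltW a0) (hb x' dx'); lra.
Qed.

Lemma coupling_eq c u x w (g : config R n -> R) : dom x -> filippov_map dom h x w ->
  g x' @[x' --> cnbhs dom x] --> g x ->
  (forall x', dom x' ->
     \sum_k c k * dotv u (\sum_(j | e k j) unitlog (x' k) (x' j)) = g x') ->
  \sum_k c k * dotv u (coupling x w k) = g x.
Proof.
move=> dx hw cg hg; have [K hK] := field_bound dx.
have := @filippov_affine_eq R n dom h x w (fun _ k => c k *: u)
  (fun x => gamma * \sum_k c k * dotv u (grad (f k) (x k)) - alpha * g x) K domS dx hK.
move=> /(_ (fun k l => cvg_cst _)) /(_ (lin_cvg dx cg)) k1.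
have := linE c u x w; rewrite /lin => hx.
have a00 : alpha != 0 by rewrite gt_eqF.
apply: (mulfI a00); rewrite hx; apply/eqP; rewrite -subr_eq0 -addrA; apply/eqP.
apply: k1 => //; apply: filterS (cnbhs_dom dom x) => x' dx'.
have := linE c u x' (h x'); rewrite /lin.
under eq_bigr do rewrite coupling_field //.
by rewrite hg // addrA => <-; rewrite subrr.
Qed.

Let sym : symmetric e. Proof. by case: tree. Qed.
Let irr : irreflexive e. Proof. by case: tree. Qed.

Let side_sum u x i j : e i j ->
  \sum_k (k \in tree_side e i j)%:R * dotv u (\sum_(l | e k l) unitlog (x k) (x l)) =
  dotv u (unitlog (x i) (x j)).
Proof.
move=> eij.
have <- := @sum_tree_side n R e i j (fun k l => dotv u (unitlog (x k) (x l))) tree eij _;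
  last first.
  by move=> k l; rewrite (unitlogN (x l)) dotvNr.
rewrite [RHS]big_mkcond /=; apply: eq_bigr => k _; rewrite dotv_sumr.
by case: ifP => _; rewrite ?mul1r ?mul0r.
Qed.

Lemma dotv_edge_flow u x w i j : dotv u (edge_flow x w i j) =
  \sum_k (k \in tree_side e i j)%:R * dotv u (coupling x w k).
Proof.
rewrite /edge_flow dotv_sumr big_mkcond /=; apply: eq_bigr => k _.
by case: ifP => _; rewrite ?mul1r ?mul0r.
Qed.

Lemma dotv_ext u v : (forall z : 'cV[R]_3, dotv z u = dotv z v) -> u = v.
Proof.
move=> huv; apply/eqP; rewrite -subr_eq0 -enorm_eq0 -sqrf_eq0 enorm_sqr.
by rewrite dotvDr dotvNr huv subrr.
Qed.

(** The bound on the field, tested against the flow v itself, gives |v|^2 <= |v|. *)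
Lemma edge_flow_le1 x w i j : dom x -> filippov_map dom h x w -> e i j ->
  dotv (edge_flow x w i j) (edge_flow x w i j) <= 1.
Proof.
move=> dx hw eij; set v := edge_flow x w i j.
have hv : dotv v v <= enorm v.
  rewrite {2}/v dotv_edge_flow; apply: coupling_le => // x' dx'.
  rewrite side_sum //; apply: le_trans (dotv_le _ _) _.
  have [_ he] := (network_domP e OS x').1 dx'.
  rewrite -[leRHS]mulr1 ler_wpM2l ?enorm_ge0 //.
  by apply: enorm_unitlog_le1; [exact: domS|exact: domS|exact: he].
have := enorm_ge0 v; rewrite -enorm_sqr in hv *; nra.
Qed.

Lemma edge_flow_unitlog x w i j : dom x -> filippov_map dom h x w -> e i j ->
  x i != x j -> edge_flow x w i j = unitlog (x i) (x j).
Proof.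
move=> dx hw eij xij; apply: dotv_ext => u; rewrite dotv_edge_flow.
apply: (@coupling_eq _ u x w (fun x => dotv u (unitlog (x i) (x j)))) => //.
  have [_ he] := (network_domP e OS x).1 dx.
  apply: cvg_dotv => l; first exact: cvg_cst.
  by apply: cvg_unitlog; try exact: cvg_cnbhs; [exact: domS|exact: domS|exact: xij|exact: he].
by move=> x' dx'; exact: side_sum.
Qed.

(** The coefficients [c] turn the difference of the two sides into a linear functional of the
    couplings. It vanishes on the field, hence on the Filippov map. *)
Lemma coupling_edge_flow x w i : dom x -> filippov_map dom h x w ->
  coupling x w i = \sum_(j | e i j) edge_flow x w i j.
Proof.
move=> dx hw; apply: dotv_ext => u; rewrite dotv_sumr; apply/eqP; rewrite -subr_eq0; apply/eqP.
pose c k : R := (k == i)%:R - \sum_(j | e i j) (k \in tree_side e i j)%:R.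
have E (s : 'I_n -> R) : \sum_k c k * s k =
    s i - \sum_(j | e i j) \sum_k (k \in tree_side e i j)%:R * s k.
  rewrite exchange_big /= -(_ : \sum_k (k == i)%:R * s k = s i); last first.
    by rewrite (bigD1 i) //= eqxx mul1r big1 ?addr0 // => k /negbTE ->; rewrite mul0r.
  by rewrite -sumrB; apply: eq_bigr => k _; rewrite /c mulrBl mulr_suml.
under eq_bigr do rewrite dotv_edge_flow.
rewrite -(E (fun k => dotv u (coupling x w k))).
apply: (@coupling_eq _ u x w (fun=> 0)) => //; first exact: cvg_cst.
move=> x' dx'; rewrite E; apply/eqP; rewrite subr_eq0 dotv_sumr; apply/eqP.
by apply: eq_bigr => j eij; rewrite side_sum.
Qed.

Lemma edge_flowN x w i j : dom x -> filippov_map dom h x w -> e i j ->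
  edge_flow x w j i = - edge_flow x w i j.
Proof.
move=> dx hw eij; apply: dotv_ext => u; rewrite dotvNr; apply/eqP; rewrite -addr_eq0; apply/eqP.
have eji : e j i by rewrite sym.
rewrite !dotv_edge_flow -big_split /=.
under eq_bigr do rewrite -mulrDl.
apply: (@coupling_eq _ u x w (fun=> 0)) => //; first exact: cvg_cst.
move=> x' dx'; under eq_bigr do rewrite mulrDl.
by rewrite big_split /= !side_sum // unitlogN dotvNr addNr.
Qed.

Lemma sum_coupling x w : dom x -> filippov_map dom h x w -> \sum_k coupling x w k = 0.
Proof.
move=> dx hw; apply: dotv_ext => u; rewrite dotv0 dotv_sumr.
under eq_bigr do rewrite -[dotv u _]mul1r.
apply: (@coupling_eq (fun=> 1) u x w (fun=> 0)) => //; first exact: cvg_cst.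
move=> x' dx'; under eq_bigr do rewrite mul1r dotv_sumr.
rewrite (sum_edges (fun i j => dotv u (unitlog (x' i) (x' j)))) //.
by apply: big1 => p _; rewrite unitlogN dotvNr addNr.
Qed.

(* The unit flow of a disagreeing edge is counted on each side of the cut. *)
Lemma coupling_norm_ge2 x w i j : dom x -> filippov_map dom h x w -> e i j ->
  x i != x j -> 2 <= \sum_k enorm (coupling x w k).
Proof.
move=> dx hw eij xij; have [_ he] := (network_domP e OS x).1 dx.
have [u1 _] := unitlogP (domS dx i) (domS dx j) xij (he i j eij).
have n1 : enorm (edge_flow x w i j) = 1.
  by rewrite edge_flow_unitlog // /enorm u1 sqrtr1.
rewrite (bigID (mem (tree_side e i j))) /=.
have k1 : 1 <= \sum_(k in tree_side e i j) enorm (coupling x w k).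
  by rewrite -n1; exact: enorm_sum.
have k2 : 1 <= \sum_(k | k \notin tree_side e i j) enorm (coupling x w k).
  apply: le_trans (enorm_sum _ _ _); rewrite -n1 -(enormN (edge_flow x w i j)).
  have := sum_coupling dx hw; rewrite (bigID (mem (tree_side e i j))) /=.
  by move/eqP; rewrite addr_eq0 => /eqP; rewrite /edge_flow => ->; rewrite opprK.
lra.
Qed.

Definition dissipation x w : R :=
  \sum_(p in edges e) dotv (edge_flow x w p.1 p.2) (col p.1 w - col p.2 w).

Lemma dissipationE x w : dom x -> filippov_map dom h x w ->
  dissipation x w = \sum_i dotv (coupling x w i) (col i w).
Proof.
move=> dx hw.
have -> : \sum_i dotv (coupling x w i) (col i w) =
    \sum_i \sum_(j | e i j) dotv (edge_flow x w i j) (col i w).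
  apply: eq_bigr => i _; rewrite coupling_edge_flow // dotvC dotv_sumr.
  by apply: eq_bigr => j _; rewrite dotvC.
rewrite (sum_edges (fun i j => dotv (edge_flow x w i j) (col i w))) //.
apply: eq_bigr => p; rewrite inE => /andP[_ ep].
by rewrite (edge_flowN dx hw ep) dotvNl dotvDr dotvNr.
Qed.

Lemma sum_sqr_ge (m : nat) (s : 'I_m -> R) : (\sum_i s i) ^+ 2 <= m%:R * \sum_i s i ^+ 2.
Proof.
case: m s => [s|m s]; first by rewrite !big_ord0 expr0n mul0r.
set S := \sum_i s i; have M0 : 0 < (m.+1%:R : R) by [].
have : 0 <= \sum_i (s i - S / m.+1%:R) ^+ 2 by apply: sumr_ge0 => i _; exact: sqr_ge0.
have gen (c : R) : \sum_i (s i - c) ^+ 2 =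
    \sum_i s i ^+ 2 - 2 * c * \sum_i s i + m.+1%:R * c ^+ 2.
  have -> : m.+1%:R * c ^+ 2 = \sum_(i < m.+1) c ^+ 2 by rewrite sumr_const card_ord mulr_natl.
  rewrite mulr_sumr -sumrB -big_split /=.
  by apply: eq_bigr => i _; ring.
have -> : \sum_i (s i - S / m.+1%:R) ^+ 2 = \sum_i s i ^+ 2 - S ^+ 2 / m.+1%:R.
  by rewrite gen -/S; field; rewrite addrC natr1 pnatr_eq0.
by rewrite subr_ge0 ler_pdivrMr // mulrC.
Qed.

(** With S the sum of the norms of the couplings, Cauchy-Schwarz bounds n times the dissipation
    below by alpha S^2 - gamma n M S. *)
Lemma dissipation_ge x w (M : R) i j : dom x -> filippov_map dom h x w ->
  (forall k, enorm (grad (f k) (x k)) <= M) -> n%:R * M / 2 < alpha / gamma ->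
  e i j -> x i != x j -> 2 / n%:R * (2 * alpha - gamma * n%:R * M) <= dissipation x w.
Proof.
move=> dx hw hM ratio eij xij; rewrite dissipationE //.
have s2 := coupling_norm_ge2 dx hw eij xij; set S := \sum_k enorm _ in s2.
have n0 : 0 < (n%:R : R) by rewrite ltr0n (leq_ltn_trans (leq0n i)).
have k1 : alpha * (\sum_k enorm (coupling x w k) ^+ 2) - gamma * M * S <=
    \sum_i dotv (coupling x w i) (col i w).
  rewrite !mulr_sumr -sumrB; apply: ler_sum => k _.
  have -> : col k w = alpha *: coupling x w k - gamma *: grad (f k) (x k).
    by rewrite /coupling scalerA divff ?scale1r ?addrK // gt_eqF.
  move: (coupling x w k) (hM k) => s; move: (grad _ _) => g hg.
  rewrite dotvDr dotvNr !dotvZr enorm_sqr lerD2l lerN2 -mulrA ler_wpM2l ?(ltW g0) //.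
  by apply: le_trans (dotv_le _ _) _; rewrite mulrC ler_wpM2r ?enorm_ge0.
have k2 := sum_sqr_ge (fun k => enorm (coupling x w k)); rewrite -/S in k2.
set Q := \sum_k enorm _ ^+ 2 in k1 k2.
have r1 : gamma * n%:R * M < 2 * alpha.
  by move: ratio; rewrite ltr_pdivrMr // mulrAC ltr_pdivlMr // => ?; lra.
apply: le_trans k1; rewrite -(ler_pM2l n0).
have -> : n%:R * (2 / n%:R * (2 * alpha - gamma * n%:R * M)) =
  2 * (2 * alpha - gamma * n%:R * M) by field; rewrite gt_eqF.
have k3 := ler_wpM2l (ltW a0) k2.
(* This product is alpha S^2 - gamma n M S minus its value at S = 2; both factors are nonnegative,
   as S >= 2 and gamma n M < 2 alpha. *)
have k4 : 0 <= (S - 2) * (alpha * S + 2 * alpha - gamma * n%:R * M).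
  apply: mulr_ge0; first by rewrite subr_ge0.
  have : alpha * 2 <= alpha * S by rewrite ler_pM2l.
  by have := a0; lra.
nra.
Qed.

End Consensus.

(** * Finite-time consensus *)

Section FiniteTime.
Variables (R : realType) (n : nat) (e : rel 'I_n) (O : set 'M[R]_3).
Variables (f : 'I_n -> 'M[R]_3 -> R) (alpha gamma rho M : R) (Rc : 'M[R]_3).
Hypotheses (OS : O `<=` @SO3 R) (Oo : open_SO3 O).
Hypothesis fC2 : forall i, C2_SO3 O (f i).
Hypotheses (a0 : 0 < alpha) (g0 : 0 < gamma) (tree : is_tree e).
Hypotheses (hRc : SO3 Rc) (r0 : 0 < rho) (rpi : rho < pi / 2).
Let C := gcball Rc rho.
Hypothesis CO : C `<=` O.
Hypotheses (M0 : 0 < M) (hM : forall i A, C A -> enorm (grad (f i) A) <= M).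
Hypothesis inward : forall i A, SO3 A -> gdist A Rc = rho ->
  dotv (dir_to Rc A) (grad (f i) A) <= 0.
Implicit Types (A B : 'M[R]_3) (x : config R n) (y z : R -> config R n).
Local Notation mu := (@lebesgue_measure R).

Let dom := network_dom e O.
Let h := network_field e alpha gamma f.
Let domS x (dx : dom x) : forall i, SO3 (x i) := network_dom_SO3 OS dx.
Let sym : symmetric e. Proof. by case: tree. Qed.
Let irr : irreflexive e. Proof. by case: tree. Qed.

Lemma ac_ldini a b k (phi : R -> R) : a <= b -> abs_continuous a b phi ->
  {ae mu, forall t, a < t < b -> ldini phi t (k * phi t)} ->
  phi b <= phi a * expR (k * (b - a)).
Proof.
move=> ab ac hd; apply: (ac_gronwall ab ac); apply: aeS hd => t ht tab eps e0.
by have [q q0 hq] := ht tab eps e0; exists q => // s _; exact: hq.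
Qed.

(** W without logarithms; the two agree on the domain by [disagreementE]. *)
Definition total_angle x : R := \sum_(p in edges e) rang (x p.1) (x p.2).

Lemma disagreementE x : dom x -> disagreement e x = total_angle x.
Proof.
move=> dx; have [_ he] := (network_domP e OS x).1 dx.
apply: eq_bigr => p; rewrite inE => /andP[_ ep].
by apply: enorm_err; [exact: domS|exact: domS|exact: he].
Qed.

Lemma rang_ge0 A B : SO3 A -> SO3 B -> 0 <= rang A B.
Proof. by move=> hA hB; case/andP: (rang_bounds hA hB). Qed.

Lemma total_angle_ge0 x : dom x -> 0 <= total_angle x.
Proof. by move=> dx; apply: sumr_ge0 => p _; apply: rang_ge0; exact: domS. Qed.

Lemma total_angle_gt0 x : dom x -> 0 < total_angle x ->
  exists i j, e i j /\ x i != x j.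
Proof.
move=> dx; apply: contraPP => no; rewrite /total_angle big1 ?ltxx // => p.
rewrite inE => /andP[_ ep].
have [->|np] := eqVneq (x p.1) (x p.2); first by rewrite rangK //; exact: domS.
by exfalso; apply: no; exists p.1, p.2.
Qed.

Lemma total_angle_eq0 x : dom x -> total_angle x <= 0 -> forall i j, x i = x j.
Proof.
move=> dx h0; have edge_eq i j : e i j -> x i = x j.
  have main (k l : 'I_n) : (k < l)%N -> e k l -> x k = x l.
    move=> kl ekl; apply: (rang_eq0 (domS dx k) (domS dx l)).
    apply/eqP; rewrite eq_le (rang_ge0 (domS dx k) (domS dx l)) andbT.
    apply: le_trans h0; rewrite /total_angle (bigD1 (k, l)) /=; last by rewrite inE kl ekl.
    by rewrite lerDl; apply: sumr_ge0 => p _; apply: rang_ge0; exact: domS.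
  move=> eij; have [ij|ji|/val_inj ->] := ltngtP i j; last by [].
  - exact: main.
  - by apply/esym/main => //; rewrite sym.
move=> i j; have [_ _ con _] := tree; have /connectP[p hp ->] := con i j.
elim: p i hp => //= k p IH i /andP[eik hp].
by rewrite (edge_eq i k eik); exact: IH.
Qed.

Section Solution.
Variable y : R -> config R n.
Hypothesis sol : forall T, 0 < T -> solution_on dom h 0 T y.
Hypothesis Cy : forall t, 0 <= t -> forall i, C (y t i).

Let dy t : 0 <= t -> dom (y t).
Proof. by move=> t0; apply: (ball_dom e OS hRc r0 rpi CO); exact: Cy. Qed.

Let K : R := alpha * n%:R + gamma * (M + 1).

Lemma solution_lipschitz s t i : 0 <= s -> s <= t -> `|y t i - y s i| <= 3 * K * (t - s).
Proof.
move=> s0 st; have T0 : 0 < t + 1 by rewrite ltr_wpDl // (le_trans s0).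
have t1 : t <= t + 1 by rewrite lerDl.
apply: (solution_ball_lipschitz OS Oo fC2 a0 g0 sym hRc r0 rpi CO M0 hM inward (ltW T0)
  (sol T0)) => //.
- exact: Cy.
- by rewrite s0 (le_trans st).
- by rewrite (le_trans s0) ?t1.
Qed.

Let K0 : 0 <= 3 * K.
Proof. by rewrite mulr_ge0 // addr_ge0 // mulr_ge0 // ?ltW // addr_gt0. Qed.

Lemma rang_solution_ac i j a b : 0 <= a ->
  abs_continuous a b (fun t => rang (y t i) (y t j)).
Proof.
move=> a_0; apply: (@ac_lipschitz R _ a b _ (9 * (3 * K + 3 * K))).
  by rewrite mulr_ge0 // addr_ge0.
move=> s t /andP[as_ _] /andP[at_ _] st.
have s0 := le_trans a_0 as_; have t0 := le_trans a_0 at_.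
have ds := dy s0; have dt := dy t0.
apply: le_trans (rang_lip (domS ds i) (domS ds j) (domS dt i) (domS dt j)) _.
rewrite -mulrA ler_pM2l // mulrDl.
by apply: lerD; exact: solution_lipschitz.
Qed.

Lemma total_angle_ac a b : 0 <= a -> abs_continuous a b (fun t => total_angle (y t)).
Proof.
move=> a_0; rewrite (_ : (fun t => _) = fun t =>
  \sum_p (if p \in edges e then rang (y t p.1) (y t p.2) else 0)); last first.
  by apply/funext => t; rewrite /total_angle big_mkcond.
apply: (@ac_sum R a b _ _ (fun (p : 'I_n * 'I_n) t => if p \in edges e then rang (y t p.1)
  (y t p.2) else 0)).
move=> p; case: (p \in edges e); [exact: rang_solution_ac|exact: ac_cst].
Qed.

Lemma total_angle_ldini t w : 0 < t -> filippov_map dom h (y t) w ->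
  (forall i, is_derive t 1 (fun s => y s i) (y t i *m hat (col i w))) ->
  ldini (fun s => total_angle (y s)) t (- dissipation e f alpha gamma (y t) w).
Proof.
move=> t0 hw hd; have dt := dy (ltW t0).
have [_ he] := (network_domP e OS (y t)).1 dt.
have hS i : \forall s \near t, SO3 (y s i).
  have : \forall s \near t, 0 < s by exact: lt_nbhsr.
  by apply: filterS => s s0; apply: domS; exact/dy/ltW.
rewrite /dissipation -sumrN; apply: ldini_sum => p; rewrite inE => /andP[_ ep].
apply: ldini_rang => //; [exact: he|exact: (edge_flow_le1 OS Oo fC2 a0 g0 tree dt hw ep)|].
by move=> np; exact: (edge_flow_unitlog OS Oo fC2 a0 g0 tree dt hw ep np).
Qed.

Hypothesis ratio : n%:R * M / 2 < alpha / gamma.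

Let kappa : R := 2 / n%:R * (2 * alpha - gamma * n%:R * M).

Lemma total_angle_rate T : 0 < T -> {ae mu, forall t, 0 < t < T ->
  ldini (fun s => total_angle (y s)) t 0 /\
  (0 < total_angle (y t) -> ldini (fun s => total_angle (y s)) t (- kappa))}.
Proof.
move=> T0; apply: aeS (solution_velocity domS (sol T0)) => t hv tT.
have [w hw hd] := hv tT; have /andP[t0 _] := tT; have dt := dy (ltW t0).
have n1 : 0 < total_angle (y t) -> kappa <= dissipation e f alpha gamma (y t) w.
  move=> W0; have [i [j [eij xij]]] := total_angle_gt0 dt W0.
  apply: (dissipation_ge OS Oo fC2 a0 g0 tree dt hw _ ratio eij xij) => k.
  by apply: hM; apply: Cy; exact: ltW.
have n2 : 0 < total_angle (y t) -> ldini (fun s => total_angle (y s)) t (- kappa).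
  by move=> W0; apply: ldini_le (total_angle_ldini t0 hw hd); rewrite lerN2; exact: n1.
split => //; have [W0|W0] := leP (total_angle (y t)) 0; last first.
  apply: ldini_le (n2 W0); rewrite oppr_le0.
  have n0 : (0 < n)%N by have [_ _ _ <-] := tree.
  have nR : 0 < (n%:R : R) by rewrite ltr0n.
  rewrite /kappa mulr_ge0 // ?divr_ge0 // ?ltW // subr_gt0.
  by move: ratio; rewrite ltr_pdivrMr // mulrAC ltr_pdivlMr // => ?; lra.
(* At a zero of the nonnegative W, the difference W(t) - W(s) is nonpositive for every earlier s. *)
move=> eps e0; exists t => // s /andP[]; rewrite subrr => s0 st.
have := total_angle_ge0 (dy (ltW s0)); have : 0 <= (0 + eps) * (t - s).
  by rewrite add0r mulr_ge0 ?subr_ge0 // ltW.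
lra.
Qed.

Lemma total_angle_nonincreasing s t : 0 <= s -> s <= t ->
  total_angle (y t) <= total_angle (y s).
Proof.
move=> s0 st; have T0 : 0 < t + 1 by rewrite ltr_wpDl // (le_trans s0).
have -> : total_angle (y s) = total_angle (y s) * expR (0 * (t - s)).
  by rewrite mul0r expR0 mulr1.
apply: (ac_ldini st (total_angle_ac _ s0)); apply: aeS (total_angle_rate T0) => r hr /andP[sr rt].
have [|h1 _] := hr; last by rewrite mul0r.
by rewrite (le_lt_trans s0) //= (lt_trans rt) // ltrDl.
Qed.

(** If W were positive at T, it would be positive on all of [0, T] by monotonicity. Then W + kappa t
    would not increase, and W(T) <= W(0) - kappa T = 0. *)
Lemma total_angle_extinct : total_angle (y (total_angle (y 0) / kappa)) <= 0.
Proof.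
have n0 : (0 < n)%N by have [_ _ _ <-] := tree.
have nR : 0 < (n%:R : R) by rewrite ltr0n.
have k0 : 0 < kappa.
  rewrite /kappa mulr_gt0 // ?divr_gt0 // subr_gt0.
  by move: ratio; rewrite ltr_pdivrMr // mulrAC ltr_pdivlMr // => ?; lra.
set T := total_angle (y 0) / kappa; have W0 := total_angle_ge0 (dy (lexx 0)).
have T0 : 0 <= T by rewrite divr_ge0 // ltW.
rewrite leNgt; apply/negP => WT.
pose psi t := total_angle (y t) + kappa * t.
have T1 : 0 < T + 1 by rewrite ltr_wpDl.
have : psi T <= psi 0.
  have -> : psi 0 = psi 0 * expR (0 * (T - 0)) by rewrite mul0r expR0 mulr1.
  apply: (ac_ldini T0).
    apply: ac_add; first exact: total_angle_ac.
    apply: (@ac_lipschitz R _ 0 T _ kappa (ltW k0)) => s t _ _ st.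
    by rewrite -mulrBr normrM gtr0_norm // ger0_norm ?subr_ge0.
  apply: aeS (total_angle_rate T1) => t ht /andP[t0 tT].
  have [|_ h1] := ht; first by rewrite t0 (lt_trans tT) // ltrDl.
  have Wt : 0 < total_angle (y t).
    exact: lt_le_trans WT (total_angle_nonincreasing (ltW t0) (ltW tT)).
  have h2 := ldini_derive (is_deriveZ kappa (is_derive_id t (1 : R))).
  rewrite mul0r -(addNr kappa); apply: ldiniD; first exact: h1.
  by move: h2; rewrite -[kappa *: 1]/(kappa * 1) mulr1.
rewrite /psi mulr0 addr0 {2}/T mulrCA divff ?mulr1 ?gt_eqF //; lra.
Qed.

Lemma finite_time_consensus : exists T : R, [/\ 0 <= T,
  T <= n%:R * disagreement e (y 0) / (2 * (2 * alpha - gamma * n%:R * M))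
  & consensus_from y T].
Proof.
have n0 : (0 < n)%N by have [_ _ _ <-] := tree.
have nR : 0 < (n%:R : R) by rewrite ltr0n.
have k1 : 0 < 2 * alpha - gamma * n%:R * M.
  rewrite subr_gt0; move: ratio; rewrite ltr_pdivrMr // mulrAC ltr_pdivlMr // => ?; lra.
have k0 : 0 < kappa by rewrite /kappa mulr_gt0 // divr_gt0.
have W0 := total_angle_ge0 (dy (lexx 0)).
exists (total_angle (y 0) / kappa); split.
- by rewrite divr_ge0 // ltW.
- rewrite (disagreementE (dy (lexx 0))) /kappa le_eqVlt; apply/orP; left; apply/eqP.
  by field; rewrite !gt_eqF.
move=> t Tt; have T0 : 0 <= total_angle (y 0) / kappa by rewrite divr_ge0 // ltW.
apply: total_angle_eq0; first exact/dy/(le_trans T0).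
exact: le_trans (total_angle_nonincreasing T0 Tt) total_angle_extinct.
Qed.

End Solution.
End FiniteTime.

(** * Sums, Hessians and geodesic convexity of the ball *)

Section SmoothSums.
Variable R : realType.
Implicit Types (A B : 'M[R]_3) (u xi : 'cV[R]_3) (O U : set 'M[R]_3) (g f : 'M[R]_3 -> R).

Lemma C2_onP U g : C2_on U g <-> [/\ forall A, U A -> {for A, continuous g}, C1_on U g
  & forall V, C1_on U ('D_V g)].
Proof.
split=> [h|[h1 h2 h3] A UA].
  by split=> [A UA|A UA V|V A UA W]; have [? ? ?] := h A UA.
by split=> [|V|V W]; [exact: h1|exact: (h2 A UA V)|exact: (h3 V A UA W)].
Qed.

Lemma C2_on_sum U (I : Type) (r : seq I) (g : I -> 'M[R]_3 -> R) : open U ->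
  (forall i, C2_on U (g i)) -> C2_on U (fun A => \sum_(i <- r) g i A).
Proof.
move=> oU hg; have hg' i := (C2_onP U (g i)).1 (hg i); apply/C2_onP; split.
- move=> A UA; apply: (@cvg_sumr R _ (nbhs A)) => i.
  by have [h _ _] := hg' i; exact: h.
- by apply: C1_on_sum => // i; have [] := hg' i.
move=> V; apply: (@C1_on_near _ U (fun A => \sum_(i <- r) 'D_V (g i) A)) => //; last first.
  by apply: C1_on_sum => // i; have [_ _] := hg' i; exact.
move=> A UA; apply/esym/derive_val/is_derive_bigsum => i; apply: derivableP.
by have [_ h _] := hg' i; have [] := h A UA V.
Qed.

Lemma C2_on_sub U U' g : U' `<=` U -> C2_on U g -> C2_on U' g.
Proof. by move=> UU h A UA; apply: h; exact: UU. Qed.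

Lemma C2_SO3_sum n O (f : 'I_n -> 'M[R]_3 -> R) : (forall i, C2_SO3 O (f i)) ->
  C2_SO3 O (fun A => \sum_(i < n) f i A).
Proof.
move=> hf A OA; have h i := hf i A OA.
pose U i := sval (cid (h i)); pose g i := sval (cid (svalP (cid (h i)))).
have hUg i : [/\ open (U i), U i A, C2_on (U i) (g i) & forall B, U i B -> O B -> g i B = f i B].
  exact: (svalP (cid (svalP (cid (h i))))).
(* The local extensions share the interior of the finite intersection of their domains. *)
pose W : set 'M[R]_3 := interior [set B | forall i, U i B].
exists W, (fun B => \sum_(i < n) g i B).
have WU i : W `<=` U i by move=> B /interior_subset; exact.
split.
- exact: open_interior.
- apply: (@filter_forall _ _ _ (nbhs A)) => i; have [oU UA _ _] := hUg i.
  exact: open_nbhs_nbhs.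
- apply: C2_on_sum; first exact: open_interior.
  by move=> i; apply: (C2_on_sub (WU i)); have [] := hUg i.
- by move=> B WB OB; apply: eq_bigr => i _; have [_ _ _] := hUg i; apply => //; exact: WU.
Qed.

Section Frame.
Variable O : set 'M[R]_3.
Hypotheses (OS : O `<=` @SO3 R) (Oo : open_SO3 O).

Let curve A xi : is_derive (0 : R) 1 (fun t => A *m expm (t *: hat xi))
  (A *m expm (0 *: hat xi) *m hat xi).
Proof. exact: is_derive_expm_curve. Qed.

Let near_curve A xi : O A -> \forall t \near (0 : R), O (A *m expm (t *: hat xi)).
Proof.
move=> OA; have O0 : O (A *m expm (0 *: hat xi)) by rewrite scale0r expm0 mulmx1.
apply: (@near_open_SO3 R O (fun t => A *m expm (t *: hat xi)) 0 Oo O0).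
- by apply: differentiable_continuous; apply/derivable1_diffP; have [] := curve A xi.
- by near=> t; apply: SO3_expm_hat; exact: OS.
Unshelve. all: by end_near.
Qed.

Lemma lieD_ext xi f g A : O A -> (forall B, O B -> f B = g B) -> lieD xi f A = lieD xi g A.
Proof.
move=> OA fg; rewrite /lieD !derive1E; apply: near_eq_derive.
by have := near_curve xi OA; apply: filterS => t; exact: fg.
Qed.

Lemma is_derive_lie f xi A : C1_SO3 O f -> O A ->
  is_derive (0 : R) 1 (fun t => f (A *m expm (t *: hat xi))) (dotv xi (grad f A)).
Proof.
move=> hf OA; have e0 : A *m expm (0 *: hat xi) = A by rewrite scale0r expm0 mulmx1.
have := @is_derive_C1_SO3 R O f (fun t => A *m expm (t *: hat xi)) 0 xi Oo hf.
rewrite e0 => /(_ OA); apply; first by near=> t; apply: SO3_expm_hat; exact: OS.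
by have := curve A xi; rewrite e0.
Unshelve. all: by end_near.
Qed.

Lemma lieD_lincomb n (c : 'I_n -> R) (g : 'I_n -> 'M[R]_3 -> R) xi A :
  (forall i, C1_SO3 O (g i)) -> O A ->
  lieD xi (fun B => \sum_i c i * g i B) A = \sum_i c i * lieD xi (g i) A.
Proof.
move=> hg OA; rewrite {1}/lieD derive1E; apply: derive_val.
apply: is_derive_bigsum => i; rewrite (lieD_grad xi Oo (hg i) OA).
exact: (is_deriveZ (c i) (is_derive_lie xi (hg i) OA)).
Qed.

Lemma grad_sum n (f : 'I_n -> 'M[R]_3 -> R) A : (forall i, C1_SO3 O (f i)) -> O A ->
  grad (fun B => \sum_(i < n) f i B) A = \sum_i grad (f i) A.
Proof.
move=> hf OA; apply/colP => k; rewrite grad_entry summxE.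
have := lieD_lincomb (fun=> 1) (basev R k) hf OA.
have -> : (fun B => \sum_(i < n) 1 * f i B) = (fun B => \sum_(i < n) f i B).
  by apply/funext => B; apply: eq_bigr => i _; rewrite mul1r.
by move=> ->; apply: eq_bigr => i _; rewrite mul1r grad_entry.
Qed.

Lemma crossN u v : cross u v = - cross v u.
Proof. by apply: cv3P; rewrite [RHS]mxE !mxE /=; ring. Qed.

Lemma quad_form_sym u (H : 'M[R]_3) (a c : 'I_3 -> 'I_3 -> R) :
  (forall i j, H i j = a i j - 2^-1 * c i j) -> (forall i j, c i j = - c j i) ->
  dotv u (H *m u) = \sum_(j < 3) u j 0 * \sum_(i < 3) u i 0 * a i j.
Proof.
move=> hH hc; rewrite dotvE !mulmx3E !hH (hc 1 0) (hc 2 0) (hc 2 1) !sum_ord3.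
have c0 i : c i i = 0 by have := hc i i; lra.
by rewrite !c0; ring.
Qed.

(** The term of the connection is antisymmetric in the two frame fields, so it drops out on the
    diagonal; what remains is the second derivative along the geodesic A exp(s u^). *)
Lemma hess_quad f A u : C2_SO3 O f -> O A ->
  dotv u (hess f A *m u) = lieD u (lieD u f) A.
Proof.
move=> f2 OA; have f1 := C2_C1_SO3 f2.
have c1 xi := C2_SO3_lieD xi Oo f2.
have -> : lieD u (lieD u f) A = lieD u (fun B => \sum_(j < 3) u j 0 * lieD (basev R j) f B) A.
  apply: lieD_ext => // B OB; rewrite (lieD_grad u Oo f1 OB) dotvE !grad_entry.
  by rewrite sum_ord3.
rewrite (lieD_lincomb _ _ (fun j => c1 (basev R j)) OA).
have L j : lieD u (lieD (basev R j) f) A = \sum_(i < 3) u i 0 * lieD (basev R i)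
  (lieD (basev R j) f) A.
  rewrite (lieD_grad u Oo (c1 (basev R j)) OA) dotvE sum_ord3; congr (_ + _ + _);
    by rewrite grad_entry.
under eq_bigr do rewrite L.
apply: (@quad_form_sym u (hess f A) (fun i j => lieD (basev R i) (lieD (basev R j) f) A)
  (fun i j => lieD (cross (basev R i) (basev R j)) f A)) => i j; first by rewrite mxE.
by rewrite !(lieD_grad _ Oo f1 OA) crossN dotvNl.
Qed.

End Frame.

Lemma derive_local_min (phi : R -> R) (d : R) : is_derive (0 : R) 1 phi d ->
  (\forall t \near (0 : R), phi 0 <= phi t) -> d = 0.
Proof.
move=> hd hmin; apply/eqP; apply: contraT => d0.
have e0 : 0 < `|d| / 2 by rewrite divr_gt0 // normr_gt0.
have [r r0 hr] := (is_derive_epsP _ _ _).1 hd _ e0.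
have [r' r'0 hr'] := (nbhs_ballP _ _).1 hmin; have r'p : 0 < r' by [].
pose m := Num.min r r' / 2.
have m0 : 0 < m by rewrite divr_gt0 // lt_min r0.
have mr : m < r.
  have : Num.min r r' <= r by rewrite ge_min lexx.
  by rewrite /m; lra.
have mr' : m < r'.
  have : Num.min r r' <= r' by rewrite ge_min lexx orbT.
  by rewrite /m; lra.
have sm (sg : R) : `|sg| = 1 -> `|sg * m| = m by move=> s1; rewrite normrM s1 mul1r gtr0_norm.
have main (sg : R) : `|sg| = 1 -> - (sg * d) <= `|d| / 2.
  move=> s1; have := hr (sg * m); rewrite subr0 (sm _ s1) => /(_ mr).
  have : phi 0 <= phi (sg * m).
    by apply: hr'; rewrite /ball /= sub0r normrN (sm _ s1).
  rewrite -[_ *: d]/(sg * m * d) ler_norml => k1 /andP[_ k2].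
  by rewrite -(ler_pM2l m0); lra.
have := main 1 (normr1 _); have := main (-1); rewrite normrN1 => /(_ erefl).
by move: e0; case: (ltrgt0P d) d0 => // dd _; lra.
Qed.

(** Along a geodesic, g(s) - a is a combination of cos s and sin s, so sin D (g(s) - a) = sin(D -
    s)(g(0) - a) + sin s (g(D) - a). The weights on the right add up to at least sin D, and a <= 0 <
    m. This is the geodesic convexity of the ball. *)
Lemma ball_geodesic Q A u (m D s : R) : SO3 Q -> SO3 A -> dotv u u = 1 -> 0 < D < pi ->
  0 <= s <= D -> 0 < m -> m <= rcos Q A -> m <= rcos Q (A *m rotm u D) ->
  m <= rcos Q (A *m rotm u s).
Proof.
move=> hQ hA u1 /andP[D0 Dpi] /andP[s0 sD] m0 gA gB.
set q := dotv u (Q^T *m A *m u); pose a := (q - 1) / 2.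
have q1 : q <= 1 by apply: dotv_SO3_le => //; exact: SO3_trmul.
pose b := \tr (Q^T *m A); pose r := dotv (axv (Q^T *m A)) u.
have gE t : rcos Q (A *m rotm u t) = a + (b - q) / 2 * cos t - r / 2 * sin t.
  by rewrite /rcos mulmxA mxtrace_mul_rotm // -/q -/b -/r /a; field.
have g0 : rcos Q A = a + (b - q) / 2 by rewrite /rcos -/b /a; field.
have sinD0 : 0 < sin D by apply: sin_gt0_pi; rewrite D0.
have h1 : sin D * (rcos Q (A *m rotm u s) - a) =
   sin (D - s) * (rcos Q A - a) + sin s * (rcos Q (A *m rotm u D) - a).
  by rewrite !gE g0 sinB; ring.
have s1 : 0 <= sin s by apply: sin_ge0_pi; rewrite s0 (le_trans sD) // ltW.
have s2 : 0 <= sin (D - s) by apply: sin_ge0_pi; apply/andP; split; lra.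
have s3 : sin D <= sin (D - s) + sin s.
  have -> : sin D = sin (D - s) * cos s + cos (D - s) * sin s by rewrite -sinD subrK.
  by have := cos_le1 s; have := cos_le1 (D - s); nra.
have ma : 0 < m - a by rewrite /a; lra.
rewrite -(lerD2r (- a)) -(ler_pM2l sinD0) h1.
have k1 : sin (D - s) * (m - a) <= sin (D - s) * (rcos Q A - a) by rewrite ler_wpM2l // lerD2r.
have k2 : sin s * (m - a) <= sin s * (rcos Q (A *m rotm u D) - a) by rewrite ler_wpM2l // lerD2r.
have k3 := ler_wpM2r (ltW ma) s3.
by lra.
Qed.

End SmoothSums.

(** * Strong convexity along the geodesic to the minimiser *)

Section StrongConvexity.
Variables (R : realType) (O : set 'M[R]_3) (F : 'M[R]_3 -> R) (Rc Rstar : 'M[R]_3).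
Variables (rho muF : R).
Hypotheses (OS : O `<=` @SO3 R) (Oo : open_SO3 O) (F2 : C2_SO3 O F).
Hypotheses (hRc : SO3 Rc) (r0 : 0 < rho) (rpi : rho < pi / 2).
Let C := gcball Rc rho.
Hypotheses (CO : C `<=` O) (convF : geod_strongly_convex muF C F).
Hypotheses (argmin : is_argmin C F Rstar) (inter : interior_SO3 C Rstar).

Lemma grad_argmin : grad F Rstar = 0.
Proof.
have [CR Fmin] := argmin; have OR := CO CR.
apply/colP => k; rewrite [RHS]mxE grad_entry.
have hd := is_derive_lie OS Oo (basev R k) (C2_C1_SO3 F2) OR.
rewrite (lieD_grad (basev R k) Oo (C2_C1_SO3 F2) OR).
apply: (derive_local_min hd); rewrite /= scale0r expm0 mulmx1.
have [SR hin] := inter.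
have cc : (fun t : R => Rstar *m expm (t *: hat (basev R k))) @ (0 : R) --> Rstar.
  have e0 : Rstar *m expm ((0 : R) *: hat (basev R k)) = Rstar by rewrite scale0r expm0 mulmx1.
  have hc : {for (0 : R), continuous (fun t : R => Rstar *m expm (t *: hat (basev R k)))}.
    apply: differentiable_continuous; apply/derivable1_diffP.
    by have [] := is_derive_expm_curve Rstar (basev R k) (0 : R).
  by rewrite -[X in _ --> X]e0; exact: hc.
have hn : \forall t \near (0 : R), SO3 (Rstar *m expm (t *: hat (basev R k))) ->
    C (Rstar *m expm (t *: hat (basev R k))) := cc _ hin.
by apply: filterS hn => t ht; apply: Fmin; apply: ht; exact: SO3_expm_hat.
Qed.

(** The derivative of F along the geodesic grows at least at the rate [muF] and vanishes at the
    minimiser; the mean value theorem over the whole geodesic compares its two ends. *)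
Lemma grad_towards_argmin A : C A -> A != Rstar ->
  dotv (unitlog A Rstar) (grad F A) <= - muF * rang A Rstar.
Proof.
move=> CA AR; have [CR _] := argmin; have OA := CO CA; have hA := OS OA; have hR := OS (CO CR).
have Dpi := ball_rang hRc r0 rpi CA CR.
have D0 := rang_gt0 hA hR AR; set D := rang A Rstar in Dpi D0 *.
have [u1 eR] := unitlogP hA hR AR Dpi; set u := unitlog A Rstar in u1 eR *.
have Dp : 0 < D < pi by rewrite D0.
have ball_iff B : C B <-> SO3 B /\ cos rho <= rcos Rc B.
  exact: gcballE (ball_radius rpi).
have [_ gA] := (ball_iff A).1 CA; have [_ gR] := (ball_iff Rstar).1 CR.
have hC s : 0 <= s <= D -> C (A *m rotm u s).
  move=> hs; apply/ball_iff; split; first by apply: SO3_mul => //; exact: SO3_rotm.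
  by apply: (ball_geodesic hRc hA u1 Dp hs (cos_radius r0 rpi) gA); rewrite -eR.
pose phi s := lieD u F (A *m rotm u s).
have dphi s : 0 <= s <= D -> is_derive s 1 phi (lieD u (lieD u F) (A *m rotm u s)).
  move=> hs; have Os := CO (hC s hs).
  rewrite (lieD_grad u Oo (C2_SO3_lieD u Oo F2) Os).
  apply: (@is_derive_C1_SO3 R O (lieD u F) (fun s => A *m rotm u s) s u Oo) => //.
  - exact: C2_SO3_lieD.
  - by near=> t; apply: SO3_mul => //; exact: SO3_rotm.
  - have := is_derive_mulmx (is_derive_cst A s 1) (is_derive_rotm s u1).
    by move=> k; apply: (is_derive_eqr k); rewrite mul0mx add0r mulmxA.
have [||c] := @MVT R phi (fun s => lieD u (lieD u F) (A *m rotm u s)) 0 D D0.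
- move=> s; rewrite in_itv /= => /andP[s0 sD]; apply: dphi; by rewrite !ltW.
- apply: derivable_within_continuous => s; rewrite in_itv /= => hs.
  by have [] := dphi s hs.
rewrite in_itv /= => /andP[c0 cD]; have hc : 0 <= c <= D by rewrite !ltW.
rewrite -(hess_quad OS Oo u F2 (CO (hC c hc))) subr0.
have := convF (hC c hc) u; rewrite u1 mulr1 => hmu.
rewrite /phi rotm0 mulmx1 -eR (lieD_grad u Oo (C2_C1_SO3 F2) (CO CR)).
rewrite grad_argmin dotv0 (lieD_grad u Oo (C2_C1_SO3 F2) OA) sub0r => e1.
have := ler_wpM2r (ltW D0) hmu; rewrite -e1; lra.
Unshelve. all: by end_near.
Qed.

End StrongConvexity.

(** * The common trajectory after consensus *)

Lemma is_derive_shift (R : realType) (V : normedModType R) (c : R -> V) (d : V) (T s : R) :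
  is_derive (T + s) 1 c d -> is_derive s 1 (fun r => c (T + r)) d.
Proof.
move=> /is_derive_epsP hc; apply/is_derive_epsP => e e0; have [q q0 hq] := hc e e0.
have E r : T + r - (T + s) = r - s by ring.
by exists q => // r rs; have := hq (T + r); rewrite E; exact.
Qed.

Section ConsensusPhase.
Variables (R : realType) (n : nat) (e : rel 'I_n) (O : set 'M[R]_3).
Variables (f : 'I_n -> 'M[R]_3 -> R) (alpha gamma rho M : R) (Rc : 'M[R]_3).
Hypotheses (OS : O `<=` @SO3 R) (Oo : open_SO3 O).
Hypothesis fC2 : forall i, C2_SO3 O (f i).
Hypotheses (a0 : 0 < alpha) (g0 : 0 < gamma) (tree : is_tree e).
Hypotheses (hRc : SO3 Rc) (r0 : 0 < rho) (rpi : rho < pi / 2).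
Let C := gcball Rc rho.
Hypothesis CO : C `<=` O.
Hypotheses (M0 : 0 < M) (hM : forall i A, C A -> enorm (grad (f i) A) <= M).
Hypothesis inward : forall i A, SO3 A -> gdist A Rc = rho ->
  dotv (dir_to Rc A) (grad (f i) A) <= 0.
Implicit Types (A B : 'M[R]_3) (x : config R n) (y z : R -> config R n).
Local Notation mu := (@lebesgue_measure R).

Let dom := network_dom e O.
Let h := network_field e alpha gamma f.
Let F A := \sum_(i < n) f i A.
Let domS x (dx : dom x) : forall i, SO3 (x i) := network_dom_SO3 OS dx.
Let K3 : R := 3 * (alpha * n%:R + gamma * (M + 1)).

Let K30 : 0 <= K3.
Proof. by rewrite mulr_ge0 // addr_ge0 // mulr_ge0 // ?ltW // addr_gt0. Qed.

Let F2 : C2_SO3 O F. Proof. exact: C2_SO3_sum. Qed.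

Let n_gt0 : 0 < (n%:R : R).
Proof. by rewrite ltr0n; have [_ _ _ <-] := tree. Qed.

Definition mean_flow A : 'cV[R]_3 := - (gamma / n%:R) *: grad F A.

Section Solution.
Variables (y : R -> config R n) (T : R).
Hypothesis sol : forall T, 0 < T -> solution_on dom h 0 T y.
Hypothesis Cy : forall t, 0 <= t -> forall i, C (y t i).
Hypotheses (T0 : 0 <= T) (cons : consensus_from y T).

Let lip s t i : 0 <= s -> s <= t -> `|y t i - y s i| <= K3 * (t - s).
Proof.
exact: (solution_lipschitz OS Oo fC2 a0 g0 tree hRc r0 rpi CO M0 hM inward sol Cy).
Qed.

Let yS t i : 0 <= t -> SO3 (y t i).
Proof. by move=> t0; apply: OS; apply: CO; exact: Cy. Qed.

(** After T all agents coincide on a neighbourhood of t, so they share one velocity; as the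
    couplings sum to zero, the sum of the velocities determines it. *)
Lemma consensus_ae T' : {ae mu, forall t, T < t < T' -> forall i,
  is_derive t 1 (fun s => y s i) (y t i *m hat (mean_flow (y t i)))}.
Proof.
have [T'0|T'0] := leP T' 0.
  by apply: aeS (ae_point 0) => t _ /andP[t1 t2]; have := T0; lra.
apply: aeS (solution_velocity domS (sol T'0)) => t hv /andP[Tt tT'].
have t0 : 0 < t := le_lt_trans T0 Tt.
have [|w hw hd] := hv; first by rewrite t0.
have weq i j : col i w = col j w.
  have near_eq : \forall s \near t, y s i = y s j.
    have : \forall s \near t, T < s by exact: lt_nbhsr.
    by apply: filterS => s Ts; apply: cons; exact: ltW.
  have [_ e1] := near_eq_is_derive near_eq (hd i); have [_ e2] := hd j.
  have yij : y t i = y t j by apply: cons; exact: ltW.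
  rewrite e1 yij in e2.
  have [orth _] := SO3_orth (yS j (ltW t0)).
  have := congr1 (mulmx (y t j)^T) e2; rewrite !mulmxA orth !mul1mx => /(congr1 (@vee R)).
  by rewrite !hatK.
move=> i; suff <- : col i w = mean_flow (y t i) by [].
have dt : dom (y t) by apply: (ball_dom e OS hRc r0 rpi CO); apply: Cy; exact: ltW.
have := sum_coupling OS Oo fC2 a0 g0 tree dt hw.
rewrite /coupling -scaler_sumr big_split /= -scaler_sumr => /eqP.
rewrite scaler_eq0 invr_eq0 gt_eqF //= addr_eq0 => /eqP.
have -> : \sum_k col k w = n%:R *: col i w.
  rewrite (eq_bigr (fun=> col i w)); last by move=> k _; exact: weq.
  by rewrite sumr_const card_ord scaler_nat.
have -> : \sum_k grad (f k) (y t k) = grad F (y t i).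
  have f1 k := C2_C1_SO3 (fC2 k).
  rewrite /F (grad_sum OS Oo f1 (CO (Cy (ltW t0) i))); apply: eq_bigr => k _.
  by congr grad; apply: cons; exact: ltW.
move=> k1; have -> : col i w = n%:R^-1 *: (n%:R *: col i w).
  by rewrite scalerA mulVf ?scale1r // gt_eqF.
by rewrite k1 -scaleNr scalerA /mean_flow mulrN mulrC.
Qed.

Lemma consensus_ode : {ae mu, forall t, T <= t -> forall i,
  derivable (fun s => y s i) t 1 /\
  derive1 (fun s => y s i) t = y t i *m hat (mean_flow (y t i))}.
Proof.
have := @ae_foralln _ _ _ mu (fun m t => T < t < T + m.+1%:R -> forall i,
  is_derive t 1 (fun s => y s i) (y t i *m hat (mean_flow (y t i)))).
move=> /(_ (fun m => consensus_ae _)); apply: aeS2 (ae_point T) => t tT ht Tt i.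
have [m tm] : exists m : nat, t < T + m.+1%:R.
  exists (Num.truncn (t - T)); rewrite -ltrBlDl.
  have /truncn_itv /andP[_ //] : 0 <= t - T by rewrite subr_ge0.
have [|d1 d2] := ht m _ i.
  by rewrite tm andbT lt_neqAle Tt andbT eq_sym; apply/eqP.
by rewrite derive1E.
Qed.

Lemma consensus_decay (Rstar : 'M[R]_3) (muF : R) : geod_strongly_convex muF C F ->
  is_argmin C F Rstar -> interior_SO3 C Rstar -> forall t i, T <= t ->
  rang (y t i) Rstar <= rang (y T i) Rstar * expR (- (gamma * muF / n%:R) * (t - T)).
Proof.
move=> convF argmin inter t i Tt; have [CR _] := argmin; have SR := OS (CO CR).
apply: (@ac_ldini R T t (- (gamma * muF / n%:R)) (fun s => rang (y s i) Rstar) Tt).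
  apply: (@ac_lipschitz R _ T t _ (9 * K3)); first by rewrite mulr_ge0.
  move=> r s /andP[Tr _] _ rs; have r_0 := le_trans T0 Tr; have s_0 := le_trans r_0 rs.
  apply: le_trans (rang_lip (yS i r_0) SR (yS i s_0) SR) _.
  by rewrite subrr normr0 addr0 -mulrA ler_pM2l //; exact: lip.
apply: aeS (consensus_ae t) => s hs sT; have hd := hs sT i; have /andP[Ts st] := sT.
have s_0 : 0 < s := le_lt_trans T0 Ts.
(* At the minimiser the angle has a corner, but it is zero there and nonnegative before, which
   bounds its left Dini derivative. *)
have [eR|nR] := eqVneq (y s i) Rstar.
  rewrite eR rangK // mulr0 => eps e0; exists s => // q /andP[]; rewrite subrr => q0 qs.
  rewrite add0r eR rangK //; have := rang_ge0 (yS i (ltW q0)) SR.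
  have : 0 <= eps * (s - q) by rewrite mulr_ge0 ?subr_ge0 // ltW.
  lra.
have hpi := ball_rang hRc r0 rpi (Cy (ltW s_0) i) CR.
have hc : is_derive s 1 (fun=> Rstar) (Rstar *m hat (0 : 'cV[R]_3)).
  by rewrite hat0 mulmx0; exact: is_derive_cst.
have := is_derive_rang (yS i (ltW s_0)) SR nR hpi hd hc => /ldini_derive.
apply: ldini_le; rewrite subr0 /mean_flow dotvZr mulNr opprK.
have := grad_towards_argmin OS Oo F2 hRc r0 rpi CO convF argmin inter (Cy (ltW s_0) i) nR.
have gn : 0 < gamma / n%:R by rewrite divr_gt0.
move=> /(ler_wpM2l (ltW gn)) k1; apply: le_trans k1 _.
by rewrite le_eqVlt; apply/orP; left; apply/eqP; ring.
Qed.

Let cvg_y (t : R) i : 0 < t -> y s i @[s --> t] --> y t i.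
Proof.
move=> t0; apply: (@cvgrPdist_lt _ _ _ (nbhs t) _ (fun s => y s i) _).2 => eps e0.
have k1 : 0 < eps / (K3 + 1) by rewrite divr_gt0 // ltr_wpDl.
have n1 : \forall s \near t, 0 < s by exact: lt_nbhsr.
have n2 : \forall s \near t, `|t - s| < eps / (K3 + 1) by exact: (@nbhsx_ballx _ _ t _ k1).
near=> s; have s0 : 0 < s by near: s.
have ts : `|t - s| < eps / (K3 + 1) by near: s.
move: ts; rewrite ltr_pdivlMr ?ltr_wpDl // => ts.
have le : `|y t i - y s i| <= K3 * `|t - s|.
  have [st|st] := leP s t; first by rewrite (ger0_norm (_ : 0 <= t - s)) ?subr_ge0 // lip // ltW.
  have st' : 0 <= s - t by rewrite subr_ge0 ltW.
  rewrite distrC [`|t - s|]distrC (ger0_norm st').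
  by apply: lip; exact: ltW.
by apply: le_lt_trans le _; have := normr_ge0 (t - s); nra.
Unshelve. all: by end_near.
Qed.

Let cvg_flow (t : R) i : 0 < t ->
  y s i *m hat (mean_flow (y s i)) @[s --> t] --> y t i *m hat (mean_flow (y t i)).
Proof.
move=> t0; apply: (@cvg_mulmx R _ (nbhs t)); first exact: cvg_y.
have [r [L [rp L0 hL]]] := grad_lipschitz Oo F2 (CO (Cy (ltW t0) i)).
apply: (@cvgrPdist_lt _ _ _ (nbhs t) _ (fun s => hat (mean_flow (y s i))) _).2 => eps e0.
have gn : 0 < gamma / n%:R by rewrite divr_gt0.
have k1 : 0 < eps / (gamma / n%:R * L + 1) by rewrite divr_gt0 // ltr_wpDl // mulr_ge0 // ltW.
have hc := (@cvgrPdist_lt _ _ _ (nbhs t) _ (fun s => y s i) _).1 (@cvg_y t i t0).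
have n0 : \forall s \near t, 0 < s by exact: lt_nbhsr.
have n1 : \forall s \near t, `|y t i - y s i| < r by exact: hc.
have n2 : \forall s \near t, `|y t i - y s i| < eps / (gamma / n%:R * L + 1) by exact: hc.
near=> s; have s0 : 0 < s by near: s.
have q1 : `|y t i - y s i| < r by near: s.
have q2 : `|y t i - y s i| < eps / (gamma / n%:R * L + 1) by near: s.
rewrite -hatN -hatD; apply: le_lt_trans (norm_hat_enorm _) _.
rewrite /mean_flow -scalerBr enormZ normrN gtr0_norm //.
have := hL (y s i) (y t i) (CO (Cy (ltW s0) i)) (CO (Cy (ltW t0) i)).
rewrite subrr normr0 distrC => /(_ q1 rp) q3.
have p1 : 0 < gamma / n%:R * L + 1 by rewrite ltr_wpDl // mulr_ge0 // ltW.
move: q2; rewrite ltr_pdivlMr // => q2.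
apply: le_lt_trans (ler_wpM2l (ltW gn) q3) _.
by have := normr_ge0 (y t i - y s i); rewrite distrC in q2 *; lra.
Unshelve. all: by end_near.
Qed.

(** The right-hand side is continuous along the solution, so the equation extends from almost every
    to every t > T. Shifted solutions can then be compared without moving null sets. *)
Lemma consensus_is_derive (t : R) i : T < t ->
  is_derive t 1 (fun s => y s i) (y t i *m hat (mean_flow (y t i))).
Proof.
move=> Tt; have t0 : 0 < t := le_lt_trans T0 Tt.
apply/is_derive_mxP => k l; apply/is_derive_epsP => eps e0.
pose v s := (y s i *m hat (mean_flow (y s i))) k l.
have cv : v s @[s --> t] --> v t.
  exact: (cvg_entry (@cvg_flow t i t0)).
have n1 : \forall s \near t, `|v t - v s| <= eps.
  exact: (@cvgrPdist_le _ _ _ (nbhs t) _ v _).1 cv _ e0.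
have n2 : \forall s \near t, T < s by exact: lt_nbhsr.
have [d d0 hd] := (nbhs_ballP _ _).1 (filterI n1 n2); have dp : 0 < d by [].
(* The two signs [sg] together give the two-sided estimate; each is monotonicity of [phi], deduced
   from the equation almost everywhere. *)
have main (sg a b : R) : `|sg| = 1 -> t - d < a -> a <= b -> b < t + d ->
    sg * (y b i k l - y a i k l) <= (sg * v t + eps) * (b - a).
  move=> sg1 ta ab bt.
  have bl s : a <= s <= b -> `|v t - v s| <= eps /\ T < s.
    move=> /andP[as_ sb]; apply: hd; rewrite /ball /= ltr_norml; apply/andP; split; lra.
  have Ta : T < a by have [] := bl a; rewrite ?lexx ?ab.
  pose phi s := sg * y s i k l + - (sg * v t + eps) * s.
  suff : phi b <= phi a by rewrite /phi; lra.
  have -> : phi a = phi a * expR (0 * (b - a)) by rewrite mul0r expR0 mulr1.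
  have a_0 : 0 <= a by rewrite ltW // (le_lt_trans T0).
  apply: (@ac_ldini R a b 0 phi ab).
    apply: (@ac_lipschitz R _ a b _ (K3 + `|sg * v t + eps|)); first by rewrite addr_ge0.
    move=> r s /andP[ar _] _ rs.
    have -> : phi s - phi r = sg * (y s i k l - y r i k l) + - (sg * v t + eps) * (s - r).
      by rewrite /phi; ring.
    apply: le_trans (ler_normD _ _) _; rewrite !normrM normrN sg1 mul1r mulrDl.
    rewrite [`|s - r|]ger0_norm ?subr_ge0 // lerD2r.
    have := le_mx_norm (y s i - y r i) k l; rewrite !mxE => m1.
    by apply: le_trans m1 (lip i (le_trans a_0 ar) rs).
  apply: aeS (consensus_ae b) => s hs /andP[as_ sb].
  have [|q1 _] := bl s; first by rewrite !ltW.
  have [|d1 d2] := hs _ i; first by rewrite (lt_trans Ta as_).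
  have /is_derive_mxP/(_ k l) hkl : is_derive s 1 (fun s => y s i)
    (y s i *m hat (mean_flow (y s i))).
    by apply: hs; rewrite (lt_trans Ta as_).
  have hphi := is_deriveD (is_deriveZ sg hkl) (is_deriveZ (- (sg * v t + eps))
    (is_derive_id s (1 : R))).
  apply: ldini_le (ldini_derive hphi).
  rewrite mul0r -[_ *: _]/(sg * v s) -[_ *: 1]/(- (sg * v t + eps) * 1) mulr1 subr_le0.
  have : sg * (v s - v t) <= eps.
    by apply: le_trans (ler_norm _) _; rewrite normrM sg1 mul1r distrC.
  by rewrite mulrBr lerBlDl.
exists d => // s; rewrite ltr_norml => /andP[s1 s2].
rewrite -[_ *: _]/((s - t) * v t).
have [ts|st] := leP t s.
  rewrite (ger0_norm (_ : 0 <= s - t)) ?subr_ge0 //.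
  have h1 : t - d < t by lra.
  have h2 : s < t + d by lra.
  have := main 1 t s (normr1 _) h1 ts h2; have := main (-1) t s (normrN1 _) h1 ts h2.
  by rewrite ler_norml => ? ?; apply/andP; split; lra.
rewrite (ltr0_norm (_ : s - t < 0)) ?subr_lt0 //.
have h1 : t - d < s by lra.
have h2 : t < t + d by lra.
have := main 1 s t (normr1 _) h1 (ltW st) h2; have := main (-1) s t (normrN1 _) h1 (ltW st) h2.
by rewrite ler_norml => ? ?; apply/andP; split; lra.
Qed.

End Solution.

(** The angle between the shifted trajectories satisfies a Gronwall inequality near a common point,
    because grad F is locally Lipschitz; real induction carries the equality on. *)
Lemma consensus_unique y z T S :
  (forall T, 0 < T -> solution_on dom h 0 T y) -> (forall t, 0 <= t -> forall i, C (y t i)) ->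
  (forall T, 0 < T -> solution_on dom h 0 T z) -> (forall t, 0 <= t -> forall i, C (z t i)) ->
  0 <= T -> 0 <= S -> consensus_from y T -> consensus_from z S -> y T = z S ->
  forall s, 0 <= s -> y (T + s) = z (S + s).
Proof.
move=> soly Cy solz Cz T0 S0 cy cz yz s s0; apply/funext => i.
have lip := solution_lipschitz OS Oo fC2 a0 g0 tree hRc r0 rpi CO M0 hM inward.
have Ts r : 0 <= r -> 0 <= T + r by move=> r_0; rewrite addr_ge0.
have Ss r : 0 <= r -> 0 <= S + r by move=> r_0; rewrite addr_ge0.
have ySO r : 0 <= r -> SO3 (y (T + r) i) by move=> r_0; apply/OS/CO/Cy/Ts.
have zSO r : 0 <= r -> SO3 (z (S + r) i) by move=> r_0; apply/OS/CO/Cz/Ss.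
have ylip p q : 0 <= p -> p <= q -> `|y (T + q) i - y (T + p) i| <= K3 * (q - p).
  move=> p0 pq; have := lip y soly Cy (T + p) (T + q) i (Ts p p0); rewrite lerD2l => /(_ pq).
  by have -> : T + q - (T + p) = q - p by ring.
have zlip p q : 0 <= p -> p <= q -> `|z (S + q) i - z (S + p) i| <= K3 * (q - p).
  move=> p0 pq; have := lip z solz Cz (S + p) (S + q) i (Ss p p0); rewrite lerD2l => /(_ pq).
  by have -> : S + q - (S + p) = q - p by ring.
pose D r := rang (y (T + r) i) (z (S + r) i).
have Dlip p q : 0 <= p -> p <= q -> `|D q - D p| <= 18 * K3 * (q - p).
  move=> p0 pq; have q0 := le_trans p0 pq.
  apply: le_trans (rang_lip (ySO p p0) (zSO p p0) (ySO q q0) (zSO q q0)) _.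
  by have := ylip p q p0 pq; have := zlip p q p0 pq; lra.
have K18 : 0 <= 18 * K3 by rewrite mulr_ge0.
suff : forall r, 0 <= r <= s -> y (T + r) i = z (S + r) i by apply; rewrite s0 lexx.
apply: real_induction.
- by rewrite !addr0 yz.
- move=> c /andP[c0 cs] hr; apply: (rang_eq0 (ySO c (ltW c0)) (zSO c (ltW c0))).
  apply/eqP; rewrite eq_le rang_ge0 ?andbT; [|exact: ySO (ltW c0)|exact: zSO (ltW c0)].
  apply/ler_addgt0Pr => eps e0; rewrite add0r.
  pose p := Num.max 0 (c - eps / (18 * K3 + 1)).
  have k1 : 0 < 18 * K3 + 1 by rewrite ltr_wpDl.
  have p0 : 0 <= p by rewrite /p le_max lexx.
  have pc : p < c by rewrite /p gt_max c0 gtrBl divr_gt0.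
  have Dp : D p = 0 by rewrite /D hr ?p0 // rangK //; exact: zSO.
  have := Dlip p c p0 (ltW pc); rewrite Dp subr0 => k2.
  apply: le_trans (ler_norm _) _; apply: le_trans k2 _.
  have : c - p <= eps / (18 * K3 + 1).
    have : c - eps / (18 * K3 + 1) <= p by rewrite /p le_max lexx orbT.
    lra.
  rewrite ler_pdivlMr // => k3; apply: le_trans k3.
  by rewrite mulrC ler_wpM2l ?subr_ge0 ?(ltW pc) // lerDl.
move=> c /andP[c0 cs] hr; have eqc : y (T + c) i = z (S + c) i by apply: hr; rewrite c0 lexx.
have OA : O (y (T + c) i) by apply: CO; apply: Cy; exact: Ts.
have [r [L [rp L0 hL]]] := grad_lipschitz Oo F2 OA.
have k1 : 0 < K3 + 1 by rewrite ltr_wpDl.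
exists (r / (K3 + 1)); first by rewrite divr_gt0.
move=> q /andP[cq qd] _; have q0 := le_trans c0 (ltW cq).
have close p : c <= p <= q -> `|y (T + p) i - y (T + c) i| < r /\ `|z (S + p) i - y (T + c) i| < r.
  move=> /andP[cp pq]; have : K3 * (p - c) < r.
    have : p - c < r / (K3 + 1) by lra.
    rewrite ltr_pdivlMr // => k2; apply: le_lt_trans k2.
    by rewrite mulrC ler_wpM2l ?subr_ge0 // lerDl.
  move=> k2; split; first exact: le_lt_trans (ylip c p c0 cp) k2.
  by rewrite eqc; exact: le_lt_trans (zlip c p c0 cp) k2.
apply: (rang_eq0 (ySO q q0) (zSO q q0)); apply/eqP.
rewrite eq_le rang_ge0 ?andbT; [|exact: ySO|exact: zSO].
(* The factor 2 converts the matrix norm into the angle by [norm_le_rang]. *)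
pose k := gamma / n%:R * (L * 2).
have gn : 0 < gamma / n%:R by rewrite divr_gt0.
have -> : 0 = D c * expR (k * (q - c)).
  by rewrite /D eqc rangK ?mul0r //; exact: zSO.
apply: (@ac_ldini R c q k D (ltW cq)).
  apply: (ac_lipschitz K18) => a b /andP[ca _] _ ab; apply: Dlip => //.
  exact: le_trans ca.
apply: aeS (ae_point 0) => p _ /andP[cp pq]; have p0 : 0 < p := le_lt_trans c0 cp.
have [|y1 z1] := close p; first by rewrite !ltW.
have Oy : O (y (T + p) i) by apply: CO; apply: Cy; exact/Ts/ltW.
have Oz : O (z (S + p) i) by apply: CO; apply: Cz; exact/Ss/ltW.
have hpi : rang (y (T + p) i) (z (S + p) i) < pi.
  by apply: (ball_rang hRc r0 rpi); [exact/Cy/Ts/ltW|exact/Cz/Ss/ltW].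
have Tp : T < T + p by rewrite ltrDl.
have Sp : S < S + p by rewrite ltrDl.
have hy := is_derive_shift (consensus_is_derive soly Cy T0 cy i Tp).
have hz := is_derive_shift (consensus_is_derive solz Cz S0 cz i Sp).
set v := unitlog (y (T + p) i) (z (S + p) i).
have v1 : enorm v <= 1 by apply: enorm_unitlog_le1 => //; exact: OS.
have v2 : dotv v v <= 1 by rewrite -enorm_sqr expr_le1 // enorm_ge0.
have pos : \forall r \near p, 0 < r by exact: lt_nbhsr.
have nS1 : \forall r \near p, SO3 (y (T + r) i) by apply: filterS pos => ? /ltW; exact: ySO.
have nS2 : \forall r \near p, SO3 (z (S + r) i) by apply: filterS pos => ? /ltW; exact: zSO.
(* Where the trajectories meet, [unitlog] is 0, a vector that [ldini_rang] allows, so the corner is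
   covered as well. *)
apply: ldini_le (ldini_rang nS1 nS2 hpi v2 (fun _ => erefl) hy hz).
rewrite /mean_flow -scalerBr dotvZr mulNr opprK /k -[leRHS]mulrA ler_pM2l //.
apply: le_trans (ler_norm _) _; apply: le_trans (normr_dotv_le _ _) _.
have q1 := hL _ _ Oz Oy z1 y1.
have q2 := norm_le_rang (OS Oy) (OS Oz).
have q3 := enorm_ge0 (grad F (y (T + p) i) - grad F (z (S + p) i)).
apply: (@le_trans _ _ (enorm (grad F (y (T + p) i) - grad F (z (S + p) i)))).
  by rewrite -[leRHS]mul1r ler_wpM2r.
by apply: le_trans q1 _; rewrite -mulrA ler_wpM2l.
Qed.

End ConsensusPhase.

Theorem theorem1 (R : realType) (n : nat) (e : rel 'I_n)
    (Rc Rstar : 'M[R]_3) (rho : R) (O : set 'M[R]_3)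
    (f : 'I_n -> 'M[R]_3 -> R) (muF M alpha gamma : R) :
  let C := gcball Rc rho in
  let F := fun A => \sum_(i < n) f i A in
  let h := network_field e alpha gamma f in
  let dom := network_dom e O in
  is_tree e ->
  SO3 Rc ->
  0 < rho -> rho < pi / 2 ->
  O `<=` @SO3 R -> open_SO3 O -> C `<=` O ->
  (forall i, C2_SO3 O (f i)) ->
  0 < muF -> geod_strongly_convex muF C F ->
  is_argmin C F Rstar -> interior_SO3 C Rstar ->
  0 < M -> (forall i A, C A -> enorm (grad (f i) A) <= M) ->
  (forall i A, SO3 A -> gdist A Rc = rho ->
     dotv (dir_to Rc A) (grad (f i) A) <= 0) ->
  0 < alpha -> 0 < gamma ->
  (* (i) *)
  (forall x0 : config R n, (forall i, C (x0 i)) ->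
     (exists2 y : R -> config R n,
        filippov_solution dom h [set` `[0, +oo[] y & y 0 = x0) /\
     (forall I y, maximal_solution dom h I y -> y 0 = x0 ->
        I = [set` `[0, +oo[] /\ forall t, 0 <= t -> forall i, C (y t i))) /\
  (n%:R * M / 2 < alpha / gamma ->
   (* (ii) *)
   (forall I y, maximal_solution dom h I y -> (forall i, C (y 0 i)) ->
      exists T : R,
        [/\ 0 <= T,
            T <= n%:R * disagreement e (y 0) / (2 * (2 * alpha - gamma * n%:R * M))
          & consensus_from y T]) /\
   (* (iii) *)
   (forall I y, maximal_solution dom h I y -> (forall i, C (y 0 i)) ->
      forall T : R, 0 <= T -> consensus_from y T ->
        {ae @lebesgue_measure R, forall t, T <= t -> forall i,
           derivable (fun s => y s i) t 1 /\
           derive1 (fun s => y s i) t =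
             y t i *m hat (- (gamma / n%:R) *: grad F (y t i))} /\
        (forall t, T <= t -> forall i,
           gdist (y t i) Rstar <=
             gdist (y T i) Rstar * expR (- (gamma * muF / n%:R) * (t - T)))) /\
   (forall I y J z, maximal_solution dom h I y -> (forall i, C (y 0 i)) ->
      maximal_solution dom h J z -> (forall i, C (z 0 i)) ->
      forall T S : R, 0 <= T -> 0 <= S ->
        consensus_from y T -> consensus_from z S -> y T = z S ->
        forall s, 0 <= s -> y (T + s) = z (S + s))).
Proof.
move=> C F h dom tree hRc r0 rpi OS Oo CO fC2 muF0 convF argmin inter M0 hM inward a0 g0.
have [sym irr _ _] := tree.
have domS x (dx : dom x) := network_dom_SO3 OS dx.
have max_sol := maximal_global OS Oo fC2 a0 g0 sym irr hRc r0 rpi CO M0 hM inward.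
have distE A B : C A -> C B -> gdist A B = rang A B.
  by move=> CA CB; apply: gdistE; [exact/OS/CO|exact/OS/CO].
split=> [x0 hx0|ratio].
  split; last first.
    by move=> I y maxy y0; have [|IE _ Cy] := max_sol I y maxy; [rewrite y0|split].
  have [y [y0 sol _]] := existence OS Oo fC2 a0 g0 sym irr hRc r0 rpi CO M0 hM inward 0 hx0.
  by exists y => // T T0 _; exact: sol.
split.
  move=> I y maxy y0; have [_ sol Cy] := max_sol I y maxy y0.
  exact: (finite_time_consensus OS Oo fC2 a0 g0 tree hRc r0 rpi CO M0 hM inward sol Cy ratio).
split.
  move=> I y maxy y0 T T0 cons; have [_ sol Cy] := max_sol I y maxy y0; split.
    exact: (consensus_ode OS Oo fC2 a0 g0 tree hRc r0 rpi CO sol Cy T0 cons).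
  move=> t Tt i; have [CR _] := argmin.
  rewrite !distE //; [|exact: Cy|apply: Cy; exact: le_trans Tt].
  exact: (consensus_decay OS Oo fC2 a0 g0 tree hRc r0 rpi CO M0 hM inward sol Cy T0 cons convF
    argmin inter).
move=> I y J z maxy y0 maxz z0 T S T0 S0 cy cz yz.
have [_ soly Cy] := max_sol I y maxy y0; have [_ solz Cz] := max_sol J z maxz z0.
exact: (consensus_unique OS Oo fC2 a0 g0 tree hRc r0 rpi CO M0 hM inward soly Cy solz Cz).
Qed.
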